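(* Let $\phi$ be analytic in $\mathbb D$ with $|\phi|<1$, and let $g$ be a bounded homeomorphic $W^{1,2}_{loc}$-solution of $\partial_{\bar z}g=-\phi\,\overline{\partial_zg}$ in $\mathbb D$. Suppose $I\subset\partial\mathbb D$ is an open arc such that $\lim_{z\to w,\,z\in\mathbb D}|\phi(z)|=1$ for every $w\in I$. Then there is a function $R$ meromorphic on $\Omega_I:=\mathbb D\cup I\cup(\widehat{\mathbb C}\setminus\overline{\mathbb D})$ such that $g$ extends continuously to $I$ with $g=R$ on $I$; moreover every critical point of $R$ on $I$ is simple, i.e. if $z_0\in I$ and $R'(z_0)=0$ then $R''(z_0)\neq0$.
   Context: $\mathbb D$ is the open unit disc and $\widehat{\mathbb C}$ the Riemann sphere. *)

(* Defs.v *)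
From HB Require Import structures.
From mathcomp Require Import all_boot all_order all_algebra.
From mathcomp Require Import complex.
From mathcomp Require Import all_classical all_reals all_analysis.
Set Implicit Arguments. Unset Strict Implicit. Unset Printing Implicit Defensive.
Import Order.TTheory GRing.Theory Num.Theory.
Import numFieldNormedType.Exports.
Local Open Scope classical_set_scope.
Local Open Scope ring_scope.

(* C as a numClosedFieldType, so that the normed/topological structure
   of MathComp-Analysis (numFieldNormedType) applies *)
Definition Cs (R : realType) : numClosedFieldType := R[i].

Section Defs.
Variable R : realType.
Local Notation C := (Cs R).

Definition toC (p : R * R) : C := Complex p.1 p.2.

Definition leb2 := (@lebesgue_measure R \x @lebesgue_measure R)%E.

Definition disc : set C := [set z | `|z| < 1].

Definition expi (t : R) : C := Complex (cos t) (sin t).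
Definition open_arc (I : set C) : Prop :=
  exists a b : R, 0 < b - a <= 2 * pi /\ I = [set expi t | t in `]a, b[%classic].

Fixpoint iterD (vs : seq (R * R)) (f : R * R -> R) : R * R -> R :=
  if vs is v :: vs' then 'D_v (iterD vs' f) else f.
Definition smooth2 (f : R * R -> R) : Prop :=
  forall vs p, differentiable (iterD vs f) p.

Definition test_fun (U : set C) (psi : R * R -> R) : Prop :=
  smooth2 psi /\ compact (closure [set p | psi p != 0]) /\
  closure [set p | psi p != 0] `<=` toC @^-1` U.

Definition L2loc (U : set C) (f : C -> C) : Prop :=
  measurable_fun (toC @^-1` U) (fun p => complex.Re (f (toC p))) /\
  measurable_fun (toC @^-1` U) (fun p => complex.Im (f (toC p))) /\
  forall K : set (R * R), compact K -> K `<=` toC @^-1` U ->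
    leb2.-integrable K (fun p => ((complex.Re (f (toC p))) ^+ 2
                                 + (complex.Im (f (toC p))) ^+ 2)%:E).

Definition weak_deriv (U : set C) (v : R * R) (f h : C -> C) : Prop :=
  forall psi, test_fun U psi ->
    (\int[leb2]_p ((complex.Re (f (toC p)) * 'D_v psi p)%:E)
       = - \int[leb2]_p ((complex.Re (h (toC p)) * psi p)%:E))%E /\
    (\int[leb2]_p ((complex.Im (f (toC p)) * 'D_v psi p)%:E)
       = - \int[leb2]_p ((complex.Im (h (toC p)) * psi p)%:E))%E.

Definition W12loc_with (U : set C) (f fx fy : C -> C) : Prop :=
  L2loc U f /\ L2loc U fx /\ L2loc U fy /\
  weak_deriv U (1, 0) f fx /\ weak_deriv U (0, 1) f fy.

Definition homeo_on (U : set C) (g : C -> C) : Prop :=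
  {within U, continuous g} /\ set_inj U g /\
  exists h : C -> C, (forall z, U z -> h (g z) = z) /\ {within g @` U, continuous h}.

Definition holomorphic_on (U : set C) (f : C -> C) : Prop :=
  forall z, U z -> derivable f z 1.

(* meromorphic on an open set U of C: holomorphic off a set P of poles
   which is discrete and closed in U, with |f| -> +oo at each pole
   (the values of f at poles are irrelevant) *)
Definition meromorphic_on (U : set C) (f : C -> C) : Prop :=
  exists P : set C, P `<=` U /\
    (forall z, U z -> exists2 r : R, 0 < r &
        forall w, P w -> `|w - z| < r%:C%C -> w = z) /\
    (forall z, U z -> ~ P z -> derivable f z 1) /\
    (forall p, P p -> forall M : R, \forall z \near p^', M%:C%C < `|f z|).

Definition meromorphic_at_infty (f : C -> C) : Prop :=
  exists2 r : R, 0 < r & exists c : C,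
    meromorphic_on [set w | `|w| < r%:C%C] (fun w => if w == 0 then c else f w^-1).

(* finite part of Omega_I = D u I u (Chat \ closed D) *)
Definition OmegaI (I : set C) : set C :=
  [set z | `|z| < 1] `|` I `|` [set z | 1 < `|z|].

Definition meromorphic_OmegaI (I : set C) (f : C -> C) : Prop :=
  meromorphic_on (OmegaI I) f /\ meromorphic_at_infty f.

End Defs.
Arguments disc R : clear implicits.
Arguments leb2 R : clear implicits.

(* Main.v *)
Require Import Defs.
From HB Require Import structures.
From mathcomp Require Import all_boot all_order all_algebra.
From mathcomp Require Import complex.
From mathcomp Require Import all_classical all_reals all_analysis.
From mathcomp Require Import measurable_realfun ring lra.
Import Order.TTheory GRing.Theory Num.Theory.
Import numFieldNormedType.Exports.
Local Open Scope classical_set_scope.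
Local Open Scope ring_scope.
Set Implicit Arguments. Unset Strict Implicit. Unset Printing Implicit Defensive.

(** The Beltrami equation says that F = g + phi * conj g satisfies dbar F = 0 weakly, so F is
holomorphic by Weyl's lemma; conversely F = G + phi * conj G has G = g as its only solution
because |phi| < 1. As |phi| tends to 1 at I, both phi and F extend holomorphically across I by
reflection: below, phi is continued by 1 / conj phi(z') and F by conj F(z') * phi(z), where
z' = 1 / conj z, and the jumps across I are O(1 - |phi|^2). Moreover phi' <> 0 on I, since phi
maps one side of I into the unit disc. Put h = F' / phi' and R = F - phi * h; differentiating the
two reflection identities gives R(z) = conj h(z'), which defines R outside the disc. Near I,

  g(z) = F(z) - phi(z) * (F(z') - F(z)) / (phi(z') - phi(z)),

which tends to R on I. Finally, if R' = R'' = 0 at a point of I where R = a, then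
F - a - conj(a) * phi vanishes there to order at least 4, and this forces g to take some value
twice in the disc. All local work is done in the upper half plane, after a Cayley transform. *)

(** * The real-valued modulus, continuity and complex derivatives in epsilon-delta form *)

Section ComplexBasics.
Variable R : realType.
Local Notation C := (Cs R).
Implicit Types (z w p : C) (f g : C -> C).

(** One statement, [regularity_exc_line], carries most of the complex analysis: on a horizontal line
    nothing is assumed except that the jump across it tends to 0. A line off the disc yields higher
    derivatives, a line through a point removable singularities, the real axis the reflections. The
    last use dictates its form: near I only |phi| is controlled, and neither phi nor F is known to
    have a limit, so only jumps can be estimated.

    The order 4 arises as follows. As F' = phi' h, one has R' = - phi h', so R' = R'' = 0 means h' =
    h'' = 0. At the point in question conj(a) = h, hence f = F - a - conj(a) phi has f' = phi' (h -
    conj(a)), with a zero of order at least 3. For real q, f = q (b + conj(b) phi) means g = a + q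
    b. So g repeats a value when the quotient f / (b + conj(b) phi), real on I with a zero of order
    n, takes one real value twice on one side of I. This happens once z^n = -1 has two roots in the
    upper half plane, that is from n = 4 on; order 3, a simple critical point of R, offers only
    one. *)

Definition mkC (x y : R) : C := Complex x y.
Definition rC (x : R) : C := mkC x 0.
Definition iC : C := mkC 0 1.
Definition reC (z : C) : R := complex.Re z.
Definition imC (z : C) : R := complex.Im z.
Definition cj (z : C) : C := conjc z.
(** The norm of [C] has values in [C]; [nm] is the same modulus as a real number, so that estimates
    live in the ordered field [R]. *)
Definition nm (z : C) : R := ComplexField.Normc.normc z.

Lemma normE z : `|z| = (nm z)%:C%C.
Proof. by case: z. Qed.

Lemma nmM z w : nm (z * w) = nm z * nm w.
Proof. exact: ComplexField.Normc.normcM. Qed.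

Lemma nmD z w : nm (z + w) <= nm z + nm w.
Proof. exact: le_normcD. Qed.

Lemma nmN z : nm (- z) = nm z.
Proof. exact: normcN. Qed.

Lemma nmB z w : nm (z - w) <= nm z + nm w.
Proof. by rewrite -(nmN w); exact: nmD. Qed.

Lemma nmBC z w : nm (z - w) = nm (w - z).
Proof. by rewrite -nmN opprB. Qed.

Lemma nmV z : nm (z^-1) = (nm z)^-1.
Proof. exact: ComplexField.Normc.normcV. Qed.

Lemma nm_ge0 z : 0 <= nm z.
Proof. by case: z => a b; rewrite /nm /= sqrtr_ge0. Qed.

Lemma nm0 : nm 0 = 0.
Proof. exact: ComplexField.Normc.normc0. Qed.

Lemma nm1 : nm 1 = 1.
Proof. exact: ComplexField.Normc.normc1. Qed.

Lemma nm_eq0 z : (nm z == 0) = (z == 0).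
Proof. by apply/eqP/eqP => [/ComplexField.Normc.eq0_normc //|->]; exact: nm0. Qed.

Lemma nm_gt0 z : (0 < nm z) = (z != 0).
Proof. by rewrite lt0r nm_eq0 nm_ge0 andbT. Qed.

Lemma nmX z n : nm (z ^+ n) = nm z ^+ n.
Proof. by elim: n => [|n IH]; rewrite ?expr0 ?nm1 // !exprS nmM IH. Qed.

Lemma nm_cj z : nm (cj z) = nm z.
Proof. by case: z => a b; rewrite /nm /cj /= sqrrN. Qed.

Lemma nmE z : nm z = Num.sqrt (reC z ^+ 2 + imC z ^+ 2).
Proof. by case: z. Qed.

Lemma nm_sq z : nm z ^+ 2 = reC z ^+ 2 + imC z ^+ 2.
Proof. by rewrite nmE sqr_sqrtr // addr_ge0 // sqr_ge0. Qed.

Lemma re_le_nm z : `|reC z| <= nm z.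
Proof. by rewrite nmE -sqrtr_sqr ler_wsqrtr // lerDl sqr_ge0. Qed.

Lemma im_le_nm z : `|imC z| <= nm z.
Proof. by rewrite nmE -sqrtr_sqr ler_wsqrtr // lerDr sqr_ge0. Qed.

Lemma nm_le_reim z : nm z <= `|reC z| + `|imC z|.
Proof.
rewrite nmE -[leRHS]ger0_norm ?addr_ge0 // -sqrtr_sqr ler_wsqrtr //.
by rewrite sqrrD !real_normK ?num_real // lerD2r lerDl mulrn_wge0 // mulr_ge0.
Qed.

Lemma nm_rC x : nm (rC x) = `|x|.
Proof. by rewrite nmE /reC /imC /= expr0n addr0 sqrtr_sqr. Qed.

Lemma nm_iC : nm iC = 1.
Proof. by rewrite nmE /reC /imC /= expr0n add0r expr1n sqrtr1. Qed.

Lemma nm_natr n : nm n%:R = n%:R.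
Proof.
have -> : (n%:R : C) = rC n%:R by rewrite /rC /mkC complexr0 rmorph_nat.
by rewrite nm_rC ger0_norm.
Qed.

Lemma eqC z w : reC z = reC w -> imC z = imC w -> z = w.
Proof. by case: z w => a b [c d] /= -> ->. Qed.

Lemma mkC_eta z : z = mkC (reC z) (imC z).
Proof. by case: z. Qed.

Lemma mkCE x y : mkC x y = rC x + iC * rC y.
Proof. by apply: eqC; rewrite /reC /imC /=; ring. Qed.

Lemma reD z w : reC (z + w) = reC z + reC w.
Proof. by case: z w => a b [c d]. Qed.

Lemma imD z w : imC (z + w) = imC z + imC w.
Proof. by case: z w => a b [c d]. Qed.

Lemma reN z : reC (- z) = - reC z.
Proof. by case: z. Qed.

Lemma imN z : imC (- z) = - imC z.
Proof. by case: z. Qed.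

Lemma reB z w : reC (z - w) = reC z - reC w.
Proof. by rewrite reD reN. Qed.

Lemma imB z w : imC (z - w) = imC z - imC w.
Proof. by rewrite imD imN. Qed.

Lemma reM z w : reC (z * w) = reC z * reC w - imC z * imC w.
Proof. by case: z w => a b [c d]. Qed.

Lemma imM z w : imC (z * w) = reC z * imC w + imC z * reC w.
Proof. by case: z w => a b [c d]. Qed.

Lemma re_mk x y : reC (mkC x y) = x. Proof. by []. Qed.
Lemma im_mk x y : imC (mkC x y) = y. Proof. by []. Qed.
Lemma re_rC x : reC (rC x) = x. Proof. by []. Qed.
Lemma im_rC x : imC (rC x) = 0. Proof. by []. Qed.
Lemma re_i : reC iC = 0. Proof. by []. Qed.
Lemma im_i : imC iC = 1. Proof. by []. Qed.
Lemma re_1 : reC 1 = 1. Proof. by []. Qed.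
Lemma im_1 : imC 1 = 0. Proof. by []. Qed.
Lemma re_0 : reC 0 = 0. Proof. by []. Qed.
Lemma im_0 : imC 0 = 0. Proof. by []. Qed.
Lemma re_cj z : reC (cj z) = reC z. Proof. by case: z. Qed.
Lemma im_cj z : imC (cj z) = - imC z. Proof. by case: z. Qed.
Definition reimE := (reD, imD, reN, imN, reM, imM, re_mk, im_mk, re_rC, im_rC, re_i, im_i, re_1, im_1, re_0, im_0, re_cj, im_cj).

Lemma iC2 : iC * iC = -1.
Proof. by apply: eqC; rewrite !reimE; ring. Qed.

Lemma rCD x y : rC (x + y) = rC x + rC y.
Proof. by apply: eqC; rewrite !reimE //; ring. Qed.

Lemma rCB x y : rC (x - y) = rC x - rC y.
Proof. by apply: eqC; rewrite !reimE //; ring. Qed.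

Lemma rCM x y : rC (x * y) = rC x * rC y.
Proof. by apply: eqC; rewrite !reimE //; ring. Qed.

Lemma rC0 : rC 0 = 0. Proof. by []. Qed.
Lemma rC1 : rC 1 = 1. Proof. by []. Qed.

Lemma rCX x n : rC (x ^+ n) = rC x ^+ n.
Proof. by elim: n => [|n IH]; rewrite ?expr0 ?rC1 // !exprS rCM IH. Qed.

Lemma rC_eq0 x : (rC x == 0) = (x == 0).
Proof. by rewrite -nm_eq0 nm_rC normr_eq0. Qed.

Lemma cjD z w : cj (z + w) = cj z + cj w. Proof. exact: rmorphD. Qed.
Lemma cjB z w : cj (z - w) = cj z - cj w. Proof. exact: rmorphB. Qed.
Lemma cjN z : cj (- z) = - cj z. Proof. exact: rmorphN. Qed.
Lemma cjM z w : cj (z * w) = cj z * cj w. Proof. exact: rmorphM. Qed.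
Lemma cjV z : cj (z^-1) = (cj z)^-1. Proof. exact: fmorphV. Qed.
Lemma cj0 : cj 0 = 0. Proof. exact: rmorph0. Qed.
Lemma cj1 : cj 1 = 1. Proof. exact: rmorph1. Qed.
Lemma cjK z : cj (cj z) = z. Proof. exact: conjcK. Qed.
Lemma cj_rC x : cj (rC x) = rC x. Proof. by rewrite /cj /rC /mkC /= oppr0. Qed.
Lemma cj_eq0 z : (cj z == 0) = (z == 0). Proof. by rewrite -nm_eq0 nm_cj nm_eq0. Qed.

Lemma mulcj z : z * cj z = rC (nm z ^+ 2).
Proof. by rewrite nm_sq; apply: eqC; rewrite !reimE; ring. Qed.

Lemma ltnm z (r : R) : (`|z| < r%:C%C) = (nm z < r).
Proof. by rewrite normE ltcR. Qed.

Lemma ltnm1 z : (`|z| < 1) = (nm z < 1).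
Proof. by rewrite normE -ltcR. Qed.

Lemma gtnm1 z : (1 < `|z|) = (1 < nm z).
Proof. by rewrite normE -ltcR. Qed.

Lemma toCE (p : R * R) : toC p = mkC p.1 p.2. Proof. by []. Qed.

Lemma nbhsCP z (P : set C) :
  nbhs z P <-> exists2 d : R, 0 < d & forall w, nm (w - z) < d -> P w.
Proof.
split.
  move=> /nbhs_ballP [e /= e0 H].
  exists (complex.Re e).
    by move: e0; case: (e) => a b; rewrite ltcE /= => /andP[].
  move=> w wz; apply: H; rewrite /ball /= normE nmBC.
  move: e0; case: (e) wz => a b /= wz; rewrite !ltcE /= => /andP[/eqP -> _].
  by rewrite eqxx wz.
move=> [d d0 H]; apply/nbhs_ballP; exists (d%:C)%C => /=; first by rewrite ltcR.
by move=> w; rewrite /ball /= normE ltcR nmBC; apply: H.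
Qed.

Lemma cvgCP (T : Type) (F : set_system T) (FF : Filter F) (f : T -> C) l :
  f @ F --> l <-> forall e : R, 0 < e -> \forall t \near F, nm (f t - l) < e.
Proof.
split => [H e e0|H].
  have : nbhs l [set w | nm (w - l) < e] by apply/nbhsCP; exists e.
  by move=> /H.
by move=> P /nbhsCP [d d0 dP]; have := H d d0; apply: filterS => t; exact: dP.
Qed.

Definition ccont f z := forall e : R, 0 < e ->
  exists2 d : R, 0 < d & forall w, nm (w - z) < d -> nm (f w - f z) < e.

Lemma ccontP f z : ccont f z <-> {for z, continuous f}.
Proof.
split=> [H|H].
  apply/(cvgCP (nbhs_filter z)) => e /H [d d0 dP]; apply/nbhsCP; by exists d.
move=> e e0; move/(cvgCP (nbhs_filter z)) : H => /(_ _ e0) /nbhsCP [d d0 dP]; by exists d.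
Qed.

Lemma half_gt0 (e : R) : 0 < e -> 0 < e / 2.
Proof. by move=> e0; rewrite divr_gt0. Qed.

(** The first-order expansion multiplied out: the point w = z is not excluded, and error terms add
    up without division by [w - z]. *)
Definition cder f z L := forall e : R, 0 < e ->
  exists2 d : R, 0 < d &
    forall w, nm (w - z) < d -> nm (f w - f z - L * (w - z)) <= e * nm (w - z).

Lemma scaleCE (a b : C) : a *: b = a * b. Proof. by []. Qed.

Lemma cder_cvgP f z L :
  cder f z L <-> h^-1 *: (f (h + z) - f z) @[h --> 0^'] --> L.
Proof.
split=> [H|H].
  apply/(cvgCP (dnbhs_filter _)) => e e0; have [d d0 dP] := H (e / 2) (half_gt0 e0).
  rewrite near_withinE; apply/nbhsCP; exists d => // h; rewrite subr0 => hd h0.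
  have := dP (h + z); rewrite addrK => /(_ hd) H2.
  have -> : h^-1 *: (f (h + z) - f z) - L = h^-1 * (f (h + z) - f z - L * h).
    by rewrite scaleCE; field.
  rewrite nmM nmV.
  have h0' : 0 < nm h by rewrite nm_gt0.
  apply: (@le_lt_trans _ _ (e / 2)); last by lra.
  by rewrite mulrC ler_pdivrMr.
move=> e e0; move/(cvgCP (dnbhs_filter _)) : H => /(_ _ e0); rewrite near_withinE => /nbhsCP [d d0 dP].
exists d => // w wd.
have [->|wz] := eqVneq w z; first by rewrite !subrr mulr0 subr0 nm0 mulr0.
have h0 : w - z != 0 by rewrite subr_eq0.
have := dP (w - z); rewrite subr0 => /(_ wd h0); rewrite subrK => H.
have -> : f w - f z - L * (w - z) = (w - z) * ((w - z)^-1 *: (f w - f z) - L).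
  by rewrite scaleCE; field.
by rewrite nmM mulrC ler_wpM2r ?nm_ge0 // ltW.
Qed.

Lemma cderP f z L : cder f z L <-> derivable f z 1 /\ f^`()%classic z = L.
Proof.
have E : (fun h : C => h^-1 *: ((f \o shift z) (h *: (1 : C)) - f z)) =
         (fun h : C => h^-1 *: (f (h + z) - f z)).
  by apply/funext => h /=; rewrite /GRing.scale /= mulr1.
split => [/cder_cvgP H|[D <-]].
  split; first by apply/cvg_ex; exists L; rewrite E.
  by rewrite /derive1; apply/cvg_lim.
apply/cder_cvgP; rewrite /derive1; have := D; rewrite /derivable E. by [].
Qed.

Lemma cder_is f z L : cder f z L <-> is_derive z (1 : C) f L.
Proof.
split => [/cderP[D E]|[D E]].
  by apply: (@DeriveDef C C C z (1 : C) f L D); rewrite -(@derive1E C C).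
by apply/cderP; split; [exact: D | rewrite (@derive1E C C)].
Qed.

Lemma derivable_cder f z : derivable f z 1 -> cder f z (f^`()%classic z).
Proof. by move=> H; apply/cderP. Qed.

Lemma cder_derivable f z L : cder f z L -> derivable f z 1.
Proof. by move=> /cderP[]. Qed.

Lemma cder_val f z L : cder f z L -> f^`()%classic z = L.
Proof. by move=> /cderP[]. Qed.

Lemma cder_uniq f z L L' : cder f z L -> cder f z L' -> L = L'.
Proof. by move=> /cder_val <- /cder_val. Qed.

Lemma cder_cst k z : cder (fun=> k) z 0.
Proof. by move=> e e0; exists 1 => // w _; rewrite subrr mul0r subr0 nm0 mulr_ge0 ?nm_ge0 // ltW. Qed.

Lemma cder_id z : cder id z 1.
Proof. by move=> e e0; exists 1 => // w _; rewrite mul1r subrr nm0 mulr_ge0 ?nm_ge0 // ltW. Qed.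

Lemma cderD f g z L M : cder f z L -> cder g z M -> cder (fun w => f w + g w) z (L + M).
Proof. by move=> /cder_is H /cder_is G; apply/cder_is; exact: is_deriveD. Qed.

Lemma cderN f z L : cder f z L -> cder (fun w => - f w) z (- L).
Proof. by move=> /cder_is H; apply/cder_is; exact: is_deriveN. Qed.

Lemma cderB f g z L M : cder f z L -> cder g z M -> cder (fun w => f w - g w) z (L - M).
Proof. by move=> H /cderN; exact: cderD. Qed.

Lemma cderM f g z L M : cder f z L -> cder g z M ->
  cder (fun w => f w * g w) z (L * g z + f z * M).
Proof.
move=> /cder_is H /cder_is G; apply/cder_is.
have := @is_deriveM _ _ f g z 1 _ _ H G; rewrite /GRing.scale /= => K.
by rewrite addrC [L * _]mulrC.
Qed.

Lemma cderZ f z L k : cder f z L -> cder (fun w => k * f w) z (k * L).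
Proof. by move=> /(cderM (cder_cst k z)); rewrite mul0r add0r. Qed.

Lemma cderV f z L : f z != 0 -> cder f z L -> cder (fun w => (f w)^-1) z (- L / f z ^+ 2).
Proof.
move=> f0 H; apply/cderP.
have D := cder_derivable H; split; first exact: (@derivableV C C f z 1 f0 D).
rewrite (@derive1E C C) (@deriveV C C f z 1 f0 D) -(@derive1E C C) (cder_val H).
by rewrite /GRing.scale /= !mulNr mulrC.
Qed.

Lemma cder_div f g z L M : g z != 0 -> cder f z L -> cder g z M ->
  cder (fun w => f w / g w) z ((L * g z - f z * M) / g z ^+ 2).
Proof.
move=> g0 H /(cderV g0) G; have := cderM H G.
suff -> : L / g z + f z * (- M / g z ^+ 2) = (L * g z - f z * M) / g z ^+ 2 by [].
by field.
Qed.

Lemma cderX f z L n : cder f z L -> cder (fun w => f w ^+ n) z (n%:R * f z ^+ n.-1 * L).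
Proof.
move=> H; elim: n => [|n IH].
  by rewrite !mul0r; exact: cder_cst.
have := cderM H IH; under eq_fun do rewrite -exprS.
suff -> : L * f z ^+ n + f z * (n%:R * f z ^+ n.-1 * L) = n.+1%:R * f z ^+ n * L by [].
case: n {IH} => [|n] /=; first by rewrite !mul0r mulr0 addr0 !expr0; ring.
rewrite exprS [n.+2%:R]mulrS; ring.
Qed.

Lemma cder_ccont f z L : cder f z L -> ccont f z.
Proof.
move=> H e e0; have [d d0 dP] := H 1 ltr01.
have K : 0 < 1 + nm L by have := nm_ge0 L; lra.
exists (Num.min d (e / (1 + nm L))); first by rewrite lt_min d0 divr_gt0.
move=> w; rewrite lt_min => /andP[/dP wd]; rewrite ltr_pdivlMr // => we.
rewrite -(subrK (L * (w - z)) (f w - f z)); apply: le_lt_trans (nmD _ _) _.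
rewrite nmM; apply: le_lt_trans we; move: wd; rewrite mul1r; lra.
Qed.

Lemma cder_near f g z L (r : R) : 0 < r -> (forall w, nm (w - z) < r -> f w = g w) ->
  cder f z L -> cder g z L.
Proof.
move=> r0 E H e e0; have [d d0 dP] := H e e0.
exists (Num.min d r); first by rewrite lt_min d0.
move=> w; rewrite lt_min => /andP[/dP + /E <-]; rewrite -E //.
by rewrite subrr nm0.
Qed.

Lemma cder_comp f g z L M : cder f z L -> cder g (f z) M -> cder (g \o f) z (M * L).
Proof.
move=> H G e e0.
have K : 0 < 1 + nm L by have := nm_ge0 L; lra.
have K' : 0 < 1 + nm M by have := nm_ge0 M; lra.
have [d1 d10 P1] := G (e / 2 / (1 + nm L)) (divr_gt0 (half_gt0 e0) K).
(* The bound 1 makes [f] Lipschitz at [z] with constant 1 + |L|, which the first error term absorbs;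
   the other bound halves the second error term. *)
have m0 : 0 < Num.min 1 (e / 2 / (1 + nm M)) by rewrite lt_min ltr01 !divr_gt0.
have [d2 d20 P2] := H _ m0.
have [d3 d30 P3] := cder_ccont H d10.
exists (Num.min d2 d3); first by rewrite lt_min d20.
move=> w; rewrite lt_min => /andP[w2 w3] /=.
have Q1 := P1 _ (P3 _ w3); have Q2 := P2 _ w2.
have -> : g (f w) - g (f z) - M * L * (w - z) =
  (g (f w) - g (f z) - M * (f w - f z)) + M * (f w - f z - L * (w - z)) by ring.
apply: le_trans (nmD _ _) _; rewrite nmM.
have B1 : nm (f w - f z) <= (1 + nm L) * nm (w - z).
  rewrite -(subrK (L * (w - z)) (f w - f z)); apply: le_trans (nmD _ _) _.
  rewrite nmM mulrDl mul1r lerD2r; apply: le_trans Q2 _.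
  by rewrite -[leRHS]mul1r ler_wpM2r ?nm_ge0 // ge_min lexx.
have -> : e * nm (w - z) = e / 2 * nm (w - z) + e / 2 * nm (w - z) by lra.
apply: lerD.
  apply: le_trans Q1 _; apply: (@le_trans _ _ (e / 2 / (1 + nm L) * ((1 + nm L) * nm (w - z)))).
    by rewrite ler_wpM2l // ltW // divr_gt0 // divr_gt0.
  by rewrite mulrA divfK // gt_eqF.
apply: (@le_trans _ _ (nm M * (e / 2 / (1 + nm M) * nm (w - z)))).
  rewrite ler_wpM2l ?nm_ge0 //; apply: le_trans Q2 _.
  by rewrite ler_wpM2r ?nm_ge0 // ge_min lexx orbT.
rewrite mulrA ler_wpM2r ?nm_ge0 // mulrCA -[leRHS]mulr1 ler_wpM2l //; first by lra.
by rewrite ler_pdivrMr // mul1r lerDr.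
Qed.

(** The two conjugations cancel their antilinearity, so reflected functions stay holomorphic. *)
Lemma cder_cj f z L : cder f (cj z) L -> cder (fun w => cj (f (cj w))) z (cj L).
Proof.
move=> H e e0; have [d d0 dP] := H e e0; exists d => // w wd.
have E : nm (cj w - cj z) = nm (w - z) by rewrite -cjB nm_cj.
have := dP (cj w); rewrite E => /(_ wd).
by rewrite -nm_cj !(cjB, cjM) cjK cjK.
Qed.

Lemma ccontD f g z : ccont f z -> ccont g z -> ccont (fun w => f w + g w) z.
Proof. by move=> /ccontP H /ccontP G; apply/ccontP; exact: (@cvgD _ _ _ (nbhs z) _ _ _ _ _ H G). Qed.

Lemma ccontB f g z : ccont f z -> ccont g z -> ccont (fun w => f w - g w) z.
Proof. by move=> /ccontP H /ccontP G; apply/ccontP; exact: (@cvgB _ _ _ (nbhs z) _ _ _ _ _ H G). Qed.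

Lemma ccontM f g z : ccont f z -> ccont g z -> ccont (fun w => f w * g w) z.
Proof. by move=> /ccontP H /ccontP G; apply/ccontP; exact: (@cvgM _ _ (nbhs z) _ _ _ _ _ H G). Qed.

Lemma ccontV f z : f z != 0 -> ccont f z -> ccont (fun w => (f w)^-1) z.
Proof. by move=> f0 /ccontP H; apply/ccontP; exact: (cvgV f0 H). Qed.

Lemma ccont_cst k z : ccont (fun=> k) z.
Proof. exact: cder_ccont (cder_cst _ _). Qed.

Lemma ccont_id z : ccont id z.
Proof. exact: cder_ccont (cder_id _). Qed.

Lemma ccont_comp f g z : ccont f z -> ccont g (f z) -> ccont (g \o f) z.
Proof.
move=> H G e /G [d d0 dP]; have [d' d'0 d'P] := H d d0.
by exists d' => // w /d'P /dP.
Qed.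

Lemma ccont_cj z : ccont cj z.
Proof. by move=> e e0; exists e => // w; rewrite -cjB nm_cj. Qed.

Lemma ccont_near f g z (r : R) : 0 < r -> (forall w, nm (w - z) < r -> f w = g w) ->
  ccont f z -> ccont g z.
Proof.
move=> r0 E H e e0; have [d d0 dP] := H e e0.
exists (Num.min d r); first by rewrite lt_min d0.
move=> w; rewrite lt_min => /andP[/dP + /E <-]; rewrite -E //.
by rewrite subrr nm0.
Qed.

Lemma ccont_neq0 f z : ccont f z -> f z != 0 ->
  exists2 d : R, 0 < d & forall w, nm (w - z) < d -> f w != 0.
Proof.
move=> H f0; have f0' : 0 < nm (f z) by rewrite nm_gt0.
have [d d0 dP] := H _ f0'.
exists d => // w /dP; apply: contraTneq => ->.
by rewrite sub0r nmN ltxx.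
Qed.
End ComplexBasics.

(** * Integrals along segments *)

Section SegmentIntegral.
Variable R : realType.
Local Notation C := (Cs R).
Local Notation mu := (@lebesgue_measure R).
Implicit Types (h k : R -> C) (a b : R).

Definition rccont h t := forall e : R, 0 < e ->
  exists2 d : R, 0 < d & forall s, `|s - t| < d -> nm (h s - h t) < e.

(** Bounded and measurable rather than continuous: a vertical segment crossing an exceptional line
    carries an integrand that may be discontinuous at one point. Such integrands are integrable and
    closed under products. *)
Definition good a b h :=
  [/\ measurable_fun `[a, b]%classic (fun t => reC (h t)),
      measurable_fun `[a, b]%classic (fun t => imC (h t)) &
      exists M, forall t, a <= t <= b -> nm (h t) <= M].

Definition rint a b (u : R -> R) : R := \int[mu]_(t in `[a, b]) u t.
Definition cint a b h : C := mkC (rint a b (fun t => reC (h t))) (rint a b (fun t => imC (h t))).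

Lemma rccont_re h t : rccont h t -> {for t, continuous (fun s => reC (h s))}.
Proof.
move=> H; apply/cvgrPdist_lt => e e0; have [d d0 dP] := H e e0.
apply/nbhs_ballP; exists d => //= s; rewrite /ball /= distrC => /dP.
by rewrite distrC -reB; apply: le_lt_trans (re_le_nm _).
Qed.

Lemma rccont_im h t : rccont h t -> {for t, continuous (fun s => imC (h s))}.
Proof.
move=> H; apply/cvgrPdist_lt => e e0; have [d d0 dP] := H e e0.
apply/nbhs_ballP; exists d => //= s; rewrite /ball /= distrC => /dP.
by rewrite distrC -imB; apply: le_lt_trans (im_le_nm _).
Qed.

Lemma rccont_nm h t : rccont h t -> {for t, continuous (fun s => nm (h s))}.
Proof.
move=> H; apply/cvgrPdist_lt => e e0; have [d d0 dP] := H e e0.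
apply/nbhs_ballP; exists d => //= s; rewrite /ball /= distrC => /dP.
apply: le_lt_trans; rewrite distrC ler_norml; apply/andP; split.
  by have := nmD (h t - h s) (h s); rewrite subrK nmBC; lra.
by have := nmD (h s - h t) (h t); rewrite subrK; lra.
Qed.

(** A singleton is measurable and imposes no condition, so the crossing point with an exceptional
    line costs nothing. *)
Lemma measurable_cont_off1 a b (u : R -> R) (y : R) :
  (forall t, a <= t <= b -> t != y -> {for t, continuous u}) ->
  measurable_fun `[a, b]%classic u.
Proof.
move=> H.
have mD : measurable (`[a, b]%classic `\ y) by apply: measurableD => //; exact: measurable_itv.
have S : `[a, b]%classic `<=` (`[a, b]%classic `\ y) `|` [set y].
  move=> t tab; have [->|ty] := eqVneq t y; [by right | left; split => //=; exact/eqP].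
apply: (measurable_funS _ S); first exact: measurableU.
apply/measurable_funU => //; split; last exact: measurable_fun_set1.
apply: subspace_continuous_measurable_fun => //.
apply: continuous_in_subspaceT => t /set_mem [/=]; rewrite in_itv /= => tab ty.
by apply: H => //; exact/eqP.
Qed.

Lemma good_exc a b h y M : (forall t, a <= t <= b -> t != y -> rccont h t) ->
  (forall t, a <= t <= b -> nm (h t) <= M) -> good a b h.
Proof.
move=> H HM; split; last by exists M.
  by apply: (@measurable_cont_off1 _ _ _ y) => t tab ty; apply: rccont_re; exact: H.
by apply: (@measurable_cont_off1 _ _ _ y) => t tab ty; apply: rccont_im; exact: H.
Qed.

Lemma good_cont a b h : (forall t, a <= t <= b -> rccont h t) -> good a b h.
Proof.
move=> H.
have : {within `[a, b]%classic, continuous (fun s => nm (h s))}.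
  by apply: continuous_in_subspaceT => t /set_mem /=; rewrite in_itv /= => tab;
     apply: rccont_nm; exact: H.
move=> /continuous_compact /(_ (@segment_compact R a b)) /compact_bounded [M [_ HM]].
apply: (@good_exc _ _ _ a (M + 1)) => t tab; first by move=> _; exact: H.
have := HM (M + 1); rewrite ltrDl ltr01 => /(_ isT (nm (h t))) /=.
rewrite ger0_norm ?nm_ge0 //; apply; exists t => //=; by rewrite in_itv.
Qed.

Lemma good_sub a b c d h : a <= c -> d <= b -> good a b h -> good c d h.
Proof.
move=> ac db [m1 m2 [M HM]].
have S : `[c, d]%classic `<=` `[a, b]%classic.
  by apply: subset_itv; rewrite bnd_simp.
split; try exact: (measurable_funS _ S).
by exists M => t /andP[t1 t2]; apply: HM; rewrite (le_trans ac t1) (le_trans t2 db).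
Qed.

Lemma goodI a b h : good a b h ->
  mu.-integrable `[a, b]%classic (EFin \o (fun t => reC (h t))) /\
  mu.-integrable `[a, b]%classic (EFin \o (fun t => imC (h t))).
Proof.
move=> [m1 m2 [M HM]].
have F : (mu `[a, b]%classic < +oo)%E by rewrite lebesgue_measure_itv /=; case: ifP => _; rewrite ?ltry // -EFinB ltry.
split; apply: measurable_bounded_integrable => //; exists M; split; rewrite ?num_real // => x Mx t /=;
  rewrite in_itv /= => /HM H; apply: le_trans (ltW Mx); apply: le_trans H.
  exact: re_le_nm.
exact: im_le_nm.
Qed.

Lemma good_eq a b h k : (forall t, a <= t <= b -> h t = k t) -> good a b h -> good a b k.
Proof.
move=> E [m1 m2 [M HM]]; split.
- by apply: eq_measurable_fun m1 => t /set_mem /=; rewrite in_itv /= => /E ->.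
- by apply: eq_measurable_fun m2 => t /set_mem /=; rewrite in_itv /= => /E ->.
- by exists M => t tab; rewrite -E // HM.
Qed.

Lemma goodD a b h k : good a b h -> good a b k -> good a b (fun t => h t + k t).
Proof.
move=> [m1 m2 [M HM]] [n1 n2 [N HN]]; split.
- apply: (@eq_measurable_fun _ _ _ _ _ (fun t => reC (h t) + reC (k t))).
    by move=> t _; rewrite reD.
  exact: measurable_funD.
- apply: (@eq_measurable_fun _ _ _ _ _ (fun t => imC (h t) + imC (k t))).
    by move=> t _; rewrite imD.
  exact: measurable_funD.
- by exists (M + N) => t tab; apply: le_trans (nmD _ _) _; rewrite lerD ?HM ?HN.
Qed.

Lemma goodM a b h k : good a b h -> good a b k -> good a b (fun t => h t * k t).
Proof.
move=> [m1 m2 [M HM]] [n1 n2 [N HN]]; split.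
- apply: (@eq_measurable_fun _ _ _ _ _ (fun t => reC (h t) * reC (k t) - imC (h t) * imC (k t))).
    by move=> t _; rewrite reM.
  by apply: measurable_funB; exact: measurable_funM.
- apply: (@eq_measurable_fun _ _ _ _ _ (fun t => reC (h t) * imC (k t) + imC (h t) * reC (k t))).
    by move=> t _; rewrite imM.
  by apply: measurable_funD; exact: measurable_funM.
- by exists (M * N) => t tab; rewrite nmM ler_pM ?nm_ge0 ?HM ?HN.
Qed.

Lemma good_cst a b c : good a b (fun=> c).
Proof. by apply: good_cont => t _ e e0; exists 1 => // s _; rewrite subrr nm0. Qed.

Lemma goodZ a b h c : good a b h -> good a b (fun t => c * h t).
Proof. by apply: goodM; exact: good_cst. Qed.

Lemma goodN a b h : good a b h -> good a b (fun t => - h t).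
Proof. by move=> /(goodZ (-1)); apply: good_eq => t _; rewrite mulN1r. Qed.

Lemma goodB a b h k : good a b h -> good a b k -> good a b (fun t => h t - k t).
Proof. by move=> H /goodN; exact: goodD. Qed.

Lemma cint_eq a b h k : (forall t, a <= t <= b -> h t = k t) -> cint a b h = cint a b k.
Proof.
move=> E; rewrite /cint /rint; congr mkC; apply: eq_Rintegral => t /set_mem /=;
  by rewrite in_itv /= => /E ->.
Qed.

Lemma cintD a b h k : good a b h -> good a b k ->
  cint a b (fun t => h t + k t) = cint a b h + cint a b k.
Proof.
move=> /goodI[h1 h2] /goodI[k1 k2]; apply: eqC; rewrite /cint !reimE /rint.
  by under eq_Rintegral do rewrite reD; rewrite RintegralD //; exact: measurable_itv.
by under eq_Rintegral do rewrite imD; rewrite RintegralD //; exact: measurable_itv.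
Qed.

Lemma integrable_scale a b (u : R -> R) (c : R) :
  mu.-integrable `[a, b]%classic (EFin \o u) ->
  mu.-integrable `[a, b]%classic (EFin \o (fun t => c * u t)).
Proof.
move=> H; have := integrableZl _ c H; move/(_ (measurable_itv _)).
by apply: eq_integrable; first exact: measurable_itv.
Qed.

Lemma cintZ a b h c : good a b h -> cint a b (fun t => c * h t) = c * cint a b h.
Proof.
move=> /goodI[h1 h2]; apply: eqC; rewrite /cint !reimE /rint.
  under eq_Rintegral do rewrite reM.
  rewrite RintegralB ?RintegralZl //; try exact: measurable_itv; exact: integrable_scale.
under eq_Rintegral do rewrite imM.
rewrite RintegralD ?RintegralZl //; try exact: measurable_itv; exact: integrable_scale.
Qed.

Lemma cintN a b h : good a b h -> cint a b (fun t => - h t) = - cint a b h.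
Proof.
by move=> H; rewrite -mulN1r -cintZ //; apply: cint_eq => t _; rewrite mulN1r.
Qed.

Lemma cintB a b h k : good a b h -> good a b k ->
  cint a b (fun t => h t - k t) = cint a b h - cint a b k.
Proof. by move=> H K; rewrite cintD ?cintN //; exact: goodN. Qed.

Lemma rint_cst a b (c : R) : a <= b -> rint a b (fun=> c) = c * (b - a).
Proof.
move=> ab; rewrite /rint Rintegral_cst; last exact: measurable_itv.
have E : mu `[a, b]%classic = (b - a)%:E.
  rewrite lebesgue_measure_itv /= lte_fin; case: ltP => [//|ba].
  by have -> : a = b; [apply/le_anti; rewrite ab ba | rewrite subrr].
exact: (congr1 (fun x => c * fine x) E).
Qed.

Lemma rint_le a b (u : R -> R) (M : R) : a <= b ->
  mu.-integrable `[a, b]%classic (EFin \o u) ->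
  (forall t, a <= t <= b -> `|u t| <= M) -> `|rint a b u| <= M * (b - a).
Proof.
move=> ab iu H; rewrite -rint_cst //.
apply: (@le_trans _ _ (rint a b (fun t => `|u t|))).
  by apply: le_normr_Rintegral => //; exact: measurable_itv.
have S t : `[a, b]%classic t -> `|u t| <= M by rewrite /= in_itv /= => /H.
rewrite /rint; apply: le_Rintegral; [exact: measurable_itv | exact: integrable_norm | | exact: S].
exact: (goodI (good_cst a b (rC M))).1.
Qed.

(** Real and imaginary parts are bounded separately, hence the factor 2. *)
Lemma cint_le a b h M : a <= b -> good a b h ->
  (forall t, a <= t <= b -> nm (h t) <= M) -> nm (cint a b h) <= 2 * M * (b - a).
Proof.
move=> ab /goodI[h1 h2] H; apply: le_trans (nm_le_reim _) _.
rewrite /cint re_mk im_mk -mulrA mulr_natl mulr2n; apply: lerD; apply: rint_le => // t tab;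
  apply: le_trans (H _ tab); [exact: re_le_nm | exact: im_le_nm].
Qed.

Lemma cint_cst a b c : a <= b -> cint a b (fun=> c) = c * rC (b - a).
Proof.
by move=> ab; rewrite /cint !rint_cst //; apply: eqC; rewrite !reimE; ring.
Qed.

Lemma rint_cat a b c (u : R -> R) : a <= b -> b <= c ->
  mu.-integrable `[a, c]%classic (EFin \o u) -> rint a c u = rint a b u + rint b c u.
Proof.
move=> ab bc iu; rewrite /rint.
have S : `]b, c]%classic `<=` `[a, c]%classic by apply: subset_itv; rewrite bnd_simp.
have iu' : mu.-integrable `]b, c]%classic (EFin \o u).
  apply: (integrableS _ _ _ iu) => //; exact: measurable_itv.
rewrite -(Rintegral_itv_obnd_cbnd iu') -(@Rintegral_itvB _ u (BLeft a) (BRight c) b) //.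
  by rewrite addrC subrK.
Qed.

Lemma cint_cat a b c h : a <= b -> b <= c -> good a c h ->
  cint a c h = cint a b h + cint b c h.
Proof.
move=> ab bc /goodI[h1 h2]; apply: eqC; rewrite /cint !reimE;
  exact: rint_cat.
Qed.

Lemma cint_pt a h : cint a a h = 0.
Proof.
by rewrite /cint /rint set_itv1 !Rintegral_set1.
Qed.

Lemma rccont_h (f : C -> C) x y : ccont f (mkC x y) -> rccont (fun t => f (mkC t y)) x.
Proof.
move=> H e /H [d d0 dP]; exists d => // s sx; apply: dP.
have -> : mkC s y - mkC x y = rC (s - x) by apply: eqC; rewrite !reimE //; ring.
by rewrite nm_rC.
Qed.

Lemma rccont_v (f : C -> C) x y : ccont f (mkC x y) -> rccont (fun t => f (mkC x t)) y.
Proof.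
move=> H e /H [d d0 dP]; exists d => // s sy; apply: dP.
have -> : mkC x s - mkC x y = iC R * rC (s - y) by apply: eqC; rewrite !reimE //; ring.
by rewrite nmM nm_iC mul1r nm_rC.
Qed.
End SegmentIntegral.

(** * Goursat's theorem on rectangles *)

Section Goursat.
Variable R : realType.
Local Notation C := (Cs R).
Local Notation iC := (iC R).
Implicit Types (f g : C -> C) (a b c d : R).

(** The counterclockwise contour integral around [a, b] x [c, d]. Opposite sides share one
    integrand, so that a bound on their difference can be used before integrating. *)
Definition rect f a b c d : C :=
  cint a b (fun x => f (mkC x c) - f (mkC x d)) +
  iC * cint c d (fun y => f (mkC b y) - f (mkC a y)).
Definition goodh f y a b := good a b (fun x => f (mkC x y)).
Definition goodv f x c d := good c d (fun y => f (mkC x y)).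

Lemma goodh_cont f y a b : (forall x, a <= x <= b -> ccont f (mkC x y)) -> goodh f y a b.
Proof. by move=> H; apply: good_cont => x /H; exact: rccont_h. Qed.

Lemma goodv_cont f x c d : (forall y, c <= y <= d -> ccont f (mkC x y)) -> goodv f x c d.
Proof. by move=> H; apply: good_cont => y /H; exact: rccont_v. Qed.

Lemma rect_splity f a b c e d : c <= e -> e <= d ->
  goodh f c a b -> goodh f e a b -> goodh f d a b -> goodv f a c d -> goodv f b c d ->
  rect f a b c d = rect f a b c e + rect f a b e d.
Proof.
move=> ce ed hc he hd va vb; rewrite /rect.
rewrite (cintB hc hd) (cintB hc he) (cintB he hd) (cint_cat ce ed); last exact: goodB.
ring.
Qed.

Lemma rect_splitx f a e b c d : a <= e -> e <= b ->
  goodh f c a b -> goodh f d a b -> goodv f a c d -> goodv f e c d -> goodv f b c d ->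
  rect f a b c d = rect f a e c d + rect f e b c d.
Proof.
move=> ae eb hc hd va ve vb; rewrite /rect.
rewrite (cintB vb va) (cintB ve va) (cintB vb ve) (cint_cat ae eb); last exact: goodB.
ring.
Qed.

Definition goodr f a b c d :=
  [/\ goodh f c a b, goodh f d a b, goodv f a c d & goodv f b c d].

Lemma goodr_cont f a b c d : a <= b -> c <= d ->
  (forall x y, a <= x <= b -> c <= y <= d -> ccont f (mkC x y)) -> goodr f a b c d.
Proof.
move=> ab cd H; split.
- by apply: goodh_cont => x xab; apply: H; rewrite ?lexx ?cd ?ab.
- by apply: goodh_cont => x xab; apply: H; rewrite ?lexx ?cd ?ab.
- by apply: goodv_cont => x xab; apply: H; rewrite ?lexx ?cd ?ab.
- by apply: goodv_cont => x xab; apply: H; rewrite ?lexx ?cd ?ab.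
Qed.

Lemma rectB f g a b c d : goodr f a b c d -> goodr g a b c d ->
  rect (fun z => f z - g z) a b c d = rect f a b c d - rect g a b c d.
Proof.
move=> [h1 h2 v1 v2] [k1 k2 w1 w2]; rewrite /rect.
have e1 := cintB (goodB h1 h2) (goodB k1 k2).
have e2 := cintB (goodB v2 v1) (goodB w2 w1).
have -> : forall x y z t : C, x + iC * y - (z + iC * t) = (x - z) + iC * (y - t) by move=> *; ring.
by rewrite -e1 -e2; congr (_ + iC * _); apply: cint_eq => t _; ring.
Qed.

Lemma rectZ f k a b c d : goodr f a b c d ->
  rect (fun z => k * f z) a b c d = k * rect f a b c d.
Proof.
move=> [h1 h2 v1 v2]; rewrite /rect mulrDr mulrCA.
rewrite -(cintZ _ (goodB h1 h2)) -(cintZ _ (goodB v2 v1)).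
by congr (_ + iC * _); apply: cint_eq => t _; ring.
Qed.

Lemma rect_le f a b c d M : a <= b -> c <= d -> goodr f a b c d ->
  (forall x, a <= x <= b -> nm (f (mkC x c)) <= M) ->
  (forall x, a <= x <= b -> nm (f (mkC x d)) <= M) ->
  (forall y, c <= y <= d -> nm (f (mkC a y)) <= M) ->
  (forall y, c <= y <= d -> nm (f (mkC b y)) <= M) ->
  nm (rect f a b c d) <= 4 * M * ((b - a) + (d - c)).
Proof.
move=> ab cd [h1 h2 v1 v2] H1 H2 H3 H4; rewrite /rect.
apply: le_trans (nmD _ _) _; rewrite nmM nm_iC mul1r mulrDr; apply: lerD.
  have -> : 4 * M = 2 * (M + M) by ring.
  apply: cint_le => //; first exact: goodB.
  by move=> t tt; apply: le_trans (nmB _ _) _; apply: lerD; [exact: H1|exact: H2].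
have -> : 4 * M = 2 * (M + M) by ring.
apply: cint_le => //; first exact: goodB.
by move=> t tt; apply: le_trans (nmB _ _) _; apply: lerD; [exact: H4|exact: H3].
Qed.

Lemma rect_affine (u v : C) a b c d : a <= b -> c <= d ->
  rect (fun z => u + v * z) a b c d = 0.
Proof.
move=> ab cd; rewrite /rect.
rewrite (@cint_eq _ _ _ _ (fun=> v * iC * rC (c - d))); last first.
  by move=> t _; rewrite !(mkCE t) rCB; ring.
rewrite (@cint_eq _ _ _ (fun y => u + v * mkC b y - (u + v * mkC a y)) (fun=> v * rC (b - a))); last first.
  by move=> t _; rewrite (mkCE b) (mkCE a) rCB; ring.
by rewrite !cint_cst // !rCB; ring.
Qed.

Lemma ccont_affine (u v : C) z : ccont (fun z => u + v * z) z.
Proof.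
apply: ccontD; first exact: ccont_cst.
by apply: ccontM; [exact: ccont_cst | exact: ccont_id].
Qed.

Lemma nm_le_box (x y x' y' : R) : nm (mkC x y - mkC x' y') <= `|x - x'| + `|y - y'|.
Proof. by apply: le_trans (nm_le_reim _) _; rewrite !reimE. Qed.

(** The affine part f(z) + L (w - z) integrates to 0 around the rectangle, and the remainder is at
    most [e] times the half-perimeter on every side. *)
Lemma goursat_local f a b c d (x y : R) L (e : R) : a <= b -> c <= d -> a <= x <= b -> c <= y <= d ->
  (forall s t, a <= s <= b -> c <= t <= d -> ccont f (mkC s t)) -> 0 <= e ->
  (forall s t, a <= s <= b -> c <= t <= d ->
    nm (f (mkC s t) - f (mkC x y) - L * (mkC s t - mkC x y)) <= e * nm (mkC s t - mkC x y)) ->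
  nm (rect f a b c d) <= 4 * e * ((b - a) + (d - c)) ^+ 2.
Proof.
move=> ab cd xab ycd Hc e0 H.
set z := mkC x y.
pose r := fun w => f w - ((f z - L * z) + L * w).
have Gf : goodr f a b c d by exact: goodr_cont.
have Ga : goodr (fun w => (f z - L * z) + L * w) a b c d.
  by apply: goodr_cont => // *; exact: ccont_affine.
have Gr : goodr r a b c d.
  by apply: goodr_cont => // s t hs ht; apply: ccontB; [exact: Hc | exact: ccont_affine].
have -> : rect f a b c d = rect r a b c d by rewrite (rectB Gf Ga) rect_affine // subr0.
have Hr s t : a <= s <= b -> c <= t <= d -> nm (r (mkC s t)) <= e * ((b - a) + (d - c)).
  move=> hs ht; have -> : r (mkC s t) = f (mkC s t) - f z - L * (mkC s t - z) by rewrite /r; ring.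
  apply: le_trans (H s t hs ht) _; rewrite ler_wpM2l //.
  apply: le_trans (nm_le_box _ _ _ _) _; apply: lerD; rewrite ler_norml;
  by move: xab ycd hs ht => /andP[? ?] /andP[? ?] /andP[? ?] /andP[? ?]; apply/andP; split; lra.
rewrite expr2 mulrA -[4 * e * _]mulrA; apply: rect_le => // t tt; apply: Hr => //;
  by rewrite ?lexx ?ab ?cd.
Qed.

(** One half keeps at least half of the modulus. [a'] is the left end of that half, whose width is
    (b - a) / 2 in both cases. *)
Lemma goursat_halfx f a b c d (eta : R) : a <= b -> c <= d ->
  (forall s t, a <= s <= b -> c <= t <= d -> ccont f (mkC s t)) ->
  eta <= nm (rect f a b c d) ->
  exists2 a', a' = a \/ a' = a + (b - a) / 2 & eta / 2 <= nm (rect f a' (a' + (b - a) / 2) c d).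
Proof.
move=> ab cd Hc H; set m := a + (b - a) / 2.
have am : a <= m by rewrite /m; lra.
have mb : m <= b by rewrite /m; lra.
have E : rect f a b c d = rect f a m c d + rect f m b c d.
  apply: rect_splitx => //; [apply: goodh_cont|apply: goodh_cont|apply: goodv_cont|apply: goodv_cont|apply: goodv_cont];
    move=> t tt; apply: Hc; rewrite ?lexx ?ab ?cd ?am ?mb //.
have N := nmD (rect f a m c d) (rect f m b c d).
have [h|h] := leP (eta / 2) (nm (rect f a m c d)); first by exists a; [left|].
exists m; first by right.
have -> : m + (b - a) / 2 = b by rewrite /m; lra.
by rewrite E in H; lra.
Qed.

Lemma goursat_halfy f a b c d (eta : R) : a <= b -> c <= d ->
  (forall s t, a <= s <= b -> c <= t <= d -> ccont f (mkC s t)) ->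
  eta <= nm (rect f a b c d) ->
  exists2 c', c' = c \/ c' = c + (d - c) / 2 & eta / 2 <= nm (rect f a b c' (c' + (d - c) / 2)).
Proof.
move=> ab cd Hc H; set m := c + (d - c) / 2.
have am : c <= m by rewrite /m; lra.
have mb : m <= d by rewrite /m; lra.
have E : rect f a b c d = rect f a b c m + rect f a b m d.
  apply: rect_splity => //; [apply: goodh_cont|apply: goodh_cont|apply: goodh_cont|apply: goodv_cont|apply: goodv_cont];
    move=> t tt; apply: Hc; rewrite ?lexx ?ab ?cd ?am ?mb //.
have N := nmD (rect f a b c m) (rect f a b m d).
have [h|h] := leP (eta / 2) (nm (rect f a b c m)); first by exists c; [left|].
exists m; first by right.
have -> : m + (d - c) / 2 = d by rewrite /m; lra.
by rewrite E in H; lra.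
Qed.

Lemma goursat_quarter f a b c d (eta : R) : a <= b -> c <= d ->
  (forall s t, a <= s <= b -> c <= t <= d -> ccont f (mkC s t)) ->
  eta <= nm (rect f a b c d) ->
  exists a' c', [/\ a <= a', a' + (b - a) / 2 <= b, c <= c', c' + (d - c) / 2 <= d &
    eta / 4 <= nm (rect f a' (a' + (b - a) / 2) c' (c' + (d - c) / 2))].
Proof.
move=> ab cd Hc H; have [a' a'E K1] := goursat_halfx ab cd Hc H.
have a1 : a <= a' by case: a'E => -> {Hc H K1}; lra.
have a2 : a' + (b - a) / 2 <= b by case: a'E => -> {Hc H K1}; lra.
have a3 : a' <= a' + (b - a) / 2 by clear -ab; lra.
have Hc2 s t : a' <= s <= a' + (b - a) / 2 -> c <= t <= d -> ccont f (mkC s t).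
  by move=> /andP[h k]; apply: Hc; rewrite (le_trans a1 h) (le_trans k a2).
have [c' c'E K2] := goursat_halfy a3 cd Hc2 K1.
exists a', c'; split => //; [case: c'E => -> {Hc Hc2 H K1 K2}; lra..|].
by apply: le_trans K2; clear; lra.
Qed.

(** The supremum of the left ends lies below every right end. *)
Lemma nested_lim (u l : nat -> R) (w : R) : (forall n, u n <= u n.+1) ->
  (forall n, u n.+1 + l n.+1 <= u n + l n) -> (forall n, 0 <= l n) ->
  exists x, forall n, u n <= x <= u n + l n.
Proof.
move=> ui li l0.
have mu m n : (m <= n)%N -> u m <= u n by exact: (homo_leq (@lexx _ _) (@le_trans _ _) ui).
have ml m n : (m <= n)%N -> u n + l n <= u m + l m.
  by move=> mn; apply: (homo_leq (f := fun n => u n + l n) (r := fun x y => y <= x)) => // x y z h k; exact: le_trans k h.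
have ub m n : u m <= u n + l n.
  case: (leqP m n) => mn; first by apply: le_trans (mu _ _ mn) _; rewrite lerDl.
  by apply: le_trans (ml _ _ (ltnW mn)); rewrite lerDl.
exists (sup (range u)) => n; apply/andP; split.
  by apply: ub_le_sup; [exists (u 0 + l 0) => _ [m _ <-]; exact: ub | exists n].
by apply: ge_sup; [exists (u 0), 0 | move=> _ [m _ <-]; exact: ub].
Qed.

Theorem goursat f a b c d : a <= b -> c <= d ->
  (forall x y, a <= x <= b -> c <= y <= d -> derivable f (mkC x y) 1) ->
  rect f a b c d = 0.
Proof.
move=> ab cd Hd.
have Hc x y : a <= x <= b -> c <= y <= d -> ccont f (mkC x y).
  by move=> h k; have /derivable_cder := Hd _ _ h k; exact: cder_ccont.
apply/eqP; rewrite -nm_eq0; apply/negP => /negP E0.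
set eta := nm (rect f a b c d) in E0.
have eta0 : 0 < eta by rewrite lt_neqAle eq_sym E0 nm_ge0.
pose w n := (b - a) * (2^-1) ^+ n; pose h n := (d - c) * (2^-1) ^+ n.
have wS n : w n.+1 = w n / 2 by rewrite /w exprSr mulrA.
have hS n : h n.+1 = h n / 2 by rewrite /h exprSr mulrA.
have e20 n : 0 <= (2^-1 : R) ^+ n by rewrite exprn_ge0 // invr_ge0.
have w0 n : 0 <= w n by rewrite /w mulr_ge0 // subr_ge0.
have h0 n : 0 <= h n by rewrite /h mulr_ge0 // subr_ge0.
(* A state holds the generation n and the lower left corner of a rectangle with sides [w n] and
   [h n]. The invariant is containment in the original rectangle and a contour integral of modulus
   at least eta / 4^n. *)
pose inv (s : nat * (R * R)) := [/\ a <= s.2.1, s.2.1 + w s.1 <= b, c <= s.2.2, s.2.2 + h s.1 <= d &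
  eta * (4^-1) ^+ s.1 <= nm (rect f s.2.1 (s.2.1 + w s.1) s.2.2 (s.2.2 + h s.1))].
pose scaled_step (s t : nat * (R * R)) := inv s -> [/\ inv t, t.1 = s.1.+1, (s.2.1 <= t.2.1) /\ (t.2.1 + w t.1 <= s.2.1 + w s.1), s.2.2 <= t.2.2 & t.2.2 + h t.1 <= s.2.2 + h s.1].
have step s : {t | scaled_step s t}.
  apply: cid; case: (pselect (inv s)) => [I|nI]; last by exists s.
  case: s I => n [x y]; rewrite /inv /= => -[i1 i2 i3 i4 i5].
  have xw : x <= x + w n by rewrite lerDl.
  have yh : y <= y + h n by rewrite lerDl.
  have Hc1 s t : x <= s <= x + w n -> y <= t <= y + h n -> ccont f (mkC s t).
    move=> /andP[s1 s2] /andP[t1 t2].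
    by apply: Hc; rewrite ?(le_trans i1 s1) ?(le_trans s2 i2) ?(le_trans i3 t1) ?(le_trans t2 i4).
  have [x' [y']] := goursat_quarter xw yh Hc1 i5.
  have EE (u v : R) : u + v - u = v by ring.
  rewrite !EE => -[k1 k2 k3 k4 k5].
  exists (n.+1, (x', y')); rewrite /scaled_step /inv /= wS hS => _; split => //.
  split => //; rewrite ?(le_trans i1 k1) ?(le_trans k2 i2) ?(le_trans i3 k3) ?(le_trans k4 i4) //.
  by rewrite exprSr mulrA.
have [F [F0 FS]] := dependent_choice step (0%N, (a, c)).
have I0 : inv (F 0%N).
  rewrite F0 /inv /= /w /h !expr0 !mulr1; have -> : a + (b - a) = b by lra.
  by have -> : c + (d - c) = d by lra.
have In n : inv (F n) by elim: n => // n /FS[].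
have F1 n : (F n).1 = n by elim: n => [|n IH]; [rewrite F0 | have [_ -> _ _ _] := FS n (In n); rewrite IH].
have [|n|n|x Hx] := @nested_lim (fun n => (F n).2.1) w 0.
- by move=> n; have [_ _ [+ _] _ _] := FS n (In n).
- by have [_ _ [_ +] _ _] := FS n (In n); rewrite !F1.
- exact: w0.
have [|n|n|y Hy] := @nested_lim (fun n => (F n).2.2) h 0.
- by move=> n; have [_ _ _ + _] := FS n (In n).
- by have [_ _ _ _] := FS n (In n); rewrite !F1.
- exact: h0.
have := Hd x y; have := Hx 0%N; have := Hy 0%N; rewrite F0 /= /w /h !expr0 !mulr1.
have -> : a + (b - a) = b by lra.
have -> : c + (d - c) = d by lra.
move=> yy xx /(_ xx yy) /derivable_cder D.
pose S := (b - a) + (d - c).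
(* With e = eta / (8 (S^2 + 1)) the local estimate 4 e (S / 2^n)^2 equals eta / 4^n times S^2 / (2
   (S^2 + 1)), a factor below 1; the summand 1 covers S = 0. *)
have D0 : 0 < 8 * (S ^+ 2 + 1) by rewrite mulr_gt0 // ltr_wpDl // sqr_ge0.
have [dl dl0 dlP] := D (eta / (8 * (S ^+ 2 + 1))) (divr_gt0 eta0 D0).
have [n Hn] : exists n, S * (2^-1) ^+ n < dl.
  have : (S * (2^-1 : R) ^+ n) @[n --> \oo] --> S * 0.
    by apply: cvgM; [exact: cvg_cst | apply: cvg_expr; rewrite ger0_norm ?invr_ge0 // invf_lt1 // ltr1n].
  rewrite mulr0 => /cvgrPdist_lt /(_ _ dl0) [N _ NP]; exists N.
  have := NP N (leqnn N) ; rewrite sub0r normrN; apply: le_lt_trans; exact: ler_norm.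
have [i1 i2 i3 i4 i5] := In n; rewrite !F1 in i2 i4 i5.
have xw : (F n).2.1 <= (F n).2.1 + w n by rewrite lerDl.
have yh : (F n).2.2 <= (F n).2.2 + h n by rewrite lerDl.
have Hxn := Hx n; have Hyn := Hy n.
have K : nm (rect f (F n).2.1 ((F n).2.1 + w n) (F n).2.2 ((F n).2.2 + h n)) <=
  4 * (eta / (8 * (S ^+ 2 + 1))) * (((F n).2.1 + w n - (F n).2.1) + ((F n).2.2 + h n - (F n).2.2)) ^+ 2.
  apply: (@goursat_local _ _ _ _ _ x y (f^`()%classic (mkC x y))) => //.
  - move=> s t /andP[s1 s2] /andP[t1 t2].
    by apply: Hc; rewrite ?(le_trans i1 s1) ?(le_trans s2 i2) ?(le_trans i3 t1) ?(le_trans t2 i4).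
  - by rewrite ltW // divr_gt0.
  move=> s t /andP[s1 s2] /andP[t1 t2]; apply: dlP.
  apply: le_lt_trans (nm_le_box _ _ _ _) _; apply: le_lt_trans Hn.
  have -> : S * 2^-1 ^+ n = w n + h n by rewrite /S /w /h; ring.
  move: Hxn Hyn => /andP[x1 x2] /andP[y1 y2].
  apply: lerD; rewrite ler_norml; apply/andP; split.
  + by clear -s1 x2; lra.
  + by clear -s2 x1; lra.
  + by clear -t1 y2; lra.
  + by clear -t2 y1; lra.
have := le_trans i5 K.
have -> : (F n).2.1 + w n - (F n).2.1 + ((F n).2.2 + h n - (F n).2.2) = S * 2^-1 ^+ n by rewrite /S /w /h; ring.
rewrite exprMn exprAC.
have -> : (2^-1 : R) ^+ 2 = 4^-1 by field.
rewrite [X in _ <= X]mulrA ler_pM2r ?exprn_gt0 ?invr_gt0 //.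
apply/negP; rewrite -ltNge.
have S2 := sqr_ge0 S.
have -> : 4 * (eta / (8 * (S ^+ 2 + 1))) * S ^+ 2 = eta * (S ^+ 2 / (2 * (S ^+ 2 + 1))).
  by field; rewrite gt_eqF // ltr_wpDl.
rewrite -[ltRHS]mulr1 ltr_pM2l // ltr_pdivrMr; clear -S2; lra.
Qed.
End Goursat.

(** * Cauchy's theorem across an exceptional line *)

Section Cauchy.
Variable R : realType.
Local Notation C := (Cs R).
Local Notation iC := (iC R).
Local Notation mu := (@lebesgue_measure R).
Implicit Types (f g : C -> C) (a b c d : R).

Lemma rint_dct a b (u : nat -> R -> R) (M : R) :
  (forall n, measurable_fun `[a, b]%classic (u n)) ->
  (forall n t, a <= t <= b -> `|u n t| <= M) ->
  (forall t, a <= t <= b -> u n t @[n --> \oo] --> 0) ->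
  rint a b (u n) @[n --> \oo] --> 0.
Proof.
move=> mu_ bu cu.
have iM : mu.-integrable `[a, b]%classic (EFin \o (fun=> M)).
  exact: (goodI (good_cst a b (rC M))).1.
have A1 : \forall t \ae mu, `[a, b]%classic t -> (EFin \o u n) t @[n --> \oo] --> (EFin \o (fun=> (0 : R))) t.
  apply: aeW => t /=; rewrite in_itv /= => tab; apply: cvg_EFin; first by near=> n.
  exact: cu.
have A2 : \forall t \ae mu, forall n, `[a, b]%classic t -> (`|(EFin \o u n) t| <= (EFin \o (fun=> M)) t)%E.
  by apply: aeW => t n /=; rewrite in_itv /= => tab; rewrite lee_fin bu.
have mI := measurable_itv (Interval (BLeft a) (BRight b)).
have Hu n : measurable_fun `[a, b]%classic (EFin \o u n) by apply/measurable_EFinP.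
have [_ _ H] := @dominated_convergence _ _ _ mu _ mI _ _ _ Hu (measurable_cst _) A1 iM A2.
rewrite /= integral0 in H; exact: (fine_cvg H).
Unshelve. all: end_near.
Qed.

(* The class of integrands for which Cauchy's theorem survives an exceptional horizontal line:
   nothing is assumed on the line itself, only that the jump across it tends to 0. *)
Definition exc_line f a b c d y0 :=
  [/\ forall x y, a <= x <= b -> c <= y <= d -> y != y0 -> derivable f (mkC x y) 1,
      exists M, forall x y, a <= x <= b -> c <= y <= d -> nm (f (mkC x y)) <= M &
      forall x, a <= x <= b -> forall e : R, 0 < e -> exists2 t0 : R, 0 < t0 &
        forall t, 0 < t -> t < t0 -> nm (f (mkC x (y0 + t)) - f (mkC x (y0 - t))) < e].

Lemma cint_dct a b (h : nat -> R -> C) (M : R) :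
  (forall n, good a b (h n)) ->
  (forall n t, a <= t <= b -> nm (h n t) <= M) ->
  (forall t, a <= t <= b -> forall e : R, 0 < e -> exists N : nat, forall n, (N <= n)%N -> nm (h n t) < e) ->
  forall e : R, 0 < e -> exists N : nat, forall n, (N <= n)%N -> nm (cint a b (h n)) < e.
Proof.
move=> hg hM hc e e0.
have C1 : rint a b (fun t => reC (h n t)) @[n --> \oo] --> 0.
  apply: (@rint_dct _ _ _ M).
  - by move=> n; have [] := hg n.
  - by move=> n t tab; apply: le_trans (re_le_nm _) (hM _ _ tab).
  - move=> t tab; apply/cvgrPdist_lt => d d0; have [N NP] := hc t tab d d0.
    by exists N => // n /= /NP; rewrite sub0r normrN; apply: le_lt_trans (re_le_nm _).
have C2 : rint a b (fun t => imC (h n t)) @[n --> \oo] --> 0.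
  apply: (@rint_dct _ _ _ M).
  - by move=> n; have [] := hg n.
  - by move=> n t tab; apply: le_trans (im_le_nm _) (hM _ _ tab).
  - move=> t tab; apply/cvgrPdist_lt => d d0; have [N NP] := hc t tab d d0.
    by exists N => // n /= /NP; rewrite sub0r normrN; apply: le_lt_trans (im_le_nm _).
move/cvgrPdist_lt : C1 => /(_ _ (half_gt0 e0)) [N1 _ H1].
move/cvgrPdist_lt : C2 => /(_ _ (half_gt0 e0)) [N2 _ H2].
exists (maxn N1 N2) => n; rewrite geq_max => /andP[/H1 k1 /H2 k2].
apply: le_lt_trans (nm_le_reim _) _; rewrite /cint re_mk im_mk.
by move: k1 k2; rewrite /= !sub0r !normrN; lra.
Qed.

(** A strip of height 2t around the line is cut out. The two outer rectangles contribute 0 and the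
    vertical sides of the strip O(t). Its horizontal sides tend to 0 by dominated convergence, the
    difference of their integrands being bounded by 2M and pointwise convergent to 0. *)
Lemma rect_line f a b c d y0 (M : R) : a <= b -> c < y0 -> y0 < d ->
  (forall x y, a <= x <= b -> c <= y <= d -> nm (f (mkC x y)) <= M) ->
  (forall y, c <= y <= d -> y != y0 -> goodh f y a b) ->
  goodv f a c d -> goodv f b c d ->
  (forall y, c <= y -> y < y0 -> rect f a b c y = 0) ->
  (forall y, y0 < y -> y <= d -> rect f a b y d = 0) ->
  (forall x, a <= x <= b -> forall e : R, 0 < e -> exists2 t0 : R, 0 < t0 &
        forall t, 0 < t -> t < t0 -> nm (f (mkC x (y0 + t)) - f (mkC x (y0 - t))) < e) ->
  rect f a b c d = 0.
Proof.
move=> ab cy yd HM gh va vb lo hi J.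
have M0 : 0 <= M by apply: le_trans (HM a c _ _); rewrite ?nm_ge0 ?lexx ?ab // (ltW (lt_trans cy yd)).
pose D := Num.min (y0 - c) (d - y0).
have D0 : 0 < D by rewrite lt_min !subr_gt0 cy.
have Dc : D <= y0 - c by rewrite ge_min lexx.
have Dd : D <= d - y0 by rewrite ge_min lexx orbT.
(* The 2 makes [tt n] smaller than [D] already for n = 0, so the strip stays inside the
   rectangle. *)
pose tt (n : nat) := D / n.+2%:R.
have tt0 n : 0 < tt n by rewrite divr_gt0.
have ttD n : tt n < D by rewrite ltr_pdivrMr // -[ltLHS]mulr1 ltr_pM2l // ltr1n.
have ttc : forall e : R, 0 < e -> exists N, forall n, (N <= n)%N -> tt n < e.
  move=> e e0; pose N := Num.bound (D / e); exists N => n Nn.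
  rewrite ltr_pdivrMr // mulrC -ltr_pdivrMr //.
  have := archi_boundP (ltW (divr_gt0 D0 e0)); move/lt_le_trans; apply.
  by rewrite ler_nat (leq_trans Nn) // -addn2 leq_addr.
pose h n x := f (mkC x (y0 - tt n)) - f (mkC x (y0 + tt n)).
have yl n : c <= y0 - tt n <= d by have := ttD n; have := tt0 n; move=> *; apply/andP; split; lra.
have yr n : c <= y0 + tt n <= d by have := ttD n; have := tt0 n; move=> *; apply/andP; split; lra.
have yln n : y0 - tt n != y0 by rewrite lt_eqF // ltrBlDr ltrDl.
have yrn n : y0 + tt n != y0 by rewrite gt_eqF // ltrDl.
have hg n : good a b (h n) by apply: goodB; apply: gh.
have HH := @cint_dct a b h (M + M) hg.
have {}HH : forall e : R, 0 < e -> exists N : nat, forall n, (N <= n)%N -> nm (cint a b (h n)) < e.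
  apply: HH.
    by move=> n t tab; apply: le_trans (nmB _ _) _; rewrite lerD // HM.
  move=> t tab e e0; have [t0 t00 H] := J t tab e e0.
  by have [N NP] := ttc _ t00; exists N => n /NP K; rewrite /h nmBC; apply: H.
apply/eqP; rewrite -nm_eq0; apply/negP => /negP E.
have E0 : 0 < nm (rect f a b c d) by rewrite lt_neqAle eq_sym E nm_ge0.
set e := nm _ in E0 E.
(* The vertical sides of the strip contribute at most 2 (2M) (2t) = 8Mt. *)
have K0 : 0 < 1 + 8 * M by lra.
have [N1 H1] := HH (e / 2) (half_gt0 E0).
have [N2 H2] := ttc (e / 2 / (1 + 8 * M)) (divr_gt0 (half_gt0 E0) K0).
pose n := maxn N1 N2.
have {}H1 := H1 n (leq_maxl _ _); have {}H2 := H2 n (leq_maxr _ _).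
have /andP[yl1 yl2] := yl n; have /andP[yr1 yr2] := yr n; have t0 := tt0 n.
have cd : c <= d by exact: le_trans yl1 yl2.
have ghc : goodh f c a b by apply: gh; rewrite ?lexx ?cd // lt_eqF.
have ghd : goodh f d a b by apply: gh; rewrite ?lexx ?cd // gt_eqF.
have ghl : goodh f (y0 - tt n) a b by apply: gh.
have ghr : goodh f (y0 + tt n) a b by apply: gh.
have lr : y0 - tt n <= y0 + tt n by lra.
have va' : goodv f a (y0 - tt n) d by apply: good_sub va.
have vb' : goodv f b (y0 - tt n) d by apply: good_sub vb.
have va2 : goodv f a (y0 - tt n) (y0 + tt n) by apply: good_sub va'.
have vb2 : goodv f b (y0 - tt n) (y0 + tt n) by apply: good_sub vb'.
have RE : rect f a b c d = rect f a b (y0 - tt n) (y0 + tt n).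
  rewrite (rect_splity yl1 yl2 ghc ghl ghd va vb) lo //; last by rewrite ltrBlDr ltrDl.
  by rewrite (rect_splity lr yr2 ghl ghr ghd va' vb') hi ?add0r ?addr0 // ltrDl.
have : e <= nm (cint a b (h n)) + 2 * (M + M) * (2 * tt n).
  rewrite {1}/e RE /rect; apply: le_trans (nmD _ _) _; rewrite lerD2l nmM nm_iC mul1r.
  have -> : 2 * tt n = (y0 + tt n) - (y0 - tt n) by ring.
  apply: cint_le => //; first exact: goodB.
  move=> t /andP[t1 t2]; apply: le_trans (nmB _ _) _.
  by rewrite lerD // HM ?lexx ?ab // (le_trans yl1 t1) (le_trans t2 yr2).
move: H2; rewrite ltr_pdivlMr // => H2; nra.
Qed.

Lemma exc_line_goodv f a b c d y0 x : exc_line f a b c d y0 -> a <= x <= b -> goodv f x c d.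
Proof.
move=> [D [M HM] _] xab; apply: (@good_exc _ _ _ _ y0 M) => y ycd; last exact: HM.
by move=> yy; apply: rccont_v; apply: cder_ccont (derivable_cder (D _ _ xab ycd yy)).
Qed.

Lemma exc_line_goodh f a b c d y0 y : exc_line f a b c d y0 -> c <= y <= d -> y != y0 -> goodh f y a b.
Proof.
move=> [D [M HM] _] ycd yy; apply: goodh_cont => x xab.
by apply: cder_ccont (derivable_cder (D _ _ xab ycd yy)).
Qed.

Lemma rect_exc_line f a b c d y0 : a <= b -> c < y0 -> y0 < d -> exc_line f a b c d y0 ->
  rect f a b c d = 0.
Proof.
move=> ab cy yd E; have [D [M HM] J] := E.
apply: (@rect_line _ _ _ _ _ y0 M) => //.
- by move=> y ycd yy; apply: exc_line_goodh E _ _.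
- by apply: exc_line_goodv E _; rewrite lexx ab.
- by apply: exc_line_goodv E _; rewrite lexx ab.
- move=> y c1 y1; apply: goursat => // s t h /andP[k1 k2]; apply: D => //.
    by rewrite k1 (le_trans k2) // (ltW (lt_trans y1 yd)).
  by rewrite lt_eqF // (le_lt_trans k2).
- move=> y y1 d1; apply: goursat => // s t h /andP[k1 k2]; apply: D => //.
    by rewrite k2 (le_trans _ k1) // (ltW (lt_trans cy y1)).
  by rewrite gt_eqF // (lt_le_trans y1).
Qed.

Definition jump0 f x y0 := forall e : R, 0 < e -> exists2 t0 : R, 0 < t0 &
  forall t, 0 < t -> t < t0 -> nm (f (mkC x (y0 + t)) - f (mkC x (y0 - t))) < e.

Lemma vdist x y t : 0 < t -> nm (mkC x (y + t) - mkC x y : C) = t /\ nm (mkC x (y - t) - mkC x y : C) = t.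
Proof.
move=> t0; split.
  have -> : mkC x (y + t) - mkC x y = iC * rC t by apply: eqC; rewrite !reimE; ring.
  by rewrite nmM nm_iC mul1r nm_rC gtr0_norm.
have -> : mkC x (y - t) - mkC x y = - (iC * rC t) by apply: eqC; rewrite !reimE; ring.
by rewrite nmN nmM nm_iC mul1r nm_rC gtr0_norm.
Qed.

Lemma jump0_ccont f x y0 : ccont f (mkC x y0) -> jump0 f x y0.
Proof.
move=> H e e0; have [d d0 dP] := H (e / 2) (half_gt0 e0).
exists d => // t t0 td; have [v1 v2] := vdist x y0 t0.
have -> : f (mkC x (y0 + t)) - f (mkC x (y0 - t)) = (f (mkC x (y0 + t)) - f (mkC x y0)) - (f (mkC x (y0 - t)) - f (mkC x y0)) by ring.
apply: le_lt_trans (nmB _ _) _.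
have := dP (mkC x (y0 + t)); rewrite v1 => /(_ td).
have := dP (mkC x (y0 - t)); rewrite v2 => /(_ td); lra.
Qed.

Lemma jump0_eq f g x y0 (r : R) : 0 < r -> (forall w, nm (w - mkC x y0) < r -> f w = g w) ->
  jump0 f x y0 -> jump0 g x y0.
Proof.
move=> r0 E H e e0; have [t0 t00 P] := H e e0.
exists (Num.min t0 r); first by rewrite lt_min t00.
move=> t t1; rewrite lt_min => /andP[t2 t3]; have [v1 v2] := vdist x y0 t1.
by rewrite -!E ?v1 ?v2 //; exact: P.
Qed.

Lemma jump0B f g x y0 : jump0 f x y0 -> jump0 g x y0 -> jump0 (fun z => f z - g z) x y0.
Proof.
move=> H G e e0; have [t1 t10 P1] := H (e / 2) (half_gt0 e0).
have [t2 t20 P2] := G (e / 2) (half_gt0 e0).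
exists (Num.min t1 t2); first by rewrite lt_min t10.
move=> t h0; rewrite lt_min => /andP[k1 k2].
have := P1 t h0 k1; have := P2 t h0 k2.
set u := f _; set v := f _; set u' := g _; set v' := g _ => Q1 Q2.
have -> : u - u' - (v - v') = (u - v) - (u' - v') by ring.
by apply: le_lt_trans (nmB _ _) _; lra.
Qed.

(** From uu' - vv' = (u - v) u' + v (u' - v'): the factor [f] may have no limit at the line, so its
    boundedness takes the place of continuity. *)
Lemma jump0M f k x y0 (M r : R) : 0 < r -> (forall w, nm (w - mkC x y0) < r -> nm (f w) <= M) ->
  jump0 f x y0 -> ccont k (mkC x y0) -> jump0 (fun z => f z * k z) x y0.
Proof.
move=> r0 HM H G e e0.
have M0 : 0 <= M by apply: le_trans (HM (mkC x y0) _); rewrite ?nm_ge0 // subrr nm0.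
have K0 : 0 < 1 + nm (k (mkC x y0)) by have := nm_ge0 (k (mkC x y0)); lra.
have [t1 t10 P1] := H (e / 2 / (1 + nm (k (mkC x y0)))) (divr_gt0 (half_gt0 e0) K0).
have [t2 t20 P2] := G 1 ltr01.
have N0 : 0 < 1 + M by lra.
have [t3 t30 P3] := jump0_ccont G (divr_gt0 (half_gt0 e0) N0).
exists (Num.min (Num.min t1 t2) (Num.min t3 r)); first by rewrite !lt_min t10 t20 t30.
move=> t h0; rewrite !lt_min => /andP[/andP[k1 k2] /andP[k3 k4]].
have [v1 v2] := vdist x y0 h0.
have Q1 := P1 t h0 k1; have Q3 := P3 t h0 k3.
have := P2 (mkC x (y0 + t)); rewrite v1 => /(_ k2) Q2.
have := HM (mkC x (y0 - t)); rewrite v2 => /(_ k4) Q4.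
set u := f _ in Q1 *; set v := f _ in Q1 Q4 *; set u' := k _ in Q2 Q3 *; set v' := k _ in Q3 *.
have -> : u * u' - v * v' = (u - v) * u' + v * (u' - v') by ring.
apply: le_lt_trans (nmD _ _) _; rewrite !nmM.
have U : nm u' <= 1 + nm (k (mkC x y0)).
  by have := nmD (u' - k (mkC x y0)) (k (mkC x y0)); rewrite subrK; lra.
have := ler_pM (nm_ge0 _) (nm_ge0 _) (ltW Q1) U; rewrite divfK ?gt_eqF // => W1.
have : nm v * nm (u' - v') < e / 2.
  apply: (@le_lt_trans _ _ (M * nm (u' - v'))); first by rewrite ler_wpM2r // nm_ge0.
  move: Q3; rewrite ltr_pdivlMr //; have := nm_ge0 (u' - v'); lra.
by clear -W1; lra.
Qed.

Lemma rect_eqb f g a b c d : 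
  (forall x, a <= x <= b -> f (mkC x c) = g (mkC x c)) ->
  (forall x, a <= x <= b -> f (mkC x d) = g (mkC x d)) ->
  (forall y, c <= y <= d -> f (mkC a y) = g (mkC a y)) ->
  (forall y, c <= y <= d -> f (mkC b y) = g (mkC b y)) ->
  rect f a b c d = rect g a b c d.
Proof.
move=> E1 E2 E3 E4; rewrite /rect; congr (_ + iC * _); apply: cint_eq => t tt.
  by rewrite E1 // E2.
by rewrite E3 // E4.
Qed.
End Cauchy.

(** * Cauchy's integral formula across an exceptional line, and Cauchy transforms *)

Section CauchyFormula.
Variable R : realType.
Local Notation C := (Cs R).
Local Notation iC := (iC R).
Local Notation mu := (@lebesgue_measure R).
Implicit Types (f g : C -> C) (a b c d : R).

Lemma good_cat a b c (h : R -> C) : a <= b -> b <= c -> good a b h -> good b c h -> good a c h.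
Proof.
move=> ab bc [m1 m2 [M HM]] [n1 n2 [N HN]].
have S : `[a, c]%classic `<=` `[a, b]%classic `|` `[b, c]%classic.
  move=> t /=; rewrite !in_itv /= => /andP[t1 t2].
  by case: (leP t b) => h1; [left|right]; rewrite ?t1 ?t2 // (ltW h1).
split.
- apply: (measurable_funS _ S); first by apply: measurableU; exact: measurable_itv.
  by apply/measurable_funU; [exact: measurable_itv|exact: measurable_itv|split].
- apply: (measurable_funS _ S); first by apply: measurableU; exact: measurable_itv.
  by apply/measurable_funU; [exact: measurable_itv|exact: measurable_itv|split].
exists (Num.max M N) => t /andP[t1 t2]; rewrite le_max.
by case: (leP t b) => h1; [rewrite HM ?t1 | rewrite HN ?orbT ?t2 ?(ltW h1)].
Qed.

Lemma goodrM f g a b c d : goodr f a b c d -> goodr g a b c d -> goodr (fun z => f z * g z) a b c d.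
Proof. by move=> [? ? ? ?] [? ? ? ?]; split; exact: goodM. Qed.

Lemma goodrZ k f a b c d : goodr f a b c d -> goodr (fun z => k * f z) a b c d.
Proof. by move=> [? ? ? ?]; split; exact: goodZ. Qed.

Lemma goodrB f g a b c d : goodr f a b c d -> goodr g a b c d -> goodr (fun z => f z - g z) a b c d.
Proof. by move=> [? ? ? ?] [? ? ? ?]; split; exact: goodB. Qed.

Definition onedge a b c d (z : C) := 
  ((a <= reC z <= b) && ((imC z == c) || (imC z == d))) ||
  ((c <= imC z <= d) && ((reC z == a) || (reC z == b))).

Lemma goodr_edge f a b c d :
  (forall z, onedge a b c d z -> ccont f z) -> goodr f a b c d.
Proof.
move=> H; split; [apply: goodh_cont|apply: goodh_cont|apply: goodv_cont|apply: goodv_cont] => t tt; apply: H;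
  by rewrite /onedge !reimE tt eqxx ?orbT.
Qed.

Lemma rect_edge f g a b c d : (forall z, onedge a b c d z -> f z = g z) ->
  rect f a b c d = rect g a b c d.
Proof. by move=> H; apply: rect_eqb => t tt; apply: H; rewrite /onedge !reimE tt eqxx ?orbT. Qed.

Lemma rect_le_edge f a b c d (M : R) : a <= b -> c <= d -> goodr f a b c d ->
  (forall z, onedge a b c d z -> nm (f z) <= M) ->
  nm (rect f a b c d) <= 4 * M * ((b - a) + (d - c)).
Proof. by move=> ab cd G H; apply: rect_le => // t tt; apply: H; rewrite /onedge !reimE tt eqxx ?orbT. Qed.

Lemma onedge_neq a b c d (z w : C) : a < reC z < b -> c < imC z < d -> onedge a b c d w -> w != z.
Proof.
move=> /andP[z1 z2] /andP[z3 z4] H; apply/eqP => E; move: H; rewrite E /onedge.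
by rewrite (gt_eqF z1) (lt_eqF z2) (gt_eqF z3) (lt_eqF z4) !andbF.
Qed.

Lemma ck_cder (z w : C) : w != z -> cder (fun w => (w - z)^-1) w (- 1 / (w - z) ^+ 2).
Proof.
move=> wz; apply: (@cderV _ (fun w => w - z) w 1); first by rewrite subr_eq0.
by have := cderB (cder_id w) (cder_cst z w); rewrite subr0.
Qed.

Lemma ck_ccont (z w : C) : w != z -> ccont (fun w => (w - z)^-1) w.
Proof. by move=> /ck_cder; exact: cder_ccont. Qed.

Lemma goodr_ck a b c d (z : C) : a < reC z < b -> c < imC z < d -> goodr (fun w => (w - z)^-1) a b c d.
Proof. by move=> h k; apply: goodr_edge => w /(onedge_neq h k); exact: ck_ccont. Qed.

Lemma exc_line_goodr f a b c d y0 : a <= b -> c < y0 -> y0 < d -> exc_line f a b c d y0 -> goodr f a b c d.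
Proof.
move=> ab h k E.
have cd : c <= d by exact: ltW (lt_trans h k).
split; [apply: exc_line_goodh E _ _|apply: exc_line_goodh E _ _|apply: exc_line_goodv E _|apply: exc_line_goodv E _];
  by rewrite ?lexx ?ab ?cd // ?(lt_eqF h) ?(gt_eqF k).
Qed.

(** The rectangle is cut halfway between the two lines. In the Cauchy formula the second line is the
    horizontal through the singular point of the kernel. *)
Lemma rect_exc_line2 f a b c d l1 l2 : a <= b -> c < l1 -> l1 < l2 -> l2 < d ->
  (forall x y, a <= x <= b -> c <= y <= d -> y != l1 -> y != l2 -> derivable f (mkC x y) 1) ->
  (exists M, forall x y, a <= x <= b -> c <= y <= d -> nm (f (mkC x y)) <= M) ->
  (forall x, a <= x <= b -> jump0 f x l1) -> (forall x, a <= x <= b -> jump0 f x l2) ->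
  rect f a b c d = 0.
Proof.
move=> ab c1 l12 l2d D [M HM] J1 J2; pose m := (l1 + l2) / 2.
have m1 : l1 < m by rewrite /m; lra.
have m2 : m < l2 by rewrite /m; lra.
have cm := lt_trans c1 m1; have md := lt_trans m2 l2d.
have E1 : exc_line f a b c m l1.
  split => //; last by exists M => x y xab /andP[h k]; rewrite HM // h (le_trans k) // ltW.
  move=> x y xab /andP[h k] y1; apply: D => //; first by rewrite h (le_trans k) // ltW.
  by rewrite lt_eqF // (le_lt_trans k).
have E2 : exc_line f a b m d l2.
  split => //; last by exists M => x y xab /andP[h k]; rewrite HM // k (le_trans _ h) // ltW.
  move=> x y xab /andP[h k] y1; apply: D => //; first by rewrite k (le_trans _ h) // ltW.
  by rewrite gt_eqF // (lt_le_trans m1).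
have [g1 g2 g3 g4] := exc_line_goodr ab c1 m1 E1.
have [k1 k2 k3 k4] := exc_line_goodr ab m2 l2d E2.
rewrite (rect_splity (ltW cm) (ltW md)) //; last 2 first.
- by apply: (@good_cat _ m) => //; exact: ltW.
- by apply: (@good_cat _ m) => //; exact: ltW.
by rewrite (rect_exc_line ab c1 m1 E1) (rect_exc_line ab m2 l2d E2) addr0.
Qed.

Lemma quot_cont f z L : cder f z L ->
  ccont (fun w => if w == z then L else (f w - f z) * (w - z)^-1) z.
Proof.
move=> H e e0; have [d d0 dP] := H (e / 2) (half_gt0 e0).
exists d => // w wd; rewrite eqxx; case: eqVneq => [_|wz]; first by rewrite subrr nm0.
have w0 : w - z != 0 by rewrite subr_eq0.
have -> : (f w - f z) * (w - z)^-1 - L = (f w - f z - L * (w - z)) / (w - z) by field.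
rewrite nmM nmV ltr_pdivrMr ?nm_gt0 //; apply: le_lt_trans (dP w wd) _.
rewrite ltr_pM2r ?nm_gt0 //; lra.
Qed.

Lemma quot_der f z L w : w != z -> derivable f w 1 ->
  derivable (fun w => if w == z then L else (f w - f z) * (w - z)^-1) w 1.
Proof.
move=> wz /derivable_cder H.
have w0 : 0 < nm (w - z) by rewrite nm_gt0 subr_eq0.
have G := cderM (cderB H (cder_cst (f z) w)) (ck_cder wz).
apply: cder_derivable; apply: cder_near w0 _ G => v vw.
case: eqVneq => // vz; move: vw; rewrite vz nmBC ltxx //.
Qed.

(** The difference quotient [q] at [z], completed by f'(z), is continuous at [z] but not known to be
    differentiable there, so the horizontal through [z] is treated as a second exceptional line. Its
    contour integral is 0, and splitting [q] on the edges gives the formula with the index left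
    unevaluated. *)
Lemma cauchy_exc_line f a b c d y0 (z : C) : exc_line f a b c d y0 -> c < y0 -> y0 < d ->
  a < reC z < b -> c < imC z < d -> imC z != y0 ->
  rect (fun w => f w * (w - z)^-1) a b c d = f z * rect (fun w => (w - z)^-1) a b c d.
Proof.
move=> E cy yd zab zcd zy0; have [D [M HM] J] := E.
have /andP[za zb] := zab; have /andP[zc zd] := zcd.
have ab : a <= b by exact: ltW (lt_trans za zb).
have Dz : derivable f z 1.
  by rewrite (mkC_eta z); apply: D => //; rewrite ?ltW ?za ?zb ?zc ?zd.
have /derivable_cder Dz' := Dz.
set L := f^`()%classic z in Dz'.
pose q w := if w == z then L else (f w - f z) * (w - z)^-1.
have Q1 w : w != z -> derivable f w 1 -> derivable q w 1 by exact: quot_der.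
have Q2 : ccont q z by exact: quot_cont.
have Fz : nm (f z) <= M by rewrite {1}(mkC_eta z) HM // ?ltW ?za ?zb ?zc ?zd.
have M0 : 0 <= M by exact: le_trans (nm_ge0 _) Fz.
have QD x y : a <= x <= b -> c <= y <= d -> y != y0 -> y != imC z -> derivable q (mkC x y) 1.
  move=> h k y1 y2; apply: Q1; last exact: D.
  by apply: contra_neq y2 => <-.
have QB : exists N, forall x y, a <= x <= b -> c <= y <= d -> nm (q (mkC x y)) <= N.
  have [r r0 rP] := Q2 1 ltr01.
  exists (nm (q z) + 1 + (M + M) / r) => x y h k; set w := mkC x y.
  have K : 0 <= (M + M) / r by rewrite divr_ge0 ?addr_ge0 // ltW.
  have [wr|wr] := ltP (nm (w - z)) r.
    by have := rP w wr; have := nmD (q w - q z) (q z); rewrite subrK; lra.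
  have wz : w != z by apply/eqP => wz; move: wr; rewrite wz subrr nm0 leNgt r0.
  have : nm (q w) <= (M + M) / r.
    rewrite /q (negbTE wz) nmM nmV; apply: ler_pM; rewrite ?nm_ge0 ?invr_ge0 ?nm_ge0 //.
      by apply: le_trans (nmB _ _) _; rewrite lerD // HM.
    by rewrite lef_pV2 // posrE ?(lt_le_trans r0 wr).
  have := nm_ge0 (q z); lra.
have QJ1 x : a <= x <= b -> jump0 q x y0.
  move=> h; set p := mkC x y0.
  have pz : p != z by apply: contra_neq zy0 => <-.
  have r0 : 0 < nm (p - z) by rewrite nm_gt0 subr_eq0.
  apply: (jump0_eq (f := fun w => f w * (w - z)^-1 - f z * (w - z)^-1) r0).
    move=> w wp; rewrite /q; case: eqVneq => [wz|wz]; last by rewrite mulrBl.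
    by move: wp; rewrite wz nmBC ltxx.
  apply: jump0B; last first.
    by apply: jump0_ccont; apply: ccontM; [exact: ccont_cst | exact: ck_ccont].
  have r'0 : 0 < Num.min (y0 - c) (d - y0) by rewrite lt_min !subr_gt0 cy.
  have [t1 t10 P1] := J x h 1 ltr01.
  (* [jump0M] asks for a bound on a full neighbourhood, which leaves the rectangle when x = a or x =
     b. Cutting [f] off outside the rectangle supplies it and does not change the values that enter
     the jump. *)
  pose g w := if (a <= reC w <= b) && (c <= imC w <= d) then f w else 0.
  have Hg w : nm (g w) <= M.
    by rewrite /g; case: ifP => [/andP[h1 h2]|_]; [rewrite {1}(mkC_eta w); exact: HM | rewrite nm0].
  have G : jump0 (fun w => g w * (w - z)^-1) x y0.
    apply: (@jump0M _ _ _ _ _ M 1) => //; last exact: ck_ccont.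
    move=> e e0; have [t0 t00 P0] := J x h e e0.
    exists (Num.min t0 (Num.min (y0 - c) (d - y0))); first by rewrite lt_min t00.
    move=> t k0; rewrite !lt_min => /and3P[k1 k2 k3]; rewrite /g !reimE h.
    have /andP[m1 m2] : (c <= y0 + t <= d) && (c <= y0 - t <= d).
      by apply/andP; split; apply/andP; split; clear -k0 k2 k3; lra.
    by rewrite m1 m2 /=; exact: P0.
  move=> e e0; have [t0 t00 P0] := G e e0.
  exists (Num.min t0 (Num.min (y0 - c) (d - y0))); first by rewrite lt_min t00.
  move=> t k0; rewrite !lt_min => /and3P[k1 k2 k3]; have := P0 t k0 k1; rewrite /g !reimE h.
  have /andP[m1 m2] : (c <= y0 + t <= d) && (c <= y0 - t <= d).
    by apply/andP; split; apply/andP; split; clear -k0 k2 k3; lra.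
  by rewrite m1 m2.
have QJ2 x : a <= x <= b -> jump0 q x (imC z).
  move=> h; apply: jump0_ccont; have [xz|xz] := eqVneq x (reC z).
    by rewrite xz -mkC_eta.
  apply: (cder_ccont (derivable_cder _)); apply: Q1; first by apply: contra_neq xz => <-.
  by apply: D => //; rewrite ?ltW ?zc ?zd.
have Q0 : rect q a b c d = 0.
  have [k|k|k] := ltgtP y0 (imC z); last by rewrite k eqxx in zy0.
    exact: (rect_exc_line2 ab cy k zd QD QB QJ1 QJ2).
  exact: (rect_exc_line2 ab zc k yd (fun x y h1 h2 h3 h4 => QD x y h1 h2 h4 h3) QB QJ2 QJ1).
have G1 : goodr (fun w => f w * (w - z)^-1) a b c d.
  by apply: goodrM; [exact: exc_line_goodr E | exact: goodr_ck].
have G2 := goodr_ck zab zcd.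
apply/eqP; rewrite -subr_eq0 -(rectZ (f z) G2) -(rectB G1 (goodrZ (f z) G2)) -{}Q0.
apply/eqP; apply: rect_edge => w /(onedge_neq zab zcd) wz.
by rewrite /q (negbTE wz) mulrBl.
Qed.

(** Differentiation under the integral sign: a second-order remainder that is uniform over the edges
    survives integration. *)
Lemma rect_cder (K : C -> C -> C) (K' : C -> C) (z0 : C) (A r : R) a b c d :
  a <= b -> c <= d -> 0 < r -> 0 <= A ->
  (forall z, nm (z - z0) < r -> goodr (K z) a b c d) -> goodr K' a b c d ->
  (forall z w, nm (z - z0) < r -> onedge a b c d w ->
    nm (K z w - K z0 w - (z - z0) * K' w) <= A * nm (z - z0) ^+ 2) ->
  cder (fun z => rect (K z) a b c d) z0 (rect K' a b c d).
Proof.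
move=> ab cd r0 A0 G G' H e e0; pose S := (b - a) + (d - c).
have S0 : 0 <= S by rewrite addr_ge0 // subr_ge0.
have T0 : 0 < 4 * A * S + 1 by rewrite ltr_wpDl // !mulr_ge0.
exists (Num.min r (e / (4 * A * S + 1))); first by rewrite lt_min r0 divr_gt0.
move=> z; rewrite lt_min => /andP[zr]; rewrite ltr_pdivlMr // => ze.
have G0 : goodr (K z0) a b c d by apply: G; rewrite subrr nm0.
have Gz := G z zr.
rewrite [_ * (z - z0)]mulrC -(rectZ (z - z0) G') -(rectB Gz G0) -(rectB (goodrB Gz G0) (goodrZ _ G')).
apply: le_trans (@rect_le_edge _ _ _ _ _ (A * nm (z - z0) ^+ 2) ab cd _ _) _.
- exact: goodrB (goodrB Gz G0) (goodrZ _ G').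
- by move=> w; exact: H.
rewrite -/S expr2; have := nm_ge0 (z - z0) => n0.
have -> : 4 * (A * (nm (z - z0) * nm (z - z0))) * S = (4 * A * S * nm (z - z0)) * nm (z - z0) by ring.
rewrite ler_wpM2r //; clear -ze n0; lra.
Qed.

(** The remainder equals h^2 / (u^2 (u - h)), and both |u| and |u - h| are at least [dl]. *)
Lemma kernel1 (u h : C) (dl : R) : 0 < dl -> 2 * dl <= nm u -> nm h < dl ->
  nm ((u - h)^-1 - u^-1 - h * u^-1 ^+ 2) <= (dl ^-1) ^+ 3 * nm h ^+ 2.
Proof.
move=> d0 ud hd.
have u0 : u != 0 by rewrite -nm_gt0; lra.
have uh : dl <= nm (u - h) by have := nmD (u - h) h; rewrite subrK; lra.
have uh0 : u - h != 0 by rewrite -nm_gt0; lra.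
have -> : (u - h)^-1 - u^-1 - h * u^-1 ^+ 2 = (u^-1 * u^-1 * (u - h)^-1) * h ^+ 2 by field; rewrite ?u0 ?uh0.
rewrite nmM nmX ler_wpM2r ?exprn_ge0 ?nm_ge0 // !nmM !nmV !exprS expr0 mulr1 -mulrA.
have k1 : (nm u)^-1 <= dl^-1 by rewrite lef_pV2 ?posrE ?nm_gt0 //; lra.
have k2 : (nm (u - h))^-1 <= dl^-1 by rewrite lef_pV2 ?posrE ?nm_gt0 //.
by rewrite !ler_pM ?mulr_ge0 ?invr_ge0 ?nm_ge0.
Qed.

(** The remainder equals h^2 (2 / (u^3 (u - h)) + 1 / (u^2 (u - h)^2)), with the same lower bounds
    for the denominators. *)
Lemma kernel2 (u h : C) (dl : R) : 0 < dl -> 2 * dl <= nm u -> nm h < dl ->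
  nm ((u - h)^-1 ^+ 2 - u^-1 ^+ 2 - h * (2 * u^-1 ^+ 3)) <= 3 * (dl ^-1) ^+ 4 * nm h ^+ 2.
Proof.
move=> d0 ud hd.
have u0 : u != 0 by rewrite -nm_gt0; lra.
have uh : dl <= nm (u - h) by have := nmD (u - h) h; rewrite subrK; lra.
have uh0 : u - h != 0 by rewrite -nm_gt0; lra.
have -> : (u - h)^-1 ^+ 2 - u^-1 ^+ 2 - h * (2 * u^-1 ^+ 3) =
  (2 * (u^-1 ^+ 3 * (u - h)^-1) + u^-1 ^+ 2 * (u - h)^-1 ^+ 2) * h ^+ 2 by field; rewrite ?u0 ?uh0.
rewrite nmM nmX ler_wpM2r ?exprn_ge0 ?nm_ge0 //.
have k1 : (nm u)^-1 <= dl^-1 by rewrite lef_pV2 ?posrE ?nm_gt0 //; lra.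
have k2 : (nm (u - h))^-1 <= dl^-1 by rewrite lef_pV2 ?posrE ?nm_gt0 //.
have i1 : 0 <= (nm u)^-1 by rewrite invr_ge0 nm_ge0.
have i2 : 0 <= (nm (u - h))^-1 by rewrite invr_ge0 nm_ge0.
apply: le_trans (nmD _ _) _; rewrite (nmM 2) (nmM (u^-1 ^+ 3)) (nmM (u^-1 ^+ 2)) !nmX !nmV nm_natr.
have -> : 3 * dl^-1 ^+ 4 = 2 * (dl^-1 ^+ 3 * dl^-1) + dl^-1 ^+ 2 * dl^-1 ^+ 2 by ring.
have i3 : 0 <= dl^-1 by rewrite invr_ge0 ltW.
have X1 n : (nm u)^-1 ^+ n <= dl^-1 ^+ n by apply: lerXn2r.
have X2 n : (nm (u - h))^-1 ^+ n <= dl^-1 ^+ n by apply: lerXn2r.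
apply: lerD; last by apply: ler_pM; rewrite ?exprn_ge0.
by rewrite ler_pM2l // ler_pM // exprn_ge0.
Qed.

Definition sq f (p : C) (s : R) := rect f (reC p - s) (reC p + s) (imC p - s) (imC p + s).
Definition sqedge (p : C) (s : R) (w : C) := onedge (reC p - s) (reC p + s) (imC p - s) (imC p + s) w.

Lemma sqedge_dist (p w : C) (s : R) : 0 < s -> sqedge p s w -> s <= nm (w - p).
Proof.
move=> s0; rewrite /sqedge /onedge => /orP[] /andP[_ /orP[]] /eqP E.
- by apply: le_trans (im_le_nm _); rewrite imB E addrAC subrr add0r normrN gtr0_norm.
- by apply: le_trans (im_le_nm _); rewrite imB E addrAC subrr add0r gtr0_norm.
- by apply: le_trans (re_le_nm _); rewrite reB E addrAC subrr add0r normrN gtr0_norm.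
- by apply: le_trans (re_le_nm _); rewrite reB E addrAC subrr add0r gtr0_norm.
Qed.

Lemma sq_int (p z : C) (s : R) : nm (z - p) < s ->
  reC p - s < reC z < reC p + s /\ imC p - s < imC z < imC p + s.
Proof.
move=> h; have := le_lt_trans (re_le_nm _) h; have := le_lt_trans (im_le_nm _) h.
rewrite reB imB !ltr_norml => /andP[? ?] /andP[? ?]; split; apply/andP; split; lra.
Qed.

Section transform.
Variables (f : C -> C) (p : C) (s M : R).
Hypothesis s0 : 0 < s.
Hypothesis Gf : goodr f (reC p - s) (reC p + s) (imC p - s) (imC p + s).
Hypothesis Mf : forall w, sqedge p s w -> nm (f w) <= M.

(** The Cauchy transform with kernel (w - z)^(-m) and no factor 1 / (2 pi i). For m = 2 and m = 3 it
    is the first derivative and half the second derivative of the case m = 1. *)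
Definition cauchy_tr (m : nat) (z : C) := sq (fun w => f w * (w - z)^-1 ^+ m) p s.

Lemma cauchy_tr_good m z : nm (z - p) < s -> goodr (fun w => f w * (w - z)^-1 ^+ m) (reC p - s) (reC p + s) (imC p - s) (imC p + s).
Proof.
move=> /sq_int[h k]; apply: goodrM => //.
apply: goodr_edge => w /(onedge_neq h k) wz.
by apply: cder_ccont; apply: cderX; exact: ck_cder.
Qed.

Lemma sq_le : reC p - s <= reC p + s /\ imC p - s <= imC p + s.
Proof. by have s0' := s0; split; lra. Qed.

Lemma cauchy_tr_cder1 z0 : nm (z0 - p) < s / 2 -> cder (cauchy_tr 1) z0 (cauchy_tr 2 z0).
Proof.
move=> zp; have s0' := s0; have [h1 h2] := sq_le; have d0 : 0 < s / 4 by rewrite divr_gt0.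
have MM : 0 <= `|M| by [].
(* Points within s/2 of the centre have distance at least s/2 from the edges, twice the increment
   s/4 allowed in [kernel1]. *)
apply: (@rect_cder _ _ z0 (`|M| * (s / 4)^-1 ^+ 3) (s / 4)) => //.
- by rewrite mulr_ge0 // exprn_ge0 // invr_ge0 ltW.
- move=> z zz; apply: cauchy_tr_good; have := nmD (z - z0) (z0 - p).
  by rewrite addrA subrK; lra.
- by apply: cauchy_tr_good; lra.
move=> z w zz we; set h := z - z0; set u := w - z0.
have -> : w - z = u - h by rewrite /u /h; ring.
have -> : f w * (u - h)^-1 ^+ 1 - f w * u^-1 ^+ 1 - h * (f w * u^-1 ^+ 2) = f w * ((u - h)^-1 - u^-1 - h * u^-1 ^+ 2).
  by rewrite !expr1; ring.
rewrite nmM -mulrA ler_pM ?nm_ge0 //; first by apply: le_trans (ler_norm _); exact: Mf.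
apply: kernel1 => //; have := sqedge_dist s0 we; have := nmD (w - z0) (z0 - p).
by rewrite addrA subrK -/u; lra.
Qed.

Lemma cauchy_tr_cder2 z0 : nm (z0 - p) < s / 2 -> cder (cauchy_tr 2) z0 (2 * cauchy_tr 3 z0).
Proof.
move=> zp; have s0' := s0; have [h1 h2] := sq_le; have d0 : 0 < s / 4 by rewrite divr_gt0.
have MM : 0 <= `|M| by [].
have zs : nm (z0 - p) < s by lra.
rewrite /cauchy_tr /sq -(rectZ _ (cauchy_tr_good 3 zs)).
apply: (@rect_cder _ _ z0 (`|M| * (3 * (s / 4)^-1 ^+ 4)) (s / 4)) => //.
- by rewrite mulr_ge0 // mulr_ge0 // exprn_ge0 // invr_ge0 ltW.
- move=> z zz; apply: cauchy_tr_good; have := nmD (z - z0) (z0 - p).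
  by rewrite addrA subrK; lra.
- by apply: goodrZ; apply: cauchy_tr_good.
move=> z w zz we; set h := z - z0; set u := w - z0.
have -> : w - z = u - h by rewrite /u /h; ring.
have -> : f w * (u - h)^-1 ^+ 2 - f w * u^-1 ^+ 2 - h * (2 * (f w * u^-1 ^+ 3)) = f w * ((u - h)^-1 ^+ 2 - u^-1 ^+ 2 - h * (2 * u^-1 ^+ 3)).
  by ring.
rewrite nmM -mulrA ler_pM ?nm_ge0 //; first by apply: le_trans (ler_norm _); exact: Mf.
apply: kernel2 => //; have := sqedge_dist s0 we; have := nmD (w - z0) (z0 - p).
by rewrite addrA subrK -/u; lra.
Qed.
End transform.

Lemma rint_ge a b (u : R -> R) (m : R) : a <= b ->
  mu.-integrable `[a, b]%classic (EFin \o u) ->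
  (forall t, a <= t <= b -> m <= u t) -> m * (b - a) <= rint a b u.
Proof.
move=> ab iu H; rewrite -rint_cst // /rint; apply: le_Rintegral; [exact: measurable_itv | exact: (goodI (good_cst a b (rC m))).1 | exact: iu |].
by move=> t /=; rewrite in_itv /= => /H.
Qed.

(* The winding number of a square is never computed: f is recovered as a quotient of two
   Cauchy transforms, for which it is enough that this integral does not vanish. *)
Lemma index_ge (p : C) (s : R) : 0 < s -> 4 <= nm (sq (fun w => (w - p)^-1) p s).
Proof.
move=> s0.
have ps : nm (p - p) < s by rewrite subrr nm0.
have [h k] := sq_int ps.
have [g1 g2 g3 g4] := goodr_ck h k.
have ab : reC p - s <= reC p + s by clear -s0; lra.
have cd : imC p - s <= imC p + s by clear -s0; lra.
(* On opposite sides of the square the values of 1 / (w - p) differ by this positive kernel, up to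
   the factor i for the horizontal pair. It is at least 1/s, so each pair of sides contributes at
   least 2. *)
pose u (x0 t : R) := 2 * s / ((t - x0) ^+ 2 + s ^+ 2).
have N0 (t x0 : R) : (t - x0) ^+ 2 + s ^+ 2 != 0 by rewrite gt_eqF // ltr_wpDl ?sqr_ge0 // exprn_gt0.
have E1 t : (mkC t (imC p - s) - p)^-1 - (mkC t (imC p + s) - p)^-1 = iC * rC (u (reC p) t).
  have -> : mkC t (imC p - s) - p = mkC (t - reC p) (- s) by apply: eqC; rewrite !reimE //; ring.
  have -> : mkC t (imC p + s) - p = mkC (t - reC p) s by apply: eqC; rewrite !reimE //; ring.
  by apply: eqC; rewrite /mkC /u /= !sqrrN; field; exact: N0.
have E2 t : (mkC (reC p + s) t - p)^-1 - (mkC (reC p - s) t - p)^-1 = rC (u (imC p) t).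
  have -> : mkC (reC p - s) t - p = mkC (- s) (t - imC p) by apply: eqC; rewrite !reimE //; ring.
  have -> : mkC (reC p + s) t - p = mkC s (t - imC p) by apply: eqC; rewrite !reimE //; ring.
  by apply: eqC; rewrite /mkC /u /= !sqrrN [s ^+ 2 + _]addrC; field; exact: N0.
have HU a b x0 : a = x0 - s -> b = x0 + s -> good a b (fun t => rC (u x0 t)) -> 2 <= reC (cint a b (fun t => rC (u x0 t))).
  move=> -> -> /goodI[gI _]; rewrite /cint re_mk.
  have -> : 2 = s^-1 * ((x0 + s) - (x0 - s)) by field; rewrite gt_eqF.
  apply: rint_ge => //; first by clear -s0; lra.
  move=> t /andP[t1 t2]; rewrite re_rC /u ler_pdivlMr; last by rewrite lt_neqAle eq_sym N0 addr_ge0 ?sqr_ge0.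
  rewrite mulrC ler_pdivrMr //; have : (t - x0) ^+ 2 <= s ^+ 2 by nra.
  by rewrite -mulrA -expr2; clear; lra.
have G1 : good (reC p - s) (reC p + s) (fun t => rC (u (reC p) t)).
  have := goodZ (- iC) (goodB g1 g2); apply: good_eq => t _ /=; rewrite E1.
  by rewrite mulNr mulrA iC2 mulN1r opprK.
have G2 : good (imC p - s) (imC p + s) (fun t => rC (u (imC p) t)).
  by have := goodB g4 g3; apply: good_eq => t _ /=; rewrite E2.
have K1 := HU _ _ _ erefl erefl G1; have K2 := HU _ _ _ erefl erefl G2.
have -> : sq (fun w => (w - p)^-1) p s = iC * (cint (reC p - s) (reC p + s) (fun t => rC (u (reC p) t)) + cint (imC p - s) (imC p + s) (fun t => rC (u (imC p) t))).
  rewrite /sq /rect mulrDr -(cintZ _ G1); congr (_ + iC * _); apply: cint_eq => t _; [exact: E1 | exact: E2].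
rewrite nmM nm_iC mul1r; apply: le_trans (re_le_nm _); rewrite reD.
by apply: le_trans (ler_norm _); clear -K1 K2; lra.
Qed.
End CauchyFormula.

(** * Local theory of holomorphic functions *)

Section Holomorphic.
Variable R : realType.
Local Notation C := (Cs R).
Local Notation iC := (iC R).
Implicit Types (f g : C -> C) (a b c d : R) (p z w : C) (r s : R).

Definition hol f p r := forall z, nm (z - p) < r -> derivable f z 1.

Lemma rect_bounded f a b c d :
  (forall x y, a <= x <= b -> c <= y <= d -> ccont f (mkC x y)) ->
  exists M, forall x y, a <= x <= b -> c <= y <= d -> nm (f (mkC x y)) <= M.
Proof.
move=> H; pose A := (`[a, b]%classic `*` `[c, d]%classic : set (R * R)).
have K : compact A by apply: compact_setX; exact: segment_compact.
have : {within A, continuous (fun q : R * R => nm (f (mkC q.1 q.2)))}.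
  apply: continuous_in_subspaceT => -[x y] /set_mem [] /=; rewrite !in_itv /= => xab ycd.
  apply/cvgrPdist_lt => e e0; have [dl d0 dP] := H x y xab ycd e e0.
  have dl2 : 0 < dl / 2 by rewrite divr_gt0.
  exists (ball x (dl / 2), ball y (dl / 2)); first by split; exact: nbhsx_ballx.
  move=> -[x' y'] [] /=; rewrite /ball /= => h1 h2.
  have : nm (mkC x' y' - mkC x y : C) < dl.
    by apply: le_lt_trans (nm_le_box _ _ _ _) _; rewrite distrC [`|y' - y|]distrC; clear -h1 h2; lra.
  move=> /dP; apply: le_lt_trans; rewrite distrC ler_norml; apply/andP; split.
    by have := nmD (f (mkC x y) - f (mkC x' y')) (f (mkC x' y')); rewrite subrK nmBC; lra.
  by have := nmD (f (mkC x' y') - f (mkC x y)) (f (mkC x y)); rewrite subrK; lra.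
move=> /continuous_compact /(_ K) /compact_bounded [M [_ HM]]; exists (M + 1) => x y xab ycd.
have := HM (M + 1); rewrite ltrDl ltr01 => /(_ isT (nm (f (mkC x y)))) /=.
rewrite ger0_norm ?nm_ge0 //; apply; exists (x, y) => //=; by rewrite !in_itv.
Qed.

Definition insq p s z := (reC p - s <= reC z <= reC p + s) && (imC p - s <= imC z <= imC p + s).

Lemma insqP p s z : insq p s z -> nm (z - p) <= 2 * s.
Proof.
move=> /andP[/andP[h1 h2] /andP[h3 h4]]; apply: le_trans (nm_le_reim _) _; rewrite reB imB.
have : `|reC z - reC p| <= s by rewrite ler_norml; apply/andP; split; clear -h1 h2; lra.
have : `|imC z - imC p| <= s by rewrite ler_norml; apply/andP; split; clear -h3 h4; lra.
by clear; lra.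
Qed.

Lemma edge_insq p s w : 0 <= s -> sqedge p s w -> insq p s w.
Proof.
move=> s0; rewrite /insq /sqedge /onedge => /orP[/andP[-> /orP[]] | /andP[-> /orP[]]] /eqP -> //=;
  rewrite ?andbT; apply/andP; split; lra.
Qed.

Lemma center_insq p s : 0 <= s -> insq p s p.
Proof. by move=> s0; apply/andP; split; apply/andP; split; lra. Qed.

Lemma exc_line_der f a b c d y0 : c < y0 -> y0 < d ->
  (forall x y, a <= x <= b -> c <= y <= d -> derivable f (mkC x y) 1) -> exc_line f a b c d y0.
Proof.
move=> cy yd D; split; first by move=> x y h k _; exact: D.
  by apply: rect_bounded => x y h k; exact: cder_ccont (derivable_cder (D _ _ h k)).
move=> x h; apply: jump0_ccont; apply: cder_ccont (derivable_cder _); apply: D => //.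
by rewrite !ltW.
Qed.

(** A substitute for the maximum principle: Cauchy's formula bounds |f(p)| times the modulus of the
    index integral by 4 (M/s) (4s) = 16M, and that modulus is at least 4. *)
Lemma center_bound f p s (M : R) : 0 < s -> (forall z, insq p s z -> derivable f z 1) ->
  (forall w, sqedge p s w -> nm (f w) <= M) -> nm (f p) <= 4 * M.
Proof.
move=> s0 D HM.
have D' x y : reC p - s <= x <= reC p + s -> imC p - s <= y <= imC p + s -> derivable f (mkC x y) 1.
  by move=> h k; apply: D; rewrite /insq !reimE h k.
have E : exc_line f (reC p - s) (reC p + s) (imC p - s) (imC p + s) (imC p + s / 2).
  by apply: exc_line_der => //; clear -s0; lra.
have ps : nm (p - p) < s by rewrite subrr nm0.
have [h k] := sq_int ps.
have h1 : imC p - s < imC p + s / 2 by clear -s0; lra.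
have h2 : imC p + s / 2 < imC p + s by clear -s0; lra.
have h3 : imC p != imC p + s / 2 by rewrite lt_eqF //; clear -s0; lra.
have ab : reC p - s <= reC p + s by clear -s0; lra.
have cd : imC p - s <= imC p + s by clear -s0; lra.
have := cauchy_exc_line E h1 h2 h k h3.
have I := index_ge p s0; rewrite /sq in I.
move=> EQ; have := congr1 (@nm R) EQ; rewrite nmM => EQ'.
have : nm (rect (fun w => f w * (w - p)^-1) (reC p - s) (reC p + s) (imC p - s) (imC p + s)) <= 4 * (M * s^-1) * ((reC p + s - (reC p - s)) + (imC p + s - (imC p - s))).
  apply: rect_le_edge => //.
    by apply: goodrM; [exact: exc_line_goodr E | exact: goodr_ck].
  move=> w we; rewrite nmM nmV ler_pM ?nm_ge0 ?invr_ge0 ?nm_ge0 ?HM //.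
  by have := sqedge_dist s0 we => sw; rewrite lef_pV2 // posrE // (lt_le_trans s0).
have -> : 4 * (M * s^-1) * ((reC p + s - (reC p - s)) + (imC p + s - (imC p - s))) = 16 * M.
  by field; rewrite gt_eqF.
rewrite EQ'; have := nm_ge0 (f p) => F0 K.
have : nm (f p) * 4 <= 16 * M by apply: le_trans K; rewrite ler_wpM2l.
by clear; lra.
Qed.

(** Off the line, Cauchy's formula reads f = N1 / c1 with the Cauchy transforms of [f] and of the
    constant 1. These are twice differentiable whatever [f] does on the line, so N1 / c1 continues
    [f] across it and has a holomorphic derivative. The radius is chosen so that c1 has no zero. *)
Lemma regularity_exc_line f p s y0 : 0 < s -> imC p - s < y0 -> y0 < imC p + s ->
  exc_line f (reC p - s) (reC p + s) (imC p - s) (imC p + s) y0 ->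
  exists2 r, 0 < r <= s / 2 & exists fh, [/\ hol fh p r, hol fh^`()%classic p r &
    forall z, nm (z - p) < r -> imC z != y0 -> f z = fh z].
Proof.
move=> s0 y1 y2 E; have [_ [M HM] _] := E.
have ab : reC p - s <= reC p + s by clear -s0; lra.
have Gf : goodr f (reC p - s) (reC p + s) (imC p - s) (imC p + s) by exact: exc_line_goodr E.
have G1 : goodr (fun=> 1 : C) (reC p - s) (reC p + s) (imC p - s) (imC p + s).
  by apply: goodr_edge => w _; exact: ccont_cst.
have Mf w : sqedge p s w -> nm (f w) <= M.
  by move=> /(edge_insq (ltW s0)) /andP[h k]; rewrite (mkC_eta w); exact: HM.
have M1 w : sqedge p s w -> nm (1 : C) <= 1 by rewrite nm1.
have F1 := cauchy_tr_cder1 s0 Gf Mf; have F2 := cauchy_tr_cder2 s0 Gf Mf.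
have C1 := cauchy_tr_cder1 s0 G1 M1; have C2 := cauchy_tr_cder2 s0 G1 M1.
set N1 := cauchy_tr f p s 1 in F1; set N2 := cauchy_tr f p s 2 in F1 F2; set N3 := cauchy_tr f p s 3 in F2.
set c1 := cauchy_tr _ p s 1 in C1; set c2 := cauchy_tr _ p s 2 in C1 C2; set c3 := cauchy_tr _ p s 3 in C2.
have pp : nm (p - p) < s / 2 by rewrite subrr nm0 divr_gt0.
have c1E z : c1 z = rect (fun w => (w - z)^-1) (reC p - s) (reC p + s) (imC p - s) (imC p + s).
  by apply: rect_edge => w _; rewrite mul1r expr1.
have cp0 : c1 p != 0 by rewrite -nm_gt0 c1E; apply: lt_le_trans (index_ge p s0).
have [d0 d00 dP] := ccont_neq0 (cder_ccont (C1 p pp)) cp0.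
have s2 : 0 < s / 2 by rewrite divr_gt0.
exists (Num.min d0 (s / 2)); first by rewrite lt_min d00 s2 /= ge_min lexx orbT.
have D1 z : nm (z - p) < Num.min d0 (s / 2) -> cder (fun z => N1 z / c1 z) z ((N2 z * c1 z - N1 z * c2 z) / c1 z ^+ 2).
  by rewrite lt_min => /andP[z1 z2]; apply: cder_div; [exact: dP | exact: F1 | exact: C1].
exists (fun z => N1 z / c1 z); split.
- by move=> z /D1; exact: cder_derivable.
- move=> z zr; have := zr; rewrite lt_min => /andP[z1 z2].
  have T := @cder_div R _ (fun w => c1 w ^+ 2) z _ _ (expf_neq0 2 (dP z z1)) (cderB (cderM (F2 z z2) (C1 z z2)) (cderM (F1 z z2) (C2 z z2))) (cderX 2 (C1 z z2)).
  apply: cder_derivable; apply: (cder_near (r := Num.min d0 (s / 2) - nm (z - p))) T.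
    by rewrite subr_gt0; exact: zr.
  move=> w wz; rewrite (cder_val (D1 w _)) //.
  have := nmD (w - z) (z - p); rewrite addrA subrK => /le_lt_trans; apply.
  by rewrite -ltrBrDr.
move=> z; rewrite lt_min => /andP[z1 z2] zy.
have zs : nm (z - p) < s by apply: lt_le_trans z2 _; clear -s0; lra.
have [h k] := sq_int zs.
have := cauchy_exc_line E y1 y2 h k zy; rewrite -c1E => K.
apply: (mulIf (dP z z1)); rewrite divfK ?dP // -K.
Qed.

Lemma hol_sub f p r q r' : nm (q - p) + r' <= r -> hol f p r -> hol f q r'.
Proof.
move=> H D z zq; apply: D; apply: lt_le_trans H; have := nmD (z - q) (q - p).
by rewrite addrA subrK => /le_lt_trans; apply; rewrite addrC ltrD2l.
Qed.

Lemma hol_near f g p r : (forall z, nm (z - p) < r -> f z = g z) -> hol f p r -> hol g p r.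
Proof.
move=> E H z zp; have /derivable_cder D := H z zp.
apply: cder_derivable; apply: (cder_near (r := r - nm (z - p))) D; first by rewrite subr_gt0.
move=> w wz; apply: E; have := nmD (w - z) (z - p); rewrite addrA subrK => /le_lt_trans; apply.
by rewrite -ltrBrDr.
Qed.

Lemma hol_deriv_eq f g p r : (forall z, nm (z - p) < r -> f z = g z) -> hol f p r ->
  forall z, nm (z - p) < r -> f^`()%classic z = g^`()%classic z.
Proof.
move=> E H z zp; have /derivable_cder D := H z zp.
apply/esym; apply: cder_val; apply: (cder_near (r := r - nm (z - p))) D; first by rewrite subr_gt0.
move=> w wz; apply: E; have := nmD (w - z) (z - p); rewrite addrA subrK => /le_lt_trans; apply.
by rewrite -ltrBrDr.
Qed.

Lemma hol_insq f p r : 0 < r -> hol f p r -> forall z, insq p (r / 3) z -> derivable f z 1.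
Proof. by move=> r0 H z /insqP h; apply: H; clear -h r0; lra. Qed.

Theorem hol_deriv f p r : hol f p r -> hol f^`()%classic p r.
Proof.
move=> H z zp; pose r1 := r - nm (z - p).
have r10 : 0 < r1 by rewrite subr_gt0.
have H1 : hol f z r1 by apply: hol_sub H; rewrite /r1; lra.
have D := hol_insq r10 H1; pose s := r1 / 3.
have s0 : 0 < s by rewrite divr_gt0.
have h1 : imC z - s < imC z + s / 2 by clear -s0; lra.
have h2 : imC z + s / 2 < imC z + s by clear -s0; lra.
(* The line at height s/2 above [z] misses the disc of radius r' <= s/2, so [fh] agrees with [f] on
   all of that disc. *)
have E : exc_line f (reC z - s) (reC z + s) (imC z - s) (imC z + s) (imC z + s / 2).
  by apply: exc_line_der => // x y h k; apply: D; rewrite /insq !reimE h k.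
have [r' /andP[r'0 r's] [fh [F1 F2 F3]]] := regularity_exc_line s0 h1 h2 E.
have EQ w : nm (w - z) < r' -> fh w = f w.
  move=> wz; apply/esym; apply: F3 => //; rewrite lt_eqF //.
  have := le_lt_trans (im_le_nm _) (lt_le_trans wz r's); rewrite imB ltr_norml => /andP[_].
  by clear; lra.
have D2 := hol_deriv_eq EQ F1.
by apply: (hol_near D2 F2); rewrite subrr nm0.
Qed.

(** For every t > 0 at least one of the points z + it and z - it is off the line. *)
Lemma ccont_offline f g z r y0 : 0 < r -> ccont f z -> ccont g z ->
  (forall w, nm (w - z) < r -> imC w != y0 -> f w = g w) -> f z = g z.
Proof.
move=> r0 F G H; apply/eqP; rewrite -subr_eq0 -nm_eq0; apply/negP => /negP N.
have e0 : 0 < nm (f z - g z) by rewrite lt_neqAle eq_sym N nm_ge0.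
have [d1 d10 P1] := ccontB F G e0.
pose t := Num.min r d1 / 2.
have t0 : 0 < t by rewrite divr_gt0 // lt_min r0.
have tr : t < r /\ t < d1.
  have : Num.min r d1 <= r by rewrite ge_min lexx.
  have : Num.min r d1 <= d1 by rewrite ge_min lexx orbT.
  have : 0 < Num.min r d1 by rewrite lt_min r0.
  by rewrite /t; split; lra.
have [t1 t2] := tr.
have K w : nm (w - z) = t -> imC w != y0 -> False.
  move=> wt wy; have := P1 w; rewrite wt => /(_ t2); rewrite H ?wt // subrr sub0r nmN ltxx //.
have [v1 v2] := vdist (reC z) (imC z) t0; rewrite -mkC_eta in v1 v2.
have [E|/eqP E] := eqVneq (imC z + t) y0; last by apply: (K _ v1); rewrite im_mk; exact/eqP.
by apply: (K _ v2); rewrite im_mk -E; apply/eqP; clear -t0; lra.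
Qed.

Definition dquot f p w := if w == p then f^`()%classic p else (f w - f p) * (w - p)^-1.

(** A removable singularity: the quotient is continuous, and holomorphic off the horizontal through
    [p], which serves as exceptional line. On that line it agrees with the regularised function by
    continuity. *)
Lemma hol_dquot f p r : hol f p r -> hol (dquot f p) p r.
Proof.
move=> H z zp; have r0 : 0 < r by exact: le_lt_trans (nm_ge0 _) zp.
have [->|zp'] := eqVneq z p; last by apply: quot_der => //; exact: H.
have D := hol_insq r0 H; pose s := r / 3.
have s0 : 0 < s by rewrite divr_gt0.
have h1 : imC p - s < imC p by clear -s0; lra.
have h2 : imC p < imC p + s by clear -s0; lra.
have Qc w : insq p s w -> ccont (dquot f p) w.
  move=> h; have [->|wp] := eqVneq w p.
    by apply: quot_cont; apply: derivable_cder; apply: H; rewrite subrr nm0.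
  by apply: (cder_ccont (derivable_cder _)); apply: quot_der => //; exact: D.
have E : exc_line (dquot f p) (reC p - s) (reC p + s) (imC p - s) (imC p + s) (imC p).
  split.
  - move=> x y h k yp; apply: quot_der; first by apply: contra_neq yp => <-.
    by apply: D; rewrite /insq !reimE h k.
  - by apply: rect_bounded => x y h k; apply: Qc; rewrite /insq !reimE h k.
  - by move=> x h; apply: jump0_ccont; apply: Qc; rewrite /insq !reimE h !ltW.
have [r' /andP[r'0 r's] [fh [F1 F2 F3]]] := regularity_exc_line s0 h1 h2 E.
have EQ w : nm (w - p) < r' -> fh w = dquot f p w.
  move=> wz; have r1 : 0 < r' - nm (w - p) by rewrite subr_gt0.
  apply: (ccont_offline (y0 := imC p) r1 (cder_ccont (derivable_cder (F1 w wz)))).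
    apply: Qc; have ws : nm (w - p) < s by apply: lt_le_trans wz _; clear -r's s0; lra.
    by have [/andP[? ?] /andP[? ?]] := sq_int ws; rewrite /insq !ltW.
  move=> v vw vi; apply/esym; apply: F3 => //.
  have := nmD (v - w) (w - p); rewrite addrA subrK => /le_lt_trans; apply.
  by rewrite -ltrBrDr.
by apply: (hol_near EQ F1); rewrite subrr nm0.
Qed.

Lemma dquotE f p w : f w = f p + (w - p) * dquot f p w.
Proof.
rewrite /dquot; case: eqVneq => [->|wp]; first by rewrite subrr mul0r addr0.
by rewrite mulrCA mulfV ?subr_eq0 // mulr1 addrC subrK.
Qed.

Lemma expr_small (x e B : R) : 0 <= x -> x < 1 -> 0 < e -> exists n : nat, B * x ^+ n < e.
Proof.
move=> x0 x1 e0.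
have : (B * x ^+ n) @[n --> \oo] --> B * 0.
  by apply: cvgM; [exact: cvg_cst | apply: cvg_expr; rewrite ger0_norm].
rewrite mulr0 => /cvgrPdist_lt /(_ _ e0) [N _ NP]; exists N.
have := NP N (leqnn N); rewrite sub0r normrN; apply: le_lt_trans; exact: ler_norm.
Qed.

(* If f vanishes to infinite order, f = (z-p)^n u_n for all n, and the center bound applied to
   u_n on a square centered at z forces f(z) = O(3^-n). *)
Theorem hol_order f p r : 0 < r -> hol f p r ->
  (exists2 r', 0 < r' & forall z, nm (z - p) < r' -> f z = 0) \/
  exists n u, [/\ hol u p r, u p != 0 & forall z, f z = (z - p) ^+ n * u z].
Proof.
move=> r0 H; case: (pselect (exists n u, [/\ hol u p r, u p != 0 & forall z, f z = (z - p) ^+ n * u z])) => [|N]; first by right.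
left.
have A n : exists2 u, hol u p r & forall z, f z = (z - p) ^+ n * u z.
  elim: n => [|n [u Hu uE]]; first by exists f => // z; rewrite mul1r.
  have up : u p = 0 by apply/eqP; apply/negP => /negP up; apply: N; exists n, u.
  exists (dquot u p); first exact: hol_dquot.
  by move=> z; rewrite uE {1}(dquotE u p z) up add0r exprSr mulrA.
pose s := r / 6; have s0 : 0 < s by rewrite divr_gt0.
have ss : r / 3 = 2 * s by rewrite /s; clear; lra.
have [M HM] : exists M, forall x y, reC p - 2 * s <= x <= reC p + 2 * s -> imC p - 2 * s <= y <= imC p + 2 * s -> nm (f (mkC x y)) <= M.
  apply: rect_bounded => x y h k; apply: cder_ccont (derivable_cder _).
  by apply: (hol_insq r0 H); rewrite ss /insq !reimE h k.
(* For |z - p| < s/4 the square of half-side s around z has its edges at distance at least 3s/4 from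
   p; the ratio of the two radii is the 1/3 whose powers beat 4 |M|. *)
exists (s / 4); first by rewrite divr_gt0.
move=> z zp; apply/eqP; rewrite -nm_eq0; apply/negP => /negP fz0.
have f0 : 0 < nm (f z) by rewrite lt_neqAle eq_sym fz0 nm_ge0.
have l1 : 0 <= (1 / 3 : R) by rewrite divr_ge0.
have l2 : (1 / 3 : R) < 1 by rewrite ltr_pdivrMr // mul1r ltr1n.
have [n nP] := @expr_small _ _ (4 * `|M|) l1 l2 f0.
have [u Hu uE] := A n.
have Dz w : insq z s w -> insq p (2 * s) w /\ nm (w - p) < r.
  move=> /andP[/andP[a1 a2] /andP[a3 a4]].
  have := le_lt_trans (re_le_nm _) zp; have := le_lt_trans (im_le_nm _) zp.
  rewrite reB imB !ltr_norml => /andP[b1 b2] /andP[b3 b4].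
  have K : insq p (2 * s) w by apply/andP; split; apply/andP; split; clear -s0 a1 a2 a3 a4 b1 b2 b3 b4; lra.
  by split => //; have := insqP K; rewrite -ss; clear -r0; lra.
have B : nm (u z) <= 4 * (`|M| / (s * (3 / 4)) ^+ n).
  apply: (center_bound s0); first by move=> w /Dz [_]; exact: Hu.
  move=> w we; have [/andP[w1 w2] _] := Dz w (edge_insq (ltW s0) we).
  have wp : s * (3 / 4) <= nm (w - p).
    have := sqedge_dist s0 we; have := nmD (w - p) (p - z); rewrite addrA subrK.
    by rewrite (nmBC p z); clear -zp; lra.
  have wp0 : 0 < s * (3 / 4) by rewrite mulr_gt0.
  rewrite ler_pdivlMr ?exprn_gt0 //; apply: (@le_trans _ _ (nm (f w))).
    rewrite uE nmM nmX mulrC ler_wpM2r ?nm_ge0 // lerXn2r ?nnegrE ?nm_ge0 //; exact: ltW.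
  by apply: le_trans (ler_norm _); rewrite (mkC_eta w); exact: HM.
have : nm (f z) <= 4 * `|M| * (1 / 3) ^+ n.
  rewrite uE nmM nmX.
  apply: (@le_trans _ _ ((s / 4) ^+ n * (4 * (`|M| / (s * (3 / 4)) ^+ n)))).
    apply: ler_pM; rewrite ?exprn_ge0 ?nm_ge0 //; apply: lerXn2r; rewrite ?nnegrE ?nm_ge0 //.
      by rewrite ltW // divr_gt0.
    exact: ltW.
  have -> : (1 / 3 : R) ^+ n = (s / 4) ^+ n / (s * (3 / 4)) ^+ n.
    by rewrite -expr_div_n; congr (_ ^+ n); field; rewrite gt_eqF.
  by rewrite le_eqVlt; apply/orP; left; apply/eqP; field; rewrite expf_neq0 // gt_eqF // mulr_gt0.
by rewrite leNgt nP.
Qed.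

(* A zero-free h close to f would contradict the center bound for 1/h. *)
Lemma zero_near f p L (dl : R) : cder f p L -> L != 0 -> f p = 0 -> 0 < dl ->
  exists s eta, [/\ 0 < s, s < dl, 0 < eta & forall h, (forall z, insq p s z -> derivable h z 1) ->
    (forall z, insq p s z -> nm (h z - f z) <= eta) -> exists2 w, insq p s w & h w = 0].
Proof.
move=> D L0 fp d0.
have Lp : 0 < nm L by rewrite nm_gt0.
have [d1 d10 P1] := D (nm L / 2) (half_gt0 Lp).
pose s := Num.min dl d1 / 3.
have m0 : 0 < Num.min dl d1 by rewrite lt_min d0.
have s0 : 0 < s by rewrite divr_gt0.
have md : Num.min dl d1 <= dl by rewrite ge_min lexx.
have md1 : Num.min dl d1 <= d1 by rewrite ge_min lexx orbT.
have sdl : s < dl by rewrite /s; clear -m0 md; lra.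
pose m := nm L / 2 * s; have mp : 0 < m by rewrite mulr_gt0 // divr_gt0.
(* On the edges |f| >= m, so |h| >= 9m/10 there, and the centre bound for 1/h gives |h(p)| >= 9m/40,
   more than the m/10 left by f(p) = 0. *)
exists s, (m / 10); split => //; first by rewrite divr_gt0.
move=> h Dh Hh; case: (pselect (exists2 w, insq p s w & h w = 0)) => // N; exfalso.
have h0 w : insq p s w -> h w != 0.
  by move=> wi; apply/eqP => hw; apply: N; exists w.
have F w : sqedge p s w -> m <= nm (f w).
  move=> we; have wi := edge_insq (ltW s0) we; have := insqP wi => w2.
  have wd : nm (w - p) < d1 by apply: le_lt_trans w2 _; rewrite /s; clear -m0 md1; lra.
  have := P1 w wd; rewrite fp subr0 => Q; have := sqedge_dist s0 we => ws.
  have := nmD (L * (w - p) - f w) (f w); rewrite subrK nmM (nmBC (L * _)) => K.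
  have : nm L / 2 * s <= nm L / 2 * nm (w - p) by rewrite ler_wpM2l // divr_ge0 // nm_ge0.
  by rewrite /m; clear -K Q; lra.
have B : nm (h p)^-1 <= 4 * (m * (9 / 10))^-1.
  apply: (center_bound (f := fun w => (h w)^-1) s0).
    by move=> z zi; apply: (@derivableV C C h z 1 (h0 z zi)); exact: Dh.
  move=> w we; have wi := edge_insq (ltW s0) we.
  rewrite nmV lef_pV2 ?posrE ?nm_gt0 ?h0 ?mulr_gt0 //.
  have := F w we; have := Hh w wi; have := nmD (f w - h w) (h w); rewrite subrK nmBC.
  by clear; lra.
have pi := center_insq p (ltW s0).
have hp : 0 < nm (h p) by rewrite nm_gt0 h0.
have := Hh p pi; rewrite fp subr0 => hm.
move: B; rewrite nmV -[4 * _]invrK invfM invrK lef_pV2 ?posrE //; last by rewrite mulr_gt0 ?invr_gt0 // mulr_gt0.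
by clear -hm mp; lra.
Qed.

(** The increment of an integral with moving upper end, for either order of the two ends:
    subtracting the constant [k] leaves an integrand of modulus at most [e]. *)
Lemma cint_diff a x x' (h : R -> C) (k : C) (e : R) : a <= x -> a <= x' -> 0 <= e ->
  good a (Num.max x x') h ->
  (forall t, Num.min x x' <= t <= Num.max x x' -> nm (h t - k) <= e) ->
  nm (cint a x' h - cint a x h - k * rC (x' - x)) <= 2 * e * `|x' - x|.
Proof.
wlog xx : x x' / x <= x'.
  move=> W; case/orP: (le_total x x') => h1; first exact: W.
  move=> h2 h3 h4; rewrite maxC minC => G H; have := W x' x h1 h3 h2 h4 G H.
  by rewrite -nmN distrC (_ : - _ = cint a x' h - cint a x h - k * rC (x' - x)) // !rCB; ring.
rewrite (max_idPr xx) (min_idPl xx) => ax ax' e0 G H.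
have G2 : good x x' h by apply: good_sub G.
rewrite (cint_cat ax xx G) -(cint_cst k xx) [_ + cint x x' h]addrC addrK -(cintB G2 (good_cst _ _ _)).
rewrite ger0_norm ?subr_ge0 //; apply: cint_le => //.
by apply: goodB => //; exact: good_cst.
Qed.

(** [P] integrates along the bottom and then upwards; since rectangles integrate to 0, going up
    first and then across gives the same value ([P2]). One form controls vertical and the other
    horizontal increments, so P' = f, and [f] is holomorphic as a derivative. *)
Theorem morera f p s : 0 < s -> (forall z, insq p s z -> ccont f z) ->
  (forall a b c d, reC p - s <= a -> a <= b -> b <= reC p + s -> imC p - s <= c -> c <= d -> d <= imC p + s ->
     rect f a b c d = 0) -> hol f p s.
Proof.
move=> s0 Fc FR; pose a := reC p - s; pose c := imC p - s.
pose P z : C := cint a (reC z) (fun t => f (mkC t c)) + iC * cint c (imC z) (fun t => f (mkC (reC z) t)).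
have gh y x : imC p - s <= y <= imC p + s -> x <= reC p + s -> goodh f y a x.
  move=> h k; apply: goodh_cont => t /andP[t1 t2]; apply: Fc; rewrite /insq !reimE h t1 (le_trans t2 k) //.
have gv y x : reC p - s <= x <= reC p + s -> y <= imC p + s -> goodv f x c y.
  move=> h k; apply: goodv_cont => t /andP[t1 t2]; apply: Fc; rewrite /insq !reimE h t1 (le_trans t2 k) //.
have cc : c <= c <= imC p + s by rewrite lexx /c; clear -s0; lra.
have aa : a <= a <= reC p + s by rewrite lexx /a; clear -s0; lra.
have P2 z : insq p s z -> P z = cint a (reC z) (fun t => f (mkC t (imC z))) + iC * cint c (imC z) (fun t => f (mkC a t)).
  move=> zi; have /andP[z1 z2] := zi; have /andP[z11 z12] := z1; have /andP[z21 z22] := z2.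
  have := FR a (reC z) c (imC z) (lexx _) z11 z12 (lexx _) z21 z22.
  rewrite /rect (cintB (gh _ _ cc z12) (gh _ _ z2 z12)) (cintB (gv _ _ z1 z22) (gv _ _ aa z22)) => /eqP.
  by rewrite mulrBr addrACA -opprD subr_eq0 => /eqP.
have DP z : nm (z - p) < s -> cder P z (f z).
  move=> zs; have [zz1 zz2] := sq_int zs; have /andP[z11 z12] := zz1; have /andP[z21 z22] := zz2.
  have zi : insq p s z by rewrite /insq !ltW.
  move=> e e0; have e4 : 0 < e / 4 by rewrite divr_gt0.
  have [d1 d10 d1P] := Fc z zi (e / 4) e4.
  pose dl := Num.min (d1 / 2) (s - nm (z - p)).
  have dl0 : 0 < dl by rewrite lt_min divr_gt0 // subr_gt0.
  exists dl => // w; rewrite lt_min => /andP[w1 w2].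
  have ws : nm (w - p) < s.
    by have := nmD (w - z) (z - p); rewrite addrA subrK => /le_lt_trans; apply; rewrite -ltrBrDr.
  have [ww1 ww2] := sq_int ws; have /andP[w11 w12] := ww1; have /andP[w21 w22] := ww2.
  have wi : insq p s w by rewrite /insq !ltW.
  have rw : `|reC w - reC z| <= nm (w - z) by rewrite -reB re_le_nm.
  have iw : `|imC w - imC z| <= nm (w - z) by rewrite -imB im_le_nm.
  (* The corner of the path that goes up from [z] to [v] and across from [v] to [w]. *)
  pose v := mkC (reC z) (imC w).
  have vi : insq p s v by rewrite /insq !reimE !ltW.
  have -> : P w - P z - f z * (w - z) =
    (cint a (reC w) (fun t => f (mkC t (imC w))) - cint a (reC z) (fun t => f (mkC t (imC w))) - f z * rC (reC w - reC z)) +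
    iC * (cint c (imC w) (fun t => f (mkC (reC z) t)) - cint c (imC z) (fun t => f (mkC (reC z) t)) - f z * rC (imC w - imC z)).
    have E1 := P2 v vi; rewrite /v !reimE in E1.
    have E2 := P2 w wi; rewrite {1 2}/P.
    have EW : w - z = rC (reC w - reC z) + iC * rC (imC w - imC z).
      by rewrite {1}(mkC_eta w) {1}(mkC_eta z) !mkCE !rCB; ring.
    rewrite {1}EW -[cint a (reC w) _ + _]/(P w) E2.
    move: E1; rewrite /P !reimE => E1.
    have -> : cint a (reC w) (fun t => f (mkC t (imC w))) + iC * cint c (imC w) (fun t => f (mkC a t)) =
       cint a (reC w) (fun t => f (mkC t (imC w))) - cint a (reC z) (fun t => f (mkC t (imC w))) +
       (cint a (reC z) (fun t => f (mkC t c)) + iC * cint c (imC w) (fun t => f (mkC (reC z) t))).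
      by rewrite E1; ring.
    ring.
  apply: le_trans (nmD _ _) _; rewrite nmM nm_iC mul1r.
  have B1 : nm (cint a (reC w) (fun t => f (mkC t (imC w))) - cint a (reC z) (fun t => f (mkC t (imC w))) - f z * rC (reC w - reC z)) <= 2 * (e / 4) * `|reC w - reC z|.
    apply: cint_diff; [exact: ltW|exact: ltW|exact: ltW| |].
      by apply: gh; [rewrite !ltW | rewrite ge_max !ltW].
    move=> t /andP[t1 t2]; apply/ltW/d1P; rewrite {1}(mkC_eta z).
    apply: le_lt_trans (nm_le_box _ _ _ _) _.
    have : `|t - reC z| <= `|reC w - reC z|.
      move: t1 t2; rewrite ge_min le_max; case: (leP (reC z) (reC w)) => k.
        rewrite (ger0_norm (_ : 0 <= reC w - reC z)) ?subr_ge0 // => t1 t2.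
        have t1' : reC z <= t by case/orP: t1 => // /(le_trans k).
        have t2' : t <= reC w by case/orP: t2 => // h; exact: le_trans h k.
        by rewrite ger0_norm ?subr_ge0 // lerD2r.
      rewrite (ltr0_norm (_ : reC w - reC z < 0)) ?subr_lt0 // => t1 t2.
      have t1' : reC w <= t by case/orP: t1 => // /(le_trans (ltW k)).
      have t2' : t <= reC z by case/orP: t2 => // h; exact: le_trans h (ltW k).
      by rewrite ler0_norm ?subr_le0 // lerN2 lerD2r.
    by clear -rw iw w1; lra.
  have B2 : nm (cint c (imC w) (fun t => f (mkC (reC z) t)) - cint c (imC z) (fun t => f (mkC (reC z) t)) - f z * rC (imC w - imC z)) <= 2 * (e / 4) * `|imC w - imC z|.
    apply: cint_diff; [exact: ltW|exact: ltW|exact: ltW| |].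
      by apply: gv; [rewrite !ltW | rewrite ge_max !ltW].
    move=> t /andP[t1 t2]; apply/ltW/d1P; rewrite {2}(mkC_eta z).
    apply: le_lt_trans (nm_le_box _ _ _ _) _; rewrite subrr normr0 add0r.
    have : `|t - imC z| <= `|imC w - imC z|.
      move: t1 t2; rewrite ge_min le_max; case: (leP (imC z) (imC w)) => k.
        rewrite (ger0_norm (_ : 0 <= imC w - imC z)) ?subr_ge0 // => t1 t2.
        have t1' : imC z <= t by case/orP: t1 => // /(le_trans k).
        have t2' : t <= imC w by case/orP: t2 => // h; exact: le_trans h k.
        by rewrite ger0_norm ?subr_ge0 // lerD2r.
      rewrite (ltr0_norm (_ : imC w - imC z < 0)) ?subr_lt0 // => t1 t2.
      have t1' : imC w <= t by case/orP: t1 => // /(le_trans (ltW k)).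
      have t2' : t <= imC z by case/orP: t2 => // h; exact: le_trans h (ltW k).
      by rewrite ler0_norm ?subr_le0 // lerN2 lerD2r.
    by have := nm_ge0 (w - z); clear -iw w1; lra.
  have B3 : e / 2 * `|reC w - reC z| <= e / 2 * nm (w - z) by rewrite ler_wpM2l // ltW // divr_gt0.
  have B4 : e / 2 * `|imC w - imC z| <= e / 2 * nm (w - z) by rewrite ler_wpM2l // ltW // divr_gt0.
  by clear -B1 B2 B3 B4; lra.
have HP : hol P p s by move=> z /DP; exact: cder_derivable.
apply: hol_near (hol_deriv HP) => z zs; exact: cder_val (DP z zs).
Qed.
End Holomorphic.

(** * Smooth test functions *)

Section Smooth1.
Variable R : realType.
Local Notation mu := (@lebesgue_measure R).
Implicit Types (f g : R -> R) (x : R).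

Definition der f x (l : R) := is_derive x (1 : R) f l.

Lemma derP f x l : der f x l <-> forall e : R, 0 < e ->
  exists2 d : R, 0 < d & forall y, `|y - x| < d -> `|f y - f x - l * (y - x)| <= e * `|y - x|.
Proof.
have E0 : (fun h : R => h^-1 *: ((f \o shift x) (h *: (1 : R)) - f x)) =
         (fun h : R => h^-1 *: (f (h + x) - f x)).
  by apply/funext => h /=; rewrite /GRing.scale /= mulr1.
split=> [[D E] e e0|H].
  have : h^-1 *: (f (h + x) - f x) @[h --> 0^'] --> l.
    by move: D E; rewrite /derivable /derive E0 => D <-.
  move/cvgrPdist_lt => /(_ _ e0); rewrite near_withinE => /nbhs_ballP [d /= d0 dP].
  exists d => // y yd; have [->|yx] := eqVneq y x; first by rewrite !subrr mulr0 subr0 normr0 mulr0.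
  have h0 : y - x != 0 by rewrite subr_eq0.
  have := dP (y - x); rewrite /ball /= sub0r normrN subrK => /(_ yd h0) /ltW K.
  have -> : f y - f x - l * (y - x) = - ((l - (y - x)^-1 *: (f y - f x)) * (y - x)).
    by rewrite /GRing.scale /=; field.
  by rewrite normrN normrM ler_wpM2r.
have K : h^-1 *: (f (h + x) - f x) @[h --> 0^'] --> l.
  apply/cvgrPdist_lt => e e0; have [d d0 dP] := H (e / 2) (half_gt0 e0).
  rewrite near_withinE; apply/nbhs_ballP; exists d => // h; rewrite /ball /= sub0r normrN => hd h0.
  have := dP (h + x); rewrite addrK => /(_ hd) Q.
  have -> : l - h^-1 *: (f (h + x) - f x) = - (h^-1 * (f (h + x) - f x - l * h)).
    by rewrite /GRing.scale /=; field.
  rewrite normrN normrM normfV; have h1 : 0 < `|h| by rewrite normr_gt0.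
  by rewrite mulrC ltr_pdivrMr //; apply: le_lt_trans Q _; rewrite ltr_pM2r //; lra.
split; first by rewrite /derivable E0; apply/cvg_ex; exists l.
by rewrite /derive E0; apply/cvg_lim.
Qed.

Lemma der_near f g x l (r : R) : 0 < r -> (forall y, `|y - x| < r -> f y = g y) -> der f x l -> der g x l.
Proof.
move=> r0 E /derP H; apply/derP => e /H [d d0 dP].
exists (Num.min d r); first by rewrite lt_min d0.
by move=> y; rewrite lt_min => /andP[y1 y2]; rewrite -!E ?subrr ?normr0 //; exact: dP.
Qed.

Lemma derD f g x l m : der f x l -> der g x m -> der (fun y => f y + g y) x (l + m).
Proof. by move=> H G; exact: is_deriveD. Qed.

Lemma derM f g x l m : der f x l -> der g x m -> der (fun y => f y * g y) x (l * g x + f x * m).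
Proof.
move=> H G; have K := @is_deriveM R R f g x 1 l m H G.
by apply: (is_derive_eq K); rewrite /GRing.scale /= addrC [g x * _]mulrC.
Qed.

Lemma der_cst (k x : R) : der (fun=> k) x 0.
Proof. exact: is_derive_cst. Qed.

Lemma der_id x : der (fun y => y) x 1.
Proof. exact: is_derive_id. Qed.

Lemma derZ k f x l : der f x l -> der (fun y => k * f y) x (k * l).
Proof. by move=> /(derM (der_cst k x)); rewrite mul0r add0r. Qed.

Lemma der_comp f g x l m : der f x l -> der g (f x) m -> der (fun y => g (f y)) x (m * l).
Proof. by move=> H G; exact: is_derive1_comp. Qed.

Lemma der_cont f x l : der f x l -> {for x, continuous f}.
Proof. by move=> [D _]; apply: differentiable_continuous; apply/derivable1_diffP. Qed.

Lemma der_uniq f x l m : der f x l -> der f x m -> l = m.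
Proof. by move=> [_ <-] [_ <-]. Qed.

Lemma derX f x l n : der f x l -> der (fun y => f y ^+ n) x (n%:R * f x ^+ n.-1 * l).
Proof.
move=> H; elim: n => [|n IH]; first by rewrite !mul0r; exact: der_cst.
have := derM H IH; under eq_fun do rewrite -exprS.
suff -> : l * f x ^+ n + f x * (n%:R * f x ^+ n.-1 * l) = n.+1%:R * f x ^+ n * l by [].
case: n {IH} => [|n] /=; first by rewrite !mul0r mulr0 addr0 !expr0; ring.
rewrite exprS [n.+2%:R]mulrS; ring.
Qed.

(* Smoothness is coinductive: membership in some class closed under differentiation. *)
Definition smooth1 f := exists2 S : set (R -> R), S f &
  forall g, S g -> exists2 g', S g' & forall x, der g x (g' x).

Lemma smooth1_deriv f : smooth1 f -> exists2 f', smooth1 f' & forall x, der f x (f' x).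
Proof. by move=> [S Sf H]; have [f' Sf' D] := H f Sf; exists f' => //; exists S. Qed.

(** The derivative of a product is a sum of two products: a class of generators is rarely closed
    under differentiation, but its linear span often is. *)
Inductive span (S : set (R -> R)) : (R -> R) -> Prop :=
| span_in f of S f : span S f
| span_add f g of span S f & span S g : span S (fun x => f x + g x)
| span_scale (k : R) f of span S f : span S (fun x => k * f x).

Lemma smooth_span (S : set (R -> R)) :
  (forall g, S g -> exists2 g', span S g' & forall x, der g x (g' x)) ->
  forall f, span S f -> smooth1 f.
Proof.
move=> H f Sf; exists (span S) => // {f Sf} g; elim=> [f /H //|f h _ [f' F1 F2] _ [h' H1 H2]|k f _ [f' F1 F2]].
  by exists (fun x => f' x + h' x); [exact: span_add | move=> x; exact: derD].
by exists (fun x => k * f' x); [exact: span_scale | move=> x; exact: derZ].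
Qed.

Lemma smooth1M f g : smooth1 f -> smooth1 g -> smooth1 (fun x => f x * g x).
Proof.
move=> [S Sf HS] [T Tg HT].
pose U : set (R -> R) := fun h => exists f1 g1, [/\ S f1, T g1 & h = (fun x => f1 x * g1 x)].
apply: (@smooth_span U); last by apply: span_in; exists f, g.
move=> _ [f1 [g1 [Sf1 Tg1 ->]]]; have [f2 Sf2 D] := HS _ Sf1; have [g2 Sg2 D'] := HT _ Tg1.
exists (fun x => f2 x * g1 x + f1 x * g2 x); last by move=> x; exact: derM.
by apply: span_add; apply: span_in; [exists f2, g1 | exists f1, g2].
Qed.

Lemma smooth1D f g : smooth1 f -> smooth1 g -> smooth1 (fun x => f x + g x).
Proof.
move=> [S Sf HS] [T Tg HT].
apply: (@smooth_span (fun h => S h \/ T h)).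
  move=> h [/HS [h' Sh D]|/HT [h' Sh D]]; exists h' => //; apply: span_in; first by left.
  by right.
by apply: span_add; apply: span_in; [left|right].
Qed.

Lemma smooth1Z k f : smooth1 f -> smooth1 (fun x => k * f x).
Proof.
move=> [S Sf HS]; apply: (@smooth_span S); last by apply: span_scale; exact: span_in.
by move=> h /HS [h' Sh D]; exists h' => //; apply: span_in.
Qed.

Lemma smooth1B f g : smooth1 f -> smooth1 g -> smooth1 (fun x => f x - g x).
Proof.
move=> F /(smooth1Z (-1)) /(smooth1D F) [S Sf H]; exists S => //.
by rewrite (_ : (fun x => f x - g x) = (fun x => f x + -1 * g x)) //; apply/funext => x; rewrite mulN1r.
Qed.

Lemma der_affine f x (k l d : R) : der f (k * x + l) d -> der (fun y => f (k * y + l)) x (k * d).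
Proof.
move=> H; rewrite mulrC; apply: (@der_comp (fun y => k * y + l)) => //.
have := derD (derZ k (der_id x)) (der_cst l x); by rewrite mulr1 addr0.
Qed.

Lemma smooth1_affine f (k l : R) : smooth1 f -> smooth1 (fun x => f (k * x + l)).
Proof.
move=> [S Sf HS].
apply: (@smooth_span (fun h => exists2 h1, S h1 & h = (fun x => h1 (k * x + l)))); last first.
  by apply: span_in; exists f.
move=> _ [h Sh ->]; have [h' Sh' D] := HS h Sh.
exists (fun x => k * h' (k * x + l)); last by move=> x; exact: der_affine.
by apply: span_scale; apply: span_in; exists h'.
Qed.

Lemma smooth1_prim f f' : smooth1 f' -> (forall x, der f x (f' x)) -> smooth1 f.
Proof.
move=> [S Sf HS] D; exists (fun h => S h \/ h = f); first by right.
by move=> h [/HS [h' Sh D']|->]; [exists h' => //; left | exists f' => //; left].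
Qed.

(** For x > 0 this is x^(-k) exp(-1/x). Up to linear combinations the family over all k is closed
    under differentiation, so the smoothness of exp(-1/x), extended by 0, follows for all orders at
    once. *)
Definition flat (k : nat) x := if 0 < x then x^-1 ^+ k * expR (- x^-1) else 0.

(** exp(1/x) >= (1 / (m x))^m with m = k + 2 beats x^(-k) with a factor x^2 to spare, enough for a
    zero derivative at 0. *)
Lemma flat_small k x : 0 < x -> `|flat k x| <= k.+2%:R ^+ k.+2 * x ^+ 2.
Proof.
move=> x0; rewrite /flat x0; set m := k.+2.
have xi : 0 < x^-1 by rewrite invr_gt0.
rewrite ger0_norm ?mulr_ge0 ?exprn_ge0 ?expR_ge0 ?(ltW xi) // expRN.
have m0 : 0 < m%:R :> R by rewrite ltr0n.
have E : (x^-1 / m%:R) ^+ m <= expR x^-1.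
  have -> : expR x^-1 = expR (x^-1 / m%:R) ^+ m by rewrite -expRM_natl mulrC divfK ?gt_eqF.
  apply: lerXn2r; rewrite ?nnegrE ?expR_ge0 ?divr_ge0 ?(ltW xi) ?(ltW m0) //.
  by apply: le_trans (expR_ge1Dx _); rewrite lerDr.
have q0 : 0 < (x^-1 / m%:R) ^+ m by rewrite exprn_gt0 // divr_gt0.
apply: (@le_trans _ _ (x^-1 ^+ k * ((x^-1 / m%:R) ^+ m)^-1)).
  by rewrite ler_wpM2l ?exprn_ge0 ?(ltW xi) // lef_pV2 ?posrE ?expR_gt0.
have -> : x^-1 ^+ k / (x^-1 / m%:R) ^+ m = m%:R ^+ m * x ^+ 2; last by [].
rewrite expr_div_n; have -> : x^-1 ^+ m = x^-1 ^+ k * x^-1 ^+ 2 by rewrite -exprD addn2.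
have h1 : x^-1 ^+ k != 0 by rewrite expf_neq0 // gt_eqF.
have h2 : m%:R ^+ m != 0 :> R by rewrite expf_neq0 // gt_eqF.
move: h1 h2; set u := _ ^+ k; set v := _ ^+ m => h1 h2; field.
by rewrite h1 h2 gt_eqF.
Qed.

Lemma der_inv x : x != 0 -> der (fun y => y^-1) x (- x^-1 ^+ 2).
Proof.
move=> x0; split; first by apply: (@derivableV R R (fun y : R => y)) => //; exact: derivable_id.
rewrite (@deriveV R R (fun y : R => y) x 1 x0 (@derivable_id R R x 1)).
by rewrite derive_id /GRing.scale /= mulr1 exprVn.
Qed.

Lemma der_flat k x : der (flat k) x (flat k.+2 x - k%:R * flat k.+1 x).
Proof.
have [x0|x0|x0] := ltgtP x 0.
- rewrite /flat !(ltNge 0 x) (ltW x0) /= mulr0 subr0.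
  have r0 : 0 < - x by rewrite oppr_gt0.
  apply: (der_near r0 _ (der_cst 0 x)) => y; rewrite ltr_norml => /andP[_ h].
  by rewrite ltNge (_ : y <= 0) //; clear -h; lra.
- have D1 := der_inv (negbT (gt_eqF x0)).
  have D2 : der (fun y => expR (- y^-1)) x (expR (- x^-1) * x^-1 ^+ 2).
    have N := derZ (-1) D1; apply: (@der_comp (fun y => - y^-1) expR).
      by move: N; rewrite mulN1r opprK; apply: der_near ltr01 _ => y _; rewrite mulN1r.
    exact: is_derive_expR.
  have D3 := derM (derX k D1) D2; rewrite /flat x0.
  have -> : x^-1 ^+ k.+2 * expR (- x^-1) - k%:R * (x^-1 ^+ k.+1 * expR (- x^-1)) =
    k%:R * x^-1 ^+ k.-1 * - x^-1 ^+ 2 * expR (- x^-1) + x^-1 ^+ k * (expR (- x^-1) * x^-1 ^+ 2).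
    case: (k) => [|j] /=; first by rewrite !mul0r expr0 subr0 add0r mul1r mulrC.
    by rewrite !exprS expr0; ring.
  apply: (der_near x0 _ D3) => y; rewrite ltr_norml => /andP[h _].
  by rewrite (_ : 0 < y) //; clear -h; lra.
rewrite {}x0.
have F0 j : flat j 0 = 0 by rewrite /flat ltxx.
rewrite !F0 mulr0 subr0; apply/derP => e e0.
pose K : R := k.+2%:R ^+ k.+2.
have K0 : 0 < K by rewrite exprn_gt0 // ltr0n.
exists (e / K); first by rewrite divr_gt0.
move=> y; rewrite F0 !subr0 mul0r subr0 => yd.
have [y0|y0] := ltP 0 y; last by rewrite /flat ltNge y0 normr0 mulr_ge0 // ltW.
have := flat_small k y0; rewrite -/K => /le_trans; apply.
move: yd; rewrite gtr0_norm // ltr_pdivlMr // => yd.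
by rewrite expr2 mulrA ler_wpM2r // ?ltW // mulrC.
Qed.

Lemma smooth1_flat k : smooth1 (flat k).
Proof.
apply: (@smooth_span (fun h => exists j, h = flat j)); last by apply: span_in; exists k.
move=> _ [j ->]; exists (fun x => flat j.+2 x - j%:R * flat j.+1 x); last by move=> x; exact: der_flat.
rewrite (_ : (fun x => _) = (fun x => flat j.+2 x + (- j%:R) * flat j.+1 x)); last first.
  by apply/funext => x; rewrite mulNr.
by apply: span_add; [|apply: span_scale]; apply: span_in; eexists.
Qed.

(** exp(-1/x) exp(-1/(1 - x)) on (0, 1) and 0 elsewhere. *)
Definition bump x := flat 0 x * flat 0 (-1 * x + 1).

Lemma smooth1_bump : smooth1 bump.
Proof. by apply: smooth1M; [exact: smooth1_flat | apply: smooth1_affine; exact: smooth1_flat]. Qed.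

Lemma flat_ge0 x : 0 <= flat 0 x.
Proof. by rewrite /flat; case: ifP => // _; rewrite expr0 mul1r expR_ge0. Qed.

Lemma flat_le1 x : flat 0 x <= 1.
Proof.
rewrite /flat; case: ifP => // x0; rewrite expr0 mul1r -expR0 ler_expR.
by rewrite oppr_le0 invr_ge0 ltW.
Qed.

Lemma bump_ge0 x : 0 <= bump x.
Proof. by rewrite mulr_ge0 // flat_ge0. Qed.

Lemma bump_le1 x : bump x <= 1.
Proof. by rewrite mulr_ile1 ?flat_ge0 ?flat_le1. Qed.

Lemma bump_out x : x <= 0 \/ 1 <= x -> bump x = 0.
Proof.
rewrite /bump /flat => -[h|h]; first by rewrite ltNge h mul0r.
by rewrite [X in _ * X](_ : _ = 0) ?mulr0 //; case: ifP => // k; exfalso; move: k; lra.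
Qed.

Lemma bump_cont : continuous bump.
Proof. by have [f' _ D] := smooth1_deriv smooth1_bump => x; exact: der_cont (D x). Qed.

Lemma bump_integrable a b : mu.-integrable `[a, b]%classic (EFin \o bump).
Proof.
apply: continuous_compact_integrable; first exact: segment_compact.
by apply: continuous_subspaceT => x; exact: bump_cont.
Qed.

(** A primitive of [bump]. The integral starts at -1 and not at 0, so that 0 is an interior point
    for the fundamental theorem of calculus; negative x are treated apart. The final value [step 1]
    is not normalised and is carried along as a positive constant. *)
Definition step x := if x < 0 then 0 else rint (-1) x bump.

Lemma rint0 a b (u : R -> R) : (forall t, a <= t <= b -> u t = 0) -> rint a b u = 0.
Proof.
move=> H; have -> : rint a b u = rint a b (fun=> 0).
  by apply: eq_Rintegral => t /set_mem /=; rewrite in_itv /=; exact: H.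
by rewrite /rint /Rintegral integral0.
Qed.

Lemma bump_cat a b c : a <= b -> b <= c -> rint a c bump = rint a b bump + rint b c bump.
Proof. by move=> ab bc; apply: rint_cat => //; exact: bump_integrable. Qed.

Lemma stepE x : -1 <= x -> step x = rint (-1) x bump.
Proof.
move=> x1; rewrite /step; case: ltP => // x0; apply/esym/rint0 => t /andP[_ h].
by apply: bump_out; left; exact: le_trans h (ltW x0).
Qed.

Lemma step_lo x : x <= 0 -> step x = 0.
Proof.
move=> x0; rewrite /step; case: ltP => // x0'; apply: rint0 => t /andP[_ h].
by apply: bump_out; left; exact: le_trans h x0.
Qed.

Lemma step_hi x : 1 <= x -> step x = step 1.
Proof.
move=> x1; rewrite !stepE; [|lra|lra].
have e1 : (-1 : R) <= 1 by lra.
rewrite (bump_cat e1 x1).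
rewrite [X in _ + X]rint0 ?addr0 // => t /andP[h _].
by apply: bump_out; right.
Qed.

Lemma step_der x : der step x (bump x).
Proof.
have [x0|x0] := ltP x 0.
  rewrite (bump_out (or_introl (ltW x0))).
  have r0 : 0 < - x by rewrite oppr_gt0.
  apply: (der_near r0 _ (der_cst 0 x)) => y; rewrite ltr_norml => /andP[_ h].
  by rewrite step_lo //; clear -h; lra.
have xu : x < x + 1 by rewrite ltrDl.
have ax : (BLeft (-1)%R < BRight x)%E by rewrite /= lte_fin; clear -x0; lra.
have bc : {for x, continuous bump} by exact: bump_cont.
have [D E] := @continuous_FTC1 R bump (BLeft (-1)) x (x + 1) xu (bump_integrable _ _) ax bc.
have D' : der (fun x => rint (-1) x bump) x (bump x).
  by apply: (@DeriveDef R R R x 1 _ _ D); rewrite -(@derive1E R R).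
apply: (der_near ltr01 _ D') => y; rewrite ltr_norml => /andP[h _].
by rewrite stepE //; clear -h x0; lra.
Qed.

Lemma smooth1_step : smooth1 step.
Proof. exact: smooth1_prim smooth1_bump step_der. Qed.

Lemma step1_gt0 : 0 < step 1.
Proof.
rewrite stepE; last by lra.
rewrite (@bump_cat _ (1/4)); [|lra|lra].
rewrite (@bump_cat (1/4) (3/4)); [|lra|lra].
have P a b : a <= b -> 0 <= rint a b bump.
  by move=> ab; apply: Rintegral_ge0 => t _; exact: bump_ge0.
(* Both factors of [bump] are at least exp(-4) on [1/4, 3/4]. *)
pose m := expR (- (1/4)^-1) * expR (- (1/4 : R)^-1) : R.
have m0 : 0 < m by rewrite mulr_gt0 // expR_gt0.
have F t : 1/4 <= t -> expR (- (1/4)^-1) <= flat 0 t.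
  move=> ht; rewrite /flat (_ : 0 < t); last by clear -ht; lra.
  rewrite expr0 [1 * expR _]mul1r ler_expR lerN2 lef_pV2 ?posrE //; clear -ht; lra.
have B t : 1/4 <= t <= 3/4 -> m <= bump t.
  by move=> /andP[t1 t2]; rewrite ler_pM ?expR_ge0 // F //; clear -t1 t2; lra.
have : m * (3/4 - 1/4) <= rint (1/4) (3/4) bump.
  rewrite -rint_cst; last by lra.
  rewrite /rint; apply: le_Rintegral; [exact: measurable_itv | exact: (goodI (good_cst _ _ (rC m))).1 | exact: bump_integrable |].
  by move=> t /=; rewrite in_itv /= => /B.
have p1 : 0 <= rint (-1) (1/4) bump by apply: P; lra.
have p2 : 0 <= rint (3/4) 1 bump by apply: P; lra.
by clear -p1 p2 m0; lra.
Qed.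

Lemma step_ge0 x : 0 <= step x.
Proof. by rewrite /step; case: ifP => // _; apply: Rintegral_ge0 => t _; exact: bump_ge0. Qed.

Lemma step_le x : step x <= step 1.
Proof.
have [h|h] := leP 1 x; first by rewrite step_hi.
have [k|k] := ltP x 0; first by rewrite (step_lo (ltW k)) step_ge0.
rewrite !stepE; [|lra|lra].
rewrite (@bump_cat _ x 1); [|lra|lra].
by rewrite lerDl; apply: Rintegral_ge0 => t _; exact: bump_ge0.
Qed.
End Smooth1.

(** * Gradients, test functions and measurability in the plane *)

Section Plane.
Variable R : realType.
Local Notation C := (Cs R).
Local Notation iC := (iC R).
Implicit Types (u w : R * R -> R) (p q v : R * R) (h : C -> C) (al be : R -> R).

Definition dist1 p q : R := `|p.1 - q.1| + `|p.2 - q.2|.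
Definition has_grad u q (l1 l2 : R) := forall e : R, 0 < e -> exists2 d : R, 0 < d &
  forall p, dist1 p q < d -> `|u p - u q - (l1 * (p.1 - q.1) + l2 * (p.2 - q.2))| <= e * dist1 p q.

Lemma dist1_ge0 p q : 0 <= dist1 p q.
Proof. by rewrite addr_ge0. Qed.

Lemma dist1pp p : dist1 p p = 0.
Proof. by rewrite /dist1 !subrr normr0 addr0. Qed.

Lemma dist1_fst p q : `|p.1 - q.1| <= dist1 p q. Proof. by rewrite lerDl. Qed.
Lemma dist1_snd p q : `|p.2 - q.2| <= dist1 p q. Proof. by rewrite lerDr. Qed.

Lemma has_grad_near u w q l1 l2 (r : R) : 0 < r -> (forall p, dist1 p q < r -> u p = w p) ->
  has_grad u q l1 l2 -> has_grad w q l1 l2.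
Proof.
move=> r0 E H e /H [d d0 dP]; exists (Num.min d r); first by rewrite lt_min d0.
by move=> p; rewrite lt_min => /andP[p1 p2]; rewrite -!E ?dist1pp //; exact: dP.
Qed.

Lemma has_grad_cst (k : R) q : has_grad (fun=> k) q 0 0.
Proof.
by move=> e e0; exists 1 => // p _; rewrite !mul0r addr0 !subrr normr0 mulr_ge0 ?dist1_ge0 ?ltW.
Qed.

Lemma has_gradD u w q l1 l2 m1 m2 : has_grad u q l1 l2 -> has_grad w q m1 m2 ->
  has_grad (fun p => u p + w p) q (l1 + m1) (l2 + m2).
Proof.
move=> H G e e0; have [d1 d10 P1] := H _ (half_gt0 e0); have [d2 d20 P2] := G _ (half_gt0 e0).
exists (Num.min d1 d2); first by rewrite lt_min d10.
move=> p; rewrite lt_min => /andP[/P1 p1 /P2 p2].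
have -> : u p + w p - (u q + w q) - ((l1 + m1) * (p.1 - q.1) + (l2 + m2) * (p.2 - q.2)) =
  (u p - u q - (l1 * (p.1 - q.1) + l2 * (p.2 - q.2))) + (w p - w q - (m1 * (p.1 - q.1) + m2 * (p.2 - q.2))) by ring.
apply: le_trans (ler_normD _ _) _; lra.
Qed.

Lemma has_grad_lip u q l1 l2 : has_grad u q l1 l2 -> exists L d : R, [/\ 0 < L, 0 < d &
  forall p, dist1 p q < d -> `|u p - u q| <= L * dist1 p q].
Proof.
move=> H; have [d d0 dP] := H 1 ltr01; exists (1 + (`|l1| + `|l2|)), d; split => //.
move=> p /dP K; have -> : u p - u q = (u p - u q - (l1 * (p.1 - q.1) + l2 * (p.2 - q.2))) + (l1 * (p.1 - q.1) + l2 * (p.2 - q.2)) by ring.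
apply: le_trans (ler_normD _ _) _; rewrite mulrDl; apply: lerD => //.
apply: le_trans (ler_normD _ _) _; rewrite !normrM mulrDl; apply: lerD; rewrite ler_wpM2l //.
  exact: dist1_fst.
exact: dist1_snd.
Qed.

Lemma has_gradM u w q l1 l2 m1 m2 : has_grad u q l1 l2 -> has_grad w q m1 m2 ->
  has_grad (fun p => u p * w p) q (l1 * w q + u q * m1) (l2 * w q + u q * m2).
Proof.
move=> H G e e0.
have [L [d1 [L0 d10 P1]]] := has_grad_lip H; have [M [d2 [M0 d20 P2]]] := has_grad_lip G.
pose K := `|w q| + `|u q| + L * M.
have K0 : 0 < K by rewrite ltr_wpDl ?addr_ge0 ?mulr_gt0.
have eK : 0 < e / K by rewrite divr_gt0.
have [d3 d30 P3] := H _ eK; have [d4 d40 P4] := G _ eK.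
exists (Num.min (Num.min d1 d2) (Num.min (Num.min d3 d4) (e / K))); first by rewrite !lt_min d10 d20 d30 d40.
move=> p; rewrite !lt_min => /andP[/andP[/P1 p1 /P2 p2] /andP[/andP[/P3 p3 /P4 p4] p5]].
set a := _ - _ - _ in p3; set b := _ - _ - _ in p4.
have -> : u p * w p - u q * w q - ((l1 * w q + u q * m1) * (p.1 - q.1) + (l2 * w q + u q * m2) * (p.2 - q.2)) =
  w q * a + u q * b + (u p - u q) * (w p - w q) by rewrite /a /b; ring.
have n0 := dist1_ge0 p q.
apply: le_trans (ler_normD _ _) _.
have -> : e * dist1 p q = (`|w q| + `|u q|) * (e / K * dist1 p q) + L * M * (e / K) * dist1 p q.
  by rewrite /K; field; rewrite gt_eqF.
apply: lerD.
  apply: le_trans (ler_normD _ _) _; rewrite !normrM mulrDl.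
  by apply: lerD; rewrite ler_wpM2l.
rewrite normrM; apply: le_trans (ler_pM _ _ p1 p2) _ => //.
have -> : L * dist1 p q * (M * dist1 p q) = L * M * dist1 p q * dist1 p q by ring.
by rewrite ler_wpM2r // ler_wpM2l ?mulr_ge0 ?ltW.
Qed.

Lemma has_grad_fst al q l : der al q.1 l -> has_grad (fun p => al p.1) q l 0.
Proof.
move=> /derP H e e0; have [d d0 dP] := H e e0; exists d => // p pd.
rewrite mul0r addr0; apply: le_trans (dP _ _) _; first exact: le_lt_trans (dist1_fst _ _) pd.
by rewrite ler_wpM2l ?dist1_fst // ltW.
Qed.

Lemma has_grad_snd al q l : der al q.2 l -> has_grad (fun p => al p.2) q 0 l.
Proof.
move=> /derP H e e0; have [d d0 dP] := H e e0; exists d => // p pd.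
rewrite mul0r add0r; apply: le_trans (dP _ _) _; first exact: le_lt_trans (dist1_snd _ _) pd.
by rewrite ler_wpM2l ?dist1_snd // ltW.
Qed.

Lemma nm_toC p q : nm (toC p - toC q : C) <= dist1 p q.
Proof. exact: nm_le_box. Qed.

Lemma has_grad_re h q L : cder h (toC q) L -> has_grad (fun p => reC (h (toC p))) q (reC L) (- imC L).
Proof.
move=> H e e0; have [d d0 dP] := H e e0; exists d => // p pd.
have := dP (toC p) (le_lt_trans (nm_toC p q) pd).
have -> : reC (h (toC p)) - reC (h (toC q)) - (reC L * (p.1 - q.1) + - imC L * (p.2 - q.2)) =
  reC (h (toC p) - h (toC q) - L * (toC p - toC q)).
  by rewrite !toCE !reimE; ring.
move=> K; apply: le_trans (re_le_nm _) _; apply: le_trans K _.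
by rewrite ler_wpM2l ?nm_toC // ltW.
Qed.

(** The bridge from explicit partial derivatives to the [differentiable] and ['D_v] in the
    definition of test functions; the linear map is the differential by uniqueness of first-order
    expansions. *)
Lemma has_grad_diff u q l1 l2 : has_grad u q l1 l2 ->
  differentiable u q /\ forall v, 'D_v u q = l1 * v.1 + l2 * v.2.
Proof.
move=> H; pose L (v : R * R) : R := l1 * v.1 + l2 * v.2.
have Llin : linear L by move=> k a b; rewrite /L /= /GRing.scale /=; ring.
pose LL := GRing.isLinear.Build R (R * R)%type R *%R L Llin.
pose df : {linear (R * R)%type -> R} := HB.pack L LL.
have dfc : continuous df.
  move=> x; apply: cvgD; apply: cvgM; try exact: cvg_cst; [exact: cvg_fst | exact: cvg_snd].
have E : u \o shift q = cst (u q) + df +o_ (0 : (R * R)%type) id.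
  apply/eqaddoP => e e0; have [d d0 dP] := H (e / 2) (half_gt0 e0).
  apply/nbhs_ballP; exists (d / 2); first by rewrite /= divr_gt0.
  move=> v []; rewrite /ball /= !sub0r !normrN => v1 v2.
  have n1 : `|v.1| <= `|v| by rewrite /Num.norm /= le_max lexx.
  have n2 : `|v.2| <= `|v| by rewrite /Num.norm /= le_max lexx orbT.
  have := dP (v + q); rewrite /dist1 /= !addrK => K.
  have -> : (u \o shift q - (cst (u q) + df)) v = u (v + q) - u q - (l1 * v.1 + l2 * v.2).
    by rewrite /= !fctE /=; rewrite /L; ring.
  apply: le_trans (K _) _; first by clear -v1 v2; lra.
  have : e / 2 * (`|v.1| + `|v.2|) <= e / 2 * (`|v| + `|v|) by rewrite ler_wpM2l ?lerD // ltW // divr_gt0.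
  by clear; lra.
have dE := diff_unique dfc E.
have D : differentiable u q.
  by apply/diff_locallyP; rewrite dE; split.
by split => // v; rewrite (deriveE v D) dE.
Qed.

Lemma has_grad_cont u q l1 l2 : has_grad u q l1 l2 -> {for q, continuous u}.
Proof. by move=> /has_grad_diff [D _]; exact: differentiable_continuous. Qed.

Inductive span2 (S : set (R * R -> R)) : (R * R -> R) -> Prop :=
| span2_in u of S u : span2 S u
| span2_add u w of span2 S u & span2 S w : span2 S (fun p => u p + w p)
| span2_scale (k : R) u of span2 S u : span2 S (fun p => k * u p).

(** A directional derivative is a linear combination of the two partial derivatives, so a span
    closed under these contains all iterated derivatives. *)
Lemma smooth2_span S :
  (forall u, S u -> exists u1 u2, [/\ span2 S u1, span2 S u2 & forall q, has_grad u q (u1 q) (u2 q)]) ->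
  forall u, span2 S u -> smooth2 u /\ exists u1 u2, [/\ span2 S u1, span2 S u2 & forall q, has_grad u q (u1 q) (u2 q)].
Proof.
move=> H.
have G u : span2 S u -> exists u1 u2, [/\ span2 S u1, span2 S u2 & forall q, has_grad u q (u1 q) (u2 q)].
  elim=> [f /H //|f g _ [f1 [f2 [F1 F2 F]]] _ [g1 [g2 [G1 G2 G]]]|k f _ [f1 [f2 [F1 F2 F]]]].
    exists (fun p => f1 p + g1 p), (fun p => f2 p + g2 p); split; try exact: span2_add.
    by move=> q; exact: has_gradD.
  exists (fun p => k * f1 p), (fun p => k * f2 p); split; try exact: span2_scale.
  by move=> q; have := has_gradM (has_grad_cst k q) (F q); rewrite !mul0r !add0r.
move=> u Su; split; last exact: G.
move=> vs q; suff Sv : span2 S (Defs.iterD vs u).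
  by have [u1 [u2 [_ _ /(_ q) /has_grad_diff []]]] := G _ Sv.
elim: vs => //= v vs IH; have [u1 [u2 [U1 U2 U]]] := G _ IH.
have -> : 'D_v (Defs.iterD vs u) = (fun p => v.1 * u1 p + v.2 * u2 p).
  by apply/funext => p; have [_ ->] := has_grad_diff (U p); rewrite ![_ * v.1]mulrC ![_ * v.2]mulrC.
by apply: span2_add; exact: span2_scale.
Qed.

Definition zero_off (a b : R) al := forall t, ~~ (a <= t <= b) -> al t = 0.

Lemma zero_off_near a b al t : zero_off a b al -> ~~ (a <= t <= b) ->
  exists2 r : R, 0 < r & forall s, `|s - t| < r -> al s = 0.
Proof.
move=> Z; rewrite negb_and -!ltNge => /orP[h|h].
  exists (a - t); first by rewrite subr_gt0.
  move=> s; rewrite ltr_norml => /andP[_ k]; apply: Z; rewrite negb_and -!ltNge.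
  by apply/orP; left; clear -k; lra.
exists (t - b); first by rewrite subr_gt0.
move=> s; rewrite ltr_norml => /andP[k _]; apply: Z; rewrite negb_and -!ltNge.
by apply/orP; right; clear -k; lra.
Qed.

Lemma zero_off_der a b al al' : zero_off a b al -> (forall t, der al t (al' t)) -> zero_off a b al'.
Proof.
move=> Z D t ht; have [r r0 E] := zero_off_near Z ht.
apply: (der_uniq (D t)); apply: (der_near r0 _ (der_cst 0 t)) => y yt; by rewrite E.
Qed.

(* Multiplying by Re h, h holomorphic, lets the coefficient phi be absorbed in the test function. *)
Definition test_gen a b c d : set (R * R -> R) := fun u => exists h al be,
  [/\ hol h 0 1, smooth1 al /\ zero_off a b al, smooth1 be /\ zero_off c d be &
      u = (fun p => reC (h (toC p)) * (al p.1 * be p.2))].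

Definition box_in_disc (a b c d : R) := forall x y, a <= x <= b -> c <= y <= d -> nm (mkC x y : C) < 1.

Lemma hol0_der h q : hol h 0 1 -> nm (toC q : C) < 1 -> cder h (toC q) (h^`()%classic (toC q)).
Proof. by move=> H K; apply: derivable_cder; apply: H; rewrite subr0. Qed.

(** [h] is holomorphic in the disc only; but around a point outside the box one of the cut-offs
    vanishes identically, so the product has a gradient in the whole plane. *)
Lemma test_gen_fdE a b c d h h' al be al' be' q : box_in_disc a b c d ->
  (forall q, nm (toC q : C) < 1 -> cder h (toC q) (h' (toC q))) ->
  zero_off a b al -> zero_off c d be -> (forall t, der al t (al' t)) -> (forall t, der be t (be' t)) ->
  has_grad (fun p => reC (h (toC p)) * (al p.1 * be p.2)) q
     (reC (h' (toC q)) * (al q.1 * be q.2) + reC (h (toC q)) * (al' q.1 * be q.2))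
     (- imC (h' (toC q)) * (al q.1 * be q.2) + reC (h (toC q)) * (al q.1 * be' q.2)).
Proof.
move=> ID Hh Zal Zbe Dal Dbe.
have Zal' := zero_off_der Zal Dal; have Zbe' := zero_off_der Zbe Dbe.
case: (boolP (a <= q.1 <= b)) => q1; last first.
  rewrite (Zal _ q1) (Zal' _ q1) !mul0r !mulr0 addr0.
  have [r r0 E] := zero_off_near Zal q1.
  apply: (has_grad_near r0 _ (has_grad_cst 0 q)) => p pq.
  by rewrite E ?mul0r ?mulr0 //; exact: le_lt_trans (dist1_fst _ _) pq.
case: (boolP (c <= q.2 <= d)) => q2; last first.
  rewrite (Zbe _ q2) (Zbe' _ q2) !mulr0 addr0.
  have [r r0 E] := zero_off_near Zbe q2.
  apply: (has_grad_near r0 _ (has_grad_cst 0 q)) => p pq.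
  by rewrite E ?mul0r ?mulr0 //; exact: le_lt_trans (dist1_snd _ _) pq.
have := has_gradM (has_grad_re (Hh _ (ID _ _ q1 q2))) (has_gradM (has_grad_fst (Dal q.1)) (has_grad_snd (Dbe q.2))).
by rewrite !mul0r !mulr0 addr0 add0r.
Qed.

Lemma hol_iC h r : hol h 0 r -> hol (fun z => iC * h z) 0 r.
Proof. by move=> H z /H /derivable_cder D; apply: cder_derivable; exact: cderZ D. Qed.

(** By the Cauchy-Riemann equations the partial derivatives of Re h are Re h' and Re(i h'), again
    real parts of holomorphic functions. *)
Lemma test_gen_fd a b c d : box_in_disc a b c d -> forall u, test_gen a b c d u ->
  exists u1 u2, [/\ span2 (test_gen a b c d) u1, span2 (test_gen a b c d) u2 & forall q, has_grad u q (u1 q) (u2 q)].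
Proof.
move=> ID _ [h [al [be [Hh [Sal Zal] [Sbe Zbe] ->]]]].
have [al' Sal' Dal] := smooth1_deriv Sal; have [be' Sbe' Dbe] := smooth1_deriv Sbe.
have Hh' := hol_deriv Hh; have Hih := hol_iC Hh'.
exists (fun p => reC (h^`()%classic (toC p)) * (al p.1 * be p.2) + reC (h (toC p)) * (al' p.1 * be p.2)),
  (fun p => reC (iC * h^`()%classic (toC p)) * (al p.1 * be p.2) + reC (h (toC p)) * (al p.1 * be' p.2)).
have Zal' := zero_off_der Zal Dal; have Zbe' := zero_off_der Zbe Dbe.
split.
- by apply: span2_add; apply: span2_in; [exists h^`()%classic, al, be | exists h, al', be].
- by apply: span2_add; apply: span2_in; [exists (fun z => iC * h^`()%classic z), al, be | exists h, al, be'].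
move=> q; have := test_gen_fdE q ID (fun q => @hol0_der h q Hh) Zal Zbe Dal Dbe.
by have -> : - imC (h^`()%classic (toC q)) = reC (iC * h^`()%classic (toC q)) by rewrite !reimE; ring.
Qed.

Lemma span2_out a b c d u p : span2 (test_gen a b c d) u -> ~~ ((a <= p.1 <= b) && (c <= p.2 <= d)) -> u p = 0.
Proof.
move=> S ; elim: S => [f [h [al [be [_ [_ Za] [_ Zb] ->]]]]|f g _ F _ G|k f _ F] H.
- move: H; rewrite negb_and => /orP[/Za ->|/Zb ->]; by rewrite ?mul0r !mulr0.
- by rewrite F // G // addr0.
- by rewrite F // mulr0.
Qed.

Lemma test_gen_test a b c d u : box_in_disc a b c d -> span2 (test_gen a b c d) u -> test_fun (disc R) u.
Proof.
move=> ID S; have [Sm _] := smooth2_span (test_gen_fd ID) S.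
pose K := (`[a, b]%classic `*` `[c, d]%classic : set (R * R)).
have cK : compact K by apply: compact_setX; exact: segment_compact.
have clK : closed K by apply: compact_closed => //; exact: norm_hausdorff.
have sub : closure [set p | u p != 0] `<=` K.
  rewrite (closure_id K).1 //; apply: closure_subset => p /=; apply: contra_neqP => H.
  apply: (span2_out S); apply/negP => /andP[h k]; apply: H.
  by split => /=; rewrite in_itv.
split => //; split.
  by apply: (subclosed_compact _ cK sub); exact: closed_closure.
move=> p /sub [/=]; rewrite !in_itv /= => h k; rewrite /disc /= ltnm1; exact: ID.
Qed.

Lemma span2_cont a b c d u : box_in_disc a b c d -> span2 (test_gen a b c d) u -> continuous u.
Proof.
by move=> ID S q; have [_ [u1 [u2 [_ _ /(_ q) F]]]] := smooth2_span (test_gen_fd ID) S; exact: has_grad_cont F.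
Qed.

(** The preimage of an open ray is open, hence a countable union of boxes with rational corners, and
    boxes lie in the product sigma-algebra. *)
Lemma cont2_measurable u : continuous u -> measurable_fun setT u.
Proof.
move=> cu; apply: (measurability _ (RGenOInfty.measurableE R)) => //.
move=> _ [_ [x ->] <-]; rewrite setTI.
pose Q := (rat * rat * rat * rat)%type.
pose B (k : Q) : set (R * R) := let: (r1, r2, r3, r4) := k in `]ratr r1, ratr r2[%classic `*` `]ratr r3, ratr r4[%classic.
pose V : set (R * R) := u @^-1` `]x, +oo[%classic.
have VE : V = \bigcup_(k in [set k | B k `<=` V]) B k.
  apply/seteqP; split => [q Vq|q [k /= kV Bk]]; last exact: kV.
  have : \forall p \near q, V p.
    have : \forall t \near u q, x < t by apply: lt_nbhsr; move: Vq; rewrite /V /= in_itv /= andbT.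
    move=> /(cu q); apply: filterS => p /=; by rewrite /V /= in_itv /= andbT.
  move=> [[A1 A2] /= [/nbhs_ballP[e1 /= e10 E1] /nbhs_ballP[e2 /= e20 E2]] AV].
  have [r1 h1] := @rat_in_itvoo R (q.1 - e1) q.1 (ltac:(by rewrite ltrBlDr ltrDl)).
  have [r2 h2] := @rat_in_itvoo R q.1 (q.1 + e1) (ltac:(by rewrite ltrDl)).
  have [r3 h3] := @rat_in_itvoo R (q.2 - e2) q.2 (ltac:(by rewrite ltrBlDr ltrDl)).
  have [r4 h4] := @rat_in_itvoo R q.2 (q.2 + e2) (ltac:(by rewrite ltrDl)).
  move: h1 h2 h3 h4; rewrite !in_itv /= => /andP[a1 a2] /andP[b1 b2] /andP[c1 c2] /andP[d1 d2].
  exists (r1, r2, r3, r4) => /=; last by split; rewrite /= in_itv /= ?a2 ?b1 ?c2 ?d1.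
  move=> p [/=]; rewrite !in_itv /= => /andP[p1 p2] /andP[p3 p4]; apply: AV; split.
    apply: E1; rewrite /ball /= ltr_norml; apply/andP; split; clear -p1 p2 a1 b2; lra.
  apply: E2; rewrite /ball /= ltr_norml; apply/andP; split; clear -p3 p4 c1 d2; lra.
change (measurable V); rewrite VE.
rewrite bigcup_mkcond; apply: countable_bigcupT_measurable; first exact: countableP.
move=> -[[[r1 r2] r3] r4]; case: ifP => // _; apply: measurableX; exact: measurable_itv.
Qed.
End Plane.

(** * Integrals over the plane *)

Section PlaneIntegral.
Variable R : realType.
Local Notation C := (Cs R).
Local Notation mu := (@lebesgue_measure R).
Local Notation L2 := (leb2 R).
Implicit Types (u w : R * R -> R) (p q : R * R) (X Y : R * R -> C).

Definition rplane_int u : R := \int[L2]_p u p.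
Definition rplane_integrable u := L2.-integrable setT (EFin \o u).
Definition plane_integrable X := rplane_integrable (fun p => reC (X p)) /\ rplane_integrable (fun p => imC (X p)).
Definition plane_int X : C := mkC (rplane_int (fun p => reC (X p))) (rplane_int (fun p => imC (X p))).

Lemma rplane_int_eq u w : (forall p, u p = w p) -> rplane_int u = rplane_int w.
Proof. by move=> /funext ->. Qed.

Lemma rplane_integrable_eq u w : (forall p, u p = w p) -> rplane_integrable u -> rplane_integrable w.
Proof. by move=> /funext ->. Qed.

Lemma plane_integrable_eq X Y : (forall p, X p = Y p) -> plane_integrable X -> plane_integrable Y.
Proof. by move=> /funext ->. Qed.

Lemma plane_int_eq X Y : (forall p, X p = Y p) -> plane_int X = plane_int Y.
Proof. by move=> /funext ->. Qed.

Lemma rplane_integrableD u w : rplane_integrable u -> rplane_integrable w -> rplane_integrable (fun p => u p + w p).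
Proof. by move=> H G; have := integrableD (measurableT) H G. Qed.

Lemma rplane_integrableZ (k : R) u : rplane_integrable u -> rplane_integrable (fun p => k * u p).
Proof. by move=> H; have := integrableZl measurableT k H. Qed.

Lemma rplane_intD u w : rplane_integrable u -> rplane_integrable w -> rplane_int (fun p => u p + w p) = rplane_int u + rplane_int w.
Proof. by move=> H G; exact: RintegralD. Qed.

Lemma rplane_intZ k u : rplane_integrable u -> rplane_int (fun p => k * u p) = k * rplane_int u.
Proof. by move=> H; exact: RintegralZl. Qed.

Lemma plane_integrableD X Y : plane_integrable X -> plane_integrable Y -> plane_integrable (fun p => X p + Y p).
Proof.
move=> [x1 x2] [y1 y2]; split.
  by apply: rplane_integrable_eq (rplane_integrableD x1 y1) => p; rewrite reD.
by apply: rplane_integrable_eq (rplane_integrableD x2 y2) => p; rewrite imD.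
Qed.

Lemma plane_intD X Y : plane_integrable X -> plane_integrable Y -> plane_int (fun p => X p + Y p) = plane_int X + plane_int Y.
Proof.
move=> [x1 x2] [y1 y2]; apply: eqC; rewrite /plane_int !reimE.
  by rewrite -rplane_intD //; apply: rplane_int_eq => p; rewrite reD.
by rewrite -rplane_intD //; apply: rplane_int_eq => p; rewrite imD.
Qed.

Lemma plane_integrableZ (k : C) X : plane_integrable X -> plane_integrable (fun p => k * X p).
Proof.
move=> [x1 x2]; split.
  by apply: rplane_integrable_eq (rplane_integrableD (rplane_integrableZ (reC k) x1) (rplane_integrableZ (- imC k) x2)) => p; rewrite reM mulNr.
by apply: rplane_integrable_eq (rplane_integrableD (rplane_integrableZ (reC k) x2) (rplane_integrableZ (imC k) x1)) => p; rewrite imM.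
Qed.

Lemma plane_intZ (k : C) X : plane_integrable X -> plane_int (fun p => k * X p) = k * plane_int X.
Proof.
move=> [x1 x2]; apply: eqC; rewrite /plane_int !reimE.
  rewrite -!rplane_intZ // -mulN1r -rplane_intZ; last exact: rplane_integrableZ.
  rewrite -rplane_intD; [|exact: rplane_integrableZ|by apply: rplane_integrableZ; exact: rplane_integrableZ].
  by apply: rplane_int_eq => p; rewrite reM mulN1r.
rewrite -!rplane_intZ // -rplane_intD; [|exact: rplane_integrableZ|exact: rplane_integrableZ].
by apply: rplane_int_eq => p; rewrite imM.
Qed.

Lemma plane_integrable_cj X : plane_integrable X -> plane_integrable (fun p => cj (X p)).
Proof.
move=> [x1 x2]; split; first by apply: rplane_integrable_eq x1 => p; rewrite re_cj.
by apply: rplane_integrable_eq (rplane_integrableZ (-1) x2) => p; rewrite im_cj mulN1r.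
Qed.

Lemma plane_int_cj X : plane_integrable X -> plane_int (fun p => cj (X p)) = cj (plane_int X).
Proof.
move=> [x1 x2]; apply: eqC; rewrite /plane_int !reimE.
  by apply: rplane_int_eq => p; rewrite re_cj.
by rewrite -mulN1r -rplane_intZ //; apply: rplane_int_eq => p; rewrite im_cj mulN1r.
Qed.

Lemma mu_itv_lty (x y : R) : (mu `[x, y]%classic < +oo)%E.
Proof. by rewrite lebesgue_measure_itv /=; case: ifP => _; rewrite ?ltry // -EFinB ltry. Qed.

Definition box (a b c d : R) : set (R * R) := `[a, b]%classic `*` `[c, d]%classic.

Lemma boxP a b c d p : box a b c d p <-> (a <= p.1 <= b) && (c <= p.2 <= d).
Proof. by rewrite /box /= /setX /= !in_itv /=; split => [[-> ->]|/andP[-> ->]]. Qed.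

Lemma box_compact a b c d : compact (box a b c d).
Proof. by apply: compact_setX; exact: segment_compact. Qed.

Lemma box_measurable a b c d : @measurable _ (measurableTypeR R * measurableTypeR R)%type (box a b c d).
Proof. by apply: measurableX; exact: measurable_itv. Qed.

Lemma box_finite a b c d : (L2 (box a b c d) < +oo)%E.
Proof.
have F (x y : R) : exists r : R, mu `[x, y]%classic = r%:E.
  by rewrite lebesgue_measure_itv /=; case: ifP => _; [exists (y - x) | exists 0].
have E : L2 (box a b c d) = (mu `[a, b]%classic * mu `[c, d]%classic)%E.
  by apply: product_measure1E; exact: measurable_itv.
have [r1 E1] := F a b; have [r2 E2] := F c d.
by rewrite E E1 E2 -EFinM ltry.
Qed.

Definition zero_off_box a b c d u := forall p, ~~ ((a <= p.1 <= b) && (c <= p.2 <= d)) -> u p = 0.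

Lemma zero_off_box_bounded a b c d u : continuous u -> zero_off_box a b c d u -> exists2 B : R, 0 < B & forall p, `|u p| <= B.
Proof.
move=> cu Z.
have : {within box a b c d, continuous u} by exact: continuous_subspaceT.
move=> /continuous_compact /(_ (@box_compact a b c d)) /compact_bounded [M [_ HM]].
exists (`|M| + 1); first by rewrite ltr_pwDr.
move=> p; case: (boolP ((a <= p.1 <= b) && (c <= p.2 <= d))) => [/boxP h|/Z ->]; last by rewrite normr0 addr_ge0.
apply: (HM (`|M| + 1)); first by rewrite (le_lt_trans (ler_norm M)) // ltrDl.
by exists p.
Qed.

Lemma rplane_integrable_box a b c d u : zero_off_box a b c d u -> L2.-integrable (box a b c d) (EFin \o u) -> rplane_integrable u.
Proof.
move=> Z /(@integrable_mkcond _ _ _ L2 (box a b c d) (EFin \o u) (@box_measurable a b c d)).1.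
rewrite /rplane_integrable (_ : (EFin \o u) \_ (box a b c d) = EFin \o u) //.
apply/funext => p; rewrite /patch; case: ifPn => // /negP H /=.
by rewrite Z //; apply/negP => /boxP K; apply: H; rewrite inE.
Qed.

Lemma rplane_integrable_cont a b c d u : continuous u -> zero_off_box a b c d u -> rplane_integrable u.
Proof.
move=> cu Z; apply: (rplane_integrable_box Z); have [B B0 HB] := zero_off_box_bounded cu Z.
apply: measurable_bounded_integrable.
- exact: box_measurable.
- exact: box_finite.
- by apply: (@measurable_funS _ _ _ _ setT) => //; exact: cont2_measurable.
by exists B; split; rewrite ?num_real // => x Bx p _ /=; exact: le_trans (HB p) (ltW Bx).
Qed.

(** With v^2 <= w0 and |u| <= B one has |v u| <= (1 + w0) B, so local square integrability suffices.
    In use [v] is the real or imaginary part of a function and [w0] its squared modulus. *)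
Lemma rplane_integrable_loc (v w0 : R * R -> R) (D : set (R * R)) a b c d u :
  @measurable _ (measurableTypeR R * measurableTypeR R)%type D ->
  measurable_fun D v -> box a b c d `<=` D ->
  (forall p, v p ^+ 2 <= w0 p) -> L2.-integrable (box a b c d) (EFin \o w0) ->
  continuous u -> zero_off_box a b c d u -> rplane_integrable (fun p => v p * u p).
Proof.
move=> mD mv KD vw iw cu Z; have [B B0 HB] := zero_off_box_bounded cu Z.
apply: (@rplane_integrable_box a b c d); first by move=> p /Z ->; rewrite mulr0.
have mK := @box_measurable a b c d.
have i1 : L2.-integrable (box a b c d) (EFin \o (fun=> B)).
  apply: measurable_bounded_integrable => //; first exact: box_finite.
  by exists B; split; rewrite ?num_real // => x Bx p _ /=; rewrite gtr0_norm // ltW.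
have i2 := integrableD mK i1 (integrableZl mK B iw).
apply: (le_integrable mK _ _ i2).
  apply/measurable_EFinP; apply: measurable_funM.
    exact: (measurable_funS mD KD mv).
  by apply: (@measurable_funS _ _ _ _ setT) => //; exact: cont2_measurable.
move=> p Kp; change (`|v p * u p|%:E <= `|B + B * w0 p|%:E)%E; rewrite lee_fin.
have w1 : 0 <= w0 p by apply: le_trans (vw p); exact: sqr_ge0.
rewrite [leRHS]ger0_norm ?addr_ge0 ?mulr_ge0 ?(ltW B0) // normrM.
have -> : B + B * w0 p = (1 + w0 p) * B by ring.
apply: ler_pM => //.
have := vw p; rewrite -[v p ^+ 2]real_normK ?num_real // => H.
have := sqr_ge0 (`|v p| - 1); rewrite expr2 => K.
by have := normr_ge0 (v p); move: H; rewrite expr2; clear -K; nra.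
Qed.

Lemma disc_measurable : @measurable _ (measurableTypeR R * measurableTypeR R)%type (@toC R @^-1` disc R).
Proof.
pose u (p : R * R) : R := p.1 * p.1 + p.2 * p.2.
have cu : continuous u by move=> p; apply: cvgD; apply: cvgM; [exact: cvg_fst|exact: cvg_fst|exact: cvg_snd|exact: cvg_snd].
have := cont2_measurable cu measurableT (measurable_itv `]-oo, (1 : R)[); rewrite setTI.
suff -> : @toC R @^-1` disc R = u @^-1` `]-oo, 1[%classic by [].
apply/seteqP; split => p; rewrite /disc /= ltnm1 in_itv /=.
  move=> h; have : nm (toC p : C) ^+ 2 < 1 by rewrite -(expr1n _ 2) ltr_pXn2r ?nnegrE ?nm_ge0.
  by rewrite nm_sq /u !expr2.
move=> h; have : nm (toC p : C) ^+ 2 < 1 ^+ 2 by rewrite nm_sq /u !expr2 mulr1 in h *.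
by rewrite ltr_pXn2r ?nnegrE ?nm_ge0.
Qed.

Lemma plane_integrable_loc (f : C -> C) a b c d u : L2loc (disc R) f -> box_in_disc a b c d ->
  continuous u -> zero_off_box a b c d u -> plane_integrable (fun p => f (toC p) * rC (u p)).
Proof.
move=> [m1 [m2 H]] ID cu Z.
have KD : box a b c d `<=` @toC R @^-1` disc R.
  by move=> p /boxP /andP[h k]; rewrite /disc /= ltnm1; exact: ID.
have iw := H _ (@box_compact a b c d) KD.
split.
  apply: (rplane_integrable_eq (u := fun p => reC (f (toC p)) * u p)).
    by move=> p; rewrite reM re_rC im_rC mulr0 subr0.
  by apply: (rplane_integrable_loc disc_measurable m1 KD _ iw cu Z) => p; rewrite /reC lerDl sqr_ge0.
apply: (rplane_integrable_eq (u := fun p => imC (f (toC p)) * u p)).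
  by move=> p; rewrite imM re_rC im_rC mulr0 add0r.
by apply: (rplane_integrable_loc disc_measurable m2 KD _ iw cu Z) => p; rewrite /imC lerDr sqr_ge0.
Qed.

Lemma rplane_int_weak (v w0 psi psi' : R * R -> R) :
  (\int[L2]_p ((v p * psi' p)%:E) = - \int[L2]_p ((w0 p * psi p)%:E))%E ->
  rplane_int (fun p => v p * psi' p) = - rplane_int (fun p => w0 p * psi p).
Proof. by move=> H; rewrite /rplane_int /Rintegral H fineN. Qed.

Lemma plane_int_weak (g h : C -> C) a b c d (v : R * R) u u1 u2 : box_in_disc a b c d ->
  weak_deriv (disc R) v g h -> span2 (test_gen a b c d) u ->
  (forall q, has_grad u q (u1 q) (u2 q)) ->
  plane_int (fun p => g (toC p) * rC (u1 p * v.1 + u2 p * v.2)) = - plane_int (fun p => h (toC p) * rC (u p)).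
Proof.
move=> ID W Su F; have T := test_gen_test ID Su; have [W1 W2] := W u T.
have E p : 'D_v u p = u1 p * v.1 + u2 p * v.2 by have [_ ->] := has_grad_diff (F p).
have {}W1 := rplane_int_weak W1; have {}W2 := rplane_int_weak W2.
apply: eqC; rewrite /plane_int !reimE.
  rewrite (rplane_int_eq (w := fun p => reC (g (toC p)) * 'D_v u p)); last first.
    by move=> p; rewrite E reM re_rC im_rC mulr0 subr0.
  rewrite [RHS](_ : _ = - rplane_int (fun p => reC (h (toC p)) * u p)); last first.
    by congr (- _); apply: rplane_int_eq => p; rewrite reM re_rC im_rC mulr0 subr0.
  exact: W1.
rewrite (rplane_int_eq (w := fun p => imC (g (toC p)) * 'D_v u p)); last first.
  by move=> p; rewrite E imM re_rC im_rC mulr0 add0r.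
rewrite [RHS](_ : _ = - rplane_int (fun p => imC (h (toC p)) * u p)); last first.
  by congr (- _); apply: rplane_int_eq => p; rewrite imM re_rC im_rC mulr0 add0r.
exact: W2.
Qed.

Lemma plane_int_ae0 X : plane_integrable X -> {ae L2, forall p, X p = 0} -> plane_int X = 0.
Proof.
move=> [x1 x2] H; apply: eqC; rewrite /plane_int !reimE /rplane_int /Rintegral.
  rewrite (ae_eq_integral (cst 0%E)) ?integral0 //; first exact: measurable_int x1.
  by apply: negligibleS H => p /= K Xp; apply: K => _; rewrite Xp.
rewrite (ae_eq_integral (cst 0%E)) ?integral0 //; first exact: measurable_int x2.
by apply: negligibleS H => p /= K Xp; apply: K => _; rewrite Xp.
Qed.

Lemma int_out a b (u : R -> R) : (forall t, ~~ (a <= t <= b) -> u t = 0) ->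
  mu.-integrable `[a, b]%classic (EFin \o u) ->
  (\int[mu]_t (u t)%:E = (rint a b u)%:E)%E.
Proof.
move=> Z iu; rewrite /rint /Rintegral fineK; last first.
  by apply: integrable_fin_num => //; exact: measurable_itv.
rewrite [RHS]integral_mkcond; apply: eq_integral => t _; rewrite patchE.
case: ifPn => // /negP H; rewrite Z //; apply/negP => K; apply: H.
by rewrite inE /= in_itv.
Qed.

Lemma cont_v u x y : continuous u -> {for x, continuous (fun t => u (t, y))}.
Proof.
move=> cu; have K : (t, y) @[t --> x] --> (x, y).
  move=> P [[A B] /= [hA hB] AB]; apply: (filterS _ hA) => t At; apply: AB; split => //=.
  exact: nbhs_singleton hB.
exact: (cvg_comp _ _ K (cu (x, y))).
Qed.

Lemma integrable_cont a b (u : R -> R) : continuous u -> mu.-integrable `[a, b]%classic (EFin \o u).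
Proof.
move=> cu; apply: continuous_compact_integrable; first exact: segment_compact.
by apply: continuous_subspaceT => x; exact: cu.
Qed.

Lemma rint_out0' a b c d u y : zero_off_box a b c d u -> ~~ (c <= y <= d) -> rint a b (fun x => u (x, y)) = 0.
Proof. by move=> Z h; apply: rint0 => t _; rewrite Z // (negbTE h) andbF. Qed.

Lemma rplane_int_fubini2 a b c d u : continuous u -> zero_off_box a b c d u ->
  mu.-integrable `[c, d]%classic (EFin \o (fun y => rint a b (fun x => u (x, y)))) /\
  rplane_int u = rint c d (fun y => rint a b (fun x => u (x, y))).
Proof.
move=> cu Z; have iu := rplane_integrable_cont cu Z.
have FE y : fubini_G mu (EFin \o u) y = (rint a b (fun x => u (x, y)))%:E.
  rewrite /fubini_G /= (@int_out a b) //; last by apply: integrable_cont => x; exact: cont_v.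
  by move=> t h; rewrite Z // (negbTE h).
have G : mu.-integrable `[c, d]%classic (EFin \o (fun y => rint a b (fun x => u (x, y)))).
  have mF : measurable_fun setT (EFin \o (fun y => rint a b (fun x => u (x, y)))).
    by apply: (eq_measurable_fun _ _ (measurable_fubini_G iu)) => y _; exact: FE.
  apply: measurable_bounded_integrable; [exact: measurable_itv | | |].
  - exact: mu_itv_lty.
  - by apply: (@measurable_funS _ _ _ _ setT) => //; apply/measurable_EFinP.
  have [B B0 HB] := zero_off_box_bounded cu Z.
  exists (B * `|b - a|); split; rewrite ?num_real // => x Bx y _ /=; apply: le_trans (ltW Bx).
  have [ab|ba] := leP a b.
    rewrite [`|b - a|]ger0_norm ?subr_ge0 //; apply: rint_le => //.
    by apply: integrable_cont => z; exact: cont_v.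
  rewrite rint0 ?normr0 ?mulr_ge0 ?(ltW B0) // => t /andP[h1 h2].
  by move: (lt_le_trans ba (le_trans h1 h2)); rewrite ltxx.
split => //; rewrite /rplane_int /Rintegral -[(\int[L2]_p _)%E](integral21_prod_meas1 iu).
transitivity (fine (\int[mu]_y (rint a b (fun x => u (x, y)))%:E)%E).
  by congr fine; apply: eq_integral => y _; exact: FE.
by rewrite (@int_out c d) // => x h; exact: rint_out0' Z h.
Qed.

Definition cont2 X := continuous (fun p => reC (X p)) /\ continuous (fun p => imC (X p)).
Definition czero_off_box a b c d X := forall p, ~~ ((a <= p.1 <= b) && (c <= p.2 <= d)) -> X p = 0.

Lemma czero_off_box_re a b c d X : czero_off_box a b c d X -> zero_off_box a b c d (fun p => reC (X p)).
Proof. by move=> H p /H ->. Qed.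

Lemma czero_off_box_im a b c d X : czero_off_box a b c d X -> zero_off_box a b c d (fun p => imC (X p)).
Proof. by move=> H p /H ->. Qed.

Lemma plane_int_fubini2 a b c d X : cont2 X -> czero_off_box a b c d X ->
  plane_int X = cint c d (fun y => cint a b (fun x => X (x, y))).
Proof.
move=> [h k] Z; apply: eqC; rewrite /plane_int /cint !reimE.
  by have [_ ->] := rplane_int_fubini2 h (czero_off_box_re Z).
by have [_ ->] := rplane_int_fubini2 k (czero_off_box_im Z).
Qed.
End PlaneIntegral.

(** * Weyl's lemma for the Beltrami equation *)

Section CutOff.
Variable R : realType.
Local Notation C := (Cs R).
Implicit Types (u w al be : R -> R) (p q : R * R) (h : R -> C).

Lemma rint_ftc (a b : R) (f f' : R -> R) : a < b -> continuous f' -> (forall x, der f x (f' x)) ->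
  rint a b f' = f b - f a.
Proof.
move=> ab cf D; rewrite /rint /Rintegral (@continuous_FTC2 _ f' f) //.
- exact: continuous_subspaceT.
- split; first by move=> x _; have [] := D x.
    by apply: cvg_at_right_filter; exact: der_cont (D a).
  by apply: cvg_at_left_filter; exact: der_cont (D b).
- by move=> x _; rewrite (@derive1E R R); have [] := D x.
Qed.

(** This is (x - a) / e, written in the affine form of [smooth1_affine] and [der_affine]. *)
Definition sc (a e x : R) := e^-1 * x + (- (a / e)).

Lemma scE a e x : e != 0 -> sc a e x = (x - a) / e.
Proof. by move=> e0; rewrite /sc; field. Qed.

Definition scaled_step (a e x : R) := step (sc a e x).
Definition scaled_bump (a e x : R) := e^-1 * bump (sc a e x).
(** For 0 < e <= b - a this is [step 1] on [a + e, b] and 0 off [a, b + e]. As e tends to 0 it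
    approximates [step 1] times the indicator of [a, b], and its derivative [step 1] times the point
    mass at a minus the one at b. *)
Definition plateau (a b e x : R) := scaled_step a e x - scaled_step b e x.
Definition dplateau (a b e x : R) := scaled_bump a e x - scaled_bump b e x.

Lemma scaled_step_der a e x : der (scaled_step a e) x (scaled_bump a e x).
Proof. exact: der_affine (step_der _). Qed.

Lemma derB (f g : R -> R) x l m : der f x l -> der g x m -> der (fun y => f y - g y) x (l - m).
Proof. by move=> H G; exact: is_deriveB. Qed.

Lemma plateau_der a b e x : der (plateau a b e) x (dplateau a b e x).
Proof. by apply: derB; exact: scaled_step_der. Qed.

Lemma plateau_smooth a b e : smooth1 (plateau a b e).
Proof. by apply: smooth1B; apply: smooth1_affine; exact: smooth1_step. Qed.

Lemma dplateau_smooth a b e : smooth1 (dplateau a b e).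
Proof. by apply: smooth1B; apply: smooth1Z; apply: smooth1_affine; exact: smooth1_bump. Qed.

Lemma smooth1_cont (f : R -> R) : smooth1 f -> continuous f.
Proof. by move=> /smooth1_deriv [f' _ D] x; exact: der_cont (D x). Qed.

Lemma scaled_bump_smooth a e : smooth1 (scaled_bump a e).
Proof. by apply: smooth1Z; apply: smooth1_affine; exact: smooth1_bump. Qed.

Lemma scaled_step_lo a e x : 0 < e -> x <= a -> scaled_step a e x = 0.
Proof.
move=> e0 xa; rewrite /scaled_step scE ?gt_eqF // step_lo //.
by rewrite pmulr_lle0 ?invr_gt0 // subr_le0.
Qed.

Lemma scaled_step_hi a e x : 0 < e -> a + e <= x -> scaled_step a e x = step 1.
Proof.
move=> e0 xa; rewrite /scaled_step scE ?gt_eqF // step_hi //.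
by rewrite ler_pdivlMr // mul1r; lra.
Qed.

Lemma scaled_step_bd a e x : 0 <= scaled_step a e x <= step 1.
Proof. by rewrite /scaled_step step_ge0 step_le. Qed.

Lemma scaled_bump_out a e x : 0 < e -> x <= a \/ a + e <= x -> scaled_bump a e x = 0.
Proof.
move=> e0 H; rewrite /scaled_bump scE ?gt_eqF // bump_out ?mulr0 //.
case: H => H; [left|right]; first by rewrite pmulr_lle0 ?invr_gt0 // subr_le0.
by rewrite ler_pdivlMr // mul1r; lra.
Qed.

Lemma scaled_bump_bd a e x : 0 < e -> 0 <= scaled_bump a e x <= e^-1.
Proof.
move=> e0; have ei : 0 <= e^-1 by rewrite invr_ge0 ltW.
by rewrite mulr_ge0 ?bump_ge0 //= -[leRHS]mulr1 ler_wpM2l // bump_le1.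
Qed.

Lemma plateau_off a0 a b b0 e : 0 < e -> a0 <= a -> a <= b -> b + e <= b0 -> zero_off a0 b0 (plateau a b e).
Proof.
move=> e0 h1 h2 h3 t; rewrite negb_and -!ltNge => /orP[k|k].
  by rewrite /plateau !scaled_step_lo ?subrr //; lra.
by rewrite /plateau !scaled_step_hi ?subrr //; lra.
Qed.

Lemma good_rc a b u : continuous u -> good a b (fun x => rC (u x)).
Proof.
move=> cu; apply: good_cont => t _ e e0.
move/cvgrPdist_lt : (cu t) => /(_ e e0) /nbhs_ballP [d /= d0 dP].
exists d; first exact: d0.
move=> s sd; have : nm (rC (u s - u t)) < e; last by rewrite rCB.
by rewrite nm_rC distrC; apply: dP; rewrite /ball /= distrC.
Qed.

Lemma cint_supp a0 a b b0 h : a0 <= a -> a <= b -> b <= b0 -> good a0 b0 h ->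
  (forall t, t <= a \/ b <= t -> h t = 0) -> cint a0 b0 h = cint a b h.
Proof.
move=> h1 h2 h3 G Z.
rewrite (cint_cat h1 (le_trans h2 h3) G) (cint_cat h2 h3); last by apply: good_sub G.
rewrite (@cint_eq _ a0 a _ (fun=> 0)); last by move=> t /andP[_ k]; apply: Z; left.
rewrite (@cint_eq _ b b0 _ (fun=> 0)); last by move=> t /andP[k _]; apply: Z; right.
by rewrite !cint_cst // !mul0r add0r addr0.
Qed.

Lemma scaled_bump_int a0 b0 a e h : 0 < e -> a0 <= a -> a + e <= b0 -> good a0 b0 h ->
  cint a0 b0 (fun t => rC (scaled_bump a e t) * h t) = cint a (a + e) (fun t => rC (scaled_bump a e t) * h t) .
Proof.
move=> e0 h1 h2 G; apply: cint_supp => //; first by rewrite lerDl ltW.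
  by apply: goodM => //; apply: good_rc; exact: smooth1_cont (scaled_bump_smooth _ _).
by move=> t H; rewrite scaled_bump_out // mul0r.
Qed.

(** An approximate identity: by the fundamental theorem of calculus the mass is [step 1], and all of
    it sits in [a, a + e]. *)
Lemma scaled_bump_lim a0 b0 a h e0 : a0 <= a -> a < b0 -> good a0 b0 h -> rccont h a -> 0 < e0 ->
  exists2 d : R, 0 < d & forall e, 0 < e -> e < d ->
    nm (cint a0 b0 (fun t => rC (scaled_bump a e t) * h t) - rC (step 1) * h a) <= e0.
Proof.
move=> h1 h2 G Hc e00.
have [d d0 dP] := Hc (e0 / 2) (half_gt0 e00).
exists (Num.min d (b0 - a)); first by rewrite lt_min d0 subr_gt0.
move=> e eg; rewrite lt_min => /andP[ed eb].
have ab : a + e <= b0 by lra.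
have aa : a <= a + e by lra.
rewrite (scaled_bump_int eg h1 ab G).
have Gd : good a (a + e) (fun t => rC (scaled_bump a e t)) by apply: good_rc; exact: smooth1_cont (scaled_bump_smooth _ _).
have Gh : good a (a + e) h by apply: good_sub G.
have E : cint a (a + e) (fun t => rC (scaled_bump a e t)) = rC (step 1).
  apply: eqC; rewrite /cint !reimE.
    have -> : rint a (a + e) (fun t => reC (rC (scaled_bump a e t))) = rint a (a + e) (scaled_bump a e) by [].
    rewrite (@rint_ftc _ _ (scaled_step a e)) ?ltrDl //; first by rewrite scaled_step_hi // scaled_step_lo // subr0.
      exact: smooth1_cont (scaled_bump_smooth _ _).
    by move=> x; exact: scaled_step_der.
  by apply: rint0 => t _; rewrite im_rC.
rewrite -E [_ * h a]mulrC -(cintZ _ Gd) -cintB; [|exact: goodM|exact: goodZ].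
apply: (le_trans (@cint_le _ _ _ _ (e^-1 * (e0 / 2)) aa _ _)).
- by apply: goodB; [exact: goodM | exact: goodZ].
- move=> t /andP[t1 t2]; have -> : rC (scaled_bump a e t) * h t - h a * rC (scaled_bump a e t) = rC (scaled_bump a e t) * (h t - h a) by ring.
  rewrite nmM nm_rC; have /andP[k1 k2] := scaled_bump_bd a t eg.
  apply: ler_pM; rewrite ?nm_ge0 ?ger0_norm //; apply/ltW/dP.
  by rewrite ger0_norm ?subr_ge0 //; lra.
rewrite le_eqVlt; apply/orP; left; apply/eqP; field; by rewrite gt_eqF.
Qed.

(** The bound is independent of [e]: it is the majorant when e tends to 0 under a further
    integral. *)
Lemma scaled_bump_bound a0 b0 a e h M : 0 < e -> a0 <= a -> a + e <= b0 -> good a0 b0 h ->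
  (forall t, a0 <= t <= b0 -> nm (h t) <= M) ->
  nm (cint a0 b0 (fun t => rC (scaled_bump a e t) * h t)) <= 2 * M.
Proof.
move=> e0 h1 h2 G HM; rewrite (scaled_bump_int e0 h1 h2 G).
have aa : a <= a + e by rewrite lerDl ltW.
apply: (le_trans (@cint_le _ _ _ _ (e^-1 * M) aa _ _)).
- apply: goodM; last by apply: good_sub G.
  by apply: good_rc; exact: smooth1_cont (scaled_bump_smooth _ _).
- move=> t /andP[t1 t2]; rewrite nmM nm_rC; have /andP[k1 k2] := scaled_bump_bd a t e0.
  apply: ler_pM; rewrite ?nm_ge0 ?ger0_norm // HM //.
  by rewrite (le_trans h1 t1) (le_trans t2 h2).
rewrite le_eqVlt; apply/orP; left; apply/eqP; field; by rewrite gt_eqF.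
Qed.

Lemma dplateau_split a0 b0 a b e h : 0 < e -> good a0 b0 h ->
  cint a0 b0 (fun t => rC (dplateau a b e t) * h t) =
  cint a0 b0 (fun t => rC (scaled_bump a e t) * h t) - cint a0 b0 (fun t => rC (scaled_bump b e t) * h t).
Proof.
move=> e0 G; have D c : good a0 b0 (fun t => rC (scaled_bump c e t) * h t).
  by apply: goodM => //; apply: good_rc; exact: smooth1_cont (scaled_bump_smooth _ _).
rewrite -cintB //; apply: cint_eq => t _; by rewrite rCB mulrBl.
Qed.

Lemma dplateau_lim a0 b0 a b h e0 : a0 <= a -> a <= b -> b < b0 -> good a0 b0 h ->
  rccont h a -> rccont h b -> 0 < e0 ->
  exists2 d : R, 0 < d & forall e, 0 < e -> e < d ->
    nm (cint a0 b0 (fun t => rC (dplateau a b e t) * h t) - rC (step 1) * (h a - h b)) <= e0.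
Proof.
move=> h1 h2 h3 G Ha Hb e00.
have [d1 d10 P1] := scaled_bump_lim h1 (le_lt_trans h2 h3) G Ha (half_gt0 e00).
have [d2 d20 P2] := scaled_bump_lim (le_trans h1 h2) h3 G Hb (half_gt0 e00).
exists (Num.min d1 d2); first by rewrite lt_min d10.
move=> e eg; rewrite lt_min => /andP[/(P1 _ eg) k1 /(P2 _ eg) k2].
rewrite (dplateau_split _ _ eg G) mulrBr.
set x := cint _ _ _ in k1 *; set y := cint _ _ _ in k2 *; set z := _ * h a in k1 *; set w := _ * h b in k2 *.
have -> : x - y - (z - w) = (x - z) - (y - w) by ring.
apply: le_trans (nmB _ _) _; apply: le_trans (lerD k1 k2) _; clear -e00; lra.
Qed.

Lemma plateau_lim a0 b0 a b h e0 : a0 <= a -> a < b -> b < b0 -> good a0 b0 h -> 0 < e0 ->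
  exists2 d : R, 0 < d & forall e, 0 < e -> e < d ->
    nm (cint a0 b0 (fun t => rC (plateau a b e t) * h t) - rC (step 1) * cint a b h) <= e0.
Proof.
move=> h1 h2 h3 G e00; have [_ _ [M HM]] := G.
have s0 := @step1_gt0 R; set s := step 1 in s0 *.
have M0 : 0 <= M by apply: le_trans (HM a _); rewrite ?nm_ge0 // h1 (ltW (lt_trans h2 h3)).
(* [plateau] and s times the indicator of [a, b] differ only on [a, a + e] and [b, b + e], each
   contributing at most 2sMe. *)
have K0 : 0 < 1 + 4 * s * M by rewrite ltr_pwDl // !mulr_ge0 // ltW.
exists (Num.min (Num.min (b - a) (b0 - b)) (e0 / (1 + 4 * s * M))); first by rewrite !lt_min !subr_gt0 h2 h3 divr_gt0.
move=> e eg; rewrite !lt_min ltr_pdivlMr // => /andP[/andP[ea eb] eK].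
have ab : a <= b by exact: ltW.
have aeb : a + e <= b by lra.
have beb : b + e <= b0 by lra.
have aa : a <= a + e by lra.
have bb : b <= b + e by lra.
have Gt : good a0 b0 (fun t => rC (plateau a b e t) * h t).
  by apply: goodM => //; apply: good_rc; exact: smooth1_cont (plateau_smooth _ _ _).
have -> : cint a0 b0 (fun t => rC (plateau a b e t) * h t) = cint a (b + e) (fun t => rC (plateau a b e t) * h t).
  apply: cint_supp => //; first by lra.
  by move=> t [k|k]; rewrite /plateau; [rewrite !scaled_step_lo | rewrite !scaled_step_hi] => //; rewrite ?subrr ?mul0r //; lra.
have Gs x y : a <= x -> y <= b + e -> good x y (fun t => rC (plateau a b e t) * h t).
  by move=> k1 k2; apply: good_sub Gt; lra.
have Gh x y : a <= x -> y <= b + e -> good x y h by move=> k1 k2; apply: good_sub G; lra.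
rewrite (cint_cat ab bb); last by apply: Gs.
rewrite (cint_cat aa aeb); last by apply: Gs => //; lra.
rewrite (@cint_cat _ a (a + e) b h) //; last by apply: Gh => //; lra.
have -> : cint (a + e) b (fun t => rC (plateau a b e t) * h t) = rC s * cint (a + e) b h.
  rewrite -cintZ; last by apply: Gh.
  by apply: cint_eq => t /andP[k1 k2]; rewrite /plateau scaled_step_hi // scaled_step_lo // subr0.
set x := cint a (a + e) (fun t => rC (plateau a b e t) * h t); set w := cint (a + e) b h.
set z := cint b (b + e) _; set v := cint a (a + e) h.
have -> : x + rC s * w + z - rC s * (v + w) = (x - rC s * v) + z by ring.
have T t : `|plateau a b e t| <= s by rewrite /plateau; have /andP[? ?] := scaled_step_bd a e t; have /andP[? ?] := scaled_step_bd b e t; rewrite ler_norml; apply/andP; split; rewrite /s; lra.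
have Bz : nm z <= 2 * (s * M) * e.
  rewrite [X in _ <= _ * X](_ : e = b + e - b); last by ring.
  apply: cint_le => //; first by apply: Gs.
  move=> t /andP[k1 k2]; rewrite nmM nm_rC ler_pM ?nm_ge0 // HM //; apply/andP; split; lra.
have Bx : nm (x - rC s * v) <= 2 * (s * M) * e.
  rewrite [X in _ <= _ * X](_ : e = a + e - a); last by ring.
  rewrite /x /v -cintZ; last by apply: Gh => //; lra.
  rewrite -cintB; [|by apply: Gs => //; lra|by apply: goodZ; apply: Gh => //; lra].
  apply: cint_le => //.
    by apply: goodB; [apply: Gs => //; lra|by apply: goodZ; apply: Gh => //; lra].
  move=> t /andP[k1 k2]; rewrite -mulrBl -rCB nmM nm_rC ler_pM ?nm_ge0 //; last first.
    by rewrite HM //; apply/andP; split; lra.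
  rewrite /plateau (@scaled_step_lo b) //; last by lra.
  have /andP[? ?] := scaled_step_bd a e t; rewrite ler_norml; apply/andP; split; rewrite /s; lra.
apply: le_trans (nmD _ _) _; apply: le_trans (lerD Bx Bz) _.
by clear -eK eg; rewrite mulrDr mulr1 in eK; lra.
Qed.
End CutOff.

(** * Weak gradients and integration by parts against complex test functions *)

Section WeakGradient.
Variable R : realType.
Local Notation C := (Cs R).
Local Notation iC := (iC R).
Local Notation L2 := (leb2 R).
Implicit Types (u w al be : R -> R) (p q : R * R) (G Gx Gy h F : C -> C).

Lemma has_grad_uniq (u : R * R -> R) q l1 l2 m1 m2 : has_grad u q l1 l2 -> has_grad u q m1 m2 -> l1 = m1 /\ l2 = m2.
Proof.
move=> /has_grad_diff [_ H] /has_grad_diff [_ K]; split.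
  by have := H (1, 0); rewrite K /= !mulr1 !mulr0 !addr0 => ->.
by have := H (0, 1); rewrite K /= !mulr1 !mulr0 !add0r => ->.
Qed.

(** What is used of [W12loc_with] on a fixed box: integrability against continuous functions
    supported there, and integration by parts against the span of [test_gen]. *)
Definition weak_grad a b c d G Gx Gy :=
  (forall u : R * R -> R, continuous u -> zero_off_box a b c d u ->
     [/\ plane_integrable (fun p => G (toC p) * rC (u p)), plane_integrable (fun p => Gx (toC p) * rC (u p)) &
         plane_integrable (fun p => Gy (toC p) * rC (u p))]) /\
  (forall u u1 u2 : R * R -> R, span2 (test_gen a b c d) u -> span2 (test_gen a b c d) u1 -> span2 (test_gen a b c d) u2 -> (forall q, has_grad u q (u1 q) (u2 q)) ->
     plane_int (fun p => G (toC p) * rC (u1 p)) = - plane_int (fun p => Gx (toC p) * rC (u p)) /\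
     plane_int (fun p => G (toC p) * rC (u2 p)) = - plane_int (fun p => Gy (toC p) * rC (u p))).

Lemma W12loc_weak_grad a b c d G Gx Gy : box_in_disc a b c d -> W12loc_with (disc R) G Gx Gy -> weak_grad a b c d G Gx Gy.
Proof.
move=> ID [h1 [h2 [h3 [w1 w2]]]]; split.
  by move=> u cu bu; split; apply: plane_integrable_loc ID cu bu.
move=> u u1 u2 Su _ _ Fu; split.
  by rewrite -(plane_int_weak ID w1 Su Fu); apply: plane_int_eq => p; rewrite /= mulr1 mulr0 addr0.
by rewrite -(plane_int_weak ID w2 Su Fu); apply: plane_int_eq => p; rewrite /= mulr1 mulr0 add0r.
Qed.

(** Test functions are real, so conjugation passes through the integrals. *)
Lemma weak_grad_cj a b c d G Gx Gy : box_in_disc a b c d -> weak_grad a b c d G Gx Gy ->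
  weak_grad a b c d (fun z => cj (G z)) (fun z => cj (Gx z)) (fun z => cj (Gy z)).
Proof.
have E (X : C -> C) (u : R * R -> R) p : cj (X (toC p) * rC (u p)) = cj (X (toC p)) * rC (u p).
  by rewrite cjM cj_rC.
move=> ID [H K]; split.
  move=> u cu bu; have [i1 i2 i3] := H u cu bu.
  by split; [move: i1|move: i2|move: i3] => /plane_integrable_cj; apply: plane_integrable_eq => p; rewrite E.
move=> u u1 u2 Su Su1 Su2 Fu; have [k1 k2] := K u u1 u2 Su Su1 Su2 Fu.
have T (X : C -> C) (v : R * R -> R) : plane_integrable (fun p => X (toC p) * rC (v p)) ->
    plane_int (fun p => cj (X (toC p)) * rC (v p)) = cj (plane_int (fun p => X (toC p) * rC (v p))).
  by move=> i; rewrite -plane_int_cj //; apply: plane_int_eq => p; rewrite E.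
have J v (S : span2 (test_gen a b c d) v) := H v (span2_cont ID S) (fun p => @span2_out _ _ _ _ _ _ p S).
have [i1 _ _] := J _ Su1; have [i2 _ _] := J _ Su2; have [_ i3 i4] := J _ Su.
by rewrite !T // k1 k2 !cjN.
Qed.

(** Used with k = i: expanding (d/dx + i d/dy)(u + i v) gives four real functions with the factors
    1, i, i and i^2. *)
Lemma plane_int_lin4 (X1 X2 X3 X4 : R * R -> C) (k : C) : plane_integrable X1 -> plane_integrable X2 -> plane_integrable X3 -> plane_integrable X4 ->
  plane_integrable (fun p => X1 p + k * X2 p + k * X3 p + k * k * X4 p) /\
  plane_int (fun p => X1 p + k * X2 p + k * X3 p + k * k * X4 p) =
  plane_int X1 + k * plane_int X2 + k * plane_int X3 + k * k * plane_int X4.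
Proof.
move=> i1 i2 i3 i4.
have j2 := plane_integrableZ k i2; have j3 := plane_integrableZ k i3; have j4 := plane_integrableZ (k * k) i4.
have j12 := plane_integrableD i1 j2; have j13 := plane_integrableD j12 j3.
split; first exact: plane_integrableD j13 j4.
by rewrite (plane_intD j13 j4) (plane_intD j12 j3) (plane_intD i1 j2) !plane_intZ.
Qed.

Section Test.
Variables (a b c d : R) (al be al' be' : R -> R).
Hypothesis ID : box_in_disc a b c d.
Hypothesis Sal : smooth1 al. Hypothesis Sbe : smooth1 be.
Hypothesis Zal : zero_off a b al. Hypothesis Zbe : zero_off c d be.
Hypothesis Dal : forall t, der al t (al' t). Hypothesis Dbe : forall t, der be t (be' t).

Definition chi p := al p.1 * be p.2.
(** The operator d/dx + i d/dy, twice the dbar-derivative, applied to [chi]. *)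
Definition dchi p : C := rC (al' p.1 * be p.2) + iC * rC (al p.1 * be' p.2).

Let u0 (f : C -> C) p := reC (f (toC p)) * (al p.1 * be p.2).
Let u1 (f f' : C -> C) p := reC (f' (toC p)) * (al p.1 * be p.2) + reC (f (toC p)) * (al' p.1 * be p.2).
Let u2 (f f' : C -> C) p := - imC (f' (toC p)) * (al p.1 * be p.2) + reC (f (toC p)) * (al p.1 * be' p.2).

Lemma test_gen_parts (f f' : C -> C) : hol f 0 1 ->
  (forall q, nm (toC q : C) < 1 -> cder f (toC q) (f' (toC q))) ->
  [/\ span2 (test_gen a b c d) (u0 f), span2 (test_gen a b c d) (u1 f f'), span2 (test_gen a b c d) (u2 f f') &
     forall q, has_grad (u0 f) q (u1 f f' q) (u2 f f' q)].
Proof.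
move=> Hf Df.
have T : test_gen a b c d (u0 f) by exists f, al, be.
have F q : has_grad (u0 f) q (u1 f f' q) (u2 f f' q) := test_gen_fdE q ID Df Zal Zbe Dal Dbe.
have [v1 [v2 [S1 S2 K]]] := test_gen_fd ID T.
have E1 : v1 = u1 f f' by apply/funext => q; have [] := has_grad_uniq (K q) (F q).
have E2 : v2 = u2 f f' by apply/funext => q; have [] := has_grad_uniq (K q) (F q).
by rewrite -E1 -E2; split => //; exact: span2_in.
Qed.

(** Integration by parts against the complex test function h chi, whose real and imaginary parts are
    Re(h) chi and Re(-i h) chi. As [h] is holomorphic, d/dx + i d/dy falls on [chi] alone and no
    derivative of [h] is left. *)
Lemma weak_grad_hol G Gx Gy h : weak_grad a b c d G Gx Gy -> hol h 0 1 ->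
  [/\ plane_integrable (fun p => G (toC p) * (h (toC p) * dchi p)),
      plane_integrable (fun p => (Gx (toC p) + iC * Gy (toC p)) * (h (toC p) * rC (chi p))) &
      plane_int (fun p => G (toC p) * (h (toC p) * dchi p)) =
      - plane_int (fun p => (Gx (toC p) + iC * Gy (toC p)) * (h (toC p) * rC (chi p)))].
Proof.
move=> [WI WD] Hh; set h' := h^`()%classic.
pose k z := - iC * h z; pose k' z := - iC * h' z.
have Hh' q : nm (toC q : C) < 1 -> cder h (toC q) (h' (toC q)) by apply: hol0_der.
have Hk' q : nm (toC q : C) < 1 -> cder k (toC q) (k' (toC q)).
  by move=> /Hh' D; exact: cderZ.
have Hk : hol k 0 1.
  move=> z; rewrite subr0 [z]mkC_eta => zz; apply: cder_derivable.
  exact: (Hk' (reC z, imC z)).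
have [S0 S1 S2 F] := test_gen_parts Hh Hh'; have [T0 T1 T2 K] := test_gen_parts Hk Hk'.
have W (u : R * R -> R) : span2 (test_gen a b c d) u -> [/\ plane_integrable (fun p => G (toC p) * rC (u p)),
    plane_integrable (fun p => Gx (toC p) * rC (u p)) & plane_integrable (fun p => Gy (toC p) * rC (u p))].
  by move=> S; apply: WI; [exact: span2_cont S | move=> p; exact: span2_out].
have [_ i1 i2] := W _ S0; have [_ i3 i4] := W _ T0.
have [j1 _ _] := W _ S1; have [j2 _ _] := W _ T1; have [j3 _ _] := W _ S2; have [j4 _ _] := W _ T2.
have [D1 D3] := WD _ _ _ S0 S1 S2 F; have [D2 D4] := WD _ _ _ T0 T1 T2 K.
have [jj DL] := plane_int_lin4 iC j1 j2 j3 j4.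
have [ii DR] := plane_int_lin4 iC i1 i3 i2 i4.
have EL p : G (toC p) * rC (u1 h h' p) + iC * (G (toC p) * rC (u1 k k' p)) + iC * (G (toC p) * rC (u2 h h' p))
    + iC * iC * (G (toC p) * rC (u2 k k' p)) = G (toC p) * (h (toC p) * dchi p).
  rewrite iC2 /u1 /u2 /k /k' /dchi; move: (G (toC p)) (h (toC p)) (h' (toC p)) => x y z.
  by apply: eqC; rewrite !reimE; ring.
have ER p : Gx (toC p) * rC (u0 h p) + iC * (Gx (toC p) * rC (u0 k p)) + iC * (Gy (toC p) * rC (u0 h p))
    + iC * iC * (Gy (toC p) * rC (u0 k p)) = (Gx (toC p) + iC * Gy (toC p)) * (h (toC p) * rC (chi p)).
  rewrite iC2 /u0 /k /chi; move: (Gx (toC p)) (Gy (toC p)) (h (toC p)) => x y z.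
  by apply: eqC; rewrite !reimE; ring.
split; [exact: plane_integrable_eq jj|exact: plane_integrable_eq ii|].
rewrite -(plane_int_eq EL) -(plane_int_eq ER) DL DR D1 D2 D3 D4; ring.
Qed.

(** The case h = 1 for g and the case h = phi for conj g are added: up to sign the right-hand sides
    give the integral of 2 chi (dbar g + phi conj(dg)), where d and dbar are the two Wirtinger
    derivatives, and the integrand vanishes almost everywhere by the Beltrami equation. *)
Lemma weak_dbar (phi g gx gy : C -> C) : hol phi 0 1 -> W12loc_with (disc R) g gx gy ->
  {ae L2, forall p, disc R (toC p) ->
        (gx (toC p) + 'i * gy (toC p)) / 2%:R
        = - phi (toC p) * conjc ((gx (toC p) - 'i * gy (toC p)) / 2%:R)} ->
  plane_int (fun p => (g (toC p) + phi (toC p) * cj (g (toC p))) * dchi p) = 0.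
Proof.
move=> Hphi W AE; have P := W12loc_weak_grad ID W.
have H1 : hol (fun=> 1 : C) 0 1 by move=> z _; apply: cder_derivable; exact: cder_cst.
have [i1 i2 E1] := weak_grad_hol P H1; have [j1 j2 E2] := weak_grad_hol (weak_grad_cj ID P) Hphi.
rewrite -(@plane_int_eq _ (fun p => g (toC p) * (1 * dchi p) + cj (g (toC p)) * (phi (toC p) * dchi p))); last first.
  by move=> p; ring.
rewrite plane_intD // E1 E2 -opprD -plane_intD // plane_int_ae0 ?oppr0 //; first exact: plane_integrableD.
apply: negligibleS AE => p /= NB Bp; apply: NB; rewrite /chi.
case: (boolP ((a <= p.1 <= b) && (c <= p.2 <= d))) => [/andP[q1 q2]|]; last first.
  by rewrite negb_and => /orP[/Zal ->|/Zbe ->]; rewrite ?mul0r ?mulr0 ?rC0; ring.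
have {}Bp := Bp _; have {}Bp := Bp (etrans (ltnm1 _) (ID q1 q2)).
have -> : gx (toC p) + iC * gy (toC p) = - phi (toC p) * (cj (gx (toC p)) + iC * cj (gy (toC p))).
  have E : (2%:R : C) != 0 by rewrite pnatr_eq0.
  apply: (mulIf (invr_neq0 E)); rewrite [LHS]Bp -/(cj _) cjM cjB cjM cjV.
  have -> : cj 'i = - iC by apply: eqC; rewrite !reimE // oppr0.
  have -> : cj 2%:R = 2%:R :> C by rewrite /cj rmorph_nat.
  ring.
ring.
Qed.
End Test.
End WeakGradient.

(** * Weyl's lemma for continuous functions, by way of Morera's theorem *)

Section WeylLemma.
Variable R : realType.
Local Notation C := (Cs R).
Local Notation iC := (iC R).
Implicit Types (u w al be : R -> R) (p q : R * R) (h F X : C -> C).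

Lemma cont2_ccont X : (forall z, ccont X z) -> cont2 (fun p => X (toC p)).
Proof.
move=> H; split => q.
  apply/(cvgrPdist_lt (FF := nbhs_filter q)) => e e0.
  have [d d0 D] := H (toC q) _ e0.
  have d2 := half_gt0 d0.
  exists (ball q.1 (d / 2), ball q.2 (d / 2)); first by split; exact: nbhsx_ballx.
  move=> p [/= h1 h2]; rewrite distrC -reB; apply: le_lt_trans (re_le_nm _) _; apply: D.
  apply: le_lt_trans (nm_toC _ _) _; rewrite /dist1; move: h1 h2; rewrite /ball /=.
  by rewrite ![`|_ - q.1|]distrC ![`|_ - q.2|]distrC => h1 h2; rewrite [ltRHS]splitr ltrD.
apply/(cvgrPdist_lt (FF := nbhs_filter q)) => e e0.
have [d d0 D] := H (toC q) _ e0.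
have d2 := half_gt0 d0.
exists (ball q.1 (d / 2), ball q.2 (d / 2)); first by split; exact: nbhsx_ballx.
move=> p [/= h1 h2]; rewrite distrC -imB; apply: le_lt_trans (im_le_nm _) _; apply: D.
apply: le_lt_trans (nm_toC _ _) _; rewrite /dist1; move: h1 h2; rewrite /ball /=.
by rewrite ![`|_ - q.1|]distrC ![`|_ - q.2|]distrC => h1 h2; rewrite [ltRHS]splitr ltrD.
Qed.

Lemma rccont_rC u t : continuous u -> rccont (fun x => rC (u x)) t.
Proof.
move=> cu e e0.
move/cvgrPdist_lt : (cu t) => /(_ e e0) /nbhs_ballP [d /= d0 dP].
exists d; first exact: d0.
move=> s sd; have : nm (rC (u s - u t)) < e; last by rewrite rCB.
by rewrite nm_rC distrC; apply: dP; rewrite /ball /= distrC.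
Qed.

Lemma ccont_re u z : continuous u -> ccont (fun z => rC (u (reC z))) z.
Proof.
move=> /(@rccont_rC _ (reC z)) H e /H [d d0 D]; exists d => // w wz; apply: D.
by rewrite -reB; exact: le_lt_trans (re_le_nm _) wz.
Qed.

Lemma ccont_im u z : continuous u -> ccont (fun z => rC (u (imC z))) z.
Proof.
move=> /(@rccont_rC _ (imC z)) H e /H [d d0 D]; exists d => // w wz; apply: D.
by rewrite -imB; exact: le_lt_trans (im_le_nm _) wz.
Qed.

Lemma eq0_small (z : C) : (forall e : R, 0 < e -> nm z <= e) -> z = 0.
Proof.
move=> H; apply/eqP; rewrite -nm_eq0; apply/negPn/negP => n0.
have z0 : 0 < nm z by rewrite lt0r n0 nm_ge0.
by have := H _ (half_gt0 z0); clear -z0; lra.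
Qed.

Section Box.
Variable F : C -> C.
Hypothesis FC : forall z, nm z < 1 -> ccont F z.
Hypothesis FW : forall a b c d al be al' be', box_in_disc a b c d -> smooth1 al -> smooth1 be ->
  zero_off a b al -> zero_off c d be -> (forall t, der al t (al' t)) -> (forall t, der be t (be' t)) ->
  plane_int (fun p => F (toC p) * dchi al be al' be' p) = 0.
Variables a0 b0 c0 d0 : R.
Hypothesis ID : box_in_disc a0 b0 c0 d0.

Let Q u y := cint a0 b0 (fun x => rC (u x) * F (mkC x y)).

Lemma goodx u y : continuous u -> c0 <= y <= d0 -> good a0 b0 (fun x => rC (u x) * F (mkC x y)).
Proof.
move=> cu yy; apply: goodM; first exact: good_rc.
by apply: goodh_cont => x xx; apply: FC; exact: ID.
Qed.

(** A failure of continuity at [y] yields a sequence tending to y along which the increments of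
    [Q u] are at least e, against dominated convergence. *)
Lemma param_cont u y : continuous u -> c0 < y -> y < d0 -> rccont (Q u) y.
Proof.
move=> cu cy yd; have FB : forall x y, a0 <= x <= b0 -> c0 <= y <= d0 -> ccont F (mkC x y).
  by move=> x z xx zz; apply: FC; exact: ID.
have [M HM] := rect_bounded FB.
have [_ _ [M' HM']] := @good_rc R a0 b0 u cu.
have yy : c0 <= y <= d0 by rewrite !ltW.
apply: contrapT => /existsNP [e /not_implyP [e0 NE]].
pose D := Num.min (y - c0) (d0 - y).
have D0 : 0 < D by rewrite lt_min !subr_gt0 cy.
have Dc : D <= y - c0 by rewrite ge_min lexx.
have Dd : D <= d0 - y by rewrite ge_min lexx orbT.
pose tt (n : nat) := D / n.+2%:R.
have tt0 n : 0 < tt n by rewrite divr_gt0.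
have ttD n : tt n < D by rewrite ltr_pdivrMr // -[ltLHS]mulr1 ltr_pM2l // ltr1n.
have ttc : forall e : R, 0 < e -> exists N, forall n, (N <= n)%N -> tt n < e.
  move=> e1 e10; pose N := Num.bound (D / e1); exists N => n Nn.
  rewrite ltr_pdivrMr // mulrC -ltr_pdivrMr //.
  have := archi_boundP (ltW (divr_gt0 D0 e10)); move/lt_le_trans; apply.
  by rewrite ler_nat (leq_trans Nn) // -addn2 leq_addr.
have /choice [s sP] : forall n, exists s, `|s - y| < tt n /\ e <= nm (Q u s - Q u y).
  move=> n; apply: contrapT => K; apply: NE; exists (tt n) => // s sy.
  by rewrite ltNge; apply/negP => es; apply: K; exists s.
have sY n : c0 <= s n <= d0.
  have [h _] := sP n; have := ttD n; move: h; rewrite ltr_norml => /andP[h1 h2] h3.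
  by apply/andP; split; clear -h1 h2 h3 Dc Dd; lra.
pose h n x := rC (u x) * F (mkC x (s n)) - rC (u x) * F (mkC x y).
have [N NP] : exists N : nat, forall n, (N <= n)%N -> nm (cint a0 b0 (h n)) < e.
  apply: (@cint_dct _ a0 b0 h (M' * (M + M))) => //.
  - by move=> n; apply: goodB; exact: goodx.
  - move=> n t tt'; rewrite /h -mulrBr nmM ler_pM ?nm_ge0 ?HM' //.
    by apply: le_trans (nmB _ _) _; rewrite lerD ?HM.
  move=> t tab e1 e10.
  have K0 : 0 < `|M'| + 1 by rewrite ltr_wpDl.
  have [d d00 dP] := FC (ID tab yy) (divr_gt0 e10 K0).
  have [N NP] := ttc _ d00; exists N => n /NP tn.
  rewrite /h -mulrBr nmM; have [sn _] := sP n.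
  have : nm (F (mkC t (s n)) - F (mkC t y)) < e1 / (`|M'| + 1).
    by apply: dP; apply: le_lt_trans (nm_le_box _ _ _ _) _; rewrite subrr normr0 add0r; exact: lt_trans sn tn.
  rewrite ltr_pdivlMr // mulrC; apply: le_lt_trans.
  rewrite ler_wpM2r ?nm_ge0 //; apply: le_trans (HM' _ tab) _.
  by apply: le_trans (ler_norm _) _; rewrite lerDl.
have [_] := sP N; have := NP N (leqnn N); rewrite cintB; try exact: goodx.
by move=> /lt_le_trans H /H; rewrite ltxx.
Qed.

Lemma fubini_weak a b c d al be al' be' : box_in_disc a b c d -> smooth1 al -> smooth1 be ->
  zero_off a b al -> zero_off c d be -> (forall t, der al t (al' t)) -> (forall t, der be t (be' t)) ->
  continuous al' -> continuous be' ->
  cint c d (fun y => cint a b (fun x => F (mkC x y) * dchi al be al' be' (x, y))) = 0.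
Proof.
move=> ID1 Sal Sbe Zal Zbe Dal Dbe cal' cbe'.
have Zal' := zero_off_der Zal Dal; have Zbe' := zero_off_der Zbe Dbe.
have Z : czero_off_box a b c d (fun p => F (toC p) * dchi al be al' be' p).
  move=> p; rewrite negb_and /dchi => /orP[h|h]; last by rewrite (Zbe _ h) (Zbe' _ h) !mulr0 rC0; ring.
  by rewrite (Zal _ h) (Zal' _ h) !mul0r rC0; ring.
rewrite -(FW ID1 Sal Sbe Zal Zbe Dal Dbe) (plane_int_fubini2 _ Z) //.
pose X z := F z * (rC (al' (reC z)) * rC (be (imC z)) + iC * (rC (al (reC z)) * rC (be' (imC z)))).
have XE p : X (toC p) = F (toC p) * dchi al be al' be' p by rewrite /X /dchi !rCM.
suff /cont2_ccont [h1 h2] : forall z, ccont X z.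
  split => q; [move: (h1 q)|move: (h2 q)].
    by rewrite (_ : (fun p => _) = (fun p => reC (F (toC p) * dchi al be al' be' p))) //; apply/funext => p; rewrite XE.
  by rewrite (_ : (fun p => _) = (fun p => imC (F (toC p) * dchi al be al' be' p))) //; apply/funext => p; rewrite XE.
move=> z.
case: (boolP (a <= reC z <= b)) => q1; last first.
  have [r r0 E] := zero_off_near Zal q1; have [r' r0' E'] := zero_off_near Zal' q1.
  apply: (ccont_near (r := Num.min r r') _ _ (ccont_cst 0 z)); first by rewrite lt_min r0.
  move=> w; rewrite lt_min => /andP[wr wr']; rewrite /X E ?E'; last first.
  - by rewrite -reB; exact: le_lt_trans (re_le_nm _) wr.
  - by rewrite -reB; exact: le_lt_trans (re_le_nm _) wr'.
  by rewrite rC0; ring.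
case: (boolP (c <= imC z <= d)) => q2; last first.
  have [r r0 E] := zero_off_near Zbe q2; have [r' r0' E'] := zero_off_near Zbe' q2.
  apply: (ccont_near (r := Num.min r r') _ _ (ccont_cst 0 z)); first by rewrite lt_min r0.
  move=> w; rewrite lt_min => /andP[wr wr']; rewrite /X E ?E'; last first.
  - by rewrite -imB; exact: le_lt_trans (im_le_nm _) wr.
  - by rewrite -imB; exact: le_lt_trans (im_le_nm _) wr'.
  by rewrite rC0; ring.
have cal := smooth1_cont Sal; have cbe := smooth1_cont Sbe.
apply: ccontM; first by apply: FC; rewrite [z]mkC_eta; exact: ID1.
apply: ccontD; first by apply: ccontM; [exact: ccont_re|exact: ccont_im].
apply: ccontM; first exact: ccont_cst.
by apply: ccontM; [exact: ccont_re|exact: ccont_im].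
Qed.

(** The weak equation in the limit where the cut-off in y tends to the indicator of [c, d]: its
    derivative turns into the difference of the values at c and d. The cut-off in x stays smooth. *)
Lemma weak_y al al' c d : smooth1 al -> continuous al' -> zero_off a0 b0 al -> (forall t, der al t (al' t)) ->
  c0 < c -> c < d -> d < d0 ->
  cint c d (Q al') + iC * (Q al c - Q al d) = 0.
Proof.
move=> Sal cal' Zal Dal cc cd dd; have cal := smooth1_cont Sal.
(* Intermediate heights leave room for the right shoulder of the plateau and make the functions
   [Q u] continuous up to the ends of [c1, d1]. *)
pose c1 := (c0 + c) / 2; pose d1 := (d0 + d) / 2.
have h1 : c0 < c1 by rewrite /c1; lra.
have h2 : c1 < c by rewrite /c1; lra.
have h3 : d < d1 by rewrite /d1; lra.
have h4 : d1 < d0 by rewrite /d1; lra.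
have ID1 : box_in_disc a0 b0 c1 d1.
  by move=> x y xx /andP[y1 y2]; apply: ID => //; apply/andP; split; lra.
have rQ u y : continuous u -> c1 <= y <= d1 -> rccont (Q u) y.
  by move=> cu /andP[y1 y2]; apply: param_cont => //; lra.
have gQ u : continuous u -> good c1 d1 (Q u) by move=> cu; apply: good_cont => t tt; exact: rQ.
have s0 := @step1_gt0 R.
suff : rC (step 1) * (cint c d (Q al') + iC * (Q al c - Q al d)) = 0.
  by move=> /eqP; rewrite mulf_eq0 rC_eq0 gt_eqF //= => /eqP.
apply: eq0_small => e e0; have e2 := half_gt0 e0.
have [r r0 P1] := plateau_lim (ltW h2) cd h3 (gQ _ cal') e2.
have [r' r'0 P2] := dplateau_lim (ltW h2) (ltW cd) h3 (gQ _ cal) (rQ al c cal ltac:(by apply/andP; split; lra))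
   (rQ al d cal ltac:(by apply/andP; split; lra)) e2.
pose t := Num.min (Num.min r r') (d1 - d) / 2.
have t0 : 0 < Num.min (Num.min r r') (d1 - d) by rewrite !lt_min r0 r'0 subr_gt0.
have tg : 0 < t by rewrite half_gt0.
have tlt : t < Num.min (Num.min r r') (d1 - d) by rewrite /t; lra.
move: tlt; rewrite !lt_min => /andP[/andP[tr tr'] td].
have {}P1 := P1 t tg tr; have {}P2 := P2 t tg tr'.
have Zb : zero_off c1 d1 (plateau c d t) by apply: plateau_off => //; lra.
have cb := smooth1_cont (plateau_smooth c d t); have cb' := smooth1_cont (dplateau_smooth c d t).
have := fubini_weak ID1 Sal (plateau_smooth c d t) Zal Zb Dal (fun x => plateau_der c d t x) cal' cb'.
rewrite (@cint_eq _ _ _ _ (fun y => rC (plateau c d t y) * Q al' y + iC * (rC (dplateau c d t y) * Q al y))); last first.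
  move=> y /andP[y1 y2]; have yy : c0 <= y <= d0 by apply/andP; split; lra.
  have g1 := goodx cal' yy; have g2 := goodx cal yy.
  rewrite /Q -(cintZ (rC (plateau c d t y)) g1) -(cintZ (rC (dplateau c d t y)) g2) -(cintZ iC (goodZ _ g2)).
  rewrite -cintD; [|exact: goodZ|exact: goodZ (goodZ _ g2)].
  by apply: cint_eq => x _; rewrite /dchi /= !rCM; ring.
have g1 := goodM (good_rc c1 d1 cb) (gQ _ cal'); have g2 := goodM (good_rc c1 d1 cb') (gQ _ cal).
rewrite (cintD g1 (goodZ _ g2)) (cintZ _ g2) => E.
set A := cint c1 d1 _ in P1 E; set B := cint c1 d1 _ in P2 E.
have -> : rC (step 1) * (cint c d (Q al') + iC * (Q al c - Q al d)) =
  - (A - rC (step 1) * cint c d (Q al')) - iC * (B - rC (step 1) * (Q al c - Q al d)).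
  by rewrite -[LHS]subr0 -E; ring.
apply: le_trans (nmB _ _) _; rewrite nmN nmM nm_iC mul1r; apply: le_trans (lerD P1 P2) _.
by lra.
Qed.

(** Now the cut-off in x tends to the indicator of [a, b] as well. Under the integral over y the
    convergence is only pointwise, hence dominated convergence with the majorant from
    [scaled_bump_bound]. The limit of the left-hand side is i [step 1] times the contour
    integral. *)
Lemma weak_rect a b c d : a0 < a -> a < b -> b < b0 -> c0 < c -> c < d -> d < d0 -> rect F a b c d = 0.
Proof.
move=> aa ab bb cc cd dd.
have xa : a0 <= a <= b0 by apply/andP; split; lra.
have xb : a0 <= b <= b0 by apply/andP; split; lra.
have yc : c0 <= c <= d0 by apply/andP; split; lra.
have yd : c0 <= d <= d0 by apply/andP; split; lra.
have FB x y : a0 <= x <= b0 -> c0 <= y <= d0 -> ccont F (mkC x y).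
  by move=> xx zz; apply: FC; exact: ID.
have [M HM] := rect_bounded FB.
have gh y : c0 <= y <= d0 -> goodh F y a0 b0 by move=> yy; apply: goodh_cont => x xx; exact: FB.
have gv x : a0 <= x <= b0 -> goodv F x c d.
  by move=> xx; apply: goodv_cont => y /andP[y1 y2]; apply: FB => //; apply/andP; split; lra.
have ga y : c0 <= y <= d0 -> goodh F y a b by move=> /gh; apply: good_sub; exact: ltW.
have s0 := @step1_gt0 R; pose s := rC (step 1 : R).
have rx x y : a0 <= x <= b0 -> c0 <= y <= d0 -> rccont (fun x => F (mkC x y)) x.
  by move=> xx yy; apply: rccont_h; exact: FB.
pose D := b0 - b; have D0 : 0 < D by rewrite subr_gt0.
pose tt (n : nat) := D / n.+2%:R.
have tt0 n : 0 < tt n by rewrite divr_gt0.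
have ttD n : tt n < D by rewrite ltr_pdivrMr // -[ltLHS]mulr1 ltr_pM2l // ltr1n.
have ttc : forall e : R, 0 < e -> exists N, forall n, (N <= n)%N -> tt n < e.
  move=> e1 e10; pose N := Num.bound (D / e1); exists N => n Nn.
  rewrite ltr_pdivrMr // mulrC -ltr_pdivrMr //.
  have := archi_boundP (ltW (divr_gt0 D0 e10)); move/lt_le_trans; apply.
  by rewrite ler_nat (leq_trans Nn) // -addn2 leq_addr.
pose T n := plateau a b (tt n); pose T' n := dplateau a b (tt n).
have Zt n : zero_off a0 b0 (T n).
  by have := ttD n; rewrite /D => h; apply: plateau_off => //; try exact: ltW; lra.
have cT n : continuous (T n) by exact: smooth1_cont (plateau_smooth _ _ _).
have cT' n : continuous (T' n) by exact: smooth1_cont (dplateau_smooth _ _ _).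
have W n : cint c d (Q (T' n)) + iC * (Q (T n) c - Q (T n) d) = 0.
  by apply: weak_y => //; [exact: plateau_smooth | move=> t; exact: plateau_der].
have gQ u : continuous u -> good c d (Q u).
  by move=> cu; apply: good_cont => t /andP[t1 t2]; apply: param_cont => //; lra.
have gV : good c d (fun y => s * (F (mkC a y) - F (mkC b y))) by apply: goodZ; apply: goodB; exact: gv.
have bQ n y : c <= y <= d -> nm (Q (T' n) y) <= 2 * M + 2 * M.
  move=> /andP[y1 y2]; have yy : c0 <= y <= d0 by apply/andP; split; lra.
  have := ttD n; rewrite /D => h.
  rewrite /Q (dplateau_split _ _ (tt0 n) (gh _ yy)); apply: le_trans (nmB _ _) _; apply: lerD.
    by apply: scaled_bump_bound => //; [exact: ltW|lra|exact: gh|move=> x xx; exact: HM].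
  by apply: scaled_bump_bound => //; [lra|lra|exact: gh|move=> x xx; exact: HM].
have L1 : forall e : R, 0 < e -> exists N : nat, forall n, (N <= n)%N ->
    nm (cint c d (fun y => Q (T' n) y - s * (F (mkC a y) - F (mkC b y)))) < e.
  apply: (@cint_dct _ _ _ _ (2 * M + 2 * M + nm s * (M + M))).
  - by move=> n; apply: goodB => //; exact: gQ.
  - move=> n y yy; apply: le_trans (nmB _ _) _; apply: lerD; first exact: bQ.
    have {}yy : c0 <= y <= d0 by move: yy => /andP[y1 y2]; apply/andP; split; lra.
    by rewrite nmM ler_wpM2l ?nm_ge0 //; apply: le_trans (nmB _ _) _; rewrite lerD ?HM.
  move=> y yy e e0; have {}yy : c0 <= y <= d0 by move: yy => /andP[y1 y2]; apply/andP; split; lra.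
  have [r r0 P] := dplateau_lim (ltW aa) (ltW ab) bb (gh _ yy) (rx a y xa yy) (rx b y xb yy) (half_gt0 e0).
  have [N NP] := ttc _ r0; exists N => n /NP k.
  by apply: le_lt_trans (P _ (tt0 n) k) _; lra.
suff : s * rect F a b c d = 0 by move=> /eqP; rewrite mulf_eq0 rC_eq0 gt_eqF //= => /eqP.
apply: eq0_small => e e0; have e4 : 0 < e / 4 by rewrite divr_gt0.
have [dist1 P1] := L1 _ e4.
have [r2 r20 P2] := plateau_lim (ltW aa) ab bb (gh _ yc) e4.
have [r3 r30 P3] := plateau_lim (ltW aa) ab bb (gh _ yd) e4.
have [N2 Q2] := ttc _ r20; have [N3 Q3] := ttc _ r30.
pose n := maxn dist1 (maxn N2 N3).
have {}P1 := P1 n (leq_maxl _ _).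
have {}P2 := P2 _ (tt0 n) (Q2 n (leq_trans (leq_maxl _ _) (leq_maxr _ _))).
have {}P3 := P3 _ (tt0 n) (Q3 n (leq_trans (leq_maxr _ _) (leq_maxr _ _))).
move: P1; rewrite (cintB (gQ _ (cT' n)) gV) cintZ; last by apply: goodB; exact: gv.
rewrite (cintB (gv _ xa) (gv _ xb)); have := W n.
rewrite /rect (cintB (ga _ yc) (ga _ yd)) (cintB (gv _ xb) (gv _ xa)).
rewrite /Q in P2 P3 *; rewrite /T in P2 P3 *.
set A := cint c d _; set B := cint a0 b0 _ in P2 *; set B' := cint a0 b0 _ in P3 *.
set K1 := cint a b _ in P2 *; set K2 := cint a b _ in P3 *; set J1 := cint c d _; set J2 := cint c d _.
move=> E P1.
have -> : s * (K1 - K2 + iC * (J2 - J1)) = iC * (A - s * (J1 - J2)) - (B - s * K1) + (B' - s * K2).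
  have {}E : iC * A = B - B'.
    have -> : A = - (iC * (B - B')) by apply/eqP; rewrite -addr_eq0 E.
    by rewrite mulrN mulrA iC2 mulN1r opprK.
  transitivity (iC * A - iC * (s * (J1 - J2)) - (B - s * K1) + (B' - s * K2)); last by ring.
  by rewrite E; ring.
apply: le_trans (nmD _ _) _; apply: le_trans (lerD (nmB _ _) (lexx _)) _; rewrite nmM nm_iC mul1r.
by apply: le_trans (lerD (lerD (ltW P1) P2) P3) _; lra.
Qed.

Lemma weak_hol_loc (p : C) (s : R) : 0 < s -> a0 < reC p - s -> reC p + s < b0 -> c0 < imC p - s -> imC p + s < d0 ->
  hol F p s.
Proof.
move=> s0 h1 h2 h3 h4; apply: morera s0 _ _.
  move=> z /andP[/andP[z1 z2] /andP[z3 z4]]; apply: FC; rewrite [z]mkC_eta; apply: ID; apply/andP; split; lra.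
move=> a b c d k1 k2 k3 k4 k5 k6.
(* Degenerate rectangles are outside the scope of [weak_rect]; their integral is 0 because two
   opposite sides coincide and the other two are points. *)
have [ab|] := boolP (a < b); last first.
  rewrite -leNgt => ba; have -> : b = a by apply: le_anti; rewrite ba k2.
  rewrite /rect cint_pt add0r (@cint_eq _ _ _ _ (fun=> 0)) ?cint_cst ?mul0r ?mulr0 //.
  by move=> t _; rewrite subrr.
have [cd|] := boolP (c < d); last first.
  rewrite -leNgt => dc; have -> : d = c by apply: le_anti; rewrite dc k5.
  rewrite /rect cint_pt mulr0 addr0 (@cint_eq _ _ _ _ (fun=> 0)) ?cint_cst ?mul0r //.
  by move=> t _; rewrite subrr.
by apply: weak_rect => //; lra.
Qed.
End Box.

Theorem weyl F : (forall z, nm z < 1 -> ccont F z) ->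
  (forall a b c d al be al' be', box_in_disc a b c d -> smooth1 al -> smooth1 be ->
  zero_off a b al -> zero_off c d be -> (forall t, der al t (al' t)) -> (forall t, der be t (be' t)) ->
  plane_int (fun p => F (toC p) * dchi al be al' be' p) = 0) -> hol F 0 1.
Proof.
move=> FC FW z; rewrite subr0 => z1.
(* The box of half-side 2s stays in the disc since |z| + 4s < 1, and it leaves the margin s that
   [weak_hol_loc] asks for. *)
pose s := (1 - nm z) / 5.
have s0 : 0 < s by rewrite /s; lra.
have ID : box_in_disc (reC z - 2 * s) (reC z + 2 * s) (imC z - 2 * s) (imC z + 2 * s).
  move=> x y xx yy; have -> : mkC x y = z + (mkC x y - z) by ring.
  apply: le_lt_trans (nmD _ _) _; have := nm_le_reim (mkC x y - z); rewrite !reimE.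
  have : `|x - reC z| <= 2 * s by rewrite ler_norml; move: xx => /andP[x1 x2]; apply/andP; split; lra.
  have : `|y - imC z| <= 2 * s by rewrite ler_norml; move: yy => /andP[x1 x2]; apply/andP; split; lra.
  rewrite /s; lra.
have H : hol F z s by apply: (weak_hol_loc FC FW ID) => //; lra.
by apply: H; rewrite subrr nm0.
Qed.

Lemma beltrami_hol (phi g gx gy : C -> C) : hol phi 0 1 -> (forall z, nm z < 1 -> ccont g z) ->
  W12loc_with (disc R) g gx gy ->
  {ae leb2 R, forall p, disc R (toC p) ->
        (gx (toC p) + 'i * gy (toC p)) / 2%:R
        = - phi (toC p) * conjc ((gx (toC p) - 'i * gy (toC p)) / 2%:R)} ->
  hol (fun z => g z + phi z * cj (g z)) 0 1.
Proof.
move=> Hphi gc W AE; apply: weyl.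
  move=> z z1; apply: ccontD; first exact: gc.
  apply: ccontM; last exact: (ccont_comp (gc _ z1) (ccont_cj _)).
  by apply: cder_ccont; apply: derivable_cder; apply: Hphi; rewrite subr0.
move=> a b c d al be al' be' ID Sal Sbe Zal Zbe Dal Dbe.
by apply: (@weak_dbar R a b c d al be al' be' _ _ _ _ _ _ _ phi g gx gy).
Qed.
End WeylLemma.

(** * Reflection across the real axis *)

Section Reflection.
Variable R : realType.
Local Notation C := (Cs R).
Local Notation iC := (iC R).
Implicit Types (f h : C -> C) (z w p : C).

Lemma cj_mk (x y : R) : cj (mkC x y) = mkC x (- y). Proof. by []. Qed.

Lemma hol_cder f p (r : R) z : hol f p r -> nm (z - p) < r -> cder f z (f^`()%classic z).
Proof. by move=> H /H; exact: derivable_cder. Qed.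

Lemma hol_ccont f p (r : R) z : hol f p r -> nm (z - p) < r -> ccont f z.
Proof. by move=> H /(hol_cder H); exact: cder_ccont. Qed.

Lemma hol_le f p (r r' : R) : r' <= r -> hol f p r -> hol f p r'.
Proof. by move=> rr; apply: hol_sub; rewrite subrr nm0 add0r. Qed.

Lemma hol_cst k p (r : R) : hol (fun=> k) p r.
Proof. by move=> z _; apply: cder_derivable; exact: cder_cst. Qed.

Lemma holD f h p (r : R) : hol f p r -> hol h p r -> hol (fun z => f z + h z) p r.
Proof. by move=> F H z zr; apply: cder_derivable; apply: cderD; [exact: hol_cder F zr|exact: hol_cder H zr]. Qed.

Lemma holB f h p (r : R) : hol f p r -> hol h p r -> hol (fun z => f z - h z) p r.
Proof. by move=> F H z zr; apply: cder_derivable; apply: cderB; [exact: hol_cder F zr|exact: hol_cder H zr]. Qed.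

Lemma holM f h p (r : R) : hol f p r -> hol h p r -> hol (fun z => f z * h z) p r.
Proof. by move=> F H z zr; apply: cder_derivable; apply: cderM; [exact: hol_cder F zr|exact: hol_cder H zr]. Qed.

Lemma hol_div f h p (r : R) : (forall z, nm (z - p) < r -> h z != 0) ->
  hol f p r -> hol h p r -> hol (fun z => f z / h z) p r.
Proof.
move=> N F H z zr; apply: cder_derivable; apply: cder_div; first exact: N.
  exact: hol_cder F zr.
exact: hol_cder H zr.
Qed.

(** [f] is put above the axis, the conjugate reflection of [f2] below and the arbitrary value 0 on
    it; the jump hypothesis makes the axis an exceptional line. A separate [f2] serves both
    applications: the partner of phi is 1/phi, that of F is F/phi. *)
Lemma schwarz_reflection f f2 (r M : R) : 0 < r ->
  (forall z, nm z < r -> 0 < imC z -> derivable f z 1) ->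
  (forall z, nm z < r -> 0 < imC z -> derivable f2 z 1) ->
  (forall z, nm z < r -> 0 < imC z -> nm (f z) <= M) ->
  (forall z, nm z < r -> 0 < imC z -> nm (f2 z) <= M) ->
  (forall x : R, `|x| < r -> forall e : R, 0 < e -> exists2 d : R, 0 < d &
     forall z, nm z < r -> nm (z - rC x) < d -> 0 < imC z -> nm (f z - cj (f2 z)) < e) ->
  exists2 r', 0 < r' <= r & exists fh, [/\ hol fh 0 r',
    (forall z, nm z < r' -> 0 < imC z -> fh z = f z) &
    (forall z, nm z < r' -> imC z < 0 -> fh z = cj (f2 (cj z)))].
Proof.
move=> r0 Df Df2 Bf Bf2 J.
pose f0 z : C := if 0 < imC z then f z else if imC z < 0 then cj (f2 (cj z)) else 0.
pose s := r / 3; have s0 : 0 < s by rewrite /s; lra.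
have sq (x y : R) : - s <= x <= s -> - s <= y <= s -> nm (mkC x y) < r.
  move=> hx hy; apply: le_lt_trans (nm_le_reim _) _; rewrite !reimE.
  have : `|x| <= s by rewrite ler_norml.
  have : `|y| <= s by rewrite ler_norml.
  by rewrite /s; lra.
have E : exc_line f0 (reC (0 : C) - s) (reC (0 : C) + s) (imC (0 : C) - s) (imC (0 : C) + s) 0.
  rewrite !reimE !sub0r !add0r; split.
  - move=> x y hx hy y0; have nz := sq _ _ hx hy.
    case: (ltgtP 0 y) => yy; last by rewrite yy eqxx in y0.
      apply: cder_derivable; apply: (cder_near (f := f) (r := y) yy); last first.
        by apply: derivable_cder; apply: Df; rewrite ?reimE.
      move=> w wy; rewrite /f0; have := le_lt_trans (im_le_nm _) wy; rewrite imB im_mk.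
      by rewrite ltr_norml => /andP[k _]; have -> : 0 < imC w by lra.
    have y1 : 0 < - y by rewrite oppr_gt0.
    apply: cder_derivable; apply: (cder_near (f := fun w => cj (f2 (cj w))) (r := - y) y1); last first.
      by apply: cder_cj; apply: derivable_cder; apply: Df2; rewrite ?nm_cj // cj_mk im_mk.
    move=> w wy; rewrite /f0; have := le_lt_trans (im_le_nm _) wy; rewrite imB im_mk.
    rewrite ltr_norml => /andP[_ k]; have k2 : imC w < 0 by lra.
    by rewrite k2 ltNge (ltW k2).
  - exists `|M| => x y hx hy; have nz := sq _ _ hx hy; rewrite /f0 im_mk.
    case: ifP => k1; first by apply: le_trans (Bf _ nz k1) (ler_norm _).
    case: ifP => k2; last by rewrite nm0.
    rewrite nm_cj; apply: le_trans (Bf2 _ _ _) (ler_norm _); first by rewrite nm_cj.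
    by rewrite cj_mk im_mk oppr_gt0.
  move=> x hx e e0; have xr : `|x| < r.
    by apply: (@le_lt_trans _ _ s); [rewrite ler_norml | rewrite /s; lra].
  have [d d0 D] := J x xr e e0; exists (Num.min d (r - `|x|)); first by rewrite lt_min d0 subr_gt0.
  move=> t t0; rewrite lt_min => /andP[td tr].
  have tN : (0 < - t) = false by rewrite oppr_gt0; apply/negbTE; rewrite -leNgt ltW.
  rewrite /f0 !im_mk add0r t0 sub0r tN oppr_lt0 t0 cj_mk opprK.
  apply: D; last by rewrite im_mk.
    apply: le_lt_trans (nm_le_reim _) _; rewrite !reimE (gtr0_norm t0); lra.
  have -> : mkC x t - rC x = iC * rC t by apply: eqC; rewrite !reimE; ring.
  by rewrite nmM nm_iC mul1r nm_rC gtr0_norm.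
have l1 : imC (0 : C) - s < 0 by rewrite im_0 sub0r oppr_lt0.
have l2 : 0 < imC (0 : C) + s by rewrite im_0 add0r.
have [r' /andP[r'0 r's] [fh [H _ Hf]]] := regularity_exc_line s0 l1 l2 E.
exists r'; first by rewrite r'0 /=; move: r's; rewrite /s; lra.
exists fh; split => // z zr zi.
  by rewrite -Hf ?subr0 ?gt_eqF // /f0 zi.
by rewrite -Hf ?subr0 ?lt_eqF // /f0 zi ltNge (ltW zi).
Qed.

Lemma cder_vert f (x t : R) L : cder f (mkC x t) L ->
  der (fun s => reC (f (mkC x s))) t (- imC L) /\ der (fun s => imC (f (mkC x s))) t (reC L).
Proof.
move=> D; split; apply/derP => e /D [d d0 H]; exists d => // s sd.
  have E : mkC x s - mkC x t = iC * rC (s - t) by apply: eqC; rewrite !reimE; ring.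
  have := H (mkC x s); rewrite E nmM nm_iC mul1r nm_rC => /(_ sd); apply: le_trans.
  apply: le_trans _ (re_le_nm _); rewrite !reimE.
  by rewrite le_eqVlt; apply/orP; left; apply/eqP; congr (`|_|); ring.
have E : mkC x s - mkC x t = iC * rC (s - t) by apply: eqC; rewrite !reimE; ring.
have := H (mkC x s); rewrite E nmM nm_iC mul1r nm_rC => /(_ sd); apply: le_trans.
apply: le_trans _ (im_le_nm _); rewrite !reimE.
by rewrite le_eqVlt; apply/orP; left; apply/eqP; congr (`|_|); ring.
Qed.

Lemma mean_value_ineq (u u' : R -> R) (a b e : R) : a < b -> (forall t, a <= t <= b -> der u t (u' t)) ->
  (forall t, a <= t <= b -> `|u' t| <= e) -> `|u b - u a| <= e * (b - a).
Proof.
move=> ab D B.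
have D1 t : t \in `]a, b[%R -> is_derive t (1 : R) u (u' t).
  by rewrite in_itv /= => /andP[h1 h2]; apply: D; rewrite !ltW.
have C1 : {within `[a, b]%classic, continuous u}.
  by apply: continuous_in_subspaceT => t /set_mem /=; rewrite in_itv /= => /D /der_cont.
have [c + ->] := MVT ab D1 C1; rewrite in_itv /= => /andP[c1 c2].
rewrite normrM (gtr0_norm (x := b - a)) ?subr_gt0 //; apply: ler_wpM2r; first by rewrite subr_ge0 ltW.
by apply: B; rewrite !ltW.
Qed.

(** The difference quotient over the chord from [z] to its conjugate; on the axis, where the chord
    degenerates, its limit is the derivative. *)
Definition cjquot f z := if imC z == 0 then f^`()%classic z else (f (cj z) - f z) / (cj z - z).

(** The mean value inequality for f(z) - L z, with L the derivative at the axis point, on the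
    vertical segment between [w] and its conjugate, for real and imaginary parts separately. *)
Lemma cjquot_cont f (x r : R) : 0 < r -> hol f (rC x) r -> ccont (cjquot f) (rC x).
Proof.
move=> r0 H e e0; have H' := hol_deriv H.
have C' : ccont f^`()%classic (rC x) by apply: (hol_ccont H'); rewrite subrr nm0.
set L := f^`()%classic (rC x) in C' *.
have e4 : 0 < e / 4 by rewrite divr_gt0.
have [d d0 D] := C' _ e4; exists (Num.min d r); first by rewrite lt_min d0.
move=> w; rewrite lt_min => /andP[wd wr].
have E0 : cjquot f (rC x) = L by rewrite /cjquot im_rC eqxx.
rewrite E0 /cjquot; case: ifPn => [_|w0]; first by apply: lt_le_trans (D _ wd) _; lra.
(* No point of that segment is farther from the axis point than its end [w]. *)
have K : forall z : C, reC z = reC w -> `|imC z| <= `|imC w| -> nm (z - rC x) < d /\ nm (z - rC x) < r.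
  move=> z zw zi; suff Z : nm (z - rC x) <= nm (w - rC x) by split; exact: le_lt_trans Z _.
  rewrite !nmE !reimE zw ler_sqrt; last by rewrite addr_ge0 ?sqr_ge0.
  rewrite lerD2l !subr0 -[leLHS]real_normK ?num_real // -[leRHS]real_normK ?num_real //.
  by rewrite ler_pXn2r ?nnegrE.
pose k z := f z - L * z.
have Dk z : nm (z - rC x) < r -> cder k z (f^`()%classic z - L).
  by move=> zr; apply: cderB; [exact: hol_cder H zr|rewrite -{2}[L]mulr1; apply: cderZ; exact: cder_id].
have main (y : R) : 0 < y -> (forall t : R, - y <= t <= y -> nm (mkC (reC w) t - rC x) < d /\ nm (mkC (reC w) t - rC x) < r) ->
    nm (k (mkC (reC w) y) - k (mkC (reC w) (- y))) <= (e / 4 + e / 4) * (y + y).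
  move=> y0 Hy; apply: le_trans (nm_le_reim _) _; rewrite mulrDl reB imB.
  have yy : - y < y by lra.
  have yE : y + y = y - (- y) by rewrite opprK.
  apply: lerD; rewrite yE.
    apply: (@mean_value_ineq (fun s => reC (k (mkC (reC w) s))) (fun s => - imC (f^`()%classic (mkC (reC w) s) - L))) => //.
      by move=> t /Hy [_ tr]; have [] := cder_vert (Dk _ tr).
    by move=> t /Hy [td _]; rewrite normrN; apply: le_trans (im_le_nm _) _; exact: ltW (D _ td).
  apply: (@mean_value_ineq (fun s => imC (k (mkC (reC w) s))) (fun s => reC (f^`()%classic (mkC (reC w) s) - L))) => //.
    by move=> t /Hy [_ tr]; have [] := cder_vert (Dk _ tr).
  by move=> t /Hy [td _]; apply: le_trans (re_le_nm _) _; exact: ltW (D _ td).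
have wy : 0 < `|imC w| by rewrite normr_gt0.
have main2 : nm (k (cj w) - k w) <= (e / 4 + e / 4) * (`|imC w| + `|imC w|).
  have := main _ wy _; rewrite [w]mkC_eta cj_mk !reimE.
  have Q : forall t : R, - `|imC w| <= t <= `|imC w| -> nm (mkC (reC w) t - rC x) < d /\ nm (mkC (reC w) t - rC x) < r.
    by move=> t ht; apply: K => //; rewrite im_mk ler_norml.
  move=> /(_ Q); case: (ltgtP 0 (imC w)) => h; last by rewrite -h eqxx in w0.
    by rewrite (gtr0_norm h) nmBC.
  by rewrite (ltr0_norm h) opprK.
have dw : cj w - w = - (2 * iC * rC (imC w)) by apply: eqC; rewrite !reimE; ring.
have dn : nm (cj w - w) = `|imC w| + `|imC w|.
  by rewrite dw nmN !nmM nm_iC nm_rC nm_natr; ring.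
have dw0 : cj w - w != 0 by rewrite -nm_gt0 dn addr_gt0.
have -> : (f (cj w) - f w) / (cj w - w) - L = (k (cj w) - k w) / (cj w - w).
  by rewrite /k; field.
rewrite nmM nmV ltr_pdivrMr ?nm_gt0 // dn; apply: le_lt_trans main2 _.
by rewrite ltr_pM2r ?addr_gt0 //; lra.
Qed.
End Reflection.

(** * Orders of zeros seen from the upper half plane *)

Section Directions.
Variable R : realType.
Local Notation C := (Cs R).
Local Notation iC := (iC R).
Implicit Types (f h u : C -> C) (z w p c : C).

Lemma expiX (t : R) n : expi t ^+ n = expi (t *+ n).
Proof.
elim: n => [|n IH]; first by rewrite expr0 mulr0n /expi cos0 sin0.
by rewrite exprS IH mulrS; apply: eqC; rewrite /expi ?reimE /reC /imC /= ?cosD ?sinD //; ring.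
Qed.

Lemma nm_expi (t : R) : nm (expi t) = 1.
Proof. by rewrite nmE /expi /reC /imC /= cos2Dsin2 sqrtr1. Qed.

Lemma re_expi (t : R) : reC (expi t) = cos t. Proof. by []. Qed.
Lemma im_expi (t : R) : imC (expi t) = sin t. Proof. by []. Qed.

Lemma frac_pi (k n : nat) : (0 < k < n)%N -> 0 < (pi * k%:R / n%:R : R) < pi.
Proof.
move=> /andP[k0 kn]; have n0 : 0 < n%:R :> R by rewrite ltr0n (leq_trans _ kn).
have p0 := pi_gt0 R.
apply/andP; split; first by rewrite divr_gt0 // mulr_gt0 // ltr0n.
by rewrite ltr_pdivrMr // ltr_pM2l // ltr_nat.
Qed.

Lemma upper_root_i n : (0 < n)%N -> exists w : C, [/\ nm w = 1, 0 < imC w & w ^+ n = iC].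
Proof.
move=> n0; have k : (0 < 1 < 2 * n)%N by case: n n0 => // n _; rewrite mulnS.
pose t : R := pi * 1%:R / (2 * n)%:R.
have /sin_gt0_pi s0 : 0 < t < pi by exact: frac_pi.
exists (expi t); split; [exact: nm_expi|exact: s0|].
rewrite expiX (_ : t *+ n = pi / 2); first by rewrite /expi cos_pihalf sin_pihalf.
by rewrite /t -mulr_natr natrM; field; rewrite pnatr_eq0 -lt0n.
Qed.

(** The angle 3 pi / (2n) is below pi from n = 2 on; this is what separates multiple zeros from
    simple ones. *)
Lemma upper_root_Ni n : (1 < n)%N -> exists w : C, [/\ nm w = 1, 0 < imC w & w ^+ n = - iC].
Proof.
move=> n1; have k : (0 < 3 < 2 * n)%N by case: n n1 => [|[|n]] // _; rewrite mulnS mulnS.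
pose t : R := pi * 3%:R / (2 * n)%:R.
have /sin_gt0_pi s0 : 0 < t < pi by exact: frac_pi.
exists (expi t); split; [exact: nm_expi|exact: s0|].
rewrite expiX (_ : t *+ n = pi / 2 + pi); last first.
  by rewrite /t -mulr_natr natrM; field; rewrite pnatr_eq0 -lt0n (ltn_trans _ n1).
by apply: eqC; rewrite !reimE ?re_expi ?im_expi ?cosDpi ?sinDpi ?cos_pihalf ?sin_pihalf ?oppr0.
Qed.

(** The angles are pi / n and 3 pi / n; the second is below pi exactly for n > 3. *)
Lemma upper_roots_N1 n : (3 < n)%N -> exists w1 w2 : C,
  [/\ nm w1 = 1 /\ nm w2 = 1, 0 < imC w1 /\ 0 < imC w2, w1 ^+ n = -1 /\ w2 ^+ n = -1 & w1 != w2].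
Proof.
move=> n3; pose t k : R := pi * k%:R / n%:R.
have n0 : (n%:R : R) != 0 by rewrite pnatr_eq0 -lt0n (ltn_trans _ n3).
have t1 : 0 < t 1%N < pi by apply: frac_pi; rewrite (ltn_trans _ n3).
have t3 : 0 < t 3%N < pi by apply: frac_pi; rewrite n3.
have E k : expi (t k) ^+ n = expi (pi * k%:R).
  by rewrite expiX; congr expi; rewrite /t -mulr_natr; field.
have epi : expi (pi : R) = -1 by apply: eqC; rewrite ?re_expi ?im_expi !reimE ?cospi ?sinpi ?oppr0.
exists (expi (t 1%N)), (expi (t 3%N)); split.
- by rewrite !nm_expi.
- by rewrite !im_expi !sin_gt0_pi.
- rewrite !E mulr1 epi; split => //.
  by rewrite mulr_natr -expiX epi !exprS expr0 mulr1 mulrNN mulr1 mulN1r.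
apply/eqP => /(congr1 (@reC R)); rewrite !re_expi => /cos_inj.
rewrite !in_itv /= => H; have : t 1%N = t 3%N.
  by apply: H; [move: t1|move: t3] => /andP[h1 h2]; rewrite !ltW.
rewrite /t => K.
have : (pi * (3%:R - 1%:R) / n%:R : R) = 0 by rewrite mulrBr mulrBl -K subrr.
move/eqP; rewrite !mulf_eq0 invr_eq0 (negbTE n0) orbF gt_eqF ?pi_gt0 //= => /eqP; lra.
Qed.

(** The quotient u = f / x^n is real for small x > 0, and [u 0] is its limit. *)
Lemma real_coef f u n (r : R) : 0 < r -> ccont u 0 ->
  (forall z, f z = (z - 0) ^+ n * u z) -> (forall x : R, 0 < x -> x < r -> imC (f (rC x)) = 0) -> imC (u 0) = 0.
Proof.
move=> r0 cu E H.
have K (x : R) : 0 < x -> x < r -> imC (u (rC x)) = 0.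
  move=> x0 xr; have := H x x0 xr; rewrite E subr0 -rCX imM re_rC im_rC mul0r addr0 => /eqP.
  by rewrite mulf_eq0 gt_eqF ?exprn_gt0 //= => /eqP.
apply/eqP/negPn/negP => N; have e0 : 0 < `|imC (u 0)| by rewrite normr_gt0.
have [d d0 D] := cu _ e0; pose x := Num.min d r / 2.
have m0 : 0 < Num.min d r by rewrite lt_min d0.
have x0 : 0 < x by rewrite half_gt0.
have : x < Num.min d r by rewrite /x; lra.
rewrite lt_min => /andP[xd xr].
have := D (rC x); rewrite subr0 nm_rC gtr0_norm // => /(_ xd).
move=> /(le_lt_trans (im_le_nm _)); rewrite imB K // sub0r normrN ltxx //.
Qed.

(* A zero of order n >= 2 would map some direction of the upper half plane to the lower one. *)
Lemma simple_zero f (r : R) : 0 < r -> hol f 0 r -> f 0 = 0 ->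
  (forall z, nm z < r -> 0 < imC z -> 0 < imC (f z)) ->
  (forall x : R, 0 < x -> x < r -> imC (f (rC x)) = 0) -> exists2 L, cder f 0 L & L != 0.
Proof.
move=> r0 H f0 P Z.
have [[r' r'0 N]|[n [u [Hu u0 E]]]] := hol_order r0 H.
  have m0 : 0 < Num.min r r' by rewrite lt_min r0.
  have : Num.min r r' / 2 < Num.min r r' by lra.
  set t := _ / 2 => tm; have t0 : 0 < t by rewrite half_gt0.
  have nt : nm (iC * rC t) = t by rewrite nmM nm_iC mul1r nm_rC gtr0_norm.
  move: tm; rewrite lt_min => /andP[tr tr'].
  have i0 : 0 < imC (iC * rC t) by rewrite !reimE; lra.
  have := P (iC * rC t); rewrite nt => /(_ tr i0); rewrite N ?subr0 ?nt //.
  by rewrite im_0 ltxx.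
have cu : ccont u 0 by apply: (hol_ccont Hu); rewrite subrr nm0.
have Iu := real_coef r0 cu E Z.
case: n E => [|[|n]] E.
- by move: f0; rewrite E expr0 mul1r => /eqP; rewrite (negbTE u0).
- exists (u 0) => //; apply: (cder_near (f := fun z => z * u z) ltr01).
    by move=> w _; rewrite E subr0 expr1.
  have n0 : nm (0 - 0 : C) < r by rewrite subrr nm0.
  have := cderM (cder_id 0) (hol_cder Hu n0).
  by rewrite mul1r mul0r addr0.
have c0 : reC (u 0) != 0.
  by apply: contra u0 => /eqP h; apply/eqP; apply: eqC; rewrite ?re_0 ?im_0.
(* The sign of the real number [u 0] decides between w^n = i and w^n = -i. For small t > 0 the point
   tw is above the axis, and f(tw) would be below it. *)
have [w [w1 wi wn]] : exists w : C, [/\ nm w = 1, 0 < imC w & imC (w ^+ n.+2 * u 0) = - `|reC (u 0)|].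
  case: (ltgtP (reC (u 0)) 0) => h; last by rewrite h eqxx in c0.
    have [|w [h1 h2 h3]] := @upper_root_i n.+2; first by [].
    exists w; split => //; rewrite h3 !reimE ltr0_norm //; ring.
  have [|w [h1 h2 h3]] := @upper_root_Ni n.+2; first by [].
  exists w; split => //; rewrite h3 !reimE gtr0_norm //; ring.
have a0 : 0 < `|reC (u 0)| by rewrite normr_gt0.
have [d d0 D] := cu _ a0; pose t := Num.min d r / 2.
have m0 : 0 < Num.min d r by rewrite lt_min d0.
have t0 : 0 < t by rewrite half_gt0.
have : t < Num.min d r by rewrite /t; lra.
rewrite lt_min => /andP[td tr].
have nt : nm (rC t * w) = t by rewrite nmM w1 mulr1 nm_rC gtr0_norm.
have := P (rC t * w); rewrite nt => /(_ tr); rewrite imM re_rC im_rC mul0r addr0 pmulr_rgt0 // => /(_ wi).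
rewrite E subr0 exprMn -rCX -mulrA imM re_rC im_rC mul0r addr0 pmulr_rgt0 ?exprn_gt0 // => Pos.
have := D (rC t * w); rewrite subr0 nt => /(_ td) B.
have : nm (w ^+ n.+2 * u (rC t * w) - w ^+ n.+2 * u 0) < `|reC (u 0)|.
  by rewrite -mulrBr [nm (_ * _)]nmM nmX w1 expr1n mul1r.
move=> /(le_lt_trans (im_le_nm _)); rewrite imB wn opprK ltr_norml => /andP[_ k]; lra.
Qed.

(** W -> i (1 - W) / (1 + W) sends the unit disc to the upper half plane and the circle to the real
    line; the formula shows both at once. *)
Lemma cayley_im W : 1 + W != 0 ->
  imC (iC * ((1 - W) / (1 + W))) = (1 - nm W ^+ 2) / nm (1 + W) ^+ 2.
Proof.
move=> N; have K : nm (1 + W) ^+ 2 != 0 by rewrite expf_neq0 // nm_eq0.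
have -> : (1 - W) / (1 + W) = rC (nm (1 + W) ^+ 2)^-1 * ((1 - W) * cj (1 + W)).
  apply: (mulIf N); rewrite divfK // -!mulrA [cj _ * _]mulrC mulcj mulrCA -rCM mulVf // rC1 mulr1 //.
have -> : forall (k : R) X, imC (iC * (rC k * X)) = k * reC X by move=> k X; rewrite !reimE; ring.
by rewrite mulrC; congr (_ / _); rewrite nm_sq !reimE; ring.
Qed.

(* If |P| < 1 above the axis and |P| = 1 on it, then i(1-W)/(1+W), W = P/P(0), maps the
   upper half plane into itself near 0, so it has a simple zero. *)
Lemma boundary_deriv (P : C -> C) (r : R) : 0 < r -> hol P 0 r ->
  (forall z, nm z < r -> 0 < imC z -> nm (P z) < 1) ->
  (forall x : R, `|x| < r -> nm (P (rC x)) = 1) -> P^`()%classic 0 != 0.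
Proof.
move=> r0 HP Pin Pon; apply/eqP => P'0.
have n0 : nm (0 - 0 : C) < r by rewrite subrr nm0.
have c1 : nm (P 0) = 1 by rewrite -[0 : C]/(rC 0) Pon // normr0.
have c0 : P 0 != 0 by rewrite -nm_gt0 c1.
pose W z := P z / P 0; have nW z : nm (W z) = nm (P z) by rewrite nmM nmV c1 invr1 mulr1.
have W0 : W 0 = 1 by rewrite /W mulfV.
have HW : hol W 0 r by exact: (@hol_div R P (fun=> P 0) 0 r (fun _ _ => c0) HP (@hol_cst R (P 0) 0 r)).
have cW : ccont (fun z => 1 + W z) 0 by apply: ccontD; [exact: ccont_cst|exact: hol_ccont HW n0].
have [d d0 D] : exists2 d : R, 0 < d & forall w, nm (w - 0) < d -> 1 + W w != 0.
  by apply: ccont_neq0 => //; rewrite W0 -mulr2n pnatr_eq0.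
pose s := Num.min r d; have s0 : 0 < s by rewrite lt_min r0.
have sr : s <= r by rewrite ge_min lexx.
have sd z : nm z < s -> nm z < r /\ 1 + W z != 0.
  by rewrite lt_min => /andP[h1 h2]; split => //; apply: D; rewrite subr0.
pose Psi z := iC * ((1 - W z) / (1 + W z)).
have HPsi : hol Psi 0 s.
  apply: holM; first exact: hol_cst.
  apply: hol_div; first by move=> z; rewrite subr0 => /sd [].
    by apply: holB; [exact: hol_cst|exact: hol_le HW].
  by apply: holD; [exact: hol_cst|exact: hol_le HW].
have P0 : Psi 0 = 0 by rewrite /Psi W0 subrr mul0r mulr0.
have P1 z : nm z < s -> 0 < imC z -> 0 < imC (Psi z).
  move=> zs zi; have [zr N] := sd _ zs; rewrite /Psi cayley_im // divr_gt0 ?exprn_gt0 ?nm_gt0 //.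
  by rewrite subr_gt0 nW expr_lt1 ?nm_ge0 //; exact: Pin.
have P2 (x : R) : 0 < x -> x < s -> imC (Psi (rC x)) = 0.
  move=> x0 xs; have xs' : nm (rC x : C) < s by rewrite nm_rC gtr0_norm.
  have [zr N] := sd _ xs'; rewrite /Psi cayley_im // nW Pon; first by rewrite expr1n subrr mul0r.
  by rewrite -nm_rC.
have [L DL L0] := simple_zero s0 HPsi P0 P1 P2.
have DP := hol_cder HP n0; rewrite P'0 in DP.
have DW : cder W 0 0.
  by have := cder_div c0 DP (cder_cst (P 0) 0); rewrite mul0r mulr0 subrr mul0r.
have D1 : cder (fun z => 1 - W z) 0 0 by have := cderB (cder_cst 1 0) DW; rewrite subrr.
have D2 : cder (fun z => 1 + W z) 0 0 by have := cderD (cder_cst 1 0) DW; rewrite addr0.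
have N0 : 1 + W 0 != 0 by apply: D; rewrite subrr nm0.
have := cderZ iC (@cder_div R (fun z => 1 - W z) (fun z => 1 + W z) 0 0 0 N0 D1 D2); rewrite mul0r mulr0 subrr mul0r mulr0 => /(cder_uniq DL) h.
by rewrite h eqxx in L0.
Qed.

Lemma dquot_diag f p : dquot f p p = f^`()%classic p.
Proof. by rewrite /dquot eqxx. Qed.

(** [dquot] at 0 divides by z within the holomorphic functions; the hypothesis on k'' enters through
    k''(0) = 2 k1'(0). *)
Lemma vanish3 k (r : R) : 0 < r -> hol k 0 r -> k 0 = 0 -> k^`()%classic 0 = 0 ->
  k^`()%classic^`()%classic 0 = 0 -> exists2 k3, hol k3 0 r & forall z, k z = z ^+ 3 * k3 z.
Proof.
move=> r0 H z0 z1 z2; have n0 : nm (0 - 0 : C) < r by rewrite subrr nm0.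
pose k1 := dquot k 0; have H1 : hol k1 0 r := hol_dquot H.
have E1 z : k z = z * k1 z by rewrite (dquotE k 0 z) z0 add0r subr0.
have k10 : k1 0 = 0 by rewrite /k1 dquot_diag z1.
have D1 z : nm (z - 0) < r -> k^`()%classic z = k1 z + z * k1^`()%classic z.
  move=> zr; apply: cder_val; apply: (cder_near (f := fun z => z * k1 z) ltr01); first by move=> w _; rewrite E1.
  by have := cderM (cder_id z) (hol_cder H1 zr); rewrite mul1r.
have H1' := hol_deriv H1.
have k1'0 : k1^`()%classic 0 = 0.
  have : k^`()%classic^`()%classic 0 = k1^`()%classic 0 + k1^`()%classic 0.
    apply: cder_val; apply: (cder_near (f := fun z => k1 z + z * k1^`()%classic z) r0).
      by move=> w wr; rewrite D1.
    have := cderD (hol_cder H1 n0) (cderM (cder_id 0) (hol_cder H1' n0)).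
    by rewrite mul1r mul0r addr0.
  by rewrite z2 -mulr2n => /esym/eqP; rewrite mulrn_eq0 => /eqP.
pose k2 := dquot k1 0; have H2 : hol k2 0 r := hol_dquot H1.
have E2 z : k1 z = z * k2 z by rewrite (dquotE k1 0 z) k10 add0r subr0.
have k20 : k2 0 = 0 by rewrite /k2 dquot_diag k1'0.
exists (dquot k2 0); first exact: hol_dquot.
by move=> z; rewrite E1 E2 {1}(dquotE k2 0 z) k20 add0r subr0 !exprS expr0; ring.
Qed.

(** Suppose f = z^n u with 1 <= n <= 3 and u(0) nonzero. Then z^(n-1) (n u + z u') = f' = z^3 P k3;
    dividing by z^(n-1) leaves a positive power of z on the right, so n u(0) = 0, a
    contradiction. *)
Lemma order_ge4 f (P k : C -> C) (r : R) : 0 < r -> hol f 0 r -> f 0 = 0 -> hol P 0 r -> hol k 0 r ->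
  (forall z, nm z < r -> f^`()%classic z = P z * k z) ->
  k 0 = 0 -> k^`()%classic 0 = 0 -> k^`()%classic^`()%classic 0 = 0 ->
  (exists2 r', 0 < r' & forall z, nm z < r' -> f z = 0) \/
  exists n u, [/\ (3 < n)%N, hol u 0 r, u 0 != 0 & forall z, f z = z ^+ n * u z].
Proof.
move=> r0 Hf f0 HP Hk E z0 z1 z2; have n0 : nm (0 - 0 : C) < r by rewrite subrr nm0.
have [[r' r'0 N]|[n [u [Hu u0 Eu]]]] := hol_order r0 Hf.
  by left; exists r' => // z zr; apply: N; rewrite subr0.
right; exists n, u; split => //; last by move=> z; rewrite Eu subr0.
have {}Eu z : f z = z ^+ n * u z by rewrite Eu subr0.
have [k3 H3 E3] := vanish3 r0 Hk z0 z1 z2.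
rewrite ltnNge; apply/negP => n3.
case: n n3 Eu => [|m] m3 Eu.
  by move: f0; rewrite Eu expr0 mul1r => /eqP; rewrite (negbTE u0).
have Hu' := hol_deriv Hu.
pose v z := m.+1%:R * u z + z * u^`()%classic z.
pose q z := z ^+ (3 - m) * (P z * k3 z).
have Dv z : nm z < r -> z ^+ m * v z = P z * (z ^+ 3 * k3 z).
  move=> zr; have zr0 : nm (z - 0) < r by rewrite subr0.
  rewrite -E3 -E //; apply: esym; apply: cder_val.
  apply: (cder_near (f := fun z => z ^+ m.+1 * u z) ltr01); first by move=> w _; rewrite Eu.
  have := cderM (cderX m.+1 (cder_id z)) (hol_cder Hu zr0).
  by rewrite /v /= mulr1 exprS (_ : _ + _ = z ^+ m * (m.+1%:R * u z + z * u^`()%classic z)) //; ring.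
have cv : ccont v 0.
  apply: ccontD; apply: ccontM.
  - exact: ccont_cst.
  - exact: hol_ccont Hu n0.
  - exact: ccont_id.
  - exact: hol_ccont Hu' n0.
have cq : ccont q 0.
  apply: ccontM; first exact: cder_ccont (cderX _ (cder_id _)).
  by apply: ccontM; [exact: hol_ccont HP n0|exact: hol_ccont H3 n0].
have : v 0 = q 0.
  apply: (ccont_offline (y0 := 0) r0 cv cq) => w; rewrite subr0 => wr wi.
  have w0 : w != 0 by apply: contraNneq wi => ->; rewrite im_0.
  apply: (mulfI (expf_neq0 m w0)); rewrite Dv // /q [RHS]mulrA -exprD subnKC; last by move: m3; rewrite ltnS; exact: leqW.
  by ring.
have m2 : (3 - m = (2 - m).+1)%N by rewrite subSn.
rewrite /v /q m2 exprS !mul0r addr0 => /eqP.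
by rewrite mulf_eq0 (negbTE u0) orbF pnatr_eq0.
Qed.

(* f behaves like c z^n, and z^n = -1 has two solutions in the upper half plane when n >= 4. *)
Lemma not_injective4 f u n (r : R) : (3 < n)%N -> 0 < r -> hol u 0 r -> u 0 != 0 -> imC (u 0) = 0 ->
  (forall z, f z = z ^+ n * u z) -> exists z1 z2, [/\ z1 != z2, nm z1 < r /\ 0 < imC z1,
     nm z2 < r /\ 0 < imC z2, f z1 = f z2 & imC (f z1) = 0].
Proof.
move=> n3 r0 Hu u0 Iu E; have n0 : nm (0 - 0 : C) < r by rewrite subrr nm0.
have [w1 [w2 [[m1 m2] [i1 i2] [e1 e2] w12]]] := upper_roots_N1 n3.
pose G w : C := w ^+ n + 1.
have DG w : cder G w (n%:R * w ^+ n.-1).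
  by have := cderD (cderX n (cder_id w)) (cder_cst 1 w); rewrite addr0 mulr1.
have nn : (n%:R : C) != 0 by rewrite pnatr_eq0 -lt0n (ltn_trans _ n3).
have L0 w : nm w = 1 -> n%:R * w ^+ n.-1 != 0.
  by move=> w1'; rewrite mulf_neq0 // expf_neq0 // -nm_gt0 w1'.
have G1 : G w1 = 0 by rewrite /G e1 addNr.
have G2 : G w2 = 0 by rewrite /G e2 addNr.
(* The zeros to be found lie within 2s < 2 dl of [w1] and [w2]: a quarter of the distance keeps them
   apart, and the imaginary parts keep them above the axis. *)
pose dl := Num.min (Num.min (imC w1) (imC w2)) (nm (w1 - w2) / 4).
have dl0 : 0 < dl by rewrite !lt_min i1 i2 divr_gt0 // nm_gt0 subr_eq0.
have dl1 : dl <= imC w1 by rewrite !ge_min lexx.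
have dl2 : dl <= imC w2 by rewrite !ge_min lexx !orbT.
have dl3 : dl <= nm (w1 - w2) / 4 by rewrite !ge_min lexx !orbT.
have dl4 : dl <= 1 by apply: le_trans dl1 _; rewrite -m1; apply: le_trans (im_le_nm _); exact: ler_norm.
have [s1 [t1 [s10 s1d t10 Z1]]] := zero_near (DG w1) (L0 _ m1) G1 dl0.
have [s2 [t2 [s20 s2d t20 Z2]]] := zero_near (DG w2) (L0 _ m2) G2 dl0.
pose et := Num.min t1 t2; have et0 : 0 < et by rewrite lt_min t10.
(* On both squares |z| <= 3, which gives the factor 3^n in the bound for H - G. *)
have K0 : 0 < 3 ^+ n :> R by rewrite exprn_gt0.
have nc : 0 < nm (u 0) by rewrite nm_gt0.
have ee : 0 < et * nm (u 0) / 3 ^+ n by rewrite divr_gt0 // mulr_gt0.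
have [d d0 D] := hol_ccont Hu n0 ee.
pose t := Num.min d r / 4.
have md : 0 < Num.min d r by rewrite lt_min d0.
have t0 : 0 < t by rewrite divr_gt0.
have t3 : 3 * t < Num.min d r by rewrite /t; lra.
move: t3; rewrite lt_min => /andP[td tr].
have near w s z : nm w = 1 -> 0 < s -> s < dl -> insq w s z -> nm z <= 3.
  move=> w1' s0 sd /insqP h; have -> : z = w + (z - w) by ring.
  by apply: le_trans (nmD _ _) _; rewrite w1'; lra.
have nt z : nm z <= 3 -> nm (rC t * z) < d /\ nm (rC t * z) < r.
  move=> z3; rewrite nmM nm_rC gtr0_norm //; have : t * nm z <= t * 3 by rewrite ler_pM2l.
  by move=> h; split; lra.
(* f(tw) = t^n u(0) (H(w) - 1), so at a zero of [H] the function f takes the real value -t^n u(0).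
   For small t, [H] is close to [G]. *)
pose H w := w ^+ n * (u (rC t * w) / u 0) + 1.
have DH z : nm z <= 3 -> derivable H z 1.
  move=> /nt [_ zr]; apply: cder_derivable.
  have Du : cder (fun w => u (rC t * w)) z (u^`()%classic (rC t * z) * rC t).
    have D1 : cder (fun w => rC t * w) z (rC t) by have := cderZ (rC t) (cder_id z); rewrite mulr1.
    by apply: (cder_comp D1); apply: (hol_cder Hu); rewrite subr0.
  exact: cderD (cderM (cderX n (cder_id z)) (cder_div u0 Du (cder_cst (u 0) z))) (cder_cst 1 z).
have BH z : nm z <= 3 -> nm (H z - G z) <= et.
  move=> z3; have [zd _] := nt _ z3.
  have -> : H z - G z = z ^+ n * ((u (rC t * z) - u 0) / u 0) by rewrite /H /G; field.
  rewrite [nm (_ * _)]nmM nmX [nm (_ / _)]nmM nmV.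
  have k1 : nm z ^+ n <= 3 ^+ n by rewrite lerXn2r ?nnegrE ?nm_ge0.
  have k2 : nm (u (rC t * z) - u 0) / nm (u 0) <= et / 3 ^+ n.
    rewrite ler_pdivrMr // mulrAC; apply: ltW; apply: D; by rewrite subr0.
  apply: le_trans (ler_pM _ _ k1 k2) _; rewrite ?exprn_ge0 ?nm_ge0 ?divr_ge0 ?nm_ge0 //.
  by rewrite mulrCA mulfV ?mulr1 // gt_eqF.
have e1t : et <= t1 by rewrite ge_min lexx.
have e2t : et <= t2 by rewrite ge_min lexx orbT.
have [||a a1 Ha] := Z1 H.
- by move=> z /(near _ _ _ m1 s10 s1d); exact: DH.
- by move=> z /(near _ _ _ m1 s10 s1d) /BH h; exact: le_trans h e1t.
have [||b b2 Hb] := Z2 H.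
- by move=> z /(near _ _ _ m2 s20 s2d); exact: DH.
- by move=> z /(near _ _ _ m2 s20 s2d) /BH h; exact: le_trans h e2t.
have fH z : H z = 0 -> f (rC t * z) = - (rC (t ^+ n) * u 0).
  move=> Hz; rewrite E exprMn -rCX -mulrA.
  have -> : z ^+ n * u (rC t * z) = (H z - 1) * u 0 by rewrite /H addrK mulrA divfK.
  by rewrite Hz sub0r mulN1r mulrN.
have nz w s z : nm w = 1 -> dl <= imC w -> 0 < s -> s < dl -> insq w s z -> nm (rC t * z) < r /\ 0 < imC (rC t * z).
  move=> m dw s0 sd hz; have [_ h] := nt _ (near _ _ _ m s0 sd hz); split => //.
  rewrite imM re_rC im_rC mul0r addr0 mulr_gt0 //.
  by move: hz => /andP[_ /andP[h1 _]]; lra.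
exists (rC t * a), (rC t * b); split.
- have tC : rC t != 0 by rewrite rC_eq0 gt_eqF.
  apply/eqP => /(mulfI tC) ab.
  have h1 := insqP a1; have h2 := insqP b2; rewrite -ab in h2.
  have : nm (w1 - w2) <= nm (a - w2) + nm (a - w1).
    by have -> : w1 - w2 = (a - w2) - (a - w1) by [ring]; exact: nmB.
  by lra.
- exact: nz m1 dl1 s10 s1d a1.
- exact: nz m2 dl2 s20 s2d b2.
- by rewrite !fH.
by rewrite fH // !reimE Iu; ring.
Qed.
End Directions.

(** * Continuation of phi and F across the axis *)

Section Local.
Variable R : realType.
Local Notation C := (Cs R).
Implicit Types (f h u : C -> C) (z w p : C).

Lemma hol0_cder f (r : R) z : hol f 0 r -> nm z < r -> cder f z (f^`()%classic z).
Proof. by move=> H zr; apply: (hol_cder H); rewrite subr0. Qed.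

Lemma hol0_ccont f (r : R) z : hol f 0 r -> nm z < r -> ccont f z.
Proof. by move=> H zr; apply: (hol_ccont H); rewrite subr0. Qed.

Lemma ccont_rC_eq f h (r : R) z : 0 < r -> nm z < r ->
  (forall z, nm z < r -> ccont f z) -> (forall z, nm z < r -> ccont h z) ->
  (forall z, nm z < r -> imC z != 0 -> f z = h z) -> f z = h z.
Proof.
move=> r0 zr cf ch E; apply: (@ccont_offline R f h z (r - nm z) 0); rewrite ?subr_gt0 //; try by [apply: cf|apply: ch].
move=> w wz; apply: E; have -> : w = (w - z) + z by ring.
by apply: le_lt_trans (nmD _ _) _; lra.
Qed.

Lemma ccont_cjcj f z : ccont f (cj z) -> ccont (fun w => cj (f (cj w))) z.
Proof.
move=> H; apply: (ccont_comp (f := fun w => f (cj w))); last exact: ccont_cj.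
by apply: (ccont_comp (f := @cj R)); first exact: ccont_cj.
Qed.

Variables (phi F g : C -> C) (r M : R).
Hypothesis r0 : 0 < r.
Hypothesis Dphi : forall z, nm z < r -> 0 < imC z -> derivable phi z 1.
Hypothesis DF : forall z, nm z < r -> 0 < imC z -> derivable F z 1.
Hypothesis phi1 : forall z, nm z < r -> 0 < imC z -> nm (phi z) < 1.
Hypothesis gM : forall z, nm z < r -> 0 < imC z -> nm (g z) <= M.
Hypothesis ginj : forall z w, nm z < r -> 0 < imC z -> nm w < r -> 0 < imC w -> g z = g w -> z = w.
Hypothesis FE : forall z, nm z < r -> 0 < imC z -> F z = g z + phi z * cj (g z).
Hypothesis bdry : forall x : R, `|x| < r -> forall e : R, 0 < e -> exists2 d : R, 0 < d &
  forall z, nm z < r -> nm (z - rC x) < d -> 0 < imC z -> 1 - e < nm (phi z).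

(** [P] and [Q] continue phi and F. The two functional equations hold off the axis by construction
    and on it by continuity; from here on they take the place of the boundary behaviour of |phi|. *)
Lemma local_ext : exists2 s, 0 < s <= r & exists P Q : C -> C,
  [/\ hol P 0 s /\ hol Q 0 s,
      forall z, nm z < s -> 0 < imC z -> P z = phi z /\ Q z = F z,
      forall z, nm z < s -> P z * cj (P (cj z)) = 1 &
      forall z, nm z < s -> Q z = cj (Q (cj z)) * P z].
Proof.
(* Near 0 one has |phi| > 1/2, so 1/phi is holomorphic and bounded by 2 above the axis. *)
have [d d0 D] := bdry (x := 0) (ltac:(by rewrite normr0)) (half_gt0 (@ltr01 R)).
pose s := Num.min r d; have s0 : 0 < s by rewrite lt_min r0.
have sP z : nm z < s -> nm z < r /\ nm z < d by rewrite lt_min => /andP[].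
have ph z : nm z < s -> 0 < imC z -> 1 / 2 < nm (phi z).
  by move=> /sP [zr zd] zi; have := D z zr; rewrite subr0 => /(_ zd zi); lra.
have pn z : nm z < s -> 0 < imC z -> phi z != 0.
  by move=> zs zi; rewrite -nm_gt0; have := ph _ zs zi; lra.
have pV z : nm z < s -> 0 < imC z -> nm (phi z)^-1 <= 2.
  move=> zs zi; have k := ph _ zs zi; rewrite nmV invf_ple ?posrE //; lra.
have bd (x : R) : `|x| < s -> forall e : R, 0 < e -> exists2 d : R, 0 < d &
    forall z, nm z < s -> nm (z - rC x) < d -> 0 < imC z -> 1 - nm (phi z) ^+ 2 < e.
  rewrite lt_min => /andP[xr _] e e0; have [d' d'0 D'] := bdry xr (half_gt0 e0).
  exists d' => // z /sP[zr _] zd zi; have := D' z zr zd zi; have := phi1 zr zi.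
  by have := nm_ge0 (phi z); move: (nm _) => a; nra.
have [||||x xs e e0|s1 /andP[s10 s1s] [P [HP Pu Pd]]] := @schwarz_reflection R phi (fun z => (phi z)^-1) s 2 s0.
- by move=> z /sP[zr _]; exact: Dphi.
- move=> z zs zi; have [zr _] := sP _ zs.
  by apply: cder_derivable; apply: cderV (pn _ zs zi) (derivable_cder (Dphi zr zi)).
- by move=> z /sP[zr _] zi; have := phi1 zr zi; lra.
- exact: pV.
- have [d' d'0 D'] := bd x xs _ (half_gt0 e0); exists d' => // z zs zd zi.
  have -> : phi z - cj (phi z)^-1 = - (rC (1 - nm (phi z) ^+ 2) * cj (phi z)^-1).
    rewrite rCB rC1 -mulcj cjV; have : cj (phi z) != 0 by rewrite cj_eq0 pn.
    by move=> h; field.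
  have := D' z zs zd zi; have := pV z zs zi; have := phi1 (proj1 (sP _ zs)) zi; have := nm_ge0 (phi z).
  have : 0 <= nm (phi z)^-1 by exact: nm_ge0.
  rewrite nmN nmM nm_rC nm_cj => k1 k2 k3 k4 k5.
  have k6 : 0 <= 1 - nm (phi z) ^+ 2 by nra.
  by rewrite ger0_norm //; apply: le_lt_trans (ler_wpM2l k6 k4) _; lra.
have FB z : nm z < r -> 0 < imC z -> nm (F z) <= 2 * `|M|.
  move=> zr zi; rewrite FE //; apply: le_trans (nmD _ _) _; rewrite nmM nm_cj.
  have k1 := gM zr zi; have k2 := phi1 zr zi; have k3 := nm_ge0 (g z); have k4 := nm_ge0 (phi z).
  have k5 : M <= `|M| := ler_norm M.
  have : nm (phi z) * nm (g z) <= 1 * nm (g z) by rewrite ler_wpM2r // ltW.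
  lra.
have [||||x xs e e0|s2 /andP[s20 s2s] [Q [HQ Qu Qd]]] := @schwarz_reflection R F (fun z => F z / phi z) s (4 * `|M|) s0.
- by move=> z /sP[zr _]; exact: DF.
- move=> z zs zi; have [zr _] := sP _ zs.
  by apply: cder_derivable; apply: cder_div (pn _ zs zi) (derivable_cder (DF zr zi)) (derivable_cder (Dphi zr zi)).
- move=> z /sP[zr _] zi; apply: le_trans (FB _ zr zi) _.
  by rewrite ler_wpM2r // ler_nat.
- move=> z zs zi; have [zr _] := sP _ zs; rewrite nmM.
  rewrite (_ : 4 * `|M| = 2 * `|M| * 2); last by ring.
  by apply: ler_pM; rewrite ?nm_ge0 ?pV //; exact: FB.
- have eM : 0 < e / (2 * `|M| + 1) by rewrite divr_gt0 // ltr_wpDl // mulr_ge0.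
  have [d' d'0 D'] := bd x xs _ eM; exists d' => // z zs zd zi.
  have [zr _] := sP _ zs.
  (* The terms with g cancel, and the remaining factor conj(g) / conj(phi) is bounded; this is where
     the boundedness of g controls the jump. *)
  have -> : F z - cj (F z / phi z) = - (rC (1 - nm (phi z) ^+ 2) * (cj (g z) / cj (phi z))).
    rewrite rCB rC1 -mulcj cjM cjV FE // cjD cjM cjK; have : cj (phi z) != 0 by rewrite cj_eq0 pn.
    by move=> h; field.
  have := D' z zs zd zi; have := pV z zs zi; have := phi1 (proj1 (sP _ zs)) zi; have := nm_ge0 (phi z).
  rewrite nmN nmM nm_rC nmM !nmV !nm_cj => k2 k3 k4 k5.
  have k6 : 0 <= 1 - nm (phi z) ^+ 2 by nra.
  have k7 : nm (g z) * (nm (phi z))^-1 <= `|M| * 2.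
    apply: ler_pM; rewrite ?invr_ge0 ?nm_ge0 //; apply: le_trans (gM zr zi) (ler_norm _).
  rewrite (ger0_norm k6); apply: le_lt_trans (ler_wpM2l k6 k7) _.
  move: k5; rewrite ltr_pdivlMr; last by rewrite ltr_wpDl // mulr_ge0.
  by apply: le_lt_trans; rewrite ler_wpM2l // mulrC; lra.
pose t := Num.min s1 s2; have t0 : 0 < t by rewrite lt_min s10.
have ts z : nm z < t -> nm z < s1 /\ nm z < s2 by rewrite lt_min => /andP[].
have HPt : hol P 0 t by apply: hol_le HP; rewrite ge_min lexx.
have HQt : hol Q 0 t by apply: hol_le HQ; rewrite ge_min lexx orbT.
exists t.
  rewrite t0 /=; apply: le_trans (_ : s <= r); last by rewrite ge_min lexx.
  by apply: le_trans s1s; rewrite ge_min lexx.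
have cP z : nm z < t -> ccont P z by move=> zt; exact: hol0_ccont HPt zt.
have cQ z : nm z < t -> ccont Q z by move=> zt; exact: hol0_ccont HQt zt.
have cPj z : nm z < t -> ccont (fun z => cj (P (cj z))) z by move=> zt; apply: ccont_cjcj; apply: cP; rewrite nm_cj.
have cQj z : nm z < t -> ccont (fun z => cj (Q (cj z))) z by move=> zt; apply: ccont_cjcj; apply: cQ; rewrite nm_cj.
have dich z : nm z < t -> imC z != 0 -> exists w, [/\ nm w < t, 0 < imC w & (z = w \/ z = cj w)].
  move=> zt; case: (ltgtP 0 (imC z)) => // zi _; first by exists z; split => //; left.
  by exists (cj z); rewrite nm_cj im_cj cjK oppr_gt0; split => //; right.
have val w : nm w < t -> 0 < imC w -> [/\ P w = phi w, P (cj w) = cj (phi w)^-1, Q w = F w & Q (cj w) = cj (F w / phi w)].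
  move=> wt wi; have [w1 w2] := ts _ wt.
  have h : imC (cj w) < 0 by rewrite im_cj oppr_lt0.
  have h1 : nm (cj w) < s1 by rewrite nm_cj.
  have h2 : nm (cj w) < s2 by rewrite nm_cj.
  by rewrite (Pu _ w1 wi) (Qu _ w2 wi) (Pd _ h1 h) (Qd _ h2 h) !cjK; split.
have pnz w : nm w < t -> 0 < imC w -> phi w != 0.
  by move=> /ts [w1 _] wi; apply: pn => //; apply: lt_le_trans w1 s1s.
exists P, Q; split => //.
- by move=> z zt zi; have [-> _ -> _] := val z zt zi.
- move=> z zt; apply: (@ccont_rC_eq (fun z => P z * cj (P (cj z))) (fun=> 1) t) => //.
  + by move=> w wt; apply: ccontM; [exact: cP|exact: cPj].
  + by move=> w _; exact: ccont_cst.
  move=> w wt wi; have [v [vt vi [->|->]]] := dich w wt wi; have [e1 e2 _ _] := val v vt vi.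
    by rewrite e1 e2 cjK mulfV // pnz.
  by rewrite cjK e1 e2 cjV mulVf // cj_eq0 pnz.
move=> z zt; apply: (@ccont_rC_eq Q (fun z => cj (Q (cj z)) * P z) t) => //.
  by move=> w wt; apply: ccontM; [exact: cQj|exact: cP].
move=> w wt wi; have [v [vt vi [->|->]]] := dich w wt wi; have [e1 e2 e3 e4] := val v vt vi.
  by rewrite e1 e3 e4 cjK divfK // pnz.
by rewrite cjK e2 e3 e4 cjM.
Qed.
End Local.

(** * The boundary function near a point of the arc *)

Section Symmetric.
Variable R : realType.
Local Notation C := (Cs R).
Local Notation iC := (iC R).
Implicit Types (f h u : C -> C) (z w p : C).

Definition hquot (P Q : C -> C) z := Q^`()%classic z / P^`()%classic z.
Definition rquot (P Q : C -> C) z := Q z - P z * hquot P Q z.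

Variables (P Q g : C -> C) (s : R).
Hypothesis s0 : 0 < s.
Hypothesis HP : hol P 0 s.
Hypothesis HQ : hol Q 0 s.
Hypothesis P1 : forall z, nm z < s -> 0 < imC z -> nm (P z) < 1.
Hypothesis QE : forall z, nm z < s -> 0 < imC z -> Q z = g z + P z * cj (g z).
Hypothesis ginj : forall z w, nm z < s -> 0 < imC z -> nm w < s -> 0 < imC w -> g z = g w -> z = w.
Hypothesis PP : forall z, nm z < s -> P z * cj (P (cj z)) = 1.
Hypothesis QQ : forall z, nm z < s -> Q z = cj (Q (cj z)) * P z.

Let n0 : nm (0 : C) < s. Proof. by rewrite nm0. Qed.

Lemma P_neq0 z : nm z < s -> P z != 0.
Proof. by move=> /PP h; apply/eqP => E; move: h; rewrite E mul0r => /esym/eqP; rewrite oner_eq0. Qed.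

Lemma P_axis (x : R) : `|x| < s -> cj (P (rC x)) = (P (rC x))^-1 /\ nm (P (rC x)) = 1.
Proof.
move=> xs; have xs' : nm (rC x : C) < s by rewrite nm_rC.
have := PP xs'; rewrite cj_rC => h; split; first by apply: (mulfI (P_neq0 xs')); rewrite h mulfV // P_neq0.
move: h; rewrite mulcj => /(congr1 (@reC R)); rewrite re_rC re_1 => /eqP.
by rewrite pexpr_eq1 ?nm_ge0 // => /eqP.
Qed.

Lemma P_deriv0 : P^`()%classic 0 != 0.
Proof. by apply: (boundary_deriv s0 HP P1) => x /P_axis []. Qed.

(** [pj] and [qj] stand for the conjugates of P and Q at the reflected point, primes for
    derivatives. The first two identities give pj' = - p' / p^2. In q - p q' / p' the terms with qj
    cancel, and - p^2 qj' / p' = qj' / pj' remains. *)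
Lemma sym_alg (p q p' q' pj qj pj' qj' : C) : p * pj = 1 -> p' * pj + p * pj' = 0 ->
  q = qj * p -> q' = qj' * p + qj * p' -> p' != 0 -> q - p * (q' / p') = qj' / pj'.
Proof.
move=> E1 E2 -> -> N; have p0 : p != 0 by apply/eqP => E; move: E1; rewrite E mul0r => /esym/eqP; rewrite oner_eq0.
have -> : pj' = - p' / p ^+ 2.
  have Ej : pj = p^-1 by apply: (mulfI p0); rewrite E1 mulfV.
  apply: (mulfI p0); transitivity (- (p' * pj)); last by rewrite Ej; field.
  by apply/eqP; rewrite -addr_eq0 addrC E2.
by field; rewrite p0 N.
Qed.

Lemma rquot_sym z : nm z < s -> P^`()%classic z != 0 -> rquot P Q z = cj (hquot P Q (cj z)).
Proof.
move=> zs N; have zs' : nm (cj z) < s by rewrite nm_cj.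
have DP := hol0_cder HP zs; have DQ := hol0_cder HQ zs.
have DPj := cder_cj (hol0_cder HP zs'); have DQj := cder_cj (hol0_cder HQ zs').
have rz : 0 < s - nm z by rewrite subr_gt0.
have near w : nm (w - z) < s - nm z -> nm w < s.
  by move=> h; have -> : w = (w - z) + z by [ring]; apply: le_lt_trans (nmD _ _) _; lra.
have E1 : P^`()%classic z * cj (P (cj z)) + P z * cj (P^`()%classic (cj z)) = 0.
  apply: (cder_uniq (cderM DP DPj)); apply: (cder_near rz _ (cder_cst 1 z)) => w /near ws.
  by rewrite PP.
have E2 : Q^`()%classic z = cj (Q^`()%classic (cj z)) * P z + cj (Q (cj z)) * P^`()%classic z.
  apply: (cder_uniq DQ); apply: (cder_near rz _ (cderM DQj DP)) => w /near ws.
  by rewrite -QQ.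
by rewrite /rquot /hquot cjM cjV; exact: sym_alg (PP zs) E1 (QQ zs) E2 N.
Qed.

Lemma g_unique z G : nm z < s -> 0 < imC z -> Q z = G + P z * cj G -> g z = G.
Proof.
move=> zr zi E; have E1 := QE zr zi; have p1 := P1 zr zi.
have E2 : g z - G = - (P z * cj (g z - G)).
  rewrite cjB mulrBr; move: E1; rewrite E => E1.
  have : g z + P z * cj (g z) - (G + P z * cj G) = 0 by rewrite -E1 subrr.
  by move=> h; apply/eqP; rewrite -subr_eq0 -h; apply/eqP; ring.
apply/eqP; rewrite -subr_eq0 -nm_eq0; apply/negPn/negP => N.
have := congr1 (@nm R) E2; rewrite nmN nmM nm_cj.
have : 0 < nm (g z - G) by rewrite lt0r N nm_ge0.
move: (nm _) (nm _) p1 => a b a1 b0 h; nra.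
Qed.

(** By the reflection identities the equation Q = g + P conj(g) persists at the conjugate point with
    the same value g(z). Subtracting gives conj g(z) as a quotient of increments of [Q] and [P],
    that is a quotient of two [cjquot], continuous up to the axis. *)
Lemma g_limit (x : R) : `|x| < s -> P^`()%classic (rC x) != 0 -> forall e : R, 0 < e ->
  exists2 d : R, 0 < d & forall z, nm z < s -> nm (z - rC x) < d -> 0 < imC z -> nm (g z - rquot P Q (rC x)) < e.
Proof.
move=> xs N; have xs' : nm (rC x : C) < s by rewrite nm_rC.
have rx : 0 < s - `|x| by rewrite subr_gt0.
have HPx : hol P (rC x) (s - `|x|) by apply: hol_sub HP; rewrite subr0 nm_rC; lra.
have HQx : hol Q (rC x) (s - `|x|) by apply: hol_sub HQ; rewrite subr0 nm_rC; lra.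
have cP := cjquot_cont rx HPx; have cQ := cjquot_cont rx HQx.
have ax f : cjquot f (rC x) = f^`()%classic (rC x) by rewrite /cjquot im_rC eqxx.
pose G z := Q z - P z * (cjquot Q z / cjquot P z).
have cG : ccont G (rC x).
  apply: ccontB; first exact: hol0_ccont HQ xs'.
  apply: ccontM; first exact: hol0_ccont HP xs'.
  by apply: ccontM => //; apply: ccontV => //; rewrite ax.
have -> : rquot P Q (rC x) = G (rC x) by rewrite /G !ax.
move=> e e0; have [d d0 D] := cG e e0; exists d => // z zs zd zi.
suff -> : g z = G z by exact: D.
have zs' : nm (cj z) < s by rewrite nm_cj.
have Pc := PP zs'; rewrite cjK in Pc.
have p0 : cj (P z) != 0 by rewrite cj_eq0 P_neq0.
have {}Pc : P (cj z) = (cj (P z))^-1 by apply: (mulIf p0); rewrite Pc mulVf.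
have Qc := QQ zs'; rewrite cjK Pc in Qc.
have i0 : imC z != 0 by rewrite gt_eqF.
rewrite /G /cjquot (negbTE i0) Qc Pc (QE zs zi) cjD cjM cjK.
have k : 1 - P z * cj (P z) != 0.
  rewrite mulcj -rC1 -rCB rC_eq0 subr_eq0 eq_sym pexpr_eq1 ?nm_ge0 // lt_eqF //; exact: P1.
have dz : cj z - z != 0.
  apply/eqP => /(congr1 (@imC R)); rewrite !reimE => h; have : imC z = 0 by lra.
  by move/eqP; rewrite (negbTE i0).
have k2 : (cj (P z))^-1 - P z != 0.
  by apply: contra k => /eqP h; rewrite -[1](mulVf p0) -mulrBl h mul0r.
move: (g z) (cj (g z)) => a b.
have -> : (b + cj (P z) * a) / cj (P z) - (a + P z * b) = b * ((cj (P z))^-1 - P z) by field.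
move: ((cj (P z))^-1 - P z) k2 => X X0; move: (cj z - z) dz => Y Y0.
by field; rewrite ?X0 ?Y0.
Qed.

(* If R'(0) = R''(0) = 0 then f = Q - a0 - conj(a0) P vanishes to order at least 4 at 0. As
   g = a0 + q b exactly when f = q (b + conj(b) P) for real q, two points of the upper half
   plane with the same real value of f / (b + conj(b) P) contradict the injectivity of g. *)
Lemma rquot_simple (t : R) : 0 < t -> t <= s -> (forall z, nm z < t -> P^`()%classic z != 0) ->
  (rquot P Q)^`()%classic 0 = 0 -> (rquot P Q)^`()%classic^`()%classic 0 != 0.
Proof.
move=> t0 ts PN R1; apply/eqP => R2.
have HPt : hol P 0 t := hol_le ts HP; have HQt : hol Q 0 t := hol_le ts HQ.
have [P' EP'] : exists P', P' = P^`()%classic := ex_intro _ _ erefl.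
have [Q' EQ'] : exists Q', Q' = Q^`()%classic := ex_intro _ _ erefl.
have [h Eh] : exists h, h = hquot P Q := ex_intro _ _ erefl.
have HP' : hol P' 0 t by rewrite EP'; exact: hol_deriv.
have HQ' : hol Q' 0 t by rewrite EQ'; exact: hol_deriv.
have DP z : nm z < t -> cder P z (P' z) by rewrite EP'; exact: hol0_cder.
have DQ z : nm z < t -> cder Q z (Q' z) by rewrite EQ'; exact: hol0_cder.
have {}PN z : nm z < t -> P' z != 0 by rewrite EP'; exact: PN.
have nt : nm (0 : C) < t by rewrite nm0.
have hE z : h z = Q' z / P' z by rewrite Eh EQ' EP'.
have Hh : hol h 0 t.
  apply: (hol_near (f := fun z => Q' z / P' z)); first by move=> z _; rewrite hE.
  by apply: (hol_div _ HQ' HP') => z; rewrite subr0; exact: PN.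
have [h' Eh'] : exists h', h' = h^`()%classic := ex_intro _ _ erefl.
have Hh' : hol h' 0 t by rewrite Eh'; exact: hol_deriv.
have Dh z : nm z < t -> cder h z (h' z) by rewrite Eh'; exact: hol0_cder.
have PhE z : nm z < t -> P' z * h z = Q' z.
  by move=> zt; rewrite hE mulrC divfK // PN.
have RE z : rquot P Q z = Q z - P z * h z by rewrite Eh.
(* Q' = P' h cancels two of the three terms in the derivative of Q - P h. *)
have DR z : nm z < t -> cder (rquot P Q) z (- (P z * h' z)).
  move=> zt; apply: (cder_near (f := fun z => Q z - P z * h z) ltr01); first by move=> w _; rewrite RE.
  have -> : - (P z * h' z) = Q' z - (P' z * h z + P z * h' z) by rewrite (PhE _ zt); ring.
  exact: cderB (DQ _ zt) (cderM (DP _ zt) (Dh _ zt)).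
have p0 := P_neq0 n0.
have h1 : h' 0 = 0.
  have := etrans (esym (cder_val (DR _ nt))) R1 => /eqP.
  by rewrite oppr_eq0 mulf_eq0 (negbTE p0) => /eqP.
have h2 : h'^`()%classic 0 = 0.
  have : cder (rquot P Q)^`()%classic 0 (- (P' 0 * h' 0 + P 0 * h'^`()%classic 0)).
    apply: (cder_near (f := fun z => - (P z * h' z)) t0).
      by move=> z; rewrite subr0 => zt; rewrite (cder_val (DR _ zt)).
    by apply: cderN; apply: cderM; [exact: DP|exact: hol0_cder Hh' nt].
  move=> /cder_val h2; have := etrans (esym h2) R2; rewrite h1 mulr0 add0r => /eqP.
  by rewrite oppr_eq0 mulf_eq0 (negbTE p0) => /eqP.
have [a0 Ea0] : exists a0, a0 = rquot P Q 0 := ex_intro _ _ erefl.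
(* The reflection fixes 0, so the symmetry gives conj(a0) = h(0). The derivative of [f] is then P'
   (h - h(0)), and the second factor vanishes to order at least 3. *)
have a0E : cj a0 = h 0 by rewrite Ea0 rquot_sym ?nm0 // -?EP' ?PN // cj0 cjK Eh.
pose f z := Q z - (a0 + cj a0 * P z).
pose k z := h z - h 0.
have Df z : nm z < t -> cder f z (P' z * k z).
  move=> zt; have -> : P' z * k z = Q' z - (0 + cj a0 * P' z) by rewrite /k mulrBr (PhE _ zt) a0E; ring.
  by apply: cderB; [exact: DQ|apply: cderD; [exact: cder_cst|apply: cderZ; exact: DP]].
have Hf : hol f 0 t by move=> z; rewrite subr0 => /Df; exact: cder_derivable.
have Dk z : nm z < t -> cder k z (h' z).
  by move=> zt; rewrite -[h' z]subr0; apply: cderB; [exact: Dh|exact: cder_cst].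
have Hk : hol k 0 t by move=> z; rewrite subr0 => /Dk; exact: cder_derivable.
have f0 : f 0 = 0 by rewrite /f a0E Ea0 RE; ring.
have k0 : k 0 = 0 by rewrite /k subrr.
have k1 : k^`()%classic 0 = 0 by rewrite (cder_val (Dk _ nt)) h1.
have k2 : k^`()%classic^`()%classic 0 = 0.
  apply: cder_val; apply: (cder_near (f := h') t0); last by have := hol0_cder Hh' nt; rewrite h2.
  by move=> z; rewrite subr0 => zt; rewrite (cder_val (Dk _ zt)).
have Ef z : nm z < t -> f^`()%classic z = P' z * k z by move=> zt; exact: cder_val (Df _ zt).
have sol z (G b : C) (q : R) : nm z < t -> 0 < imC z -> f z = rC q * (b + cj b * P z) -> g z = a0 + rC q * b.
  move=> zt zi E; apply: g_unique => //; first exact: lt_le_trans zt ts.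
  have -> : Q z = f z + (a0 + cj a0 * P z) by rewrite /f; ring.
  by rewrite E cjD cjM cj_rC; ring.
have [[r' r'0 N]|[n [u [n3 Hu u0 Eu]]]] := order_ge4 t0 Hf f0 HP' Hk Ef k0 k1 k2.
  (* If [f] vanishes near 0, then g equals a0 at all nearby points above the axis; im/2 and im/3
     contradict injectivity. *)
  pose m := Num.min t r'; have m0 : 0 < m by rewrite lt_min t0.
  have pt (c : R) : 0 < c -> c < 1 -> [/\ nm (iC * rC (c * m)) < t, 0 < imC (iC * rC (c * m)) & g (iC * rC (c * m)) = a0].
    move=> c0 c1; have cm : 0 < c * m by rewrite mulr_gt0.
    have : c * m < m by rewrite gtr_pMl.
    rewrite lt_min => /andP[cm1 cm2].
    have nn : nm (iC * rC (c * m)) = c * m by rewrite nmM nm_iC mul1r nm_rC gtr0_norm.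
    have ii : 0 < imC (iC * rC (c * m)) by rewrite !reimE; lra.
    split => //; first by rewrite nn.
    rewrite (sol _ 0 0 0) ?nn // ?mulr0 ?addr0 //.
    by rewrite N ?nn // cj0; ring.
  have [||x1 x2 x3] := pt (1 / 2); try lra.
  have [||y1 y2 y3] := pt (1 / 3); try lra.
  have := ginj (lt_le_trans x1 ts) x2 (lt_le_trans y1 ts) y2 (etrans x3 (esym y3)).
  move=> /(congr1 (@imC R)); rewrite !reimE; lra.
(* b = 1 works unless P(0) = -1, where b = i gives 2i. *)
have [b b0] : exists b : C, b + cj b * P 0 != 0.
  have [E|N] := eqVneq (P 0) (-1).
    exists iC; rewrite E; apply/eqP => /(congr1 (@imC R)); rewrite !reimE; lra.
  exists 1; rewrite cj1 mul1r; apply: contra N => /eqP h0; apply/eqP.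
  by apply: (addrI 1); rewrite h0 subrr.
pose B z := b + cj b * P z.
have cB : ccont B 0.
  apply: ccontD; first exact: ccont_cst.
  by apply: ccontM; [exact: ccont_cst|exact: hol0_ccont HPt nt].
have [d d0 D] := ccont_neq0 cB b0.
pose m := Num.min t d; have m0 : 0 < m by rewrite lt_min t0.
have mt : m <= t by rewrite ge_min lexx.
have mP z : nm z < m -> nm z < t /\ B z != 0.
  by rewrite lt_min => /andP[h3 h4]; split => //; apply: D; rewrite subr0.
pose v z := u z / B z.
have Hv : hol v 0 m.
  apply: hol_div; first by move=> z; rewrite subr0 => /mP [].
    exact: hol_le mt Hu.
  apply: holD; first exact: hol_cst.
  by apply: holM; [exact: hol_cst|exact: hol_le mt HPt].
pose q z := z ^+ n * v z.
have qE z : nm z < m -> f z = q z * B z.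
  by move=> /mP [_ Bz]; rewrite /q /v Eu mulrA divfK.
have v0 : v 0 != 0 by rewrite mulf_neq0 // invr_neq0.
(* On the axis conj(P) = 1/P, and X = [f] and X = [B] both satisfy P conj(X) = X; their quotient is
   therefore real. *)
have q_real (x : R) : 0 < x -> x < m -> imC (q (rC x)) = 0.
  move=> x0 xm; have nx : nm (rC x : C) < m by rewrite nm_rC gtr0_norm.
  have [xt Bx] := mP _ nx.
  have xs : `|x| < s by rewrite -(nm_rC x); exact: lt_le_trans xt ts.
  have [cP _] := P_axis xs; have px : P (rC x) != 0 by apply: P_neq0; rewrite nm_rC.
  have Qx : Q (rC x) = cj (Q (rC x)) * P (rC x) by rewrite {1}(QQ (lt_le_trans xt ts)) cj_rC.
  have Bj : P (rC x) * cj (B (rC x)) = B (rC x) by rewrite /B cjD cjM cjK cP; field.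
  have fj : P (rC x) * cj (f (rC x)) = f (rC x).
    rewrite /f cjB cjD cjM cjK cP mulrBr [P _ * cj (Q _)]mulrC -Qx; field; exact: px.
  have qj : cj (q (rC x)) = q (rC x).
    apply: (mulIf Bx); rewrite -(qE _ nx) -[in LHS]Bj mulrCA -cjM -(qE _ nx) fj //.
  have := congr1 (@imC R) qj; rewrite im_cj; lra.
have cv : ccont v 0 by apply: hol0_ccont Hv _; rewrite nm0.
have Iv : imC (v 0) = 0 by apply: (@real_coef R q v n m) => // z; rewrite subr0.
have [z1 [z2 [z12 [m1 i1] [m2 i2] qq qi]]] := not_injective4 n3 m0 Hv v0 Iv (fun z => erefl (q z)).
have qr : q z1 = rC (reC (q z1)) by apply: eqC; rewrite ?re_rC ?im_rC.
have [t1 _] := mP _ m1; have [t2 _] := mP _ m2.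
have g1 : g z1 = a0 + rC (reC (q z1)) * b by apply: (sol _ 0) => //; rewrite -qr; exact: qE.
have g2 : g z2 = a0 + rC (reC (q z1)) * b by apply: (sol _ 0) => //; rewrite -qr qq; exact: qE.
move/eqP: z12; apply; apply: ginj => //; first exact: lt_le_trans t1 ts.
  exact: lt_le_trans t2 ts.
by rewrite g1 g2.
Qed.
End Symmetric.

Section LocalMain.
Variable R : realType.
Local Notation C := (Cs R).

(** All hypotheses concern the upper half disc, which is what the Cayley transform carries over from
    the unit disc. The radius shrinks to one where P' has no zero. *)
Theorem local_main (phi F g : C -> C) (r M : R) : 0 < r ->
  (forall z, nm z < r -> 0 < imC z -> derivable phi z 1) ->
  (forall z, nm z < r -> 0 < imC z -> derivable F z 1) ->
  (forall z, nm z < r -> 0 < imC z -> nm (phi z) < 1) ->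
  (forall z, nm z < r -> 0 < imC z -> nm (g z) <= M) ->
  (forall z w, nm z < r -> 0 < imC z -> nm w < r -> 0 < imC w -> g z = g w -> z = w) ->
  (forall z, nm z < r -> 0 < imC z -> F z = g z + phi z * cj (g z)) ->
  (forall x : R, `|x| < r -> forall e : R, 0 < e -> exists2 d : R, 0 < d &
    forall z, nm z < r -> nm (z - rC x) < d -> 0 < imC z -> 1 - e < nm (phi z)) ->
  exists2 t, 0 < t <= r & exists P Q : C -> C,
  [/\ hol P 0 t /\ hol Q 0 t,
      forall z, nm z < t -> 0 < imC z -> P z = phi z /\ Q z = F z,
      forall z, nm z < t -> P^`()%classic z != 0 /\ rquot P Q z = cj (hquot P Q (cj z)),
      forall x : R, `|x| < t -> forall e : R, 0 < e -> exists2 d : R, 0 < d &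
        forall z, nm z < t -> nm (z - rC x) < d -> 0 < imC z -> nm (g z - rquot P Q (rC x)) < e &
      (rquot P Q)^`()%classic 0 = 0 -> (rquot P Q)^`()%classic^`()%classic 0 != 0].
Proof.
move=> r0 Dphi DF phi1 gM ginj FE bdry.
have [s /andP[s0 sr] [P [Q [[HP HQ] E PP QQ]]]] := local_ext r0 Dphi DF phi1 gM FE bdry.
have P1 z : nm z < s -> 0 < imC z -> nm (P z) < 1.
  by move=> zs zi; have [-> _] := E z zs zi; apply: phi1 => //; exact: lt_le_trans zs sr.
have QE z : nm z < s -> 0 < imC z -> Q z = g z + P z * cj (g z).
  by move=> zs zi; have [-> ->] := E z zs zi; apply: FE => //; exact: lt_le_trans zs sr.
have gi z w : nm z < s -> 0 < imC z -> nm w < s -> 0 < imC w -> g z = g w -> z = w.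
  by move=> h1 h2 h3 h4; apply: ginj => //; [exact: lt_le_trans h1 sr|exact: lt_le_trans h3 sr].
have n0 : nm (0 : C) < s by rewrite nm0.
have [d d0 D] := ccont_neq0 (hol0_ccont (hol_deriv HP) n0) (P_deriv0 s0 HP P1 PP).
have m0 : 0 < Num.min s d by rewrite lt_min s0.
have ms : Num.min s d <= s by rewrite ge_min lexx.
have PN z : nm z < Num.min s d -> P^`()%classic z != 0.
  by rewrite lt_min => /andP[_ zd]; apply: D; rewrite subr0.
exists (Num.min s d); first by rewrite m0 (le_trans ms sr).
exists P, Q; split.
- by split; apply: hol_le ms _.
- by move=> z zs; apply: E; exact: lt_le_trans zs ms.
- move=> z zs; split; first exact: PN.
  by apply: (rquot_sym HP HQ PP QQ); [exact: lt_le_trans zs ms|exact: PN].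
- move=> x xs e e0; have xs' := lt_le_trans xs ms.
  have [|d' d'0 D'] := g_limit HP HQ P1 QE PP QQ xs' _ e0; first by apply: PN; rewrite nm_rC.
  by exists d' => // z zs; apply: D'; exact: lt_le_trans zs ms.
exact: (rquot_simple s0 HP HQ P1 QE gi PP QQ m0 ms PN).
Qed.
End LocalMain.

(** * Cayley transform *)

Section Cayley.
Variable R : realType.
Local Notation C := (Cs R).
Local Notation iC := (iC R).
Implicit Types (z w t : C).

(** For |w0| = 1 the upper half plane goes to the unit disc, the real line to the circle and 0 to
    [w0]; conjugation of t corresponds to z -> 1 / conj(z). *)
Definition cayley w0 t : C := w0 * (1 + iC * t) / (1 - iC * t).
Definition cayley_inv w0 z : C := - iC * (z - w0) / (z + w0).

Section At.
Variable w0 : C.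
Hypothesis w01 : nm w0 = 1.

Let w00 : w0 != 0. Proof. by rewrite -nm_gt0 w01. Qed.

Lemma cayley_den t : nm t < 1 -> 1 - iC * t != 0.
Proof.
move=> t1; rewrite subr_eq0; apply/eqP => /(congr1 (@nm R)).
by rewrite nm1 nmM nm_iC mul1r => h; rewrite -h ltxx in t1.
Qed.

Lemma cayley_inv_den z : nm (z - w0) < 1 -> z + w0 != 0.
Proof.
move=> h; apply/eqP => E; move: h; have -> : z = - w0 by apply/eqP; rewrite -addr_eq0 E.
by rewrite -opprD nmN -mulr2n -mulr_natr nmM nm_natr w01; lra.
Qed.

Lemma cayley_inv0 : cayley_inv w0 w0 = 0.
Proof. by rewrite /cayley_inv subrr mulr0 mul0r. Qed.

Lemma n2C : (2%:R : C) != 0. Proof. by rewrite pnatr_eq0. Qed.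

Lemma cayley_inv_inv z : z + w0 != 0 -> 1 - iC * cayley_inv w0 z = 2%:R * w0 / (z + w0).
Proof.
move=> h; rewrite /cayley_inv; have -> : iC * (- iC * (z - w0) / (z + w0)) = (z - w0) / (z + w0).
  by rewrite !mulrA mulrN iC2 opprK mul1r.
by field.
Qed.

Lemma cayley_invK z : z + w0 != 0 -> cayley w0 (cayley_inv w0 z) = z.
Proof.
move=> h; rewrite /cayley cayley_inv_inv // /cayley_inv.
have -> : iC * (- iC * (z - w0) / (z + w0)) = (z - w0) / (z + w0).
  by rewrite !mulrA mulrN iC2 opprK mul1r.
by field; rewrite h w00.
Qed.

Lemma cayley_add t : 1 - iC * t != 0 -> cayley w0 t + w0 = 2%:R * w0 / (1 - iC * t).
Proof. by move=> h; rewrite /cayley; field. Qed.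

Lemma cayleyK t : 1 - iC * t != 0 -> cayley_inv w0 (cayley w0 t) = t.
Proof.
move=> h; rewrite /cayley_inv cayley_add //.
have -> : cayley w0 t - w0 = iC * (2%:R * w0 * t / (1 - iC * t)) by rewrite /cayley; field.
by rewrite !mulrA mulNr iC2 opprK mul1r; field; rewrite h w00.
Qed.

Lemma cayley_nm t : 1 - iC * t != 0 -> nm (cayley w0 t) ^+ 2 =
  (1 - 2 * imC t + nm t ^+ 2) / (1 + 2 * imC t + nm t ^+ 2).
Proof.
move=> h; rewrite /cayley nmM nmV nmM w01 mul1r expr_div_n.
by congr (_ / _); rewrite !nm_sq !reimE; ring.
Qed.

Lemma cayley_pos t : 1 - iC * t != 0 -> 0 < 1 + 2 * imC t + nm t ^+ 2.
Proof.
move=> h; have -> : 1 + 2 * imC t + nm t ^+ 2 = nm (1 - iC * t) ^+ 2 by rewrite !nm_sq !reimE; ring.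
by rewrite exprn_gt0 // nm_gt0.
Qed.

Lemma cayley_lt1 t : 1 - iC * t != 0 -> (nm (cayley w0 t) < 1) = (0 < imC t).
Proof.
move=> h; have k := cayley_pos h.
rewrite -(@expr_lt1 _ 2) ?nm_ge0 // cayley_nm // ltr_pdivrMr // mul1r.
by apply/idP/idP; lra.
Qed.

Lemma cayley_gt1 t : 1 - iC * t != 0 -> (1 < nm (cayley w0 t)) = (imC t < 0).
Proof.
move=> h; have k := cayley_pos h.
rewrite -(@expr_gt1 _ 2) ?nm_ge0 // cayley_nm // ltr_pdivlMr // mul1r.
by apply/idP/idP; lra.
Qed.

Lemma cayley_inv_den2 z : z + w0 != 0 -> 1 - iC * cayley_inv w0 z != 0.
Proof. by move=> h; rewrite cayley_inv_inv // !mulf_neq0 ?invr_neq0 // n2C. Qed.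

Lemma cayley_inv_up z : z + w0 != 0 -> (0 < imC (cayley_inv w0 z)) = (nm z < 1).
Proof. by move=> h; rewrite -cayley_lt1 ?cayley_inv_den2 // cayley_invK. Qed.

Lemma cayley_inv_dn z : z + w0 != 0 -> (imC (cayley_inv w0 z) < 0) = (1 < nm z).
Proof. by move=> h; rewrite -cayley_gt1 ?cayley_inv_den2 // cayley_invK. Qed.

Lemma cayley_inv_refl z : z != 0 -> z + w0 != 0 -> cayley_inv w0 (cj z)^-1 = cj (cayley_inv w0 z).
Proof.
move=> z0 h; have c0 : cj z != 0 by rewrite cj_eq0.
have E : cj w0 = w0^-1 by apply: (mulfI w00); rewrite mulcj w01 expr1n rC1 mulfV.
have ci : cj iC = - iC by apply: eqC; rewrite !reimE ?oppr0.
have k : w0 * cj z + 1 != 0.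
  have : cj (z + w0) != 0 by rewrite cj_eq0.
  rewrite cjD E => k; have -> : w0 * cj z + 1 = w0 * (cj z + w0^-1) by field.
  by rewrite mulf_neq0.
rewrite /cayley_inv !cjM cjV ![cj (_ + _)]cjD !cjN E ci.
by move: (cj z) c0 k => y c0 k; field; rewrite c0 w00 [y * _]mulrC k.
Qed.

Lemma cayley_inv_cder z : z + w0 != 0 -> cder (cayley_inv w0) z (- iC * (2%:R * w0) / (z + w0) ^+ 2).
Proof.
move=> h; have D1 : cder (fun z => - iC * (z - w0)) z (- iC * (1 - 0)).
  by apply: cderZ; apply: cderB; [exact: cder_id|exact: cder_cst].
have D2 : cder (fun z => z + w0) z (1 + 0) by apply: cderD; [exact: cder_id|exact: cder_cst].
have := @cder_div R (fun z => - iC * (z - w0)) (fun z => z + w0) z _ _ h D1 D2; rewrite subr0 addr0 !mulr1.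
by have -> : - iC * (z + w0) - - iC * (z - w0) = - iC * (2%:R * w0) by ring.
Qed.

Lemma cayley_cder t : 1 - iC * t != 0 -> exists L, cder (cayley w0) t L.
Proof.
move=> h; have D1 : cder (fun t => w0 * (1 + iC * t)) t (w0 * (0 + iC * 1)).
  apply: cderZ; apply: cderD; [exact: cder_cst|apply: cderZ; exact: cder_id].
have D2 : cder (fun t => 1 - iC * t) t (0 - iC * 1).
  by apply: cderB; [exact: cder_cst|apply: cderZ; exact: cder_id].
eexists; exact: (@cder_div R (fun t => w0 * (1 + iC * t)) (fun t => 1 - iC * t) t _ _ h D1 D2).
Qed.
End At.

(** The tangent half-angle formula (1 + ix) / (1 - ix) = exp(2i arctan x). It matches the angular
    parametrisation of [open_arc] with the real coordinate. *)
Lemma cayley_real (a x : R) : cayley (expi a) (rC x) = expi (a + 2 * atan x).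
Proof.
have c0 : 0 < cos (atan x) by apply: cos_gt0_pihalf; rewrite atan_gtNpi2 atan_ltpi2.
have s0 : sin (atan x) = x * cos (atan x).
  by rewrite -[X in X * _](atanK x) /tan divfK // gt_eqF.
have E u v : expi (u + v) = expi u * expi v :> C.
  by apply: eqC; rewrite !reimE ?re_expi ?im_expi ?cosD ?sinD; ring.
have n1 : 1 - iC * rC x != 0.
  by apply/eqP => /(congr1 (@reC R)); rewrite !reimE; lra.
rewrite E mulr2n mulrDl mul1r E /cayley -mulrA; congr (_ * _).
apply: (mulIf n1); rewrite divfK //.
have h : expi (atan x) = rC (cos (atan x)) * (1 + iC * rC x) :> C.
  by apply: eqC; rewrite !reimE ?re_expi ?im_expi ?s0; ring.
have h2 : cos (atan x) ^+ 2 * (1 + x ^+ 2) = 1.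
  have := cos2Dsin2 (atan x); rewrite s0 => e; rewrite -[RHS]e; ring.
rewrite h; transitivity (rC (cos (atan x) ^+ 2 * (1 + x ^+ 2)) * (1 + iC * rC x)).
  by rewrite h2 rC1 mul1r.
rewrite !rCM rCD rC1 !rCX; have := iC2 R; move: iC (rC (cos _)) (rC x) => i c y i2.
have -> : c * (1 + i * y) * (c * (1 + i * y)) * (1 - i * y) = c ^+ 2 * (1 - i * i * (y ^+ 2)) * (1 + i * y) by ring.
by rewrite i2 mulN1r opprK.
Qed.

Lemma open_arc_cayley (I : set C) w0 : open_arc I -> I w0 -> nm w0 = 1 /\
  exists2 r : R, 0 < r & forall x : R, `|x| < r -> I (cayley w0 (rC x)).
Proof.
move=> [a [b [_ ->]]] [u /=]; rewrite in_itv /= => /andP[au ub] <-; split; first exact: nm_expi.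
pose d := Num.min (u - a) (b - u) / 2.
have m0 : 0 < Num.min (u - a) (b - u) by rewrite lt_min !subr_gt0 au.
have d0 : 0 < d by rewrite half_gt0.
have C0 : {for 0, continuous (@atan R)} by exact: continuous_atan.
move/cvgrPdist_lt : C0 => /(_ _ d0) /nbhs_ballP [r /= r0 rP].
exists r => // x xr; exists (u + 2 * atan x); last by rewrite cayley_real.
have : `|atan x| < d by have := rP x; rewrite /ball /= atan0 !sub0r !normrN => ->.
have : 2 * d = Num.min (u - a) (b - u) by rewrite /d; lra.
have : Num.min (u - a) (b - u) <= u - a by rewrite ge_min lexx.
have : Num.min (u - a) (b - u) <= b - u by rewrite ge_min lexx orbT.
by rewrite /= in_itv /= ltr_norml => h1 h2 h3 /andP[h4 h5]; apply/andP; split; lra.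
Qed.
End Cayley.

(** * Meromorphic quotients *)

Section Mero.
Variable R : realType.
Local Notation C := (Cs R).
Implicit Types (f h : C -> C) (z w p : C).

Definition pole f p := forall M : R, exists2 d : R, 0 < d & forall z, z != p -> nm (z - p) < d -> M < nm (f z).
(** A pointwise form of [meromorphic_on], which can be checked by cases and transported by
    conjugation and inversion. *)
Definition mero f p := exists2 r : R, 0 < r &
  (forall z, z != p -> nm (z - p) < r -> derivable f z 1) /\ (derivable f p 1 \/ pole f p).

(** The poles are taken to be the points where [f] is not differentiable; the punctured discs make
    this set discrete and closed in [U]. *)
Lemma mero_on (U : set C) f : (forall p, U p -> mero f p) -> meromorphic_on U f.
Proof.
move=> H; exists [set p | U p /\ ~ derivable f p 1]; split; last split; last split.
- by move=> p [].
- move=> z /H [r r0 [D _]]; exists r => // w [_ Nw]; rewrite ltnm => wz.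
  by apply: contrapT => /eqP zw; apply: Nw; exact: D.
- by move=> z Uz N; apply: contrapT => K; exact: N.
- move=> p [/H [r r0 [_ [D|K]]] N]; first by [].
  move=> M; have [d d0 D] := K M.
  rewrite near_withinE; apply/nbhsCP; exists d => // w wp wN.
  by rewrite normE ltcR; exact: D.
Qed.

Lemma mero_der f p (r : R) : 0 < r -> (forall z, nm (z - p) < r -> derivable f z 1) -> mero f p.
Proof.
move=> r0 D; exists r => //; split; first by move=> z _; exact: D.
by left; apply: D; rewrite subrr nm0.
Qed.

Lemma derivable_near f h z (r : R) : 0 < r -> (forall w, nm (w - z) < r -> f w = h w) ->
  derivable f z 1 -> derivable h z 1.
Proof. by move=> r0 E /derivable_cder D; exact: cder_derivable (cder_near r0 E D). Qed.

Lemma mero_near f h p (r : R) : 0 < r -> (forall w, nm (w - p) < r -> f w = h w) -> mero f p -> mero h p.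
Proof.
move=> r0 E [s s0 [D K]].
exists (Num.min s r); first by rewrite lt_min s0.
split.
  move=> z zp; rewrite lt_min => /andP[zs zr].
  apply: (@derivable_near f h z (r - nm (z - p))); [by rewrite subr_gt0 | | exact: D].
  move=> w wz; apply: E; have -> : w - p = (w - z) + (z - p) by ring.
  by apply: le_lt_trans (nmD _ _) _; lra.
case: K => [D0|K]; [left|right]; first exact: derivable_near r0 E D0.
move=> M; have [d d0 Dd] := K M; exists (Num.min d r); first by rewrite lt_min d0.
by move=> z zp; rewrite lt_min => /andP[zd zr]; rewrite -E //; exact: Dd.
Qed.

Lemma mero_cj f p : mero f (cj p) -> mero (fun z => cj (f (cj z))) p.
Proof.
have nn z : nm (cj z - cj p) = nm (z - p) by rewrite -cjB nm_cj.
have ne z : z != p -> cj z != cj p by apply: contra => /eqP h; rewrite -(cjK z) h cjK.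
have der z : derivable f (cj z) 1 -> derivable (fun z => cj (f (cj z))) z 1.
  by move=> /derivable_cder /cder_cj; exact: cder_derivable.
move=> [r r0 [D K]]; exists r => //; split.
  by move=> z zp zr; apply: der; apply: D; rewrite ?nn ?ne.
case: K => [D0|K]; [left; exact: der|right].
move=> M; have [d d0 Dd] := K M; exists d => // z zp zd.
by rewrite nm_cj; apply: Dd; rewrite ?nn ?ne.
Qed.

Lemma mero_inv f p : p != 0 -> mero f p^-1 -> mero (fun z => f z^-1) p.
Proof.
move=> p0 [r r0 [D K]].
have cI : ccont (fun z : C => z^-1) p by apply: ccontV => //; exact: ccont_id.
have [d1 d10 D1] := ccont_neq0 (ccont_id p) p0.
have [d2 d20 D2] := cI r r0.
have ne z : z != p -> z^-1 != p^-1 by apply: contra => /eqP h; rewrite -(invrK z) h invrK.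
have der z : z != 0 -> derivable f z^-1 1 -> derivable (fun z => f z^-1) z 1.
  move=> z0 /derivable_cder Df; apply: cder_derivable.
  exact: (cder_comp (cderV z0 (cder_id z)) Df).
exists (Num.min d1 d2); first by rewrite lt_min d10.
split.
  by move=> z zp; rewrite lt_min => /andP[h1 h2]; apply: der; [exact: D1|apply: D; [exact: ne|exact: D2]].
case: K => [D0|K]; [left; exact: der|right].
move=> M; have [d d0 Dd] := K M; have [d3 d30 D3] := cI d d0.
by exists d3 => // z zp zd; apply: Dd; [exact: ne|exact: D3].
Qed.

Definition lim_to (A : set C) f p l := forall e : R, 0 < e -> exists2 d : R, 0 < d &
  forall z, A z -> nm (z - p) < d -> nm (f z - l) < e.
(** A limit obtained by choice, with default 0; it is unique where [p] is adherent to [A]. *)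
Definition lim_value (A : set C) f p : C := xget 0 [set l | lim_to A f p l].

Lemma lim_valueE (A : set C) f p l :
  (forall d : R, 0 < d -> exists2 z, A z & nm (z - p) < d) -> lim_to A f p l -> lim_value A f p = l.
Proof.
move=> prp H; have /(xgetPex 0) /= K : exists l, [set l | lim_to A f p l] l by exists l.
rewrite -/(lim_value A f p) in K; apply/eqP; rewrite -subr_eq0 -nm_eq0; apply/negPn/negP => N.
have n0 : 0 < nm (lim_value A f p - l) by rewrite lt0r N nm_ge0.
have [d1 d10 D1] := H _ (half_gt0 n0); have [d2 d20 D2] := K _ (half_gt0 n0).
have [|z Az zd] := prp (Num.min d1 d2); first by rewrite lt_min d10.
move: zd; rewrite lt_min => /andP[/(D1 _ Az) h1 /(D2 _ Az) h2].
have : nm (lim_value A f p - l) <= nm (f z - l) + nm (f z - lim_value A f p).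
  by have -> : lim_value A f p - l = (f z - l) - (f z - lim_value A f p) by [ring]; exact: nmB.
by lra.
Qed.

(* The quotient N / D, with removable singularities filled in. *)
Definition mquot (N D : C -> C) z :=
  if D z != 0 then N z / D z else lim_value [set w | w != z] (fun w => N w / D w) z.

Lemma near_punct p (d : R) : 0 < d -> exists2 z : C, z != p & nm (z - p) < d.
Proof.
move=> d0; exists (p + rC (d / 2)).
  by rewrite -subr_eq0 addrAC subrr add0r rC_eq0 gt_eqF // half_gt0.
by rewrite addrAC subrr add0r nm_rC gtr0_norm ?half_gt0 //; lra.
Qed.

(** Numerator and denominator are powers of z - p times functions without zero at p. If the
    numerator has at least the order of the denominator, or vanishes near p, the singularity is
    removable and [mquot] fills in the right value; otherwise there is a pole. *)
Lemma mquot_mero (N D : C -> C) p (r : R) : 0 < r -> hol N p r -> hol D p r ->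
  ~ (exists2 r', 0 < r' & forall z, nm (z - p) < r' -> D z = 0) -> mero (mquot N D) p.
Proof.
move=> r0 HN HD ND.
have [//|[k [d [Hd d0 ED]]]] := hol_order r0 HD.
have n0 : nm (p - p) < r by rewrite subrr nm0.
have [s s0 Ds] := ccont_neq0 (hol_ccont Hd n0) d0.
pose t := Num.min r s; have t0 : 0 < t by rewrite lt_min r0.
have tr : t <= r by rewrite ge_min lexx.
have ts : t <= s by rewrite ge_min lexx orbT.
have dn z : nm (z - p) < t -> d z != 0 by move=> zt; apply: Ds; exact: lt_le_trans zt ts.
have Dn z : z != p -> nm (z - p) < t -> D z != 0.
  by move=> zp zt; rewrite ED mulf_neq0 ?dn // expf_neq0 // subr_eq0.
have mE z : z != p -> nm (z - p) < t -> mquot N D z = N z / D z.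
  by move=> zp zt; rewrite /mquot Dn.
have reg (e : C -> C) (t' : R) : 0 < t' -> t' <= t -> hol e p t' ->
    (forall z, z != p -> nm (z - p) < t' -> N z / D z = e z) -> mero (mquot N D) p.
  move=> t'0 t't He E.
  have ce : ccont e p by apply: (hol_ccont He); rewrite subrr nm0.
  have Ee z : nm (z - p) < t' -> e z = mquot N D z.
    move=> zt; have [->|zp] := eqVneq z p; last by rewrite mE ?E //; exact: lt_le_trans zt t't.
    have lt : lim_to [set w | w != p] (fun w => N w / D w) p (e p).
      move=> x x0; have [y y0 Y] := ce x x0; exists (Num.min y t'); first by rewrite lt_min y0.
      by move=> w /= wp; rewrite lt_min => /andP[wy wt]; rewrite E //; exact: Y.
    rewrite /mquot; case: ifPn => [Dp|_]; last by rewrite (lim_valueE _ lt) // => x; exact: near_punct.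
    (* Where D(p) is nonzero the value of [mquot] is N(p) / D(p) by definition; it equals e(p) by
       uniqueness of limits. *)
    have cq : lim_to [set w | w != p] (fun w => N w / D w) p (N p / D p).
      move=> x x0; have : ccont (fun w => N w / D w) p.
        apply: ccontM; first exact: hol_ccont HN n0.
        by apply: ccontV => //; exact: hol_ccont HD n0.
      by move=> /(_ x x0) [y y0 Y]; exists y => // w _; exact: Y.
    have np x : 0 < x -> exists2 z : C, [set w | w != p] z & nm (z - p) < x by exact: near_punct.
    by rewrite -(lim_valueE np cq) (lim_valueE np lt).
  apply: (mero_near t'0 Ee); apply: (mero_der t'0) => z zt; exact: He.
have [[r' r'0 N0]|[j [n [Hn nn0 EN]]]] := hol_order r0 HN.
  apply: (reg (fun=> 0) (Num.min r' t)); first by rewrite lt_min r'0.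
  - by rewrite ge_min lexx orbT.
  - exact: hol_cst.
  - by move=> z zp; rewrite lt_min => /andP[zr _]; rewrite N0 // mul0r.
have quo z : z != p -> nm (z - p) < t -> N z / D z = (z - p) ^+ j / (z - p) ^+ k * (n z / d z).
  move=> zp zt; rewrite EN ED; field.
  by rewrite dn // expf_neq0 // subr_eq0.
have Hq : hol (fun z => n z / d z) p t.
  by apply: hol_div; [exact: dn|exact: hol_le tr Hn|exact: hol_le tr Hd].
have [kj|jk] := leqP k j.
  have Hp : hol (fun z => (z - p) ^+ (j - k)) p t.
    move=> z _; apply: cder_derivable.
    by apply: cderX; apply: cderB; [exact: cder_id|exact: cder_cst].
  apply: (reg _ t t0 (lexx t) (holM Hp Hq)).
  move=> z zp zt; have zk : (z - p) ^+ k != 0 by rewrite expf_neq0 // subr_eq0.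
  by rewrite (quo _ zp zt) -{1}(subnK kj) exprD (mulfK zk).
have DM z : z != p -> nm (z - p) < t -> derivable (mquot N D) z 1.
  move=> zp zt.
  have x0 : 0 < Num.min (t - nm (z - p)) (nm (z - p)) by rewrite lt_min subr_gt0 zt nm_gt0 subr_eq0.
  apply: (@derivable_near (fun z => N z / D z) _ z _ x0).
    move=> w; rewrite lt_min => /andP[w1 w2]; rewrite mE //.
      by apply: contraTneq w2 => ->; rewrite nmBC ltxx.
    have -> : w - p = (w - z) + (z - p) by ring.
    by apply: le_lt_trans (nmD _ _) _; lra.
  have zr := lt_le_trans zt tr.
  by apply: cder_derivable; apply: cder_div (Dn _ zp zt) (hol_cder HN zr) (hol_cder HD zr).
exists t => //; split => //; right => M.
pose q z := d z / n z.
have cq : ccont (fun z => (z - p) ^+ (k - j) * q z) p.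
  apply: ccontM.
    by apply: cder_ccont; apply: cderX; apply: cderB; [exact: cder_id|exact: cder_cst].
  by apply: ccontM; [exact: hol_ccont Hd n0|apply: ccontV => //; exact: hol_ccont Hn n0].
have M0 : 0 < (`|M| + 1)^-1 by rewrite invr_gt0 ltr_wpDl.
have [y y0 Y] := cq _ M0; have [x x0 Dx] := ccont_neq0 (hol_ccont Hn n0) nn0.
exists (Num.min t (Num.min x y)); first by rewrite lt_min t0 lt_min x0.
move=> z zp; rewrite lt_min => /andP[zt]; rewrite lt_min => /andP[zx zy].
have zp0 : z - p != 0 by rewrite subr_eq0.
have nz := Dx _ zx; have dz := dn _ zt.
rewrite mE // quo //.
have -> : (z - p) ^+ j / (z - p) ^+ k * (n z / d z) = ((z - p) ^+ (k - j) * q z)^-1.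
  rewrite /q -{1}(subnK (ltnW jk)) exprD; field.
  by rewrite nz dz !expf_neq0.
have kj0 : (0 < k - j)%N by rewrite subn_gt0.
have := Y z zy; rewrite subrr expr0n gtn_eqF //= mul0r subr0 => h.
rewrite nmV; apply: le_lt_trans (ler_norm M) _; apply: lt_trans (_ : `|M| < `|M| + 1) _; first by rewrite ltrDl.
have pos : 0 < nm ((z - p) ^+ (k - j) * q z) by rewrite nm_gt0 mulf_neq0 ?expf_neq0 // mulf_neq0 // invr_neq0.
by rewrite -[ltLHS]invrK ltf_pV2 // posrE // invr_gt0 ltr_wpDl.
Qed.
End Mero.

(** * Gluing *)

Section Glue.
Variable R : realType.
Local Notation C := (Cs R).
Local Notation iC := (iC R).
Implicit Types (z w p q : C).

(** On the segment from p to q let T be the supremum of the times up to which D vanishes on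
    neighbourhoods. At time T, either D vanishes near the point, so that T can be enlarged or q is
    reached, or D has no zero in a punctured disc, against its vanishing at earlier times (or near p
    when T = 0). *)
Lemma identity_disc (D : C -> C) q : hol D 0 1 -> nm q < 1 -> D q != 0 ->
  forall p, nm p < 1 -> ~ (exists2 r : R, 0 < r & forall z, nm (z - p) < r -> D z = 0).
Proof.
move=> HD q1 Dq p p1 Np.
pose ga (t : R) : C := p + rC t * (q - p).
have ga0 : ga 0 = p by rewrite /ga rC0 mul0r addr0.
have ga1 : ga 1 = q by rewrite /ga rC1; ring.
have gaB s t : ga s - ga t = rC (s - t) * (q - p) by rewrite /ga rCB; ring.
have gan t : 0 <= t <= 1 -> nm (ga t) < 1.
  move=> /andP[t0 t1]; have -> : ga t = rC (1 - t) * p + rC t * q by rewrite /ga rCB rC1; ring.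
  apply: le_lt_trans (nmD _ _) _; rewrite !nmM !nm_rC !ger0_norm ?subr_ge0 //.
  have k1 : (1 - t) * nm p <= (1 - t) * Num.max (nm p) (nm q) by rewrite ler_wpM2l ?subr_ge0 // le_max lexx.
  have k2 : t * nm q <= t * Num.max (nm p) (nm q) by rewrite ler_wpM2l // le_max lexx orbT.
  have : Num.max (nm p) (nm q) < 1 by rewrite gt_max p1.
  lra.
pose good t := exists2 r : R, 0 < r & forall z, nm (z - ga t) < r -> D z = 0.
have good0 : good 0 by rewrite /good ga0.
have pq : 0 < nm (q - p).
  rewrite nm_gt0 subr_eq0; apply/eqP => E; move: Dq; rewrite E; have [r r0 H] := Np.
  by rewrite H ?eqxx // subrr nm0.
pose S : set R := [set t | 0 <= t <= 1 /\ forall u, 0 <= u <= t -> good u].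
have S0 : S 0.
  split; first by rewrite lexx ler01.
  by move=> u u0; have -> : u = 0 by apply: le_anti; rewrite andbC.
have hS : has_sup S by split; [exists 0 | exists 1 => t [/andP[]]].
pose T := sup S.
have T0 : 0 <= T by apply: ub_le_sup => //; exact: hS.2.
have T1 : T <= 1 by apply: ge_sup; [exists 0 | move=> t [/andP[]]].
have lo u : 0 <= u -> u < T -> good u.
  move=> u0 uT; have eT : 0 < T - u by rewrite subr_gt0.
  have [t [_ St] tu] := sup_adherent eT hS; apply: St.
  by rewrite u0 /=; apply: ltW; apply: le_lt_trans tu; rewrite subKr.
have nT : nm (ga T) < 1 by apply: gan; rewrite T0.
have rT : 0 < 1 - nm (ga T) by rewrite subr_gt0.
have HT : hol D (ga T) (1 - nm (ga T)) by apply: hol_sub HD; rewrite subr0; lra.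
have [[r' r'0 Z]|[n [u [Hu u0 E]]]] := hol_order rT HT.
  have nearT t : `|t - T| < r' / nm (q - p) -> good t.
    rewrite ltr_pdivlMr // => h; exists (r' - nm (ga t - ga T)).
      by rewrite subr_gt0 gaB nmM nm_rC.
    move=> z zt; apply: Z; have -> : z - ga T = (z - ga t) + (ga t - ga T) by ring.
    by apply: le_lt_trans (nmD _ _) _; lra.
  have d0 : 0 < r' / nm (q - p) by rewrite divr_gt0.
  have [T1'|T1'] := leP 1 T.
    have TE : T = 1 by apply: le_anti; rewrite T1 T1'.
    have [r r0 H] : good 1 by apply: nearT; rewrite TE subrr normr0.
    by move: Dq; rewrite -ga1 H ?eqxx // subrr nm0.
  pose s := Num.min 1 (T + (r' / nm (q - p)) / 2).
  have sT : T < s by rewrite lt_min T1' /= ltrDl half_gt0.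
  have s1 : s <= 1 by rewrite ge_min lexx.
  have s2 : s <= T + (r' / nm (q - p)) / 2 by rewrite ge_min lexx orbT.
  have : s <= T.
    apply: ub_le_sup; first exact: hS.2.
    split; first by rewrite s1 (le_trans T0 (ltW sT)).
    move=> v /andP[v0 vs]; have [vT|vT] := ltP v T; first exact: lo.
    by apply: nearT; rewrite ger0_norm ?subr_ge0 //; lra.
  by rewrite leNgt sT.
have nTT : nm (ga T - ga T) < 1 - nm (ga T) by rewrite subrr nm0.
have [x x0 X] := ccont_neq0 (hol_ccont Hu nTT) u0.
have iso z : z != ga T -> nm (z - ga T) < x -> D z != 0.
  by move=> zT zx; rewrite E mulf_neq0 ?X // expf_neq0 // subr_eq0.
have [TE|TN] := eqVneq T 0.
  have [r r0 H] := good0; have m0 : 0 < Num.min r x by rewrite lt_min r0.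
  have [z zT] := near_punct (ga T) m0; rewrite lt_min => /andP[zr zx].
  by have := iso z zT zx; rewrite H ?eqxx //; rewrite TE in zr.
have Tp : 0 < T by rewrite lt0r TN.
have m0 : 0 < Num.min T (x / nm (q - p)) by rewrite lt_min Tp divr_gt0.
pose v := T - Num.min T (x / nm (q - p)) / 2.
have m1 : Num.min T (x / nm (q - p)) <= T by rewrite ge_min lexx.
have m2 : Num.min T (x / nm (q - p)) <= x / nm (q - p) by rewrite ge_min lexx orbT.
have vT : v < T by rewrite /v; lra.
have [r r0 H] : good v by apply: lo => //; rewrite /v; lra.
have := iso (ga v); rewrite H ?subrr ?nm0 // eqxx => K.
suff : false by []. apply: K.
  have qp : q - p != 0 by rewrite -nm_gt0.
  by rewrite -subr_eq0 gaB mulf_neq0 // rC_eq0 subr_eq0 lt_eqF.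
rewrite gaB nmM nm_rC -ltr_pdivlMr // ltr0_norm ?subr_lt0 //; rewrite /v; lra.
Qed.

Section Data.
Variables (phi g F : C -> C) (M : R) (I : set C).
Hypothesis Hphi : hol phi 0 1.
Hypothesis HF : hol F 0 1.
Hypothesis phi1 : forall z, nm z < 1 -> nm (phi z) < 1.
Hypothesis gM : forall z, nm z < 1 -> nm (g z) <= M.
Hypothesis ginj : forall z w, nm z < 1 -> nm w < 1 -> g z = g w -> z = w.
Hypothesis FE : forall z, nm z < 1 -> F z = g z + phi z * cj (g z).
Hypothesis Iarc : open_arc I.
Hypothesis bd : forall w, I w -> forall e : R, 0 < e -> exists2 d : R, 0 < d &
  forall z, nm z < 1 -> nm (z - w) < d -> 1 - e < nm (phi z).

Let D1 : set C := [set z | nm z < 1].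
Definition rquot_num z := F z * phi^`()%classic z - phi z * F^`()%classic z.
(* On the unit circle the value is the boundary limit of g (and 0 where there is none). *)
Definition glueR z := if nm z < 1 then mquot rquot_num phi^`()%classic z
  else if 1 < nm z then cj (mquot F^`()%classic phi^`()%classic (cj z)^-1) else lim_value D1 g z.

(** [local_main] in the Cayley coordinate at [w0]; a radius of at most 1 keeps the denominator 1 -
    it away from 0. *)
Lemma arc_local w0 : I w0 -> exists2 t : R, 0 < t & exists P Q : C -> C,
  [/\ hol P 0 t /\ hol Q 0 t,
      forall z, nm z < t -> 0 < imC z -> nm z < 1 /\ P z = phi (cayley w0 z) /\ Q z = F (cayley w0 z),
      forall z, nm z < t -> P^`()%classic z != 0 /\ rquot P Q z = cj (hquot P Q (cj z)),
      forall x : R, `|x| < t -> forall e : R, 0 < e -> exists2 d : R, 0 < d &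
        forall z, nm z < t -> nm (z - rC x) < d -> 0 < imC z -> nm (g (cayley w0 z) - rquot P Q (rC x)) < e &
      (rquot P Q)^`()%classic 0 = 0 -> (rquot P Q)^`()%classic^`()%classic 0 != 0].
Proof.
move=> Iw0; have [w01 [rI rI0 HI]] := open_arc_cayley Iarc Iw0.
pose r := Num.min rI 1; have r0 : 0 < r by rewrite lt_min rI0 ltr01.
have rP z : nm z < r -> nm z < rI /\ nm z < 1 by rewrite lt_min => /andP.
have den z : nm z < r -> 1 - iC * z != 0 by move=> /rP [_]; exact: cayley_den.
have up z : nm z < r -> 0 < imC z -> nm (cayley w0 z) < 1 by move=> /den h; rewrite cayley_lt1.
have der (f : C -> C) z : hol f 0 1 -> nm z < r -> 0 < imC z -> derivable (fun z => f (cayley w0 z)) z 1.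
  move=> Hf zr zi; have [L DL] := cayley_cder w0 (den _ zr).
  exact: cder_derivable (cder_comp DL (hol0_cder Hf (up _ zr zi))).
have bnd (x : R) : `|x| < r -> forall e : R, 0 < e -> exists2 d : R, 0 < d &
    forall z, nm z < r -> nm (z - rC x) < d -> 0 < imC z -> 1 - e < nm (phi (cayley w0 z)).
  move=> xr e e0; have n1 : nm (rC x : C) < r by rewrite nm_rC.
  have [xI _] := rP _ n1; rewrite nm_rC in xI.
  have [d d0 Dd] := bd (HI x xI) e0.
  have [L DL] := cayley_cder w0 (den _ n1).
  have [d' d'0 D'] := cder_ccont DL d0.
  by exists d' => // z zr zd zi; apply: Dd; [exact: up|exact: D'].
have [t /andP[t0 tr] [P [Q [H1 H2 H3 H4 H5]]]] := @local_main R (fun z => phi (cayley w0 z)) (fun z => F (cayley w0 z))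
  (fun z => g (cayley w0 z)) r M r0 (fun z => der phi z Hphi) (fun z => der F z HF) (fun z zr zi => phi1 (up z zr zi))
  (fun z zr zi => gM (up z zr zi))
  (fun z w zr zi wr wi e => etrans (esym (cayleyK w01 (den z zr)))
     (etrans (congr1 (cayley_inv w0) (ginj (up z zr zi) (up w wr wi) e)) (cayleyK w01 (den w wr))))
  (fun z zr zi => FE (up z zr zi))
  bnd.
exists t => //; exists P, Q; split => // z zt zi.
by have [-> ->] := H2 z zt zi; split => //; have [] := rP z (lt_le_trans zt tr).
Qed.

(** The derivative of the coordinate enters phi' and F' as the same factor and cancels in F' / phi',
    so [hquot] and [rquot] do not depend on the coordinate. Hence the three cases of [glueR] are one
    holomorphic function: inside directly, outside by the symmetry, on the circle as the limit of
    g. *)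
Lemma glue_local w0 : I w0 -> nm w0 = 1 /\ exists2 r : R, 0 < r & exists P Q : C -> C, exists t : R,
  [/\ hol P 0 t /\ hol Q 0 t,
      forall z, nm (z - w0) < r -> nm (cayley_inv w0 z) < t /\ z + w0 != 0,
      forall z, nm z < t -> P^`()%classic z != 0,
      (forall z, nm (z - w0) < r -> nm z < 1 -> phi^`()%classic z != 0) /\
      (forall z, nm (z - w0) < r -> glueR z = rquot P Q (cayley_inv w0 z) /\ (nm z = 1 -> lim_to D1 g z (glueR z))) &
      (rquot P Q)^`()%classic 0 = 0 -> (rquot P Q)^`()%classic^`()%classic 0 != 0].
Proof.
move=> Iw0; have [w01 _] := open_arc_cayley Iarc Iw0; split => //.
have [t t0 [P [Q [[HP HQ] PQ sym lim simp]]]] := arc_local Iw0.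
have n1 : nm (w0 - w0) < 1 by rewrite subrr nm0.
have [d d0 Dd] := cder_ccont (cayley_inv_cder (cayley_inv_den w01 n1)) t0.
pose r1 := Num.min 1 d; have r10 : 0 < r1 by rewrite lt_min ltr01.
have N1 z : nm (z - w0) < r1 -> nm (cayley_inv w0 z) < t /\ z + w0 != 0.
  rewrite lt_min => /andP[z1 zd]; split; last exact: cayley_inv_den.
  by have := Dd z zd; rewrite cayley_inv0 subr0.
have z_neq0 z : nm (z - w0) < r1 -> z != 0.
  by rewrite lt_min => /andP[z1 _]; apply: contraTneq z1 => ->; rewrite sub0r nmN w01 ltxx.
have dercomp (f p : C -> C) z : hol p 0 t -> (forall z, nm z < t -> 0 < imC z -> p z = f (cayley w0 z)) ->
    nm (z - w0) < r1 -> nm z < 1 ->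
    f^`()%classic z = p^`()%classic (cayley_inv w0 z) * (- iC * (2%:R * w0) / (z + w0) ^+ 2).
  move=> Hp E zr z1; have [it zw] := N1 _ zr; apply: cder_val.
  have m0 : 0 < Num.min (r1 - nm (z - w0)) (1 - nm z) by rewrite lt_min !subr_gt0 zr.
  apply: (cder_near m0 _ (cder_comp (cayley_inv_cder zw) (hol0_cder Hp it))).
  move=> w; rewrite lt_min => /andP[h1 h2] /=.
  have wr : nm (w - w0) < r1.
    have -> : w - w0 = (w - z) + (z - w0) by ring.
    by apply: le_lt_trans (nmD _ _) _; lra.
  have w1 : nm w < 1.
    have -> : w = (w - z) + z by ring.
    by apply: le_lt_trans (nmD _ _) _; lra.
  have [wt ww] := N1 _ wr.
  by rewrite E ?cayley_invK // cayley_inv_up.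
have L0 z : nm (z - w0) < r1 -> - iC * (2%:R * w0) / (z + w0) ^+ 2 != 0.
  have i0 : - iC != 0 by rewrite -nm_gt0 nmN nm_iC.
  have w00 : w0 != 0 by rewrite -nm_gt0 w01.
  have t2 : (2%:R : C) != 0 by rewrite pnatr_eq0.
  move=> /N1 [_ zw]; apply: mulf_neq0; last by rewrite invr_neq0 // expf_neq0.
  by apply: mulf_neq0 => //; apply: mulf_neq0.
have ins z : nm (z - w0) < r1 -> nm z < 1 ->
    [/\ phi^`()%classic z != 0, mquot rquot_num phi^`()%classic z = rquot P Q (cayley_inv w0 z) &
       mquot F^`()%classic phi^`()%classic z = hquot P Q (cayley_inv w0 z)].
  move=> zr z1; have [it zw] := N1 _ zr; have ii : 0 < imC (cayley_inv w0 z) by rewrite cayley_inv_up.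
  have E1 := dercomp phi P z HP (fun z h1 h2 => proj1 (proj2 (PQ z h1 h2))) zr z1.
  have E2 := dercomp F Q z HQ (fun z h1 h2 => proj2 (proj2 (PQ z h1 h2))) zr z1.
  have [_ [e1 e2]] := PQ _ it ii; rewrite cayley_invK // in e1 e2.
  have [p0 _] := sym _ it; have l0 := L0 _ zr.
  have ph0 : phi^`()%classic z != 0 by rewrite E1 mulf_neq0.
  split => //; rewrite /mquot ph0 /rquot_num.
    rewrite E1 E2 /rquot /hquot e1 e2; move: (F z) (phi z) l0 p0.
    move: (P^`()%classic _) (Q^`()%classic _) (_ / _) => p q l f ph l0 p0.
    by field; rewrite p0 l0.
  rewrite E1 E2 /hquot; move: l0 p0.
  move: (P^`()%classic _) (Q^`()%classic _) (_ / _) => p q l l0 p0.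
  by field; rewrite p0 l0.
have cinv : ccont (fun z : C => (cj z)^-1) w0.
  apply: (ccont_comp (f := @cj R) (g := fun z : C => z^-1)); first exact: ccont_cj.
  by apply: ccontV; [rewrite cj_eq0 -nm_gt0 w01|exact: ccont_id].
(* Outside the disc [glueR] is read at the reflected point, which must lie in the coordinate patch
   as well. *)
have [d2 d20 Dd2] := cinv _ r10.
have inv0 : (cj w0)^-1 = w0.
  have w00 : w0 != 0 by rewrite -nm_gt0 w01.
  have := mulcj w0; rewrite w01 expr1n rC1 => h; apply: (mulIf (x := cj w0)); first by rewrite cj_eq0.
  by rewrite mulVf ?cj_eq0.
pose r := Num.min r1 d2.
have rr z : nm (z - w0) < r -> nm (z - w0) < r1 /\ nm ((cj z)^-1 - w0) < r1.
  by rewrite lt_min => /andP[h1 /Dd2]; rewrite inv0.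
have lims z : nm (z - w0) < r -> nm z = 1 -> lim_to D1 g z (rquot P Q (cayley_inv w0 z)).
  move=> zr z1; have [zr1 _] := rr _ zr; have [it zw] := N1 _ zr1.
  have im0 : imC (cayley_inv w0 z) = 0.
    case: (ltgtP (imC (cayley_inv w0 z)) 0) => //.
      by rewrite cayley_inv_dn // z1 ltxx.
    by rewrite cayley_inv_up // z1 ltxx.
  have Ix : cayley_inv w0 z = rC (reC (cayley_inv w0 z)) by apply: eqC; rewrite ?re_rC ?im_rC ?im0.
  move=> e e0; have xt : `|reC (cayley_inv w0 z)| < t by rewrite -nm_rC -Ix.
  have [x x0 X] := lim _ xt e e0; rewrite -Ix in X.
  have [y y0 Y] := cder_ccont (cayley_inv_cder zw) x0.
  exists (Num.min y (r1 - nm (z - w0))); first by rewrite lt_min y0 subr_gt0.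
  move=> w w1; rewrite lt_min => /andP[wy wz].
  have wr : nm (w - w0) < r1.
    have -> : w - w0 = (w - z) + (z - w0) by ring.
    by apply: le_lt_trans (nmD _ _) _; lra.
  have [iw ww] := N1 _ wr.
  have := X (cayley_inv w0 w) iw (Y _ wy); rewrite cayley_inv_up // cayley_invK //; exact.
have glE z : nm (z - w0) < r -> glueR z = rquot P Q (cayley_inv w0 z).
  move=> zr; have [zr1 zr2] := rr _ zr; have [it zw] := N1 _ zr1; rewrite /glueR.
  case: (ltgtP (nm z) 1) => z1.
  - by have [_ -> _] := ins z zr1 z1.
  - have v1 : nm (cj z)^-1 < 1 by rewrite nmV nm_cj invf_lt1 // (lt_trans ltr01).
    have [_ _ ->] := ins _ zr2 v1.
    by rewrite (cayley_inv_refl w01 (z_neq0 _ zr1) zw); have [_ <-] := sym _ it.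
  apply: lim_valueE; last exact: lims.
  (* The radial points (1 - s) z show that [z] is adherent to the disc, so the limit is unique. *)
  move=> e e0; pose s := Num.min 1 e / 2.
  have m0 : 0 < Num.min 1 e by rewrite lt_min ltr01.
  have m1 : Num.min 1 e <= 1 by rewrite ge_min lexx.
  have m2 : Num.min 1 e <= e by rewrite ge_min lexx orbT.
  have s0 : 0 < s by rewrite half_gt0.
  exists (rC (1 - s) * z); rewrite /D1 /=.
    by rewrite nmM nm_rC z1 mulr1 ger0_norm /s; lra.
  have -> : rC (1 - s) * z - z = - (rC s * z) by rewrite rCB rC1; ring.
  by rewrite nmN nmM nm_rC z1 mulr1 gtr0_norm // /s; lra.
exists r; first by rewrite lt_min r10.
exists P, Q, t; split => //.
- by move=> z /rr [h _]; exact: N1.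
- by move=> z /sym [].
- split; first by move=> z /rr [h _] z1; have [] := ins z h z1.
  by move=> z zr; split; [exact: glE|move=> z1; rewrite glE //; exact: lims].
Qed.

(** Inside the disc, close to an arc point, phi' has no zero, so the identity theorem forbids open
    sets of zeros. This makes F' / phi' meromorphic in the whole disc. *)
Lemma phi'_neq0 p : nm p < 1 -> ~ (exists2 r : R, 0 < r & forall z, nm (z - p) < r -> phi^`()%classic z = 0).
Proof.
have [w0 Iw0] : exists w0, I w0.
  have [a [b [/andP[ab _] ->]]] := Iarc; exists (expi ((a + b) / 2)), ((a + b) / 2) => //=.
  by rewrite in_itv /=; apply/andP; split; lra.
have [w01 [r r0 [P [Q [t [_ _ _ [N _] _]]]]]] := glue_local Iw0.
have m0 : 0 < Num.min 1 r by rewrite lt_min ltr01.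
have m1 : Num.min 1 r <= 1 by rewrite ge_min lexx.
have m2 : Num.min 1 r <= r by rewrite ge_min lexx orbT.
pose s := Num.min 1 r / 2; have s0 : 0 < s by rewrite half_gt0.
have q1 : nm (rC (1 - s) * w0) < 1 by rewrite nmM nm_rC w01 mulr1 ger0_norm /s; lra.
apply: (identity_disc (hol_deriv Hphi) q1); apply: N => //.
have -> : rC (1 - s) * w0 - w0 = - (rC s * w0) by rewrite rCB rC1; ring.
by rewrite nmN nmM nm_rC w01 mulr1 gtr0_norm // /s; lra.
Qed.

Lemma mquot_phi (N : C -> C) p : hol N 0 1 -> nm p < 1 -> mero (mquot N phi^`()%classic) p.
Proof.
move=> HN p1; have r0 : 0 < 1 - nm p by rewrite subr_gt0.
have s : nm (p - 0) + (1 - nm p) <= 1 by rewrite subr0; lra.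
exact: (mquot_mero r0 (hol_sub s HN) (hol_sub s (hol_deriv Hphi)) (phi'_neq0 p1)).
Qed.

Lemma hol_rquot_num : hol (rquot_num) 0 1.
Proof. exact: (holB (holM HF (hol_deriv Hphi)) (holM Hphi (hol_deriv HF))). Qed.

Lemma nm_near_lt p (k : R) z : nm p < k -> nm (z - p) < k - nm p -> nm z < k.
Proof. by move=> _ h; have -> : z = (z - p) + p by [ring]; apply: le_lt_trans (nmD _ _) _; lra. Qed.

Lemma glue_in z : nm z < 1 -> glueR z = mquot (rquot_num) phi^`()%classic z.
Proof. by rewrite /glueR => ->. Qed.

Lemma glue_out z : 1 < nm z -> glueR z = cj (mquot F^`()%classic phi^`()%classic (cj z^-1)).
Proof. by move=> h; rewrite /glueR ltNge (ltW h) /= h cjV. Qed.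

Lemma cayley_inv_hol w0 : nm w0 = 1 -> hol (cayley_inv w0) w0 1.
Proof. by move=> w01 z zr; exact: cder_derivable (cayley_inv_cder (cayley_inv_den w01 zr)). Qed.

Lemma glue_arc w0 : I w0 -> exists2 r : R, 0 < r & exists S : C -> C, exists t : R,
  [/\ 0 < t, hol S 0 t, r <= 1 /\ forall z, nm (z - w0) < r -> nm (cayley_inv w0 z) < t,
      forall z, nm (z - w0) < r -> glueR z = S (cayley_inv w0 z) &
      S^`()%classic 0 = 0 -> S^`()%classic^`()%classic 0 != 0].
Proof.
move=> Iw0; have [w01 [r r0 [P [Q [t [[HP HQ] N1 PN [_ E] simp]]]]]] := glue_local Iw0.
exists (Num.min r 1); first by rewrite lt_min r0 ltr01.
have PN' z : nm (z - 0) < t -> P^`()%classic z != 0 by rewrite subr0; exact: PN.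
exists (rquot P Q), t; split; last exact: simp.
- have [h _] : nm (cayley_inv w0 w0) < t /\ w0 + w0 != 0 by apply: N1; rewrite subrr nm0.
  by apply: le_lt_trans h; exact: nm_ge0.
- exact: (holB HQ (holM HP (hol_div PN' (hol_deriv HQ) (hol_deriv HP)))).
- split; first by rewrite ge_min lexx orbT.
  by move=> z; rewrite lt_min => /andP[/N1 []].
- by move=> z; rewrite lt_min => /andP[/E []].
Qed.

Lemma glue_arc_cder w0 : I w0 -> exists2 r : R, 0 < r & forall z, nm (z - w0) < r -> derivable glueR z 1.
Proof.
move=> Iw0; have [w01 _] := glue_local Iw0; have [r r0 [S [t [t0 HS [r1 N] E _]]]] := glue_arc Iw0.
exists r => // z zr; have s0 : 0 < r - nm (z - w0) by rewrite subr_gt0.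
apply: cder_derivable; apply: (cder_near s0); last first.
  exact: (cder_comp (hol_cder (cayley_inv_hol w01) (lt_le_trans zr r1)) (hol0_cder HS (N _ zr))).
move=> w wz /=; rewrite E //; have -> : w - w0 = (w - z) + (z - w0) by ring.
by apply: le_lt_trans (nmD _ _) _; lra.
Qed.

(** Simple critical points survive a change of coordinate: with L the derivative of the coordinate,
    R' = S' L and, where S' vanishes, R'' = S'' L^2 with L nonzero. *)
Lemma glue_simple w0 : I w0 -> glueR^`()%classic w0 = 0 -> glueR^`()%classic^`()%classic w0 != 0.
Proof.
move=> Iw0; have [w01 _] := glue_local Iw0; have [r r0 [S [t [t0 HS [r1 N] E simp]]]] := glue_arc Iw0.
have [S' ES'] : exists S', S' = S^`()%classic := ex_intro _ _ erefl.
have [L EL] : exists L, L = (cayley_inv w0)^`()%classic := ex_intro _ _ erefl.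
have HL : hol L w0 1 by rewrite EL; exact: hol_deriv (cayley_inv_hol w01).
have HS' : hol S' 0 t by rewrite ES'; exact: hol_deriv.
have DS z : nm z < t -> cder S z (S' z) by rewrite ES'; exact: hol0_cder.
have DI z : nm (z - w0) < r -> cder (cayley_inv w0) z (L z).
  by move=> zr; rewrite EL; exact: (hol_cder (cayley_inv_hol w01) (lt_le_trans zr r1)).
have DR z : nm (z - w0) < r -> cder glueR z (S' (cayley_inv w0 z) * L z).
  move=> zr; have s0 : 0 < r - nm (z - w0) by rewrite subr_gt0.
  apply: (cder_near s0 _ (cder_comp (DI _ zr) (DS _ (N _ zr)))) => w wz /=.
  rewrite E //; have -> : w - w0 = (w - z) + (z - w0) by ring.
  by apply: le_lt_trans (nmD _ _) _; lra.
have nr : nm (w0 - w0) < r by rewrite subrr nm0.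
have nt : nm (0 : C) < t by rewrite nm0.
have w00 : w0 != 0 by rewrite -nm_gt0 w01.
have L0 : L w0 != 0.
  have ww : w0 + w0 != 0 by apply: cayley_inv_den => //; rewrite subrr nm0.
  rewrite -(cder_uniq (cayley_inv_cder ww) (DI _ nr)).
  have i0 : - iC != 0 by rewrite -nm_gt0 nmN nm_iC.
  have t2 : (2%:R : C) != 0 by rewrite pnatr_eq0.
  apply: mulf_neq0; last by rewrite invr_neq0 // expf_neq0.
  by apply: mulf_neq0 => //; apply: mulf_neq0.
move=> R1; have S1 : S' 0 = 0.
  have := etrans (esym (cder_val (DR _ nr))) R1; rewrite cayley_inv0 => /eqP.
  by rewrite mulf_eq0 (negbTE L0) orbF => /eqP.
have S2 : S'^`()%classic 0 != 0 by move: S1; rewrite ES'; exact: simp.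
have DS' : cder S' (cayley_inv w0 w0) (S'^`()%classic 0) by rewrite cayley_inv0; exact: hol0_cder HS' nt.
have DL : cder L w0 (L^`()%classic w0) by apply: (hol_cder HL); rewrite subrr nm0 ltr01.
have D2 : cder glueR^`()%classic w0 (S'^`()%classic 0 * L w0 * L w0 + S' (cayley_inv w0 w0) * L^`()%classic w0).
  apply: (cder_near r0 _ (cderM (cder_comp (DI _ nr) DS') DL)) => w wr /=.
  by rewrite (cder_val (DR _ wr)).
by rewrite (cder_val D2) cayley_inv0 S1 mul0r addr0; apply: mulf_neq0 => //; exact: mulf_neq0.
Qed.

Lemma glue_lim w0 : I w0 -> lim_to [set z | nm z < 1] g w0 (glueR w0).
Proof.
move=> Iw0; have [w01 [r r0 [P [Q [t [_ _ _ [_ E] _]]]]]] := glue_local Iw0.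
by have [|_ /(_ w01)] := E w0; first by rewrite subrr nm0.
Qed.

(** In the exterior R(z) = conj h(1 / conj z), and meromorphy is preserved by conjugation on both
    sides and by inversion. *)
Lemma glue_mero p : OmegaI I p -> mero glueR p.
Proof.
move=> [[p1|Ip]|p1].
- have {}p1 : nm p < 1 by rewrite -ltnm1.
  have r0 : 0 < 1 - nm p by rewrite subr_gt0.
  apply: (mero_near r0 _ (mquot_phi hol_rquot_num p1)) => w wp.
  by rewrite glue_in //; exact: nm_near_lt p1 wp.
- by have [r r0 D] := glue_arc_cder Ip; exact: mero_der r0 D.
have {}p1 : 1 < nm p by rewrite -gtnm1.
have r0 : 0 < nm p - 1 by rewrite subr_gt0.
have p0 : p != 0 by rewrite -nm_gt0 (lt_trans _ p1).
pose f z := cj (mquot F^`()%classic phi^`()%classic (cj z)).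
apply: (mero_near (f := fun z => f z^-1) r0).
  move=> w wp; rewrite glue_out //.
  have : nm p <= nm w + nm (w - p) by have {1}-> : p = w - (w - p) by [ring]; exact: nmB.
  lra.
apply: mero_inv => //; apply: mero_cj; apply: mquot_phi; first exact: hol_deriv.
by rewrite nm_cj nmV invf_lt1 // (lt_trans _ p1).
Qed.

Lemma glue_infty : meromorphic_at_infty glueR.
Proof.
exists 1; first exact: ltr01.
pose f z := cj (mquot F^`()%classic phi^`()%classic (cj z)).
(* Infinity is the reflection of 0: in the coordinate 1/z the exterior becomes the punctured unit
   disc. [f] is meromorphic on the whole disc, and [f 0] fills in the missing value. *)
exists (f 0); apply: mero_on => p; rewrite /= ltnm => p1.
have r0 : 0 < 1 - nm p by rewrite subr_gt0.
apply: (mero_near (f := f) r0).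
  move=> w /(nm_near_lt p1) w1; case: eqVneq => [->|w0] //.
  by rewrite glue_out ?invrK // nmV invf_gt1 // nm_gt0.
by apply: mero_cj; apply: mquot_phi; [exact: hol_deriv|rewrite nm_cj].
Qed.
End Data.
End Glue.

Theorem mainTheorem16 (R : realType) (phi g : Cs R -> Cs R) (I : set (Cs R)) :
  holomorphic_on (disc R) phi ->
  (forall z, disc R z -> `|phi z| < 1) ->
  (exists M : R, forall z, disc R z -> `|g z| <= M%:C%C) ->
  homeo_on (disc R) g ->
  (exists gx gy : Cs R -> Cs R,
     W12loc_with (disc R) g gx gy /\
     {ae leb2 R, forall p, disc R (toC p) ->
        (gx (toC p) + 'i * gy (toC p)) / 2%:R
        = - phi (toC p) * conjc ((gx (toC p) - 'i * gy (toC p)) / 2%:R)}) ->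
  open_arc I ->
  (forall w, I w -> (fun z => `|phi z|) @ within (disc R) (nbhs w) --> (1 : Cs R)) ->
  exists Rf : Cs R -> Cs R,
    meromorphic_OmegaI I Rf /\
    (forall w, I w -> derivable Rf w 1 /\ g @ within (disc R) (nbhs w) --> Rf w) /\
    (forall z0, I z0 -> derive1 Rf z0 = 0 -> derive1 (derive1 Rf) z0 != 0).
Proof.
move=> hphi phi1 [M gM] [gc [gi _]] [gx [gy [W AE]]] Iarc bd.
have dE z : disc R z <-> nm z < 1 by rewrite /disc /= ltnm1.
have Hphi : hol phi 0 1 by move=> z; rewrite subr0 => /dE; exact: hphi.
have phi1' z : nm z < 1 -> nm (phi z) < 1 by move=> /dE /phi1; rewrite ltnm1.
have gM' z : nm z < 1 -> nm (g z) <= M by move=> /dE /gM; rewrite normE lecR.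
have gi' z w : nm z < 1 -> nm w < 1 -> g z = g w -> z = w.
  by move=> /dE z1 /dE w1; apply: gi; exact: mem_set.
(* The disc is open, so continuity within it is continuity at each of its points. *)
have gc' z : nm z < 1 -> ccont g z.
  move=> z1; move/subspace_continuousP : gc => /(_ z ((dE z).2 z1)).
  move=> /(cvgCP (within_filter _ (nbhs_filter z))) H e /H /nbhsCP [d d0 D].
  exists (Num.min d (1 - nm z)); first by rewrite lt_min d0 subr_gt0.
  move=> w; rewrite lt_min => /andP[wd w1]; apply: D => //; apply/dE.
  exact: nm_near_lt z1 w1.
pose F z := g z + phi z * cj (g z).
have HF : hol F 0 1 := beltrami_hol Hphi gc' W AE.
(* Only the lower estimate is kept; |phi| < 1 holds in the whole disc. *)
have bd' w : I w -> forall e : R, 0 < e -> exists2 d : R, 0 < d &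
    forall z, nm z < 1 -> nm (z - w) < d -> 1 - e < nm (phi z).
  move=> /bd /(cvgCP (within_filter _ (nbhs_filter w))) H e /H /nbhsCP [d d0 D].
  exists d => // z /dE z1 zd; have := D z zd z1.
  rewrite normE -/(rC _) -rC1 -rCB nm_rC ltr_norml => /andP[h _]; lra.
have FE z : nm z < 1 -> F z = g z + phi z * cj (g z) by [].
exists (glueR phi g F); split; last split.
- split; last exact: (glue_infty Hphi HF phi1' gM' gi' FE Iarc bd').
  by apply: mero_on => p; exact: (glue_mero Hphi HF phi1' gM' gi' FE Iarc bd').
- move=> w Iw; split.
    have [r r0 D] := glue_arc_cder Hphi HF phi1' gM' gi' FE Iarc bd' Iw.
    by apply: D; rewrite subrr nm0.
  apply/(cvgCP (within_filter _ (nbhs_filter w))) => e e0; apply/nbhsCP.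
  have [d d0 D] := glue_lim Hphi HF phi1' gM' gi' FE Iarc bd' Iw e0.
  by exists d => // z zd /dE z1; exact: D.
- by move=> z0 Iz0; exact: (glue_simple Hphi HF phi1' gM' gi' FE Iarc bd' Iz0).
Qed.
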